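(* Let $d_i\geqslant 2$ for $i=1,\dots,k$ and $d\geqslant 4$. There is the following identity for the Poincaré series: $$P\Bigl(H_*\bigl(\Omega(\#_{i=1}^k S^{d_i}\times S^{d-d_i})\bigr);\,t\Bigr)=\frac{1}{1-\sum_{i=1}^k\bigl(t^{d_i-1}+t^{d-d_i-1}\bigr)+t^{d-2}}.$$
   Context: $\#$ denotes the connected sum operation on manifolds, $\Omega$ the based loop space, and homology is taken with coefficients in $\mathbb{Z}$. $P(V;t)$ denotes the Poincaré series of a graded object $V$; here, for $V=H_*\bigl(\Omega(\#_{i=1}^k S^{d_i}\times S^{d-d_i})\bigr)$ with $n$th graded component $V_n$, it is $P(V;t)=\sum_{n\geqslant 0}\operatorname{rank}(V_n)\,t^n$.
   Formalization: The statement additionally assumes d − d_i ≥ 2 for every i, and k ≥ 1: for d − d_i = 1 (e.g. S^3 × S^1) the loop space has H_0 of infinite rank and the formula fails, for d − d_i ≤ 0 it has no meaning, and for k = 0 (the sphere S^d) it is false. *)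

(* Defs.v *)
From HB Require Import structures.
From Stdlib Require Import Relation_Operators.
From mathcomp Require Import freeg.
From mathcomp Require Import all_boot all_order all_algebra.
From mathcomp Require Import generic_quotient ring_quotient.
From mathcomp Require Import all_classical all_reals all_analysis.
From mathcomp Require Import homotopy.
Import Order.TTheory GRing.Theory Num.Theory.
Import numFieldNormedType.Exports.

Set Implicit Arguments.
Unset Strict Implicit.
Unset Printing Implicit Defensive.

Local Open Scope classical_set_scope.
Local Open Scope ring_scope.

Record fps (A : Type) := Fps { fps_coef : nat -> A }.

Section FpsRing.
Variable A : comNzRingType.
Implicit Types P Q S : fps A.

HB.instance Definition _ := gen_eqMixin (fps A).
HB.instance Definition _ := gen_choiceMixin (fps A).

Lemma fpsP P Q : (forall n, fps_coef P n = fps_coef Q n) -> P = Q.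
Proof. by case: P Q => [f] [g] /= fg; congr Fps; apply: funext. Qed.

Definition fps_zero : fps A := Fps (fun=> 0).
Definition fps_opp P : fps A := Fps (fun n => - fps_coef P n).
Definition fps_add P Q : fps A := Fps (fun n => fps_coef P n + fps_coef Q n).
Definition fps_one : fps A := Fps (fun n => (n == 0%N)%:R).
Definition fps_mul P Q : fps A :=
  Fps (fun n => \sum_(i < n.+1) fps_coef P i * fps_coef Q (n - i)).

Fact fps_addA : associative fps_add.
Proof. by move=> P Q S; apply: fpsP => n /=; rewrite addrA. Qed.
Fact fps_addC : commutative fps_add.
Proof. by move=> P Q; apply: fpsP => n /=; rewrite addrC. Qed.
Fact fps_add0 : left_id fps_zero fps_add.
Proof. by move=> P; apply: fpsP => n /=; rewrite add0r. Qed.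
Fact fps_addN : left_inverse fps_zero fps_opp fps_add.
Proof. by move=> P; apply: fpsP => n /=; rewrite addNr. Qed.

HB.instance Definition _ :=
  GRing.isZmodule.Build (fps A) fps_addA fps_addC fps_add0 fps_addN.

Let trunc m P : {poly A} := \poly_(i < m.+1) fps_coef P i.

Let coef_trunc m P n : (n <= m)%N -> (trunc m P)`_n = fps_coef P n.
Proof. by move=> nm; rewrite coef_poly ltnS nm. Qed.

Let coef_mul_trunc m P Q n : (n <= m)%N ->
  fps_coef (fps_mul P Q) n = (trunc m P * trunc m Q)`_n.
Proof.
move=> nm; rewrite coefM /=; apply: eq_bigr => -[i /=]; rewrite ltnS => ile _.
by rewrite !coef_trunc ?(leq_trans ile) ?(leq_trans (leq_subr _ _)).
Qed.

Fact fps_mulA : associative fps_mul.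
Proof.
move=> P Q S; apply: fpsP => n.
transitivity ((trunc n P * (trunc n Q * trunc n S))`_n).
  rewrite coefM; apply: eq_bigr => -[i /=]; rewrite ltnS => ile _.
  by rewrite coef_trunc// -coef_mul_trunc// leq_subr.
rewrite mulrA coefM; apply: eq_bigr => -[i /=]; rewrite ltnS => ile _.
by rewrite -coef_mul_trunc// coef_trunc// leq_subr.
Qed.

Fact fps_mulC : commutative fps_mul.
Proof.
by move=> P Q; apply: fpsP => n; rewrite !(coef_mul_trunc _ _ (leqnn n)) mulrC.
Qed.

Fact fps_mul1 : left_id fps_one fps_mul.
Proof.
move=> P; apply: fpsP => n /=; rewrite big_ord_recl /= subn0 mul1r big1 ?addr0//.
by move=> i _; rewrite mul0r.
Qed.

Fact fps_mulDl : left_distributive fps_mul fps_add.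
Proof.
move=> P Q S; apply: fpsP => n /=; rewrite -big_split /=.
by apply: eq_bigr => i _; rewrite mulrDl.
Qed.

Fact fps_one_neq0 : fps_one != fps_zero.
Proof.
by apply/eqP => /(congr1 (fun P => fps_coef P 0%N)) /= /eqP; rewrite oner_eq0.
Qed.

HB.instance Definition _ := GRing.Zmodule_isComNzRing.Build (fps A)
  fps_mulA fps_mulC fps_mul1 fps_mulDl fps_one_neq0.

Definition fps_unit : {pred fps A} := fun P => `[< exists Q, Q * P = 1 >].
(* The (unique) multiplicative inverse when there is one; a non-invertible
   series is its own inverse, as [unitRingType] prescribes. *)
Definition fps_inv P : fps A := xget P [set Q | Q * P = 1].

Fact fps_mulV : {in fps_unit, left_inverse 1 fps_inv *%R}.
Proof. by move=> P /asboolP; exact: xgetPex. Qed.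
Fact fps_unitPl P Q : Q * P = 1 -> fps_unit P.
Proof. by move=> QP; apply/asboolP; exists Q. Qed.
Fact fps_inv_out : {in [predC fps_unit], fps_inv =1 id}.
Proof.
by move=> P /asboolPn nP; apply: xgetPN => Q /= QP; apply: nP; exists Q.
Qed.

HB.instance Definition _ := GRing.ComNzRing_hasMulInverse.Build (fps A)
  fps_mulV fps_unitPl fps_inv_out.

Definition fpsX : fps A := Fps (fun n => (n == 1%N)%:R).

End FpsRing.

Definition int_free (V : zmodType) (r : nat) (v : 'I_r -> V) : Prop :=
  forall c : 'I_r -> int, \sum_i v i *~ c i = 0 -> forall i, c i = 0.

Definition has_rank (V : zmodType) (r : nat) : Prop :=
  (exists v : 'I_r -> V, int_free v) /\ (forall v : 'I_r.+1 -> V, ~ int_free v).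

Definition finite_rank (V : zmodType) : Prop := exists r, has_rank V r.

(* 0 when no finite rank exists: to be used along with [finite_rank]. *)
Definition rank (V : zmodType) : nat := xget 0%N [set r | has_rank V r].

Definition poincare_series (V : nat -> zmodType) : fps int :=
  Fps (fun n => (rank (V n))%:Z).

Section SingularHomology.
Variable R : realType.

Definition std_simplex (n : nat) : set 'rV[R]_n.+1 :=
  [set x | (forall i, 0 <= x ord0 i) /\ \sum_i x ord0 i = 1].
Arguments std_simplex n : clear implicits.

(* Insert the barycentric coordinate 0 at position i. *)
Definition coface_fun n (i : 'I_n.+2) (x : 'rV[R]_n.+1) : 'rV[R]_n.+2 :=
  \row_j oapp (x ord0) 0 (unlift i j).

Lemma coface_subproof n (i : 'I_n.+2) (x : std_simplex n) :
  coface_fun i (\val x) \in std_simplex n.+1.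
Proof.
case: x => x /= /set_mem [x0 x1]; apply/mem_set; split => [j|].
  by rewrite mxE; case: unliftP => [j' _|_] /=.
rewrite (bigD1 i)//= mxE unlift_none /= add0r -x1.
rewrite (reindex_onto (lift i) (fun j => odflt ord0 (unlift i j))) /=.
  apply: eq_big => [j|j _]; first by rewrite liftK eqxx andbT eq_sym neq_lift.
  by rewrite mxE liftK.
by move=> j; case: unliftP => [j' ->|->]; rewrite ?eqxx.
Qed.

Definition coface n (i : 'I_n.+2) (x : std_simplex n) : std_simplex n.+1 :=
  SigSub (coface_subproof i x).

Lemma coface_continuous n (i : 'I_n.+2) : continuous (@coface n i).
Proof.
apply: continuous_comp_initial => x.
apply: (@continuous_comp _ _ _ (@set_val _ (@std_simplex n)) (coface_fun i)).
  exact: initial_continuous.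
move=> A [P nP sPA]; exists (fun k j => P k (lift i j)) => [k j|y yP].
  by have := nP k (lift i j); rewrite [k]ord1 mxE liftK.
apply: sPA => k j; rewrite mxE [k]ord1; case: unliftP => [j' ->|->] /=.
  by have := yP ord0 j'.
by apply: nbhs_singleton; have := nP ord0 i; rewrite mxE unlift_none.
Qed.

HB.instance Definition _ n (i : 'I_n.+2) :=
  isContinuous.Build _ _ (@coface n i) (@coface_continuous n i).

Variable X : topologicalType.

Definition singular_simplex (n : nat) := continuousType (std_simplex n) X.

Definition chain (n : nat) := {freeg (singular_simplex n) / int}.

Definition boundary_simplex n (s : singular_simplex n.+1) : chain n :=
  \sum_(i < n.+2) (-1) ^+ i *: << (s \o @coface n i : singular_simplex n) >>.

Definition boundary n : chain n.+1 -> chain n := fglift (@boundary_simplex n).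

HB.instance Definition _ n := GRing.isZmodMorphism.Build
  (chain n.+1) (chain n) (@boundary n) (lift_is_additive (@boundary_simplex n)).

Definition is_cycle n : {pred chain n} :=
  match n with
  | 0 => predT
  | m.+1 => fun c => boundary c == 0
  end.

Fact is_cycle_zmod_closed n : zmod_closed (@is_cycle n).
Proof.
case: n => [|n]; first by split.
split; first by apply/eqP; rewrite raddf0.
by move=> a b /eqP a0 /eqP b0; apply/eqP; rewrite raddfB /= a0 b0 subr0.
Qed.
HB.instance Definition _ n :=
  GRing.isZmodClosed.Build (chain n) (@is_cycle n) (@is_cycle_zmod_closed n).

Definition cycles (n : nat) := {c : chain n | is_cycle c}.
HB.instance Definition _ n := SubType.on (cycles n).
HB.instance Definition _ n := Choice.on (cycles n).
HB.instance Definition _ n := [SubChoice_isSubZmodule of cycles n by <:].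

Definition is_boundary n : {pred cycles n} :=
  fun z => `[< exists b : chain n.+1, boundary b = \val z >].

Fact is_boundary_zmod_closed n : zmod_closed (@is_boundary n).
Proof.
split; first by apply/asboolP; exists 0; rewrite !raddf0.
move=> y z /asboolP[b bE] /asboolP[c cE]; apply/asboolP; exists (b - c).
by rewrite raddfB /= bE cE.
Qed.
HB.instance Definition _ n := GRing.isZmodClosed.Build (cycles n)
  (@is_boundary n) (@is_boundary_zmod_closed n).

(* Boundaries are taken inside the group of cycles, where they all lie since
   the boundary map squares to zero. *)
Definition homology (n : nat) : zmodType := {ideal_quot (@is_boundary n)}.

End SingularHomology.

Section LoopSpace.
Variable R : realType.

Definition unit_interval := set_type `[0 : R, 1]%classic.
HB.instance Definition _ := Topological.on unit_interval.

Fact in_unit_interval0 : (0 : R) \in `[0 : R, 1]%classic.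
Proof. by apply/mem_set; rewrite /= in_itv /= lexx ler01. Qed.
Fact in_unit_interval1 : (1 : R) \in `[0 : R, 1]%classic.
Proof. by apply/mem_set; rewrite /= in_itv /= lexx ler01. Qed.
Fact unit_interval_neq :
  SigSub in_unit_interval0 != SigSub in_unit_interval1 :> unit_interval.
Proof. by apply/eqP => -[] /esym/eqP; rewrite oner_eq0. Qed.
HB.instance Definition _ := isBiPointed.Build unit_interval unit_interval_neq.

(* The library equips path spaces with the compact-open topology. *)
Definition loop_space (X : topologicalType) (x0 : X) : topologicalType :=
  {path unit_interval from x0 to x0 in X}.

End LoopSpace.

Definition homeomorphic (X Y : topologicalType) : Prop :=
  exists (f : X -> Y) (g : Y -> X),
    [/\ continuous f, continuous g, cancel f g & cancel g f].

Section ConnectedSum.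
Variable R : realType.

(* The norm of the library on row vectors is the sup norm. *)
Definition sqnorm n (v : 'rV[R]_n) : R := \sum_i v ord0 i ^+ 2.

Definition sphere (n : nat) : topologicalType :=
  set_type [set v : 'rV[R]_n.+1 | sqnorm v = 1].

Section Gluing.
Variables (d : nat) (M N : topologicalType).
Variables (e : 'rV[R]_d -> M) (f : 'rV[R]_d -> N).

Definition open_embedding (X Y : topologicalType) (h : X -> Y) : Prop :=
  [/\ continuous h, injective h & forall U : set X, open U -> open (h @` U)].

Definition disc_complement (X : topologicalType) (h : 'rV[R]_d -> X) : set X :=
  ~` (h @` [set v | sqnorm v < 1]).

Definition csum_piece (b : bool) : topologicalType :=
  if b then (disc_complement e : topologicalType)
  else (disc_complement f : topologicalType).

Definition csum_glue (p q : {b : bool & csum_piece b}) : Prop :=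
  exists (x : disc_complement e) (y : disc_complement f) (v : 'rV[R]_d),
    [/\ sqnorm v = 1, \val x = e v, \val y = f v,
        p = existT csum_piece true x & q = existT csum_piece false y].

Definition csum_rel : rel {b : bool & csum_piece b} :=
  fun p q => `[< clos_refl_sym_trans _ csum_glue p q >].

Fact csum_rel_refl : reflexive csum_rel.
Proof. by move=> p; apply/asboolP; exact: rst_refl. Qed.
Fact csum_rel_sym : symmetric csum_rel.
Proof. by move=> p q; apply/asboolP/asboolP; exact: rst_sym. Qed.
Fact csum_rel_trans : transitive csum_rel.
Proof.
by move=> q p r /asboolP pq /asboolP qr; apply/asboolP; exact: rst_trans pq qr.
Qed.
Canonical csum_equiv := EquivRel csum_rel csum_rel_refl csum_rel_sym csum_rel_trans.

Definition csum : topologicalType := quotient_topology {eq_quot csum_rel}%qT.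

End Gluing.

(* The discs are closed unit balls of open embeddings of R^d, hence tame.
   Every way of choosing them is allowed. In the oriented theory the
   gluing map must reverse orientation; no such condition is imposed here, which
   is harmless for products of spheres since they admit orientation-reversing
   self-homeomorphisms. *)
Definition is_csum (d : nat) (M N X : topologicalType) : Prop :=
  exists (e : 'rV[R]_d -> M) (f : 'rV[R]_d -> N),
    [/\ open_embedding e, open_embedding f & homeomorphic X (csum e f)].

(* X is M # N_1 # ... # N_r, bracketed to the left. *)
Fixpoint is_csum_from (d : nat) (M : topologicalType)
    (Ns : seq topologicalType) (X : topologicalType) : Prop :=
  match Ns with
  | [::] => homeomorphic X M
  | N :: Ns' => exists2 Y, is_csum d M N Y & is_csum_from d Y Ns' X
  end.

(* The empty connected sum is the d-sphere. *)
Definition is_iterated_csum (d k : nat) (M : 'I_k -> topologicalType)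
    (X : topologicalType) : Prop :=
  match [seq M i | i <- enum 'I_k] with
  | [::] => homeomorphic X (sphere d)
  | M0 :: Ms => is_csum_from d M0 Ms X
  end.

End ConnectedSum.

(* Main.v *)
(* Proof idea.  Let P be the path space of X at x0, fibred over X by the end point,
   and write P_A for its restriction to a subset A of X; the fibre over a point z has
   the homology of the loop space.  Homotopies of the base lift to P, so that P_A has
   excision and homotopy invariance in A, and a cell of dimension m adds to the
   homology of P_A, relative to a fibre F, a copy of the homology of F shifted by m.
   Removing a point from the connected sum X leaves a space built from cells of the
   dimensions d_i and d - d_i, whose boundaries can be contracted to a point
   inside the previous cells, so that the ranks add up; and X itself has one further cell, of dimension d.

   The last attaching map is inert: every cycle of F of positive degree bounds over the
   punctured X.  Indeed it bounds in P, which is contractible.  The part of the bounding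
   chain near {b} x S^(d-d_i) can be pushed off the puncture along this sphere, by
   following the retraction X -> S^(d-d_i) applied to the path run backwards.
   With a_n the rank of H_n(F), the long exact sequences then become
     sum_i (a_(n+1-(d_i-1)) + a_(n+1-(d-d_i-1))) = a_(n+1) + a_(n+1-(d-2)),
   with a_0 = 1, which is the formula.

   The cell decomposition is obtained by induction on the number of summands, from the
   statement [Sprop] on an arbitrary space over the punctured manifold, which does not
   depend on the puncture nor on the fibre. *)

From HB Require Import structures.
Require Import Defs.
From Stdlib Require Import Relation_Operators.
From mathcomp Require Import freeg.
From mathcomp Require Import all_boot all_order all_algebra.
From mathcomp Require Import generic_quotient ring_quotient.
From mathcomp Require Import all_classical all_reals all_analysis.
From mathcomp Require Import homotopy.
From mathcomp Require Import zify ring lra.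
Import Order.TTheory GRing.Theory Num.Theory.
Import numFieldNormedType.Exports.

Set Implicit Arguments.
Unset Strict Implicit.
Unset Printing Implicit Defensive.

Local Open Scope classical_set_scope.
Local Open Scope ring_scope.

(** Homology of pairs is treated on chains: relative cycles and boundaries are subgroups of one free
    group, cut out by support conditions, and only ranks of subquotients are computed. Subsets are
    not turned into spaces; continuity on a subset is tested along continuous maps into it, and
    functions take arbitrary values elsewhere. The obstacle is that the discs of a connected sum are
    arbitrary and no isotopy between them is at hand. The statement carried through the induction
    therefore quantifies over every base map and every target, and its independence of the puncture
    rests on the connectedness of the punctured manifold, which the statement itself yields in
    degree 0. Balls about different centres, and different charts about one point, are compared by
    interleaving them and using the 2-out-of-6 property, in place of an annulus theorem.
    Orientations do not enter: the fibre over a cell is related to a fixed fibre through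
    contractible sets, and only ranks are kept. *)

(** * Rules for continuity of functions *)

Section ContinuityKit.
Variables (R : realType) (T : topologicalType).
Implicit Types (V : normedModType R) (f g : T -> R).

Lemma cnt_comp (U W : topologicalType) (f : T -> U) (g : U -> W) :
  continuous f -> continuous g -> continuous (fun x => g (f x)).
Proof. by move=> cf cg x; apply: (@continuous_comp _ _ _ f g x); [exact: cf|exact: cg]. Qed.

Lemma cntD V (f g : T -> V) : continuous f -> continuous g -> continuous (fun x => f x + g x).
Proof. by move=> cf cg x; apply: (@cvgD _ _ _ (nbhs x)); [exact: cf|exact: cg]. Qed.

Lemma cntN V (f : T -> V) : continuous f -> continuous (fun x => - f x).
Proof. by move=> cf x; apply: (@cvgN _ _ _ (nbhs x)); exact: cf. Qed.

Lemma cntB V (f g : T -> V) : continuous f -> continuous g -> continuous (fun x => f x - g x).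
Proof. by move=> cf cg; apply: cntD => //; exact: cntN. Qed.

Lemma cntZ V f (g : T -> V) : continuous f -> continuous g -> continuous (fun x => f x *: g x).
Proof. by move=> cf cg x; apply: (@cvgZ _ _ _ (nbhs x)); [exact: cf|exact: cg]. Qed.

Lemma cntM f g : continuous f -> continuous g -> continuous (fun x => f x * g x).
Proof. by move=> cf cg x; apply: (@cvgM _ _ (nbhs x)); [exact: cf|exact: cg]. Qed.

Lemma cntV_at f x : f x != 0 -> {for x, continuous f} -> {for x, continuous (fun x => (f x)^-1)}.
Proof. by move=> fx cf; apply: (@cvgV _ _ (nbhs x)). Qed.

Lemma cntV f : (forall x, f x != 0) -> continuous f -> continuous (fun x => (f x)^-1).
Proof. by move=> f0 cf x; apply: cntV_at => //; exact: cf. Qed.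

Lemma cnt_norm V (f : T -> V) : continuous f -> continuous (fun x => `|f x|).
Proof. by move=> cf x; apply: (@cvg_norm _ _ _ (nbhs x)); exact: cf. Qed.

Lemma cnt_sum V (I : Type) (s : seq I) (F : I -> T -> V) : (forall i, continuous (F i)) ->
  continuous (fun x => \sum_(i <- s) F i x).
Proof.
move=> cF; elim: s => [|i s IH].
  by under eq_fun do rewrite big_nil; exact: cst_continuous.
by under eq_fun do rewrite big_cons; apply: cntD.
Qed.

Lemma cnt_coord m n (f : T -> 'M[R]_(m, n)) i j : continuous f -> continuous (fun x => f x i j).
Proof. by move=> cf; exact: (cnt_comp cf (@coord_continuous _ m n i j)). Qed.

Lemma cnt_mx m n (f : T -> 'M[R]_(m, n)) :
  (forall i j, continuous (fun x => f x i j)) -> continuous f.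
Proof.
move=> cf x A [P Pn sPA].
have : nbhs x [set y | forall i j, P i j (f y i j)].
  by apply: filter_forall => i; apply: filter_forall => j; exact: cf (Pn i j).
by apply: filterS => y Py; apply: sPA.
Qed.

Lemma cnt_pair (U W : topologicalType) (f : T -> U) (g : T -> W) :
  continuous f -> continuous g -> continuous (fun x => (f x, g x)).
Proof. by move=> cf cg x; apply: cvg_pair => /=; [exact: cf|exact: cg]. Qed.

Lemma cnt_fst (U W : topologicalType) (f : T -> U * W) :
  continuous f -> continuous (fun x => (f x).1).
Proof. by move=> cf; apply: (cnt_comp cf) => x; exact: cvg_fst. Qed.

Lemma cnt_snd (U W : topologicalType) (f : T -> U * W) :
  continuous f -> continuous (fun x => (f x).2).
Proof. by move=> cf; apply: (cnt_comp cf) => x; exact: cvg_snd. Qed.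

Lemma cnt_max f g : continuous f -> continuous g -> continuous (fun x => Num.max (f x) (g x)).
Proof. by move=> cf cg x; apply: continuous_max; [exact: cf|exact: cg]. Qed.

Lemma cnt_min f g : continuous f -> continuous g -> continuous (fun x => Num.min (f x) (g x)).
Proof. by move=> cf cg x; apply: continuous_min; [exact: cf|exact: cg]. Qed.

Lemma cnt_cst (U : topologicalType) (u : U) : continuous (fun _ : T => u).
Proof. exact: cst_continuous. Qed.

Lemma cnt_id : continuous (fun x : T => x).
Proof. by move=> x; exact: cvg_id. Qed.

(** Pasting along the two closed sets given by the sign of [h]. Both branches must be continuous on
    the whole space, which is why the callers clamp or fold the arguments of each branch. *)
Lemma cnt_glue (U : topologicalType) (h : T -> R) (f1 f2 : T -> U) :
  continuous h -> continuous f1 -> continuous f2 ->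
  (forall x, h x = 0 -> f1 x = f2 x) ->
  continuous (fun x => if h x <= 0 then f1 x else f2 x).
Proof.
move=> ch c1 c2 e x; have [hx|hx|hx] := ltgtP (h x) 0 => A /= nA.
- have n1 : nbhs x (f1 @^-1` A) by apply: c1; move: nA; rewrite (ltW hx).
  have n2 : nbhs x (h @^-1` [set r | r < 0]).
    by apply: (ch x); apply: open_nbhs_nbhs; split; [exact: open_lt|exact: hx].
  by apply: filterS2 n1 n2 => y fy /= hy; rewrite ltW.
- have n1 : nbhs x (f2 @^-1` A) by apply: c2; move: nA; rewrite leNgt hx.
  have n2 : nbhs x (h @^-1` [set r | 0 < r]).
    by apply: (ch x); apply: open_nbhs_nbhs; split; [exact: open_gt|exact: hx].
  by apply: filterS2 n1 n2 => y fy /= hy; rewrite leNgt hy.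
- rewrite hx lexx in nA.
  have n1 : nbhs x (f1 @^-1` A) by apply: c1.
  have n2 : nbhs x (f2 @^-1` A) by apply: c2; rewrite -e.
  by apply: filterS2 n1 n2 => y f1y f2y /=; case: ifP.
Qed.
End ContinuityKit.

(** * Ranks of subquotients of abelian groups *)

Section SubquotientRank.
Variable V : zmodType.
Implicit Types Z B K : set V.

Definition subgroup Z := Z 0 /\ forall x y, Z x -> Z y -> Z (x - y).

Lemma subgroupN Z x : subgroup Z -> Z x -> Z (- x).
Proof. by move=> [Z0 ZB] Zx; rewrite -sub0r; apply: ZB. Qed.

Lemma subgroupD Z x y : subgroup Z -> Z x -> Z y -> Z (x + y).
Proof. by move=> sZ Zx Zy; rewrite -[y]opprK; apply: sZ.2 => //; exact: subgroupN. Qed.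

Lemma subgroup_mulrz Z x (m : int) : subgroup Z -> Z x -> Z (x *~ m).
Proof.
move=> sZ Zx.
have H k : Z (x *+ k).
  by elim: k => [|k IH]; [rewrite mulr0n; exact: sZ.1|rewrite mulrS; exact: subgroupD].
case: m => m; first exact: H.
by rewrite NegzE mulrNz; apply: subgroupN => //; exact: H.
Qed.

Lemma subgroup_sum Z (I : Type) (s : seq I) (P : pred I) (F : I -> V) : subgroup Z ->
  (forall i, P i -> Z (F i)) -> Z (\sum_(i <- s | P i) F i).
Proof.
move=> sZ H; elim/big_ind: _ => //; first exact: sZ.1.
by move=> x y; exact: subgroupD.
Qed.

Definition indep_mod Z B (I : finType) (v : I -> V) :=
  (forall i, Z (v i)) /\
  (forall c : I -> int, B (\sum_i v i *~ c i) -> forall i, c i = 0).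

(* Rank of the subquotient Z / (Z `&` B). *)
Definition has_srank Z B (r : nat) :=
  (exists v : 'I_r -> V, indep_mod Z B v) /\
  (forall v : 'I_r.+1 -> V, ~ indep_mod Z B v).

Lemma indep_mod_inj Z B (I J : finType) (f : I -> J) (v : J -> V) : injective f ->
  indep_mod Z B v -> indep_mod Z B (v \o f).
Proof.
move=> fi [Zv Bv]; split=> [i|c Bc i]; first exact: Zv.
pose c' j := if [pick i | f i == j] is Some i then c i else 0.
have c'f k : c' (f k) = c k.
  rewrite /c'; case: pickP => [k' /eqP /fi -> //|/(_ k)]; by rewrite eqxx.
rewrite -c'f; apply: Bv; suff -> : \sum_j v j *~ c' j = \sum_i (v \o f) i *~ c i by [].
rewrite (bigID (fun j => j \in codom f)) /= [X in _ + X]big1 ?addr0; last first.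
  move=> j jf; rewrite /c'; case: pickP => [k /eqP kj|_]; last by rewrite mulr0z.
  by move: jf; rewrite -kj codom_f.
transitivity (\sum_(j in [set f i | i : I]) v j *~ c' j).
  by apply: eq_bigl => j; apply/idP/imsetP => [/codomP[i0 ->]|[i0 _ ->]];
    [exists i0|exact: codom_f].
rewrite big_imset /=; last by move=> ? ? _ _; exact: fi.
by apply: eq_bigr => k _; rewrite c'f.
Qed.

Lemma indep_mod_card Z B r (I : finType) (v : I -> V) : has_srank Z B r ->
  indep_mod Z B v -> (#|I| <= r)%N.
Proof.
move=> [_ H] iv; rewrite leqNgt; apply/negP => rI.
pose f (i : 'I_r.+1) : I := enum_val (widen_ord rI i).
apply: (H (v \o f)); apply: indep_mod_inj iv => i j /enum_val_inj/(congr1 val) /= ij.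
exact: val_inj.
Qed.

Lemma has_srank_uniq Z B r s : has_srank Z B r -> has_srank Z B s -> r = s.
Proof.
move=> hr hs; apply/eqP; rewrite eqn_leq.
have [[v iv] _] := hr; have [[w iw] _] := hs.
by have := indep_mod_card hs iv; have := indep_mod_card hr iw; rewrite !card_ord => -> ->.
Qed.

Lemma has_srank_bounded Z B r :
  (forall v : 'I_r.+1 -> V, ~ indep_mod Z B v) -> exists2 s, (s <= r)%N & has_srank Z B s.
Proof.
elim: r => [|r IH] H.
  exists 0%N => //; split=> //; exists (fun i : 'I_0 => 0); split; first by case.
  by move=> c _; case.
have [[v iv]|nv] := pselect (exists v : 'I_r.+1 -> V, indep_mod Z B v).
  by exists r.+1 => //; split => //; exists v.
have [v iv|s sr hs] := IH; first by apply: nv; exists v.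
by exists s => //; rewrite ltnW.
Qed.

Lemma has_srank0 Z B x : subgroup B -> has_srank Z B 0 -> Z x ->
  exists2 k : int, k != 0 & B (x *~ k).
Proof.
move=> sB [_ H] Zx; apply: contrapT => nk; apply: (H (fun=> x)); split=> // c.
rewrite big_ord1 => Bc i; rewrite [i]ord1; apply: contrapT => /eqP c0.
by apply: nk; exists (c ord0).
Qed.

Lemma srank0_intro Z B : (forall x, Z x -> exists2 k : int, k != 0 & B (x *~ k)) ->
  has_srank Z B 0.
Proof.
move=> H; split; first by exists (fun=> 0); split=> [[]//|c _ []].
move=> v [Zv Bv]; have [k k0 Bk] := H _ (Zv ord0).
move/eqP: k0; apply; apply: (Bv (fun=> k) _ ord0); by rewrite big_ord1.
Qed.

(** Independent families of [K] modulo [B] and of [Z] modulo [K] concatenate. Conversely, in an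
    independent family of [r + s + 1] elements a maximal part [S] independent modulo [K] has at most
    [s] members, and the relations expressing the other members modulo [K] form a family of [K]
    independent modulo [B], of size at most [r]. *)
Lemma srank_add Z K B r s : subgroup Z -> subgroup K -> subgroup B ->
  K `<=` Z -> Z `&` B `<=` K ->
  has_srank K B r -> has_srank Z K s -> has_srank Z B (r + s).
Proof.
move=> sZ sK sB KZ ZBK hK hZ; split.
  have [[v [Kv Bv]] _] := hK; have [[w [Zw Kw]] _] := hZ.
  exists (fun i => match fintype.split i with inl a => v a | inr b => w b end); split.
    by move=> i; case: fintype.split => // a; apply: KZ.
  move=> c; rewrite big_split_ord /=.
  under eq_bigr do rewrite (unsplitK (inl _)).
  under [X in _ + X]eq_bigr do rewrite (unsplitK (inr _)).
  set x := \sum_i _; set y := \sum_i _ => Bxy.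
  have Kx : K x by apply: subgroup_sum => // i _; exact: subgroup_mulrz.
  have Zy : Z y by apply: subgroup_sum => // i _; exact: subgroup_mulrz.
  have Ky : K y.
    rewrite -[y](addKr x) addrC; apply: sK.2 => //; apply: ZBK; split=> //.
    by apply: subgroupD => //; exact: KZ.
  have cr := Kw (fun i => c (rshift r i)) Ky.
  have y0 : y = 0 by rewrite /y big1 // => i _; rewrite cr mulr0z.
  rewrite y0 addr0 in Bxy.
  have cl := Bv (fun i => c (lshift s i)) Bxy.
  by move=> i; rewrite -(splitK i); case: (fintype.split i) => j /=; [exact: cl|exact: cr].
move=> v [Zv Bv]; set N := (r + s).+1 in v Zv Bv *.
(* Independence modulo [K] of the members indexed by [S], phrased with coefficients on all indices
   that vanish off [S]. *)
pose free (S : {set 'I_N}) := `[< forall c : 'I_N -> int, (forall i, i \notin S -> c i = 0) ->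
  K (\sum_i v i *~ c i) -> forall i, c i = 0 >].
have free0 : free finset.set0.
  by apply/asboolP => c c0 _ i; apply: c0; rewrite inE.
have [S Smax _] := @maxset_exists _ free finset.set0 free0.
have /asboolP Sf := maxsetp Smax.
have Ss : (#|S| <= s)%N.
  suff : indep_mod Z K (fun i : {i | i \in S} => v (val i)).
    by move=> /(indep_mod_card hZ); rewrite card_sig.
  split=> // c Kc; pose c' i := if insub i is Some j then c j else 0.
  have c'0 i : i \notin S -> c' i = 0 by move=> iS; rewrite /c' insubN.
  have c'v j : c' (val j) = c j by rewrite /c' valK.
  have cc : \sum_i v i *~ c' i = \sum_(i : {i | i \in S}) v (val i) *~ c i.
    rewrite (bigID (mem S)) /= [X in _ + X]big1 ?addr0; last first.
      by move=> i /c'0 ->; rewrite mulr0z.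
    rewrite (reindex_omap (val : {i | i \in S} -> 'I_N) insub) /=; last first.
      by move=> i iS; rewrite insubT.
    by apply: eq_big => [j|j _]; [rewrite valK eqxx (valP j)|rewrite c'v].
  by move=> j; rewrite -c'v; apply: Sf => //; rewrite cc.
(* Maximality of [S]: adding [i] creates a relation modulo [K], supported on [S] and [i], whose
   coefficient at [i] cannot vanish. *)
have dep i : i \notin S -> exists2 c : 'I_N -> int, c i != 0 &
    (forall j, j \notin S -> j != i -> c j = 0) /\ K (\sum_j v j *~ c j).
  move=> iS; apply: contrapT => nc.
  have iSS : i |: S = S.
    apply: (maxsetsup Smax); last exact: finset.subsetUr.
    apply/asboolP => c c0 Kc.
    have ci : c i = 0.
      apply: contrapT => /eqP ci; apply: nc; exists c => //; split => // j jS ji.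
      by apply: c0; rewrite !inE negb_or ji jS.
    apply: Sf => // j jS; have [->//|ji] := eqVneq j i.
    by apply: c0; rewrite !inE negb_or ji jS.
  by move: iS; rewrite -iSS finset.setU11.
have /choice[d dP] : forall i : {i | i \notin S}, exists c : 'I_N -> int, c (val i) != 0 /\
    (forall j, j \notin S -> j != val i -> c j = 0) /\ K (\sum_j v j *~ c j).
  by move=> [i iS]; have [c c0 cP] := dep i iS; exists c.
suff : indep_mod K B (fun i : {i | i \notin S} => \sum_j v j *~ d i j).
  move=> /(indep_mod_card hK); rewrite card_sig => le1.
  have := cardsC S; rewrite card_ord cardsE /= => E.
  have : (#|[pred i | i \notin S]| = #|~: S|)%N by apply: eq_card => i; rewrite !inE.
  move=> E2; move: le1; rewrite E2 => le1.
  have : (#|S| + #|~: S| <= s + r)%N by apply: leq_add.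
  by rewrite cardsC card_ord addnC ltnn.
split; first by move=> i; have [_ []] := dP i.
move=> c Bc i.
have E : \sum_i (\sum_j v j *~ d i j) *~ c i = \sum_j v j *~ (\sum_i d i j * c i).
  under eq_bigr do rewrite mulrz_suml.
  rewrite exchange_big /=; apply: eq_bigr => j _.
  by rewrite mulrz_sumr; apply: eq_bigr => k _; rewrite mulrzA.
(* At an index outside [S] only the relation attached to that index has a nonzero coefficient, so
   the system is diagonal there. *)
rewrite E in Bc; have := Bv _ Bc (val i); rewrite (bigD1 i) //= big1 ?addr0.
  by move=> /eqP; rewrite mulf_eq0; have [/negPf -> _] := dP i => /eqP.
move=> k ki; have [_ [-> //]] := dP k; first by rewrite mul0r.
  exact: (valP i).
by apply: contra ki => /eqP ik; apply/eqP; apply: val_inj; exact: esym ik.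
Qed.

(** A family independent modulo [K] is independent modulo [B], which bounds the rank of [Z] over
    [K]; additivity then gives its value. The inequality is recorded because the subtraction is
    truncated. *)
Lemma srank_quot Z K B r s : subgroup Z -> subgroup K -> subgroup B ->
  K `<=` Z -> Z `&` B `<=` K ->
  has_srank Z B r -> has_srank K B s -> has_srank Z K (r - s) /\ (s <= r)%N.
Proof.
move=> sZ sK sB KZ ZBK hZ hK.
have [t _ ht] : exists2 t, (t <= r)%N & has_srank Z K t.
  apply: has_srank_bounded => v [Zv Kv]; apply: (hZ.2 v); split=> // c Bc.
  apply: Kv; apply: ZBK; split=> //.
  by apply: subgroup_sum => // i _; exact: subgroup_mulrz.
have := srank_add sZ sK sB KZ ZBK hK ht => /has_srank_uniq /(_ hZ) <-.
by rewrite addKn leq_addr.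
Qed.

End SubquotientRank.

(** The hypotheses say that [f] induces an isomorphism of subquotients: injective by the equivalence
    on [Z], surjective up to [B']. Independent families are transported in both directions, without
    forming quotients. *)
Lemma srank_iso (V W : zmodType) (f : {additive V -> W}) (Z B : set V) (Z' B' : set W) r :
  subgroup B' ->
  (forall z, Z z -> Z' (f z)) -> subgroup Z ->
  (forall z, Z z -> B z <-> B' (f z)) ->
  (forall z', Z' z' -> exists2 z, Z z & B' (z' - f z)) ->
  has_srank Z B r <-> has_srank Z' B' r.
Proof.
move=> sB' fZ sZ fB fs.
have fsum (I : finType) (v : I -> V) c : f (\sum_i v i *~ c i) = \sum_i f (v i) *~ c i.
  by rewrite raddf_sum; apply: eq_bigr => i _; rewrite raddfMz.
have H1 (I : finType) (v : I -> V) : indep_mod Z B v -> indep_mod Z' B' (f \o v).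
  move=> [Zv Bv]; split=> [i|c Bc]; first exact: fZ.
  apply: Bv; apply/fB; last by rewrite fsum.
  by apply: subgroup_sum => // i _; exact: subgroup_mulrz.
have H2 (I : finType) (v : I -> W) : indep_mod Z' B' v -> exists w : I -> V, indep_mod Z B w.
  move=> [Zv Bv].
  have /choice[w wP] : forall i, exists z, Z z /\ B' (v i - f z).
    by move=> i; have [z] := fs _ (Zv i); exists z.
  exists w; split=> [i|c Bc]; first by have [] := wP i.
  apply: Bv.
  have -> : \sum_i v i *~ c i = \sum_i (v i - f (w i)) *~ c i + f (\sum_i w i *~ c i).
    rewrite fsum -big_split; apply: eq_bigr => i _ /=.
    by rewrite mulrzBl subrK.
  apply: subgroupD => //.
    by apply: subgroup_sum => // i _; apply: subgroup_mulrz => //; have [] := wP i.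
  apply/fB => //; apply: subgroup_sum => // i _; apply: subgroup_mulrz => //.
  by have [] := wP i.
split=> -[[v iv] nv]; split.
- by exists (f \o v); exact: H1.
- by move=> w /H2[u iu]; apply: (nv u).
- exact: H2 iv.
- by move=> w /H1; exact: nv.
Qed.

Lemma srank_incl (V : zmodType) (Z B Z' B' : set V) r :
  subgroup B' -> Z `<=` Z' -> subgroup Z ->
  (forall z, Z z -> B z <-> B' z) ->
  (forall z', Z' z' -> exists2 z, Z z & B' (z' - z)) ->
  has_srank Z B r <-> has_srank Z' B' r.
Proof. by move=> sB' ZZ sZ BB ex; exact: (@srank_iso V V idfun). Qed.

(** * Free abelian groups and supports of chains *)

HB.instance Definition _ (K : choiceType) (M : lmodType int) (f : K -> M) :=
  GRing.isZmodMorphism.Build {freeg K / int} M (fglift f) (lift_is_additive f).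

Section Freeg.
Variable K : choiceType.
Implicit Types (P : set K) (c : {freeg K / int}).

Lemma fgliftU (M : lmodType int) (f : K -> M) x : fglift f << x >> = f x.
Proof. by rewrite liftU scale1r. Qed.

Variant supp P c : Prop := Supp of (forall x, x \in dom c -> P x).

Lemma supp_subgroup P : subgroup (supp P).
Proof.
split=> [|c d [cP] [dP]]; split=> x; first by rewrite dom0.
by move=> /domB; rewrite mem_cat => /orP[]; [exact: cP|exact: dP].
Qed.

Lemma suppU P x : P x -> supp P << x >>.
Proof. by move=> Px; split=> y; rewrite domU1 inE => /eqP ->. Qed.

Lemma supp_mono P Q : P `<=` Q -> supp P `<=` supp Q.
Proof. by move=> PQ c [cP]; split=> x /cP/PQ. Qed.

Lemma suppI P Q c : supp P c -> supp Q c -> supp (P `&` Q) c.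
Proof. by move=> [cP] [cQ]; split=> x xc; split; [exact: cP|exact: cQ]. Qed.

(** The induction principle for chains: a property that defines a subgroup need only be checked on
    generators. *)
Lemma supp_sub P (S : set {freeg K / int}) : subgroup S ->
  (forall x, P x -> S << x >>) -> supp P `<=` S.
Proof.
move=> sS PS c [cP]; rewrite -[c]Freeg_dom.
have : forall x, x \in dom c -> P x := cP.
elim: (dom c) => [|x s IH] xP /=; first by rewrite freeg_nil; exact: sS.1.
rewrite -cat1s freeg_cat; apply: subgroupD => //; last first.
  by apply: IH => y ys; apply: xP; rewrite inE ys orbT.
rewrite -[coeff x c]intz -freegU_mulz; apply: subgroup_mulrz => //.
by apply: PS; apply: xP; rewrite inE eqxx.
Qed.

Lemma fg_ext_supp P (M : zmodType) (f g : {additive {freeg K / int} -> M}) c :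
  supp P c -> (forall x, P x -> f << x >> = g << x >>) -> f c = g c.
Proof.
move=> cP fg; have := @supp_sub P [set c | f c = g c]; apply => //.
split=> [|x y /= xE yE]; first by rewrite /= !raddf0.
by rewrite !raddfB xE yE.
Qed.

Lemma fg_ext (M : zmodType) (f g : {additive {freeg K / int} -> M}) :
  (forall x, f << x >> = g << x >>) -> f =1 g.
Proof. by move=> fg c; apply: (@fg_ext_supp setT). Qed.

Lemma supp_split P Q c : supp (P `|` Q) c ->
  exists c1 c2, [/\ supp P c1, supp Q c2 & c = c1 + c2].
Proof.
apply: (@supp_sub _ [set c | exists c1 c2, [/\ supp P c1, supp Q c2 & c = c1 + c2]]).
  split; first by exists 0, 0; rewrite addr0; split=> //; exact: (supp_subgroup _).1.
  move=> x y [a1 [a2 [a1P a2P ->]]] [b1 [b2 [b1P b2P ->]]].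
  exists (a1 - b1), (a2 - b2); split; try by apply: (supp_subgroup _).2.
  by rewrite opprD addrACA.
move=> x [Px|Qx]; [exists << x >>, 0|exists 0, << x >>]; rewrite ?addr0 ?add0r.
  by split=> //; [exact: suppU|exact: (supp_subgroup _).1].
by split=> //; [exact: (supp_subgroup _).1|exact: suppU].
Qed.

End Freeg.

Lemma fglift_supp (K J : choiceType) (P : set K) (Q : set J) (f : K -> {freeg J / int}) c :
  (forall x, P x -> supp Q (f x)) -> supp P c -> supp Q (fglift f c).
Proof.
move=> fP; apply: (@supp_sub _ P [set c | supp Q (fglift f c)]) => [|x Px /=].
  split=> [|x y /= xE yE]; first by rewrite /= raddf0; exact: (supp_subgroup Q).1.
  by rewrite raddfB; exact: (supp_subgroup Q).2.
by rewrite fgliftU; exact: fP.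
Qed.


(** * Ordered chains on lists of vertices, cones and prisms *)

Section ListChains.
Variable V : choiceType.
Local Notation L := {freeg (seq V) / int}.

(** The cone operator with apex [a]. *)
Definition consc (a : V) : L -> L := fglift (fun l => << a :: l >>).
HB.instance Definition _ a := GRing.Additive.on (consc a).

Lemma conscU a l : consc a << l >> = << a :: l >>.
Proof. exact: fgliftU. Qed.

(* Augmented ordered chains: the empty list is the generator of degree -1. *)
Fixpoint dl (l : seq V) : L :=
  if l is a :: l' then << l' >> - consc a (dl l') else 0.

Definition dL : L -> L := fglift dl.
HB.instance Definition _ := GRing.Additive.on dL.

Lemma dLU l : dL << l >> = dl l.
Proof. exact: fgliftU. Qed.

(** The cone formula. Thanks to the augmentation it holds in every degree without an exceptional
    case. *)
Lemma dL_consc a c : dL (consc a c) = c - consc a (dL c).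
Proof.
apply: (@fg_ext _ _ (dL \o consc a) (idfun \- (consc a \o dL))) => l /=.
by rewrite conscU !dLU.
Qed.

Lemma dLdL c : dL (dL c) = 0.
Proof.
apply: (@fg_ext _ _ (dL \o dL) \0) => l /=; rewrite dLU.
elim: l => [|a l IH] /=; first by rewrite raddf0.
by rewrite raddfB /= dLU dL_consc IH raddf0 subr0 subrr.
Qed.

Definition rem_nth (i : nat) (l : seq V) := take i l ++ drop i.+1 l.

(** Identifies the recursive differential with the alternating sum of faces used for singular
    simplices. *)
Lemma dlE l : dl l = \sum_(i < size l) (-1) ^+ i *: << rem_nth i l >>.
Proof.
elim: l => [|a l IH] /=; first by rewrite big_ord0.
rewrite big_ord_recl expr0 scale1r /rem_nth /= drop0 IH raddf_sum -sumrN.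
congr (_ + _); apply: eq_bigr => i _.
by rewrite raddfZsign /= conscU -scaleNr exprS mulN1r.
Qed.

End ListChains.

Ltac fg_ring := apply/eqP/freeg_eqP => ?; rewrite ?(coeffD, coeffN, coeff0); ring.

Section MapL.
Variables (V W : choiceType) (phi : V -> W).
Definition mapL : {freeg (seq V) / int} -> {freeg (seq W) / int} :=
  fglift (fun l => << map phi l >>).
HB.instance Definition _ := GRing.Additive.on mapL.

Lemma mapLU l : mapL << l >> = << map phi l >>.
Proof. exact: fgliftU. Qed.

Lemma mapL_consc a c : mapL (consc a c) = consc (phi a) (mapL c).
Proof.
apply: (@fg_ext _ _ (mapL \o consc a) (consc (phi a) \o mapL)) => l /=.
by rewrite conscU !mapLU conscU.
Qed.

Lemma mapL_dl l : mapL (dl l) = dl (map phi l).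
Proof.
elim: l => [|a l IH] /=; first by rewrite raddf0.
by rewrite raddfB /= mapLU mapL_consc IH.
Qed.

Lemma mapL_dL c : mapL (dL c) = dL (mapL c).
Proof.
apply: (@fg_ext _ _ (mapL \o @dL V) (@dL W \o mapL)) => l /=.
by rewrite mapLU !dLU mapL_dl.
Qed.
End MapL.

Lemma mapL_comp (U V W : choiceType) (f : V -> W) (g : U -> V) c :
  mapL f (mapL g c) = mapL (f \o g) c.
Proof.
apply: (@fg_ext _ _ (mapL f \o mapL g) (mapL (f \o g))) => l /=.
by rewrite !mapLU map_comp.
Qed.

Section Prism.
Variables (V I : choiceType) (i0 i1 : I).
Local Notation at0 := (mapL (fun v : V => (v, i0))).
Local Notation at1 := (mapL (fun v : V => (v, i1))).

(** The usual alternating prism sum, organised by recursion on the first vertex. *)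
Fixpoint prisml (l : seq V) : {freeg (seq (V * I)) / int} :=
  if l is v :: l' then
    consc (v, i0) (consc (v, i1) (at1 << l' >>)) - consc (v, i0) (prisml l')
  else 0.
Definition prismL := fglift prisml.
HB.instance Definition _ := GRing.Additive.on prismL.

Lemma prismL_consc v c :
  prismL (consc v c) = consc (v, i0) (consc (v, i1) (at1 c)) - consc (v, i0) (prismL c).
Proof.
apply: (@fg_ext _ _ (prismL \o consc v)
  ((consc (v, i0) \o (consc (v, i1) \o at1)) \- (consc (v, i0) \o prismL))) => l /=.
by rewrite conscU /prismL !fgliftU.
Qed.

Lemma dL_prism c : dL (prismL c) = at1 c - at0 c - prismL (dL c).
Proof.
apply: (@fg_ext _ _ (@dL (V * I)%type \o prismL) ((at1 \- at0) \- (prismL \o @dL V))) => l /=.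
rewrite dLU {1}/prismL fgliftU; elim: l => [|v l IH] /=.
  by rewrite !mapLU /= !raddf0 subrr addr0.
rewrite !raddfB /= !dL_consc IH.
rewrite -(@mapL_dL _ _ (fun v : V => (v, i1))) dLU prismL_consc.
rewrite !raddfB /= !mapLU /= !conscU {2}/prismL fgliftU.
by fg_ring.
Qed.

End Prism.

(** * Barycentric subdivision and convexity *)

Section Subdivision.
Variables (R : numFieldType) (V : lmodType R).
Local Notation L := {freeg (seq V) / int}.

Implicit Types (l : seq V) (c : L).

Definition bary (l : seq V) : V := (size l)%:R^-1 *: \sum_(v <- l) v.

(** The subdivision homotopy, taken as primitive: the cone from the barycentre over a simplex minus
    the homotopy applied to its boundary. The number [n] is fuel for the recursion on faces, always
    instantiated with the length of the list. *)
Fixpoint Tn (n : nat) (l : seq V) : L :=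
  if n is m.+1 then consc (bary l) (<< l >> - fglift (Tn m) (dl l)) else 0.

Definition TL : L -> L := fglift (fun l => Tn (size l) l).
HB.instance Definition _ := GRing.Additive.on TL.

Lemma TLU l : TL << l >> = Tn (size l) l.
Proof. exact: fgliftU. Qed.

(** Subdivision is defined from the homotopy, so that the homotopy formula holds by definition; the
    usual description as a cone over the subdivided boundary is [SLE]. *)
Definition SL (c : L) : L := c - dL (TL c) - TL (dL c).
Fact SL_additive : zmod_morphism SL.
Proof. move=> x y; rewrite /SL !raddfB /=.
by fg_ring. Qed.
HB.instance Definition _ := GRing.isZmodMorphism.Build L L SL SL_additive.

Definition sizeP (n : nat) : set (seq V) := [set l | size l = n].

Lemma consc_size n a c : supp (sizeP n) c -> supp (sizeP n.+1) (consc a c).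
Proof. by apply: fglift_supp => l /= <-; apply: suppU. Qed.

Lemma dl_size l : supp (sizeP (size l).-1) (dl l).
Proof.
elim: l => [|a l IH] /=; first exact: (supp_subgroup _).1.
apply: (supp_subgroup _).2; first exact: suppU.
case: l IH => [|b l] IH; first by rewrite /= raddf0; exact: (supp_subgroup _).1.
exact: (@consc_size (size l)).
Qed.

Lemma TLE l : l != [::] -> TL << l >> = consc (bary l) (<< l >> - TL (dl l)).
Proof.
move=> l0; rewrite TLU; case: l l0 => // a l _; rewrite [LHS]/=; congr (consc _ (_ - _)).
apply: (@fg_ext_supp _ (sizeP (size l))); first exact: (@dl_size (a :: l)).
by move=> k <-; apply: etrans (fgliftU _ _) (esym (TLU _)).
Qed.

Lemma dL_SL c : dL (SL c) = SL (dL c).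
Proof. by rewrite /SL !raddfB /= !dLdL !raddf0 !addr0. Qed.

(** The cone formula applied to [TLE], with the definition of [SL] on the boundary. On the empty
    list the formula fails, where [SL] is the identity. *)
Lemma SLE l : l != [::] -> SL << l >> = consc (bary l) (SL (dl l)).
Proof.
move=> l0; rewrite [LHS]/SL dLU TLE // dL_consc !raddfB /= dLU.
have -> : dL (TL (dl l)) = dl l - TL (dL (dl l)) - SL (dl l).
  by rewrite /SL; fg_ring.
have -> : dL (dl l) = 0 by rewrite -dLU dLdL.
rewrite !(raddfB, raddf0) /=.
by fg_ring.
Qed.

Lemma SL_nil : SL << [::] >> = << [::] >> :> L.
Proof. by rewrite /SL dLU TLU /= !raddf0 !addr0. Qed.

End Subdivision.

Section SubdivisionNat.
Variables (R : numFieldType) (V W : lmodType R) (phi : {linear V -> W}).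

Lemma bary_map l : bary (map phi l) = phi (bary l).
Proof. by rewrite /bary size_map big_map linearZ_LR [in RHS]linear_sum. Qed.

Lemma TL_map c : TL (mapL phi c) = mapL phi (TL c).
Proof.
apply: (@fg_ext _ _ (@TL _ W \o mapL phi) (mapL phi \o @TL _ V)) => l /=.
rewrite mapLU !TLU size_map.
have [n] := ubnP (size l); elim: n l => // n IH [|a l] /= ln; first by rewrite raddf0.
rewrite mapL_consc -(bary_map (a :: l)) /=; congr consc.
rewrite [in RHS]raddfB /= mapLU /=; congr (_ - _).
have /= <- := mapL_dl phi (a :: l).
apply: (@fg_ext_supp _ (@sizeP _ V (size l)) _ (fglift (Tn (size l)) \o mapL phi)
  (mapL phi \o fglift (Tn (size l)))); first exact: (@dl_size _ _ (a :: l)).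
by move=> k /= kl; rewrite mapLU !fgliftU -kl IH // kl.
Qed.

Lemma SL_map c : SL (mapL phi c) = mapL phi (SL c).
Proof. by rewrite /SL !raddfB /= TL_map -!mapL_dL TL_map. Qed.

End SubdivisionNat.

Section Convex.
Variables (R : realType) (V : lmodType R).
Definition cvx (K : set V) := forall n (w : 'I_n -> R) (v : 'I_n -> V),
  (forall i, 0 <= w i) -> \sum_i w i = 1 -> (forall i, K (v i)) -> K (\sum_i w i *: v i).

Lemma cvx_bary K l : cvx K -> l != [::] -> (forall v, v \in l -> K v) -> K (bary l).
Proof.
move=> cK l0 lK; rewrite /bary (big_nth 0) big_mkord scaler_sumr.
apply: cK => [i||i]; first by rewrite invr_ge0.
  rewrite sumr_const card_ord -[LHS]mulr_natl mulfV // pnatr_eq0.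
  by case: l l0 {lK}.
by apply: lK; apply: mem_nth.
Qed.

Definition listP (K : set V) : set (seq V) :=
  [set l : seq V | forall v, v \in l -> K v].

Lemma consc_listP K a c : K a -> supp (listP K) c -> supp (listP K) (consc a c).
Proof.
move=> Ka; apply: fglift_supp => l /= lK; apply: suppU => v.
by rewrite inE => /orP[/eqP ->//|]; exact: lK.
Qed.

Lemma dl_listP K l : listP K l -> supp (listP K) (dl l).
Proof.
elim: l => [|a l IH] lK /=; first exact: (supp_subgroup _).1.
have Kl : listP K l by move=> v vl; apply: lK; rewrite inE vl orbT.
apply: (supp_subgroup _).2; first exact: suppU.
by apply: consc_listP; [apply: lK; rewrite inE eqxx|exact: IH].
Qed.

Lemma dL_listP K c : supp (listP K) c -> supp (listP K) (dL c).
Proof. by apply: fglift_supp => l; exact: dl_listP. Qed.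

Lemma TL_listP K c : cvx K -> supp (listP K) c -> supp (listP K) (TL c).
Proof.
move=> cK; apply: fglift_supp => l; move: {2}(size l) (erefl (size l)) => n.
elim: n l => [|n IH] l ln lK; rewrite ln /=; first exact: (supp_subgroup _).1.
apply: consc_listP; first by apply: cvx_bary => //; rewrite -size_eq0 ln.
apply: (supp_subgroup _).2; first exact: suppU.
apply: (@fglift_supp _ _ (listP K `&` @sizeP _ V n)).
  by move=> k [kK /= kn]; rewrite -kn; apply: IH.
by apply: suppI; [exact: dl_listP|have := @dl_size _ V l; rewrite ln].
Qed.

Lemma SL_listP K c : cvx K -> supp (listP K) c -> supp (listP K) (SL c).
Proof.
move=> cK cP; rewrite /SL; apply: (supp_subgroup _).2; first apply: (supp_subgroup _).2 => //.
  by apply: dL_listP; exact: TL_listP.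
by apply: TL_listP => //; exact: dL_listP.
Qed.

Lemma TL_size n c : supp (@sizeP _ V n) c -> supp (@sizeP _ V n.+1) (TL c).
Proof.
apply: fglift_supp => l /=; move: {2}(size l) (erefl (size l)) => m.
elim: m l n => [|m IH] l n lm ln; rewrite lm /=; first exact: (supp_subgroup _).1.
apply: consc_size; apply: (supp_subgroup _).2; first exact: suppU.
apply: (@fglift_supp _ _ (@sizeP _ V m)).
  by move=> k /= km; rewrite -ln lm -km; apply: IH.
by have := @dl_size _ V l; rewrite lm.
Qed.

Lemma dL_size n c : supp (@sizeP _ V n) c -> supp (@sizeP _ V n.-1) (dL c).
Proof. by apply: fglift_supp => l /= <-; exact: dl_size. Qed.

Lemma SL_size n c : supp (@sizeP _ V n.+1) c -> supp (@sizeP _ V n.+1) (SL c).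
Proof.
move=> cn; rewrite /SL; apply: (supp_subgroup _).2; first apply: (supp_subgroup _).2 => //.
  by have := dL_size (TL_size cn).
by have := TL_size (dL_size cn).
Qed.

End Convex.
Arguments listP {R V} K.

(** * Singular chains as realisations of ordered chains *)

Section Pack.
Variables (X Y : topologicalType) (f : X -> Y) (cf : continuous f).
(** The dummy [let] keeps the continuity proof among the arguments, so that a structure instance can
    be attached to the function. *)
Definition packf : X -> Y := let _ := cf in f.
HB.instance Definition _ := isContinuous.Build X Y packf cf.
Definition pack : continuousType X Y := packf.
End Pack.

Lemma cont_ext (X Y : topologicalType) (f g : continuousType X Y) : f =1 g -> f = g.
Proof.
case: f g => f [[cf]] [g [[cg]]] /= /funext fg.
by move: cf cg; rewrite fg => cf cg; rewrite (Prop_irrelevance cf cg).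
Qed.

Notation simp R n := (set_type (@std_simplex R n)).

Section Singular.
Variables (R : realType) (E : topologicalType).
(** Simplices of all dimensions form one type: chains then live in a single free group with one
    endomorphism [bd], and degrees are tracked by the support condition [sP]. *)
Definition Sx := {n & singular_simplex R E n}.
HB.instance Definition _ := Choice.on Sx.
Local Notation C := {freeg Sx / int}.

Definition inC n : chain R E n -> C := fglift (fun s : singular_simplex R E n => << (existT _ n s : Sx) >>).
HB.instance Definition _ n := GRing.Additive.on (@inC n).

Definition bdS (s : Sx) : C :=
  match s with existT n s' =>
    match n return singular_simplex R E n -> C with
    | 0 => fun=> 0
    | m.+1 => fun s' => inC (boundary_simplex s')
    end s'
  end.
Definition bd : C -> C := fglift bdS.
HB.instance Definition _ := GRing.Additive.on bd.

Definition simf (s : Sx) : simp R (projT1 s) -> E :=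
  (projT2 s : singular_simplex R E (projT1 s)).

Arguments simf s : clear implicits.

Definition sP (n : nat) (A : set E) : set Sx :=
  [set s : Sx | projT1 s = n /\ range (simf s) `<=` A].

End Singular.
Arguments simf {R E} s.

Section Comb.
Variables (R : realType) (V : normedModType R).

Definition comb (n : nat) (l : seq V) (x : 'rV[R]_n.+1) : V :=
  \sum_(i < n.+1) x ord0 i *: l`_i.

Fact comb_linear n l : linear (@comb n l).
Proof.
move=> a x y; rewrite /comb scaler_sumr -big_split; apply: eq_bigr => i _ /=.
by rewrite !mxE scalerDl scalerA.
Qed.
HB.instance Definition _ n l := GRing.isLinear.Build R 'rV[R]_n.+1 V *:%R
  (@comb n l) (@comb_linear n l).

Lemma comb_continuous n l : continuous (@comb n l).
Proof.
apply: cnt_sum => i; apply: cntZ; last exact: cnt_cst.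
by apply: cnt_coord; exact: cnt_id.
Qed.

Lemma comb_cvx (K : set V) n l (x : simp R n) : cvx K -> size l = n.+1 ->
  listP K l -> K (comb l (\val x)).
Proof.
case: x => x /= /set_mem[x0 x1] cK ln lK; apply: cK => // i.
by apply: lK; rewrite mem_nth // ln.
Qed.

End Comb.

Section Retraction.
Variables (R : realType) (n : nat).
Local Notation vec := 'rV[R]_n.+1.

Definition abssum (v : vec) : R := \sum_i `|v ord0 i|.
(** A retraction of the whole vector space onto the simplex: the absolute values are scaled down,
    and the missing mass is put on vertex 0. It is nonnegative since
    [abssum v <= 1 + |abssum v - 1|], and zero on the simplex. It extends singular simplices to maps
    on a vector space, on which linear maps operate. *)
Definition retfun (v : vec) : vec :=
  (1 + `|abssum v - 1|)^-1 *: (\sum_i `|v ord0 i| *: delta_mx ord0 i) +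
  (1 - (1 + `|abssum v - 1|)^-1 * abssum v) *: delta_mx ord0 ord0.

Let dpos v : 0 < 1 + `|abssum v - 1|.
Proof. by rewrite ltr_wpDr. Qed.

Lemma retfunE v i : retfun v ord0 i = (1 + `|abssum v - 1|)^-1 * `|v ord0 i| +
   (1 - (1 + `|abssum v - 1|)^-1 * abssum v) * (i == ord0)%:R.
Proof.
rewrite !mxE eqxx /= summxE (bigD1 i) //= big1 ?addr0; last first.
  by move=> j ji; rewrite !mxE eqxx /= eq_sym (negPf ji) mulr0.
by rewrite !mxE !eqxx mulr1.
Qed.

Lemma retfun_subproof v : retfun v \in @std_simplex R n.
Proof.
apply/mem_set; split=> [i|].
  rewrite retfunE addr_ge0 ?mulr_ge0 ?invr_ge0 ?(ltW (dpos v)) //.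
  rewrite subr_ge0 mulrC ler_pdivrMr ?dpos // mul1r.
  have := ler_norm (abssum v - 1); lra.
under eq_bigr do rewrite retfunE.
rewrite big_split /= -mulr_sumr -mulr_sumr -/(abssum v).
have -> : \sum_(i < n.+1) (i == ord0)%:R = 1 :> R.
  by rewrite (bigD1 ord0) //= big1 ?addr0 // => i /negPf ->.
by rewrite mulr1 addrC subrK.
Qed.

Definition ret (v : vec) : simp R n := SigSub (retfun_subproof v).

Lemma abssum_continuous : continuous abssum.
Proof.
by apply: cnt_sum => i; apply: cnt_norm; apply: cnt_coord; exact: cnt_id.
Qed.

Lemma ret_continuous : continuous ret.
Proof.
have cs : continuous (fun v => (1 + `|abssum v - 1|)^-1).
  apply: cntV; first by move=> v; rewrite gt_eqF.
  apply: cntD; first exact: cnt_cst.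
  by apply: cnt_norm; apply: cntB; [exact: abssum_continuous|exact: cnt_cst].
apply: continuous_comp_initial; apply: cntD.
  apply: cntZ => //; apply: cnt_sum => i; apply: cntZ; last exact: cnt_cst.
  by apply: cnt_norm; apply: cnt_coord; exact: cnt_id.
apply: cntZ; last exact: cnt_cst.
apply: cntB; first exact: cnt_cst.
by apply: cntM => //; exact: abssum_continuous.
Qed.

Lemma retK (v : vec) : @std_simplex R n v -> \val (ret v) = v.
Proof.
move=> [v0 v1]; have vs : abssum v = 1.
  by rewrite -v1; apply: eq_bigr => i _; rewrite ger0_norm.
apply/rowP => i; rewrite retfunE vs subrr normr0 addr0 invr1 !mul1r subrr mul0r addr0.
by rewrite ger0_norm.
Qed.

Lemma ret_val (x : simp R n) : ret (\val x) = x.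
Proof. by apply: val_inj; apply: retK; exact: set_mem (valP x). Qed.

Lemma cvx_simplex : cvx (@std_simplex R n).
Proof.
move=> m w v w0 w1 vK; split=> [j|].
  rewrite summxE; apply: sumr_ge0 => i _; rewrite mxE; apply: mulr_ge0 => //.
  exact: (vK i).1.
under eq_bigr do rewrite summxE.
rewrite exchange_big /= -[RHS]w1; apply: eq_bigr => i _.
by under eq_bigr do rewrite mxE; rewrite -mulr_sumr (vK i).2 mulr1.
Qed.

Definition iota_s : seq vec := [seq delta_mx ord0 i | i <- enum 'I_n.+1].

Lemma size_iota_s : size iota_s = n.+1.
Proof. by rewrite size_map size_enum_ord. Qed.

Lemma nth_iota_s (i : 'I_n.+1) : iota_s`_i = delta_mx ord0 i.
Proof. by rewrite (nth_map ord0) ?nth_ord_enum // size_enum_ord. Qed.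

Lemma iota_s_simplex : listP (@std_simplex R n) iota_s.
Proof.
move=> v /mapP[i _ ->]; split=> [j|]; first by rewrite mxE ler0n.
by rewrite (bigD1 i) //= big1 ?addr0 ?mxE ?eqxx // => j /negPf ji; rewrite mxE ji.
Qed.

Lemma comb_iota_s (x : vec) : comb iota_s x = x.
Proof.
rewrite /comb; under eq_bigr do rewrite nth_iota_s.
by rewrite -row_sum_delta.
Qed.

End Retraction.

Section Realization.
Variables (R : realType) (V : normedModType R) (E : topologicalType) (G : V -> E).
Hypothesis cG : continuous G.
Local Notation C := {freeg (Sx R E) / int}.

Definition affine n (l : seq V) (x : simp R n) : E := G (comb l (\val x)).

Lemma affine_continuous n l : continuous (@affine n l).
Proof.
move=> x; apply: (@continuous_comp _ _ _ (fun x : simp R n => comb l (\val x)) G).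
  apply: (@continuous_comp _ _ _ (@set_val _ (@std_simplex R n)) (comb l)).
    exact: initial_continuous.
  exact: comb_continuous.
exact: cG.
Qed.

Definition asimp n l : singular_simplex R E n := pack (@affine_continuous n l).

(** A list of [n + 1] vectors gives an [n]-simplex; the empty list, in degree -1, is sent to 0,
    which removes the augmentation. *)
Definition reall (l : seq V) : C :=
  if size l is n.+1 then << existT _ n (asimp n l) : Sx R E >> else 0.
Definition real : {freeg (seq V) / int} -> C := fglift reall.
HB.instance Definition _ := GRing.Additive.on real.

Lemma reallE n l : size l = n.+1 -> reall l = << existT _ n (asimp n l) : Sx R E >>.
Proof. by rewrite /reall => ->. Qed.

Lemma inC_U n (s : singular_simplex R E n) : inC << s >> = << existT _ n s : Sx R E >>.
Proof. exact: fgliftU. Qed.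

Lemma bdU n (s : singular_simplex R E n.+1) :
  bd << existT _ n.+1 s : Sx R E >> = inC (boundary_simplex s).
Proof. exact: fgliftU. Qed.

Lemma bdU0 (s : singular_simplex R E 0) : bd << existT _ 0%N s : Sx R E >> = 0.
Proof. exact: fgliftU. Qed.

Lemma asimp_coface n (l : seq V) (i : 'I_n.+2) : size l = n.+2 ->
  (asimp n.+1 l \o @coface R n i : singular_simplex R E n) = asimp n (rem_nth i l).
Proof.
move=> ln; apply: cont_ext => x; rewrite /= /packf /affine; congr G.
rewrite /comb (bigD1 i) //= mxE unlift_none /= scale0r add0r.
rewrite (reindex_onto (lift i) (fun j => odflt ord0 (unlift i j))) /=; last first.
  by move=> j; case: unliftP => [j' ->|->]; rewrite ?eqxx.
apply: eq_big => [j|j _]; first by rewrite liftK eqxx andbT eq_sym neq_lift.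
rewrite mxE liftK /=; congr (_ *: _).
rewrite /rem_nth nth_cat size_take ln ltn_ord /= /bump.
have [ij|ji] := leqP i j.
  by rewrite nth_drop addSn subnKC.
by rewrite nth_take.
Qed.

Lemma size_rem_nth (T : choiceType) i (l : seq T) : (i < size l)%N ->
  size (rem_nth i l) = (size l).-1.
Proof.
move=> il; rewrite size_cat size_drop size_takel ?(ltnW il) //.
by case: (size l) il => // n; rewrite ltnS subSS => /subnKC.
Qed.

Lemma realU l : real << l >> = reall l.
Proof. exact: fgliftU. Qed.

Lemma bd_reall l : bd (reall l) = real (dl l).
Proof.
case sl : (size l) => [|[|n]].
- by move/size0nil: sl => ->; rewrite /= !raddf0.
- case: l sl => [|a []] // _; rewrite (@reallE 0) // bdU0 /= raddf0 subr0.
  by rewrite realU.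
rewrite (@reallE n.+1) // bdU /boundary_simplex raddf_sum /= dlE sl raddf_sum /=.
apply: eq_bigr => i _; rewrite asimp_coface // !raddfZsign /= inC_U realU.
by rewrite (@reallE n) // size_rem_nth sl.
Qed.

Lemma bd_real c : bd (real c) = real (dL c).
Proof.
apply: (@fg_ext _ _ (@bd R E \o real) (real \o @dL V)) => l /=.
by rewrite realU bd_reall dLU.
Qed.

Lemma real_supp n (K : set V) (A : set E) c : cvx K -> (forall v, K v -> A (G v)) ->
  supp (listP K `&` @sizeP _ V n.+1) c -> supp (sP n A) (real c).
Proof.
move=> cK KA; apply: fglift_supp => l [lK ln]; rewrite (reallE ln); apply: suppU.
split=> // _ [x _ <-]; rewrite /simf /= /packf /affine; apply: KA.
exact: comb_cvx.
Qed.

End Realization.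

(** The realisation only sees the values on the convex set containing the vertices; this is how the
    retraction hidden in [hat] is discarded. *)
Lemma real_hull (R : realType) (V : normedModType R) (E : topologicalType) (G G' : V -> E)
   (cG : continuous G) (cG' : continuous G') (K : set V) c :
  cvx K -> (forall v, K v -> G v = G' v) -> supp (listP K) c -> real cG c = real cG' c.
Proof.
move=> cK KG cP; apply: (@fg_ext_supp _ _ _ (real cG) (real cG') _ cP) => l lK /=; rewrite !realU /reall.
case sl : (size l) => [//|n]; congr << existT _ n _ >>.
by apply: cont_ext => x; apply: KG; exact: comb_cvx.
Qed.

Lemma real_map (R : realType) (V W : normedModType R) (E : topologicalType) (G : W -> E)
  (phi : {linear V -> W}) (cG : continuous G) (cGphi : continuous (fun v => G (phi v))) c :
  real cGphi c = real cG (mapL phi c).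
Proof.
apply: (@fg_ext _ _ (real cGphi) (real cG \o mapL phi)) => l /=.
rewrite mapLU !realU /reall size_map; case sl : (size l) => [//|n].
congr << existT _ n _ >>; apply: cont_ext => x; congr G; rewrite /comb linear_sum.
by apply: eq_bigr => i _; rewrite linearZ_LR (nth_map 0) // sl.
Qed.

Section Hat.
Variables (R : realType) (E : topologicalType).
Implicit Types s : Sx R E.

Definition hat s (v : 'rV[R]_(projT1 s).+1) : E := simf s (ret v).

Lemma simf_continuous s : continuous (simf s).
Proof. exact: (@cts_fun _ _ (projT2 s : singular_simplex R E (projT1 s))). Qed.

Lemma hat_continuous s : continuous (@hat s).
Proof. exact: cnt_comp (@ret_continuous R (projT1 s)) (@simf_continuous s). Qed.

Lemma hat_range s A : range (simf s) `<=` A -> forall v, A (@hat s v).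
Proof. by move=> sA v; apply: sA; exists (ret v). Qed.

(** The universal example: each singular simplex realises the standard affine simplex. Identities
    between operators on singular chains thereby reduce to identities on ordered chains. *)
Lemma real_hat s : real (@hat_continuous s) << iota_s R (projT1 s) >> = << s >>.
Proof.
rewrite realU (reallE _ (size_iota_s R _)); case: s => n s; congr << existT _ n _ >>.
by apply: cont_ext => x; rewrite /= /packf /affine comb_iota_s /hat ret_val.
Qed.

End Hat.
Arguments hat {R E} s v.

(** * Natural operators and their action on singular chains *)

Section NatOp.
Variable R : realType.
Local Notation L V := {freeg (seq V) / int}.
Local Notation timed V := (V * R^o)%type.

Definition timed_map (V W : normedModType R) (phi : V -> W) (x : timed V) : timed W :=
  (phi x.1, x.2).
Fact timed_map_linear (V W : normedModType R) (phi : {linear V -> W}) :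
  linear (timed_map phi).
Proof. by move=> a [x s] [y t]; rewrite /timed_map /= linearP. Qed.
HB.instance Definition _ (V W : normedModType R) (phi : {linear V -> W}) :=
  GRing.isLinear.Build R (timed V) (timed W) *:%R (timed_map phi) (timed_map_linear phi).

Definition timed_set (V : normedModType R) (K : set V) : set (timed V) := [set x | K x.1].

Lemma timed_cvx (V : normedModType R) (K : set V) : cvx K -> cvx (timed_set K).
Proof.
move=> cK n w v w0 w1 vK; rewrite /timed_set /=.
have -> : (\sum_i w i *: v i).1 = \sum_i w i *: (v i).1.
  by elim/big_rec2: _ => // i y1 y2 _ <-.
exact: cK.
Qed.

(* An operator on ordered chains of vectors (the real coordinate is the time
   of a homotopy), natural with respect to linear maps. *)
Record natop := NatOp {
  nop : forall V : normedModType R, L V -> L (timed V);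
  nop_sub : forall V, zmod_morphism (@nop V);
  nop_nat : forall (V W : normedModType R) (phi : {linear V -> W}) c,
    nop (mapL phi c) = mapL (timed_map phi) (nop c);
  nop_hull : forall (V : normedModType R) (K : set V) c, cvx K -> supp (listP K) c ->
    supp (listP (timed_set K)) (nop c);
  nop_nil : forall V : normedModType R, supp (@sizeP _ (timed V) 0) (@nop V << [::] >>) }.
HB.instance Definition _ (o : natop) (V : normedModType R) :=
  GRing.isZmodMorphism.Build (L V) (L (timed V)) (@nop o V) (@nop_sub o V).

Lemma mapL_listP (V W : normedModType R) (phi : V -> W) (K : set V) (K' : set W) c :
  (forall v, K v -> K' (phi v)) -> supp (listP K) c -> supp (listP K') (mapL phi c).
Proof.
move=> KK; apply: fglift_supp => l lK; apply: suppU => _ /mapP[v vl ->].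
by apply: KK; exact: lK.
Qed.

Definition at_time (t : R) (V : normedModType R) : L V -> L (timed V) :=
  mapL (fun v => (v, t) : timed V).

Section AtOp.
Variables (t : R) (o : forall V : normedModType R, L V -> L V).
Hypothesis o_sub : forall V, zmod_morphism (@o V).
Hypothesis o_nat : forall (V W : normedModType R) (phi : {linear V -> W}) c,
  o (mapL phi c) = mapL phi (o c).
Hypothesis o_hull : forall (V : normedModType R) (K : set V) c, cvx K ->
  supp (listP K) c -> supp (listP K) (o c).
Hypothesis o_nil : forall V : normedModType R, supp (@sizeP _ V 0) (@o V << [::] >>).

Let f (V : normedModType R) (c : L V) : L (timed V) := at_time t (o c).
Fact at_op_sub V : zmod_morphism (@f V).
Proof. by move=> x y; rewrite /f o_sub /at_time raddfB. Qed.
Fact at_op_nat (V W : normedModType R) (phi : {linear V -> W}) c :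
  f (mapL phi c) = mapL (timed_map phi) (f c).
Proof. by rewrite /f o_nat /at_time !mapL_comp. Qed.
Fact at_op_hull (V : normedModType R) (K : set V) c : cvx K ->
  supp (listP K) c -> supp (listP (timed_set K)) (f c).
Proof. by move=> cK Kc; apply: mapL_listP (o_hull cK Kc). Qed.
Fact at_op_nil (V : normedModType R) : supp (@sizeP _ (timed V) 0) (f (<< [::] >> : L V)).
Proof.
by apply: fglift_supp (@o_nil V) => l /= /size0nil ->; exact: suppU.
Qed.
Definition at_op := NatOp at_op_sub at_op_nat at_op_hull at_op_nil.
End AtOp.

Definition id_op (V : normedModType R) (c : L V) : L V := c.
Definition atop (t : R) : natop.
Proof. by refine (@at_op t id_op _ _ _ _) => // V; exact: suppU. Defined.

Definition TL_op (V : normedModType R) (c : L V) : L V := TL c.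
Definition tl_op : natop.
Proof.
refine (@at_op 0 TL_op _ _ _ _) => [V|V W phi c|V K c|V].
- exact: raddfB.
- exact: TL_map.
- exact: TL_listP.
- by rewrite /TL_op TLU /=; exact: (supp_subgroup _).1.
Defined.

Definition SL_op (V : normedModType R) (c : L V) : L V := SL c.
Definition sl_op : natop.
Proof.
refine (@at_op 0 SL_op _ _ _ _) => [V|V W phi c|V K c|V].
- exact: raddfB.
- exact: SL_map.
- exact: SL_listP.
- by rewrite /SL_op SL_nil; exact: suppU.
Defined.

Definition prism_op : natop.
Proof.
refine (@NatOp (fun V c => prismL (0 : R^o) 1 c : L (timed V)) _ _ _ _) =>
  [V|V W phi c|V K c cK|V].
- exact: raddfB.
- apply: (@fg_ext _ _ (@prismL W R^o 0 1 \o mapL phi) (mapL (timed_map phi) \o prismL 0 1)).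
  move=> l /=; rewrite mapLU /prismL !fgliftU; elim: l => [|v l IH] /=.
    by rewrite raddf0.
  rewrite raddfB /= !mapL_consc -IH !mapLU /=; congr (consc _ (consc _ << _ >>) - _).
  by rewrite -!map_comp.
- apply: fglift_supp; elim=> [|v l IH] lK /=; first exact: (supp_subgroup _).1.
  have Kv : K v by apply: lK; rewrite inE eqxx.
  have Kl : listP K l by move=> w wl; apply: lK; rewrite inE wl orbT.
  apply: (supp_subgroup _).2; last by apply: (@consc_listP _ (timed V)) => //; exact: IH.
  do 2!apply: (@consc_listP _ (timed V)) => //; rewrite mapLU; apply: suppU.
  by move=> _ /mapP[w wl ->]; exact: Kl.
- by rewrite /prismL fgliftU; exact: (supp_subgroup _).1.
Defined.

End NatOp.

Lemma rangeP_real (R : realType) (V : normedModType R) (E : topologicalType) (G : V -> E)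
  (cG : continuous G) (c : {freeg (seq V) / int}) :
  supp (@sizeP _ V 0) c -> real cG c = 0.
Proof.
move=> c0; apply: (@fg_ext_supp _ _ _ (real cG) \0 _ c0) => l /= /size0nil ->.
by rewrite realU.
Qed.

Definition clamp (R : realType) (t : R) : R := Num.max 0 (Num.min t 1).

Lemma clamp_itv (R : realType) (t : R) : 0 <= clamp t <= 1.
Proof. by rewrite /clamp le_max lexx /= ge_max ler01 /= ge_min lexx orbT. Qed.

Lemma clamp_id (R : realType) (t : R) : 0 <= t <= 1 -> clamp t = t.
Proof. by move=> /andP[t0 t1]; rewrite /clamp min_l // max_r. Qed.

Lemma clamp_continuous (R : realType) : continuous (@clamp R).
Proof.
by apply: cnt_max; [exact: cnt_cst|apply: cnt_min; [exact: cnt_id|exact: cnt_cst]].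
Qed.

Section SingularOp.
Variables (R : realType) (E E' : topologicalType) (D : set E) (H : E -> R -> E').
Local Notation C E := {freeg (Sx R E) / int}.

(* Continuity of a homotopy defined on a subset, tested along continuous maps. *)
Definition plot2 := forall (W : topologicalType) (k : W -> E) (t : W -> R),
  continuous k -> continuous t -> (forall w, D (k w)) -> (forall w, 0 <= t w <= 1) ->
  continuous (fun w => H (k w) (t w)).
Hypothesis pH : plot2.

Definition Kmap (V : normedModType R) (G : V -> E) (x : V * R^o) : E' := H (G x.1) (clamp x.2).

Lemma Kmap_continuous (V : normedModType R) (G : V -> E) : continuous G ->
  (forall v, D (G v)) -> continuous (Kmap G).
Proof.
move=> cG GD; apply: pH => [| |x|x]; last 2 first.
- exact: GD.
- exact: clamp_itv.
- by apply: (cnt_comp (cnt_fst (@cnt_id _)) cG).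
- exact: (cnt_comp (cnt_snd (@cnt_id _)) (@clamp_continuous R)).
Qed.

(** The operator is applied to the standard simplex and realised through [s] followed by [H].
    Simplices that leave [D], where [H] may be discontinuous, are sent to 0. *)
Definition singop_simplex (o : natop R) (s : Sx R E) : C E' :=
  match pselect (range (simf s) `<=` D) with
  | left sD => real (Kmap_continuous (@hat_continuous _ _ s) (hat_range sD))
                 (nop o << iota_s R (projT1 s) >>)
  | right _ => 0
  end.
Definition singop (o : natop R) : C E -> C E' := fglift (singop_simplex o).
HB.instance Definition _ o := GRing.Additive.on (singop o).

Definition inD : set (Sx R E) := [set s | range (simf s) `<=` D].

(** Naturality: the affine simplex with vertices [l] is the image of the standard one under the
    linear map [comb l], with which the operator commutes. *)
Lemma singop_real (o : natop R) (V : normedModType R) (G : V -> E) (cG : continuous G)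
  (GD : forall v, D (G v)) c : singop o (real cG c) = real (Kmap_continuous cG GD) (nop o c).
Proof.
apply: (@fg_ext _ _ (singop o \o real cG) (real (Kmap_continuous cG GD) \o @nop R o V)) => l.
rewrite [LHS]/= [RHS]/= realU /reall; case sl : (size l) => [|n].
  by rewrite raddf0 rangeP_real // (size0nil sl); exact: nop_nil.
rewrite /singop fgliftU /singop_simplex; case: pselect => [sD|]; last first.
  by case; move=> _ [x _ <-]; exact: GD.
pose phi : {linear 'rV[R]_n.+1 -> V} := comb l.
have cphi : continuous (fun x : 'rV[R]_n.+1 * R^o => Kmap G (timed_map phi x)).
  exact: (Kmap_continuous (cnt_comp (@comb_continuous R V n l) cG) (fun v => GD _)).
(* The two maps differ by the retraction [ret], which is the identity on the simplex, and [nop_hull]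
   keeps the chain there. *)
have -> : real (Kmap_continuous (@hat_continuous _ _ (existT _ n (asimp cG n l)))
  (hat_range sD)) (nop o << iota_s R n >>) = real cphi (nop o << iota_s R n >>).
  apply: (@real_hull _ _ _ _ _ _ _ (timed_set (@std_simplex R n))).
  - by apply: timed_cvx; exact: cvx_simplex.
  - move=> [v t] vD; rewrite /Kmap /=; congr H.
    rewrite /hat /simf /= /packf /affine; congr (G (comb l _)); exact: (retK vD).
  - apply: (@nop_hull R o _ (@std_simplex R n)); first exact: cvx_simplex.
    by apply: suppU; exact: iota_s_simplex.
rewrite (real_map (Kmap_continuous cG GD) cphi) -nop_nat mapLU; congr (real _ (nop o << _ >>)).
apply: (@eq_from_nth _ 0); first by rewrite size_map size_iota_s.
move=> i; rewrite size_map size_iota_s => lin.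
rewrite (nth_map 0) ?size_iota_s // (nth_iota_s _ (Ordinal lin)).
change (comb l (delta_mx ord0 (Ordinal lin)) = l`_i).
rewrite /comb (bigD1 (Ordinal lin)) //= big1 ?addr0 ?mxE ?eqxx ?scale1r // => j ji.
by rewrite mxE eqxx (negPf ji) scale0r.
Qed.

Lemma singopU (o : natop R) s (sD : inD s) :
  singop o << s >> = real (Kmap_continuous (@hat_continuous _ _ s) (hat_range sD))
    (nop o << iota_s R (projT1 s) >>).
Proof. by rewrite -[in LHS](real_hat s) (singop_real o _ (hat_range sD)). Qed.

Lemma singop_bdU (o : natop R) s (sD : inD s) :
  singop o (bd << s >>) = real (Kmap_continuous (@hat_continuous _ _ s) (hat_range sD))
    (nop o (dL << iota_s R (projT1 s) >>)).
Proof. by rewrite -[in LHS](real_hat s) bd_real (singop_real o _ (hat_range sD)). Qed.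

Lemma singop_atop s (sD : inD s) t : 0 <= t <= 1 ->
  exists2 ct : continuous (fun x => H (simf s x) t),
    True & singop (atop t) << s >> = << existT _ (projT1 s) (pack ct) : Sx R E' >>.
Proof.
move=> t01.
have ct : continuous (fun x => H (simf s x) t).
  apply: pH => //; [exact: simf_continuous|exact: cnt_cst|].
  by move=> x; apply: sD; exists x.
exists ct => //; rewrite singopU /= /at_time /id_op mapLU realU (@reallE _ _ _ _ _ (projT1 s)).
  congr << existT _ _ _ >>; apply: cont_ext => x; rewrite /= /packf /affine /Kmap.
  have -> : comb [seq (v, t) : _ * R^o | v <- iota_s R (projT1 s)] (\val x) = (\val x, t).
    rewrite [LHS]surjective_pairing; congr (_, _).
      rewrite -[RHS](comb_iota_s) /comb; elim/big_rec2: _ => // i y1 y2 _ <- /=.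
      by rewrite (nth_map 0) // size_iota_s.
    have [x0 x1] := set_mem (valP x).
    rewrite -[RHS]mul1r -x1 mulr_suml /comb; elim/big_rec2: _ => // i y1 y2 _ <- /=.
    by rewrite (nth_map 0) // size_iota_s.
  by rewrite /= /hat ret_val clamp_id.
by rewrite size_map size_iota_s.
Qed.

Lemma singop_homotopy c : supp inD c ->
  bd (singop (prism_op R) c) =
  singop (atop (1 : R)) c - singop (atop (0 : R)) c - singop (prism_op R) (bd c).
Proof.
move=> cD; apply: (@fg_ext_supp _ _ _ (@bd R E' \o singop (prism_op R))
  ((singop (atop (1 : R)) \- singop (atop (0 : R))) \- (singop (prism_op R) \o @bd R E)) _ cD).
move=> s sD /=; rewrite singop_bdU !singopU bd_real -!raddfB; congr (real _ _).
exact: dL_prism.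
Qed.

Lemma singop_supp (o : natop R) (A : set E) (B : set E') n m :
  (forall (V : normedModType R) (c : {freeg (seq V) / int}),
    supp (@sizeP _ V n.+1) c -> supp (@sizeP _ (V * R^o)%type m.+1) (nop o c)) ->
  (forall e t, A e -> 0 <= t <= 1 -> B (H e t)) ->
  forall c, supp (sP n A) c -> supp (sP m B) (singop o c).
Proof.
move=> osz HB c; apply: fglift_supp => s [sn sA]; rewrite /singop_simplex.
case: pselect => [sD|_]; last exact: (supp_subgroup _).1.
apply: (@real_supp _ _ _ _ _ _ setT).
- by [].
- by move=> x _; exact: (HB _ _ (hat_range sA _) (clamp_itv _)).
apply: suppI; first by split=> ? _ ? _.
by apply: osz; apply: suppU; exact: etrans (size_iota_s R _) (congr1 S sn).
Qed.

Lemma bd_singop_atop t c : 0 <= t <= 1 -> supp inD c ->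
  bd (singop (atop t) c) = singop (atop t) (bd c).
Proof.
move=> t01 cD; apply: (@fg_ext_supp _ _ _ (@bd R E' \o singop (atop t))
  (singop (atop t) \o @bd R E) _ cD) => s sD /=.
rewrite singop_bdU singopU bd_real; congr (real _ _).
by rewrite /= /at_time /id_op mapL_dL.
Qed.

End SingularOp.

(** * Diameters under subdivision and Lebesgue numbers *)

Section Mesh.
Variables (R : realType) (V : normedModType R).
Implicit Types (l : seq V) (r : R).

Definition diamP r : set (seq V) := [set l : seq V | forall v w, v \in l -> w \in l -> `|v - w| <= r].

Lemma cvx_cball (b : V) r : cvx [set v | `|b - v| <= r].
Proof.
move=> n w v w0 w1 vK /=.
rewrite -[b]scale1r -w1 scaler_suml -sumrB (le_trans (ler_norm_sum _ _ _)) //.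
rewrite -[leRHS]mul1r -w1 mulr_suml; apply: ler_sum => i _.
by rewrite -scalerBr normrZ ger0_norm // ler_wpM2l //; exact: vK.
Qed.

(** The difference is the average of the [n + 1] vectors [w - v], one of which is zero. *)
Lemma bary_dist n l r v : size l = n.+1 -> diamP r l -> v \in l ->
  `|bary l - v| <= n%:R / n.+1%:R * r.
Proof.
move=> ln dl vl.
have E : bary l - v = n.+1%:R^-1 *: \sum_(w <- l) (w - v).
  rewrite /bary ln sumrB scalerBr; congr (_ - _).
  rewrite big_const_seq count_predT ln iter_addr_0 -[v *+ _]scaler_nat scalerA mulVf ?scale1r ?pnatr_eq0 //.
rewrite E normrZ ger0_norm ?invr_ge0 // mulrAC mulrC ler_wpM2r ?invr_ge0 //.
apply: (le_trans (ler_norm_sum _ _ _)).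
have [l1 [l2 lE]] : exists l1 l2, l = l1 ++ v :: l2.
  by case/splitPr: vl => l1 l2; exists l1, l2.
have sl : (size l1 + size l2)%N = n by move: ln; rewrite lE size_cat /= addnS => -[].
rewrite lE big_cat big_cons /= subrr normr0 add0r.
rewrite -big_cat /=; rewrite -sl natrD.
have -> : ((size l1)%:R + (size l2)%:R) * r = \sum_(w <- l1 ++ l2) r.
  by rewrite big_const_seq count_predT iter_addr_0 size_cat -natrD mulr_natl.
rewrite big_seq [leRHS]big_seq; apply: ler_sum => w wl; apply: dl => //; move: wl.
by rewrite lE !mem_cat inE => /orP[->|->]; rewrite ?orbT.
Qed.

(** By [SLE] the simplices of the subdivision are cones over subdivided faces. The faces satisfy the
    bound by induction, as [n / (n + 1)] increases with [n]; the edges at the apex satisfy it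
    because the ball about the barycentre is convex and contains all vertices. *)
Lemma mesh n l r : 0 <= r -> size l = n.+1 -> diamP r l ->
  supp (diamP (n%:R / n.+1%:R * r)) (SL << l >>).
Proof.
elim: n l r => [|n IH] l r r0 ln ld.
  rewrite SLE; last by case: l ln {ld}.
  case: l ln ld => [//|a [|//]] _ _.
  have -> : dl [:: a] = << [::] >> by rewrite /dl [consc _ _]raddf0 subr0.
  rewrite SL_nil conscU; apply: suppU.
  by move=> v w; rewrite !inE => /eqP -> /eqP ->; rewrite subrr normr0 mul0r mul0r.
rewrite SLE; last by case: l ln {ld}.
set q := _ / _ * r.
have dls : supp (@sizeP _ V n.+1) (dl l) by have := @dl_size R V l; rewrite ln.
have dll : supp (listP [set v | v \in l]) (dl l) by apply: dl_listP => v.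
have sSL : supp (diamP q `&` listP [set v | `|bary l - v| <= q]) (SL (dl l)).
  apply: suppI.
    apply: (supp_mono (P := diamP (n%:R / n.+1%:R * r))).
      move=> k kd v w vk wk; apply: (le_trans (kd _ _ vk wk)); apply: ler_wpM2r => //.
      rewrite ler_pdivrMr ?ltr0Sn // mulrAC ler_pdivlMr ?ltr0Sn // -!natrM ler_nat.
      lia.
    have : supp (@sizeP _ V n.+1 `&` listP [set v | v \in l]) (dl l) by exact: suppI.
    apply: (@supp_sub _ _ [set c | supp (diamP (n%:R / n.+1%:R * r)) (SL c)]).
      split=> [|x y xP yP /=]; first by rewrite /= raddf0; exact: (supp_subgroup _).1.
      by rewrite raddfB; exact: (supp_subgroup _).2.
    move=> k [kn kl] /=; apply: IH => // v w vk wk; apply: ld; exact: kl.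
  apply: SL_listP; first exact: cvx_cball.
  by apply: (supp_mono _ dll) => k kl v vk /=; apply: bary_dist => //; exact: kl.
apply: (@fglift_supp _ _ _ _ _ _ _ sSL) => k [kd kb]; apply: suppU => v w.
have q0 : 0 <= q by rewrite mulr_ge0 // divr_ge0.
rewrite !inE => /orP[/eqP ->|vk] /orP[/eqP ->|wk].
- by rewrite subrr normr0.
- exact: kb.
- by rewrite distrC; exact: kb.
- exact: kd.
Qed.

Lemma mesh_supp n r (c : {freeg (seq V) / int}) : 0 <= r ->
  supp (diamP r `&` @sizeP _ V n.+1) c -> supp (diamP (n%:R / n.+1%:R * r)) (SL c).
Proof.
move=> r0; apply: (@supp_sub _ _ [set c | supp (diamP (n%:R / n.+1%:R * r)) (SL c)]).
  split=> [|x y xP yP /=]; first by rewrite /= raddf0; exact: (supp_subgroup _).1.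
  by rewrite raddfB; exact: (supp_subgroup _).2.
by move=> l [ld ln]; apply: mesh.
Qed.

Lemma mesh_iter n r (c : {freeg (seq V) / int}) K : 0 <= r ->
  supp (diamP r `&` @sizeP _ V n.+1) c ->
  supp (diamP ((n%:R / n.+1%:R) ^+ K * r) `&` @sizeP _ V n.+1) (iter K (@SL R V) c).
Proof.
move=> r0 cP; elim: K => [|K IH] /=; first by rewrite expr0 mul1r.
have K0 : 0 <= (n%:R / n.+1%:R) ^+ K * r by rewrite mulr_ge0 ?exprn_ge0 ?divr_ge0.
apply: suppI; first by rewrite exprS -mulrA; apply: mesh_supp.
by apply: SL_size; apply: (supp_mono _ IH) => l [].
Qed.
End Mesh.

Section Lebesgue.
Variables (R : realType) (n : nat).

Lemma simplex_compact : compact (@std_simplex R n).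
Proof.
apply: (@subclosed_compact _ _ [set v : 'rV[R]_n.+1 | forall i, `[0, 1]%classic (v ord0 i)]).
- have -> : @std_simplex R n = \bigcap_(i in [set: 'I_n.+1]) [set v | 0 <= v ord0 i] `&`
      [set v | \sum_i v ord0 i = 1].
    by apply/seteqP; split=> v [v0 v1]; split=> // i; [move=> _; exact: v0|exact: (v0 i Logic.I)].
  apply: closedI.
    apply: closed_bigI => i _.
    apply: (@preimage_closed _ _ (fun v : 'rV[R]_n.+1 => v ord0 i) [set x | 0 <= x]).
      by move=> v _; apply: cnt_coord; exact: cnt_id.
    exact: closed_ge.
  apply: (@preimage_closed _ _ (fun v : 'rV[R]_n.+1 => \sum_i v ord0 i) [set x | x = 1]).
    by move=> v _; apply: cnt_sum => i; apply: cnt_coord; exact: cnt_id.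
  exact: closed_eq.
- by apply: (@rV_compact R n.+1 (fun=> `[0 : R, 1]%classic)) => i; exact: segment_compact.
- move=> v [v0 v1] i /=; rewrite in_itv /= v0 /=.
  by rewrite -v1 (bigD1 i) //= lerDl sumr_ge0.
Qed.

(** Compactness in its near-covering form, with the radius running through the right neighbourhoods
    of 0: near each point a small ball lies in one of the two sets, uniformly in its centre. *)
Lemma lebesgue_simplex (U W : set 'rV[R]_n.+1) : open U -> open W ->
  @std_simplex R n `<=` U `|` W ->
  exists2 d : R, 0 < d & forall v, @std_simplex R n v ->
    [set w | `|v - w| <= d] `<=` U \/ [set w | `|v - w| <= d] `<=` W.
Proof.
move=> oU oW cov.
pose P (d : R) (v : 'rV[R]_n.+1) := [set w | `|v - w| <= d] `<=` U \/ [set w | `|v - w| <= d] `<=` W.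
have key (A : set 'rV[R]_n.+1) v : open A -> A v ->
    \forall v' \near v & d \near (0 : R)^'+, [set w | `|v' - w| <= d] `<=` A.
  move=> oA Av; have /nbhs_ballP[e /= e0 eA] := open_nbhs_nbhs (conj oA Av).
  exists (ball v (e / 2), [set d | d < e / 2]).
    split; first by apply: nbhsx_ballx; rewrite divr_gt0.
    by apply: nbhs_right_lt; rewrite divr_gt0.
  move=> [v' d] /= [vv' de] w /= vw; apply: eA.
  rewrite -ball_normE /= in vv' *; rewrite (splitr e).
  rewrite -(subrKA v') (le_lt_trans (ler_normD _ _)) // ltrD //.
  exact: le_lt_trans vw de.
have cc := (compact_near_coveringP _).1 simplex_compact.
have : \forall d \near (0 : R)^'+, @std_simplex R n `<=` P d.
  apply: (cc R (0 : R)^'+ P) => v /cov[Uv|Wv].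
  - have [[N e] [/= vN e0] NU] := key _ _ oU Uv.
    by exists (N, e) => // -[v' d] /= H; left; exact: (NU (v', d)).
  - have [[N e] [/= vN e0] NU] := key _ _ oW Wv.
    by exists (N, e) => // -[v' d] /= H; right; exact: (NU (v', d)).
move=> H; have [d [dP d0]] := @filter_ex _ (0 : R)^'+ _ _ (filterI H (@nbhs_right_gt R 0)).
by exists d.
Qed.
End Lebesgue.

Section OpSizes.
Variables (R : realType) (V : normedModType R).
Implicit Types c : {freeg (seq V) / int}.

Lemma at_time_size t n c : supp (@sizeP _ V n) c -> supp (@sizeP _ (V * R^o)%type n) (at_time t c).
Proof. by apply: fglift_supp => l ln; apply: suppU; rewrite /sizeP /= size_map. Qed.

Lemma tl_op_size n c : supp (@sizeP _ V n) c ->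
  supp (@sizeP _ (V * R^o)%type n.+1) (nop (tl_op R) c).
Proof. by move=> cn; apply: at_time_size; exact: TL_size. Qed.

Lemma sl_op_size n c : supp (@sizeP _ V n.+1) c ->
  supp (@sizeP _ (V * R^o)%type n.+1) (nop (sl_op R) c).
Proof. by move=> cn; apply: at_time_size; exact: SL_size. Qed.

Lemma prism_op_size n c : supp (@sizeP _ V n) c ->
  supp (@sizeP _ (V * R^o)%type n.+1) (nop (prism_op R) c).
Proof.
apply: fglift_supp => l /= <-; elim: l => [|v l IH] /=; first exact: (supp_subgroup _).1.
apply: (supp_subgroup _).2; last exact: (@consc_size _ (V * R^o)%type).
do 2!apply: (@consc_size _ (V * R^o)%type); rewrite mapLU; apply: suppU.
by rewrite /sizeP /= size_map.
Qed.
End OpSizes.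

Section PairZero.
Variables (R : realType) (V : normedModType R).
Definition pair0 (v : V) : (V * R^o)%type := (v, 0).
Fact pair0_linear : linear pair0.
Proof. by move=> a x y; rewrite /pair0; congr (_, _); rewrite /= scaler0 addr0. Qed.
HB.instance Definition _ := GRing.isLinear.Build R V (V * R^o)%type *:%R pair0 pair0_linear.
End PairZero.

(** * Small chains *)

Section Excision.
Variables (R : realType) (E : topologicalType).
Local Notation C := {freeg (Sx R E) / int}.
Implicit Types (c : C) (A U W M : set E).

(** Subdivision involves no motion; with a constant homotopy it becomes an instance of [singop]. *)
Let Hc (e : E) (t : R) : E := e.
Lemma pHc : plot2 setT Hc.
Proof. by move=> W k t ck _ _ _. Qed.

Definition Sd : C -> C := singop pHc (sl_op R).
HB.instance Definition _ := GRing.Additive.on Sd.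
Definition Td : C -> C := singop pHc (tl_op R).
HB.instance Definition _ := GRing.Additive.on Td.

Lemma Kmap_at0 (V : normedModType R) (G : V -> E) (cG : continuous G)
  (cK : continuous (Kmap Hc G)) (c : {freeg (seq V) / int}) :
  real cK (at_time 0 c) = real cG c.
Proof.
have cphi : continuous (fun v => Kmap Hc G (@pair0 R V v)) := cG.
rewrite -[LHS](real_map cK cphi); apply: (@real_hull _ _ _ _ _ _ _ setT) => //.
Qed.

Lemma Sd_real (V : normedModType R) (G : V -> E) (cG : continuous G) (c : {freeg (seq V) / int}) :
  Sd (real cG c) = real cG (SL c).
Proof. by rewrite [LHS](singop_real pHc (sl_op R) cG (fun=> Logic.I)) Kmap_at0. Qed.

Lemma Td_real (V : normedModType R) (G : V -> E) (cG : continuous G) (c : {freeg (seq V) / int}) :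
  Td (real cG c) = real cG (TL c).
Proof. by rewrite [LHS](singop_real pHc (tl_op R) cG (fun=> Logic.I)) Kmap_at0. Qed.

Lemma bd_Td c : bd (Td c) = c - Sd c - Td (bd c).
Proof.
apply: (@fg_ext _ _ (@bd R E \o Td) ((idfun \- Sd) \- (Td \o @bd R E))) => s /=.
rewrite -(real_hat s) bd_real !Td_real Sd_real bd_real -!raddfB; congr (real _ _).
by rewrite /SL !opprB !addrA; fg_ring.
Qed.

Lemma Sd_bd c : bd (Sd c) = Sd (bd c).
Proof.
apply: (@fg_ext _ _ (@bd R E \o Sd) (Sd \o @bd R E)) => s /=.
by rewrite -(real_hat s) bd_real !Sd_real bd_real dL_SL.
Qed.

Lemma bd_bd c : bd (bd c) = 0.
Proof.
apply: (@fg_ext _ _ (@bd R E \o @bd R E) \0) => s /=.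
by rewrite -(real_hat s) !bd_real dLdL raddf0.
Qed.

Lemma Sd_supp n A c : supp (sP n A) c -> supp (sP n A) (Sd c).
Proof. by apply: singop_supp => // V c' ; exact: sl_op_size. Qed.

Lemma Td_supp n A c : supp (sP n A) c -> supp (sP n.+1 A) (Td c).
Proof. by apply: singop_supp => // V c' ; exact: tl_op_size. Qed.

Lemma bd_supp n A c : supp (sP n A) c -> supp (sP n.-1 A) (bd c).
Proof.
apply: (@supp_sub _ _ [set c | supp (sP n.-1 A) (bd c)]) => [|s [sn sA] /=].
  split=> [|x y xP yP /=]; first by rewrite /= raddf0; exact: (supp_subgroup _).1.
  by rewrite raddfB; exact: (supp_subgroup _).2.
case: n sn => [|n] sn.
  case: s sn sA => n s /= sn sA; move: s sA; rewrite sn => s sA.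
  by rewrite bdU0; exact: (supp_subgroup _).1.
rewrite -(real_hat s) bd_real.
apply: (@real_supp _ _ _ _ _ _ setT) => // [v _|]; first exact: (hat_range sA).
apply: suppI; first by split=> ? _ ? _.
by apply: (@dL_size _ _ n.+2); apply: suppU; rewrite /sizeP /= -sn; exact: size_iota_s.
Qed.

Lemma iter_Sd_real K (V : normedModType R) (G : V -> E) (cG : continuous G)
  (c : {freeg (seq V) / int}) : iter K Sd (real cG c) = real cG (iter K (@SL R V) c).
Proof. by elim: K => // K IH; rewrite !iterS IH Sd_real. Qed.

(** The cover is pulled back along [hat s] to the standard simplex, whose subdivisions have
    diameters tending to 0 and so pass below a Lebesgue number. *)
Lemma Sd_small_simplex (U W : set E) s : open U -> open W -> range (simf s) `<=` U `|` W ->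
  exists K, supp (sP (projT1 s) U `|` sP (projT1 s) W) (iter K Sd << s >>).
Proof.
move=> oU oW sUW; set n := projT1 s.
have oh A : open A -> open (hat s @^-1` A).
  by move=> oA; apply: open_comp => // x _; exact: hat_continuous.
have [|d d0 dP] := lebesgue_simplex (oh _ oU) (oh _ oW).
  by move=> v _; apply: (hat_range sUW).
pose q : R := n%:R / n.+1%:R.
have q0 : 0 <= q by rewrite divr_ge0.
have q1 : `|q| < 1 by rewrite ger0_norm // ltr_pdivrMr ?ltr0Sn // mul1r ltr_nat.
(* The factor 1 bounds the diameter of the standard simplex in the sup norm. *)
have [K Kd] : exists K, q ^+ K * 1 < d.
  have /cvgrPdist_lt/(_ d d0) [K _ /(_ K (leqnn K))] := cvg_expr q1.
  rewrite /= sub0r normrN => Kd; exists K; rewrite mulr1; exact: le_lt_trans (ler_norm _) Kd.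
exists K; rewrite -(real_hat s) iter_Sd_real.
have sM : supp (diamP (q ^+ K * 1) `&` @sizeP _ _ n.+1)
    (iter K (@SL R _) << iota_s R n >>).
  apply: mesh_iter => //; apply: suppU; split; last exact: size_iota_s.
  move=> v w /iota_s_simplex [v0 v1] /iota_s_simplex [w0 w1].
  rewrite /Num.norm /= mx_normrE; apply/bigmax_leP; split=> // -[i j] _ /=.
  rewrite [i]ord1 !mxE ler_norml.
  have vj : v ord0 j <= 1 by rewrite -v1 (bigD1 j) //= lerDl sumr_ge0.
  have wj : w ord0 j <= 1 by rewrite -w1 (bigD1 j) //= lerDl sumr_ge0.
  by have := v0 j; have := w0 j; lra.
have sH : supp (listP (@std_simplex R n)) (iter K (@SL R _) << iota_s R n >>).
  elim: (K) => [|m IH]; first by apply: suppU; exact: iota_s_simplex.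
  by rewrite iterS; apply: SL_listP => //; exact: cvx_simplex.
apply: (@fglift_supp _ _ _ _ _ _ _ (suppI sM sH)) => l [[ld ln] lS].
rewrite (reallE _ ln); apply: suppU.
case: l ld ln lS => // v l ld ln lS.
have vl : v \in v :: l by rewrite inE eqxx.
have ball : listP [set w | `|v - w| <= d] (v :: l).
  by move=> w wl /=; apply: (le_trans (ld _ _ vl wl)); exact: ltW.
have H A : [set w | `|v - w| <= d] `<=` hat s @^-1` A ->
    range (asimp (@hat_continuous _ _ s) n (v :: l)) `<=` A.
  move=> dA _ [x _ <-]; rewrite /= /packf /affine; apply: dA.
  by apply: (@comb_cvx _ _ [set w | `|v - w| <= d]) => //; exact: cvx_cball.
by case: (dP v (lS _ vl)) => /H sA; [left|right]; split.
Qed.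

Lemma Sd_small n (U W : set E) c : open U -> open W -> supp (sP n (U `|` W)) c ->
  exists K, supp (sP n U `|` sP n W) (iter K Sd c).
Proof.
move=> oU oW cP.
have iterS' m (x : C) A : supp (sP n A) x -> supp (sP n A) (iter m Sd x).
  by move=> xA; elim: m => // m IH; rewrite iterS; exact: Sd_supp.
have iter0 m : iter m Sd 0 = 0 by elim: m => // m IH; rewrite iterS IH raddf0.
have iterB m x y : iter m Sd (x - y) = iter m Sd x - iter m Sd y.
  by elim: m => // m IH; rewrite !iterS IH raddfB.
have mono m (x : C) : supp (sP n U `|` sP n W) x -> supp (sP n U `|` sP n W) (iter m Sd x).
  move=> xP; have [x1 [x2 [x1P x2P ->]]] := supp_split xP.
  rewrite -[x2]opprK iterB; apply: (supp_subgroup _).2.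
    by apply: (@supp_mono _ (sP n U)); [left|exact: iterS'].
  apply: (@supp_mono _ (sP n W)); [by right|apply: iterS'].
  exact: subgroupN (supp_subgroup _) x2P.
move: cP; apply: (@supp_sub _ _ [set c | exists K, supp (sP n U `|` sP n W) (iter K Sd c)]).
  split; first by exists 0%N; exact: (supp_subgroup _).1.
  move=> x y [K1 H1] [K2 H2]; exists (K1 + K2)%N; rewrite iterB.
  apply: (supp_subgroup _).2; last by rewrite iterD; exact: mono.
  by rewrite addnC iterD; exact: mono.
by move=> s [<- sA]; exact: Sd_small_simplex.
Qed.

(** The sum of [Td] over the iterates of [Sd]: a homotopy from the identity to the [K]-th
    subdivision. *)
Fixpoint Tn_iter K c : C := if K is k.+1 then Tn_iter k c + Td (iter k Sd c) else 0.

Lemma bd_Tn_iter K c : bd (Tn_iter K c) = c - iter K Sd c - Tn_iter K (bd c).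
Proof.
have sb k x : iter k Sd (bd x) = bd (iter k Sd x).
  by elim: k => // k IH; rewrite !iterS IH Sd_bd.
elim: K => [|K IH]; first by rewrite /= raddf0 !subrr.
rewrite /= raddfD /= IH bd_Td sb.
fg_ring.
Qed.

Lemma iter_Sd_supp n A K c : supp (sP n A) c -> supp (sP n A) (iter K Sd c).
Proof. by move=> cA; elim: K => // K IH; rewrite iterS; exact: Sd_supp. Qed.

Lemma Tn_iter_supp n A K c : supp (sP n A) c -> supp (sP n.+1 A) (Tn_iter K c).
Proof.
move=> cA; elim: K => [|K IH] /=; first exact: (supp_subgroup _).1.
by apply: (@subgroupD _ (supp (sP n.+1 A))) => //; [exact: supp_subgroup|apply: (@Td_supp n A); exact: (@iter_Sd_supp n A K c cA)].
Qed.

End Excision.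

(** * Relative homology of pairs of subsets, excision and exact sequences *)

Section Relative.
Variables (R : realType) (E : topologicalType).
Local Notation C := {freeg (Sx R E) / int}.
Implicit Types (c : C) (A B T U W M Z : set E) (n r s : nat).

(** Relative cycles of the pair of subsets, as chains of the ambient space. The condition on the
    boundary mentions no degree, so degree 0 is not special in the definition. *)
Definition relZ n A B : set C := [set c | supp (sP n A) c /\ supp (@inD R E B) (bd c)].
Definition relB n A B : set C :=
  [set c | exists w u, [/\ supp (sP n.+1 A) w, supp (sP n B) u & c = bd w + u]].
Definition hr n A B r := has_srank (relZ n A B) (relB n A B) r.
Definition acyc A B := forall n, relZ n A B `<=` relB n A B.

Lemma suppD (P : set (Sx R E)) c d : supp P c -> supp P d -> supp P (c + d).
Proof. by move=> cP dP; apply: (@subgroupD _ (supp P)) => //; exact: supp_subgroup. Qed.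
Lemma suppB (P : set (Sx R E)) c d : supp P c -> supp P d -> supp P (c - d).
Proof. exact: (@supp_subgroup _ P).2. Qed.
Lemma suppN (P : set (Sx R E)) c : supp P c -> supp P (- c).
Proof. by move=> cP; apply: (@subgroupN _ (supp P)) => //; exact: supp_subgroup. Qed.
Lemma supp0 (P : set (Sx R E)) : supp P 0.
Proof. exact: (@supp_subgroup _ P).1. Qed.

Lemma sP_mono n A B : A `<=` B -> sP n A `<=` @sP R E n B.
Proof. by move=> AB s [sn sA]; split=> // x /sA/AB. Qed.
Lemma supp_sub_sP n A B c : A `<=` B -> supp (sP n A) c -> supp (sP n B) c.
Proof. by move=> AB; apply: supp_mono; exact: sP_mono. Qed.
Lemma supp_sub_inD A B c : A `<=` B -> supp (@inD R E A) c -> supp (@inD R E B) c.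
Proof. by move=> AB; apply: supp_mono => s sA x /sA/AB. Qed.
Lemma sP_inD n A : sP n A `<=` @inD R E A.
Proof. by move=> s []. Qed.
Lemma supp_inD n A c : supp (sP n A) c -> supp (@inD R E A) c.
Proof. by apply: supp_mono; exact: sP_inD. Qed.
Lemma supp_sP_inD n A B c : supp (sP n A) c -> supp (@inD R E B) c -> supp (sP n B) c.
Proof. by move=> cA cB; apply: (supp_mono _ (suppI cA cB)) => s [[]]. Qed.
Lemma supp_bd_inD n A c : supp (sP n A) c -> supp (@inD R E A) (bd c).
Proof. by move=> cA; exact: supp_inD (bd_supp cA). Qed.
Lemma supp_sPI n A B c : supp (sP n A) c -> supp (sP n B) c -> supp (sP n (A `&` B)) c.
Proof.
move=> cA cB; apply: (supp_mono _ (suppI cA cB)) => s [[sn sA] [_ sB]]; split=> // x sx.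
by split; [exact: sA|exact: sB].
Qed.
Lemma supp_inDI A B c : supp (@inD R E A) c -> supp (@inD R E B) c -> supp (@inD R E (A `&` B)) c.
Proof.
move=> cA cB; apply: (supp_mono _ (suppI cA cB)) => s [sA sB] x sx.
by split; [exact: sA|exact: sB].
Qed.
Lemma bd_sP0 A c : supp (sP 0 A) c -> bd c = 0.
Proof.
move=> cA; apply: (@fg_ext_supp _ _ _ (@bd R E) \0 _ cA) => -[n s] [/= n0 _].
by move: s; rewrite n0 => s; exact: bdU0.
Qed.

Lemma relZ_subgroup n A B : subgroup (relZ n A B).
Proof.
split; first by split; rewrite ?raddf0; exact: supp0.
by move=> x y [x1 x2] [y1 y2]; split; rewrite ?raddfB; apply: suppB.
Qed.
Lemma relB_subgroup n A B : subgroup (relB n A B).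
Proof.
split; first by exists 0, 0; rewrite raddf0 addr0; split=> //; exact: supp0.
move=> x y [w [u [wA uB ->]]] [w' [u' [wA' uB' ->]]]; exists (w - w'), (u - u').
by split; [exact: suppB|exact: suppB|rewrite raddfB /= opprD addrACA].
Qed.

Lemma relZ_mono n A B A' B' : A `<=` A' -> B `<=` B' -> relZ n A B `<=` relZ n A' B'.
Proof. by move=> AA BB c [c1 c2]; split; [exact: supp_sub_sP c1|exact: supp_sub_inD c2]. Qed.
Lemma relB_mono n A B A' B' : A `<=` A' -> B `<=` B' -> relB n A B `<=` relB n A' B'.
Proof.
by move=> AA BB c [w [u [w1 u1 ->]]]; exists w, u; split=> //;
  [exact: supp_sub_sP w1|exact: supp_sub_sP u1].
Qed.

Lemma relB_bd n A B w : supp (sP n.+1 A) w -> relB n A B (bd w).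
Proof. by move=> wA; exists w, 0; rewrite addr0; split=> //; exact: supp0. Qed.
Lemma relB_sub n A B u : supp (sP n B) u -> relB n A B u.
Proof. by move=> uB; exists 0, u; rewrite raddf0 add0r; split=> //; exact: supp0. Qed.
Lemma relZ_cycle n A B c : supp (sP n A) c -> bd c = 0 -> relZ n A B c.
Proof. by move=> cA c0; split=> //; rewrite c0; exact: supp0. Qed.

Lemma supp_bdS n A B c : relZ n.+1 A B c -> supp (sP n B) (bd c).
Proof. by move=> [/bd_supp/= c1 c2]; exact: supp_sP_inD c1 c2. Qed.

Lemma hr_acyc_left n A A' B r : B `<=` A -> A `<=` A' -> acyc A' A ->
  hr n A B r <-> hr n A' B r.
Proof.
move=> BA AA' ac; have sB := relB_subgroup n A' B.
apply: srank_incl => //.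
- by apply: relZ_mono.
- exact: relZ_subgroup.
- move=> c [c1 c2]; split; first exact: relB_mono.
  move=> [w [u [wA uB cE]]].
  have [y [w' [yA wA' wE]]] : relB n.+1 A' A w.
    apply: ac; split=> //; have -> : bd w = c - u by rewrite cE addrK.
    by apply: suppB; [exact: supp_inD c1|apply: supp_sub_inD (supp_inD uB)].
  exists w', u; split=> //; rewrite cE wE raddfD /= bd_bd add0r //.
- move=> c [c1 c2].
  have [w [u [wA uA cE]]] : relB n A' A c by apply: ac; split=> //; exact: supp_sub_inD c2.
  exists u; last by rewrite cE addrK; exact: relB_bd.
  by split=> //; move: c2; rewrite cE raddfD /= bd_bd add0r.
Qed.

Lemma hr_acyc_right n T A A' r : A `<=` A' -> A' `<=` T -> acyc A' A ->
  hr n T A r <-> hr n T A' r.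
Proof.
move=> AA' AT ac; have sB := relB_subgroup n T A'.
apply: srank_incl => //.
- by apply: relZ_mono.
- exact: relZ_subgroup.
- move=> c [c1 c2]; split; first exact: relB_mono.
  move=> [w [u [wA uA cE]]].
  have [y [u' [yA uA' uE]]] : relB n A' A u.
    by apply: ac; split=> //; move: c2; rewrite cE raddfD /= bd_bd add0r.
  exists (w + y), u'; rewrite cE uE raddfD addrA; split=> //.
  by apply: suppD => //; exact: supp_sub_sP yA.
- case: n sB => [|n] sB c [c1 c2].
    exists c; first by split=> //; rewrite (bd_sP0 c1); exact: supp0.
    by rewrite subrr; exact: (relB_subgroup _ _ _).1.
  have [y [v [yA vA bE]]] : relB n A' A (bd c).
    by apply: ac; split; [exact: (@supp_bdS n T A')|rewrite bd_bd; exact: supp0].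
  exists (c - y); last by rewrite subKr; exact: relB_sub.
  split; first by apply: suppB => //; exact: supp_sub_sP yA.
  by rewrite raddfB /= bE addrAC subrr add0r; exact: supp_inD vA.
Qed.

Lemma acyc_trans T A B : B `<=` A -> A `<=` T -> acyc T A -> acyc A B -> acyc T B.
Proof.
move=> BA AT aT aA n c [c1 c2].
have [w [u [wT uA cE]]] : relB n T A c by apply: aT; split=> //; exact: supp_sub_inD c2.
have [y [u' [yA uB uE]]] : relB n A B u.
  by apply: aA; split=> //; move: c2; rewrite cE raddfD /= bd_bd add0r.
exists (w + y), u'; rewrite cE uE raddfD addrA; split=> //.
by apply: suppD => //; exact: supp_sub_sP yA.
Qed.

(* 2-out-of-6 for a chain of four subsets. *)
Lemma acyc_sandwich A1 A2 A3 A4 : A1 `<=` A2 -> A2 `<=` A3 -> A3 `<=` A4 ->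
  acyc A3 A1 -> acyc A4 A2 -> acyc A4 A3.
Proof.
move=> A12 A23 A34 a31 a42 [|n] c [c1 c2].
  have [w [u [wA uA ->]]] : relB 0 A4 A2 c.
    by apply: a42; split=> //; rewrite (bd_sP0 c1); exact: supp0.
  by exists w, u; split=> //; exact: supp_sub_sP uA.
have [y [v [yA vA bE]]] : relB n A3 A1 (bd c).
  by apply: a31; split; [exact: (@supp_bdS n A4 A3)|rewrite bd_bd; exact: supp0].
have [w [u [wA uA cE]]] : relB n.+1 A4 A2 (c - y).
  apply: a42; split; first by apply: suppB => //; exact: supp_sub_sP yA.
  by rewrite raddfB /= bE addrAC subrr add0r; exact: supp_sub_inD (supp_inD vA).
exists w, (u + y); split=> //; last by rewrite addrA -cE subrK.
by apply: suppD => //; exact: supp_sub_sP uA.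
Qed.

Section Exc.
Variables (M U W : set E).
Hypotheses (oU : open U) (oW : open W).
Let P := M `&` U.
Let Q := M `&` W.

(** An iterated subdivision splits into a part in [P] and a part in [Q]; the homotopy to it
    restricts to [Q] on the boundary of [c]. Only traces on [M] of open sets occur, so the cover
    need only be relatively open. *)
Lemma excise_surj n c : relZ n (P `|` Q) Q c ->
  exists2 c', relZ n P (P `&` Q) c' & relB n (P `|` Q) Q (c - c').
Proof.
move=> [c1 c2].
have cUW : supp (sP n (U `|` W)) c by apply: supp_sub_sP c1 => x [[]|[]]; [left|right].
have cM : supp (sP n M) c by apply: supp_sub_sP c1 => x [[]|[]].
have [K HK] := Sd_small oU oW cUW.
have [a [b [aU bW SE]]] := supp_split HK.
have aM' : exists a' b', [/\ supp (sP n P) a', supp (sP n Q) b' & iter K (@Sd R E) c = a' + b'].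
  have SM := @iter_Sd_supp R E n M K c cM.
  have : supp (sP n P `|` sP n Q) (iter K (@Sd R E) c).
    apply: (supp_mono _ (suppI HK SM)) => s [[[sn sA]|[sn sA]] [_ sM]]; [left|right].
      by split=> // x sx; split; [exact: sM|exact: sA].
    by split=> // x sx; split; [exact: sM|exact: sA].
  by move/supp_split.
have [a' [b' [aP bQ SE']]] := aM'.
have TE : c = bd (Tn_iter K c) + Tn_iter K (bd c) + a' + b'.
  by rewrite -addrA -SE' bd_Tn_iter; fg_ring.
have TcQ : supp (sP n Q) (Tn_iter K (bd c)).
  case: n c1 c2 {cUW cM HK aU bW aM' aP bQ} => [|n] c1 c2.
    have -> : bd c = 0 by exact: bd_sP0 c1.
    have -> : Tn_iter K 0 = 0 :> C; last exact: supp0.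
    have i0 k : iter k (@Sd R E) 0 = 0 by elim: k => //= k ->; rewrite raddf0.
    by elim: K {SE' TE SE} => //= K ->; rewrite add0r i0 raddf0.
  by apply: (@Tn_iter_supp R E n); exact: (@supp_bdS n (P `|` Q) Q).
exists a'.
  split=> //; apply: supp_inDI; first exact: supp_bd_inD aP.
  have -> : a' = c - bd (Tn_iter K c) - Tn_iter K (bd c) - b' by rewrite {1}TE; fg_ring.
  rewrite !raddfB /= bd_bd subr0; apply: suppB; first apply: suppB => //.
    exact: supp_bd_inD TcQ.
  exact: supp_bd_inD bQ.
exists (Tn_iter K c), (Tn_iter K (bd c) + b'); split.
- exact: (@Tn_iter_supp R E n (P `|` Q) K c c1).
- exact: suppD.
- by rewrite {1}TE; fg_ring.
Qed.

(** Here the bounding chain is subdivided: its part in [P] bounds the subdivided cycle up to the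
    remainder [q]. *)
Lemma excise_inj n c : relZ n P (P `&` Q) c -> relB n (P `|` Q) Q c -> relB n P (P `&` Q) c.
Proof.
move=> [c1 c2] [w [v [wPQ vQ cE]]].
have wUW : supp (sP n.+1 (U `|` W)) w by apply: supp_sub_sP wPQ => x [[]|[]]; [left|right].
have wM : supp (sP n.+1 M) w by apply: supp_sub_sP wPQ => x [[]|[]].
have [K HK] := Sd_small oU oW wUW.
have SM := @iter_Sd_supp R E n.+1 M K w wM.
have : supp (sP n.+1 P `|` sP n.+1 Q) (iter K (@Sd R E) w).
  apply: (supp_mono _ (suppI HK SM)) => s [[[sn sA]|[sn sA]] [_ sM]]; [left|right].
    by split=> // x sx; split; [exact: sM|exact: sA].
  by split=> // x sx; split; [exact: sM|exact: sA].
move/supp_split => [a [b [aP bQ SE]]].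
have iterD' (x y : C) k : iter k (@Sd R E) (x + y) = iter k (@Sd R E) x + iter k (@Sd R E) y.
  by elim: k => // k IH; rewrite !iterS IH raddfD.
have iter_bd (x : C) k : iter k (@Sd R E) (bd x) = bd (iter k (@Sd R E) x).
  by elim: k => // k IH; rewrite !iterS IH Sd_bd.
have ScE : iter K (@Sd R E) c = bd a + (bd b + iter K (@Sd R E) v).
  by rewrite cE iterD' iter_bd SE raddfD addrA.
(* [q] is a chain of [Q] by construction, and a chain of [P] as the difference of the subdivided
   cycle and [bd a]; hence it lies in the intersection. *)
set q := bd b + iter K (@Sd R E) v in ScE.
have qQ : supp (sP n Q) q.
  by apply: suppD; [have := bd_supp bQ|apply: (@iter_Sd_supp R E n Q K v)].
have qP : supp (sP n P) q.
  have -> : q = iter K (@Sd R E) c - bd a by rewrite ScE addrAC subrr add0r.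
  by apply: suppB; [apply: (@iter_Sd_supp R E n P K c)|have := bd_supp aP].
have TE : c = bd (Tn_iter K c) + Tn_iter K (bd c) + iter K (@Sd R E) c.
  by rewrite bd_Tn_iter; fg_ring.
exists (Tn_iter K c + a), (Tn_iter K (bd c) + q); split.
- by apply: suppD => //; exact: (@Tn_iter_supp R E n P K c c1).
- apply: suppD; last exact: supp_sPI.
  case: n c1 c2 {vQ wPQ wUW wM HK SM aP bQ qQ qP} => [|n] c1 c2.
    have -> : bd c = 0 by exact: bd_sP0 c1.
    have -> : Tn_iter K 0 = 0 :> C; last exact: supp0.
    have i0 k : iter k (@Sd R E) 0 = 0 by elim: k => //= k ->; rewrite raddf0.
    by elim: K {SE ScE TE q} => //= K ->; rewrite add0r i0 raddf0.
  by apply: (@Tn_iter_supp R E n); exact: (@supp_bdS n P (P `&` Q)).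
- by rewrite {1}TE {1}ScE raddfD /=; fg_ring.
Qed.

Lemma hr_excision n r : hr n P (P `&` Q) r <-> hr n (P `|` Q) Q r.
Proof.
have sB := relB_subgroup n (P `|` Q) Q; apply: srank_incl => //.
- by apply: relZ_mono => [x|x []]; [left|].
- exact: relZ_subgroup.
- move=> c cZ; split; first by apply: relB_mono => [x|x []]; [left|].
  exact: excise_inj.
- by move=> c /excise_surj[c' c1 c2]; exists c'.
Qed.

End Exc.

(** The connecting map of the triple, from the homology of the pair of [B] and [A] to that of [A]
    and [Z], is zero in all degrees. *)
Definition dzero B A Z := forall n c, relZ n.+1 B A c -> relB n A Z (bd c).

(** With vanishing connecting maps the long exact sequence of the triple breaks into short ones. The
    intermediate subgroup [K] consists of the cycles whose class comes from the pair of [A] and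
    [Z]. *)
Lemma hr_short_exact n B A Z r s : Z `<=` A -> A `<=` B -> dzero B A Z ->
  hr n A Z r -> hr n B A s -> hr n B Z (r + s).
Proof.
move=> ZA AB dz hA hB.
pose K := relZ n B Z `&` relB n B A.
have sK : subgroup K.
  split; first by split; [exact: (relZ_subgroup _ _ _).1|exact: (relB_subgroup _ _ _).1].
  by move=> x y [x1 x2] [y1 y2]; split;
    [exact: (relZ_subgroup _ _ _).2|exact: (relB_subgroup _ _ _).2].
apply: (@srank_add _ _ K) => //.
- exact: relZ_subgroup.
- exact: relB_subgroup.
- by move=> x [].
- by move=> x [xZ xB]; split=> //; exact: relB_mono xB.
- have sB := relB_subgroup n B Z.
  apply: (srank_incl _ sB _ _ _ _).1 hA.
  + by move=> c cZ; split; [exact: relZ_mono cZ|apply: relB_sub; exact: cZ.1].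
  + exact: relZ_subgroup.
  + move=> c cZ; split; first exact: relB_mono.
    move=> [w [u [wB uZ cE]]].
    have wZ : relZ n.+1 B A w.
      split=> //; have -> : bd w = c - u by rewrite cE addrK.
      by apply: suppB; [exact: supp_inD cZ.1|apply: supp_sub_inD (supp_inD uZ)].
    have /= := dz _ _ wZ; have -> : bd w = c - u by rewrite cE addrK.
    move=> H; rewrite -[c](subrK u); apply: subgroupD => //; first exact: relB_subgroup.
    exact: relB_sub.
  + move=> c [cZ [w [u [wB uA cE]]]]; exists u.
      by split=> //; have := cZ.2; rewrite cE raddfD /= bd_bd add0r.
    by rewrite cE addrK; exact: relB_bd.
- have sB := relB_subgroup n B A.
  apply: (srank_incl _ sB _ _ _ _).2 hB => //.
  + by move=> c; apply: relZ_mono.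
  + exact: relZ_subgroup.
  + by move=> c cZ; split=> [[]//|cB].
  + case: n hA {K sK sB} => [|n] _ c [c1 c2].
      exists c; last by rewrite subrr; exact: (relB_subgroup _ _ _).1.
      by split=> //; rewrite (bd_sP0 c1); exact: supp0.
    have [w [u [wA uZ bE]]] := dz n c (conj c1 c2).
    exists (c - w); last by rewrite subKr; exact: relB_sub.
    split; first by apply: suppB => //; exact: supp_sub_sP wA.
    by rewrite raddfB /= bE addrAC subrr add0r; exact: supp_inD uZ.
Qed.

End Relative.

(** * Homotopy invariance and transport *)

Section Homotopy.
Variables (R : realType) (E E' : topologicalType) (D : set E) (H : E -> R -> E').
Hypothesis pH : plot2 D H.

Let r01 : 0 <= (0 : R) <= 1. Proof. by rewrite lexx ler01. Qed.
Let r11 : 0 <= (1 : R) <= 1. Proof. by rewrite lexx ler01. Qed.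

Lemma atop_supp t n (A : set E) (B : set E') c : 0 <= t <= 1 -> A `<=` D ->
  (forall e, A e -> B (H e t)) -> supp (sP n A) c -> supp (sP n B) (singop pH (atop t) c).
Proof.
move=> t01 AD AB.
apply: (@supp_sub _ _ [set c | supp (sP n B) (singop pH (atop t) c)]) => [|s [sn sA] /=].
  split=> [|x y xP yP /=]; first by rewrite /= raddf0; exact: supp0.
  by rewrite raddfB; exact: suppB.
have sD : inD D s by move=> x /sA/AD.
have [ct _ ->] := singop_atop pH sD t01; apply: suppU; split=> // _ [x _ <-].
by apply: AB; apply: sA; exists x.
Qed.

Lemma prism_supp n (A : set E) (B : set E') c :
  (forall e t, A e -> 0 <= t <= 1 -> B (H e t)) ->
  supp (sP n A) c -> supp (sP n.+1 B) (singop pH (prism_op R) c).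
Proof. by move=> AB; apply: singop_supp => // V c'; exact: prism_op_size. Qed.

End Homotopy.

Section HomotopyRep.
Variables (R : realType) (E : topologicalType) (A B A' B' A1 B1 : set E) (H : E -> R -> E).
Hypotheses (pH : plot2 B H) (AB : A `<=` B) (H0 : forall e, B e -> H e 0 = e).
Hypotheses (HB : forall e t, B e -> 0 <= t <= 1 -> B' (H e t)).
Hypotheses (HA : forall e t, A e -> 0 <= t <= 1 -> A' (H e t)).
Hypotheses (HB1 : forall e, B e -> B1 (H e 1)) (HA1 : forall e, A e -> A1 (H e 1)).

Let r01 : 0 <= (0 : R) <= 1. Proof. by rewrite lexx ler01. Qed.
Let r11 : 0 <= (1 : R) <= 1. Proof. by rewrite lexx ler01. Qed.

Lemma atop0_id n (c : {freeg (Sx R E) / int}) : supp (sP n B) c -> singop pH (atop (0 : R)) c = c.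
Proof.
move=> cB; apply: (@fg_ext_supp _ _ _ (singop pH (atop (0 : R))) idfun _ cB) => s [_ sB] /=.
have [ct _ ->] := singop_atop pH sB r01; case: s sB ct => m s sB ct.
congr << existT _ m _ >>; apply: cont_ext => x; rewrite /= /packf.
by apply: H0; apply: sB; exists x.
Qed.

(** The cycle may sweep through the large pair [B'], [A'] but ends in the pair [B1], [A1]. Keeping
    the two apart is what allows a cell to be moved into a slice. *)
Lemma homotopy_rep n (c : {freeg (Sx R E) / int}) : relZ n B A c -> exists2 c1, relZ n B1 A1 c1 & relB n B' A' (c - c1).
Proof.
move=> [c1 c2]; exists (singop pH (atop (1 : R)) c).
  split; first exact: (atop_supp pH r11 (@subset_refl _ B) HB1 c1).
  rewrite bd_singop_atop //; last exact: supp_inD c1.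
  case: n c1 c2 => [|n] c1 c2.
    by rewrite (bd_sP0 c1) raddf0; exact: supp0.
  by apply: supp_inD; apply: (atop_supp pH r11 AB HA1 (@supp_bdS _ _ n B A c _)).
have hE := singop_homotopy pH (supp_inD c1).
exists (- singop pH (prism_op R) c), (- singop pH (prism_op R) (bd c)); split.
- by apply: suppN; apply: prism_supp HB c1.
- apply: suppN; case: n c1 c2 => [|n] c1 c2.
    by rewrite (bd_sP0 c1) raddf0; exact: supp0.
  exact: (prism_supp pH HA (@supp_bdS _ _ n B A c _)).
- rewrite raddfN /= hE (atop0_id c1); fg_ring.
Qed.
End HomotopyRep.

Lemma homotopy_acyc (R : realType) (E : topologicalType) (A B : set E) (H : E -> R -> E) :
  plot2 B H -> A `<=` B -> (forall e, B e -> H e 0 = e) ->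
  (forall e t, B e -> 0 <= t <= 1 -> B (H e t)) ->
  (forall e t, A e -> 0 <= t <= 1 -> A (H e t)) ->
  (forall e, B e -> A (H e 1)) -> @acyc R E B A.
Proof.
move=> pH AB H0 HB HA HB1 n c cZ.
have HA1 e : A e -> A (H e 1) by move=> Ae; apply: HA => //; rewrite lexx ler01.
have [c1 [c1A _] cB] := homotopy_rep pH AB H0 HB HA HB1 HA1 cZ.
rewrite -[c](subrK c1); apply: subgroupD => //; first exact: relB_subgroup.
exact: relB_sub.
Qed.

Section Transport.
Variables (R : realType) (E E' : topologicalType) (D : set E) (D' : set E').
Variables (f : E -> E') (f' : E' -> E).
Hypotheses (pf : @plot2 R E E' D (fun e _ => f e)) (pf' : @plot2 R E' E D' (fun e _ => f' e)).
Hypotheses (fK : forall e, D e -> f' (f e) = e) (f'K : forall e, D' e -> f (f' e) = e).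

Let r01 : 0 <= (0 : R) <= 1. Proof. by rewrite lexx ler01. Qed.

Lemma transportK c : (forall e, D e -> D' (f e)) -> supp (@inD R E D) c ->
  singop pf' (atop (0 : R)) (singop pf (atop (0 : R)) c) = c.
Proof.
move=> fD cD; apply: (@fg_ext_supp _ _ _
  (singop pf' (atop (0 : R)) \o singop pf (atop (0 : R))) idfun _ cD) => s sD /=.
have [ct _ ->] := singop_atop pf sD r01.
have sD' : @inD R E' D' (existT _ (projT1 s) (pack ct)).
  by move=> _ [x _ <-]; apply: fD; apply: sD; exists x.
have [ct' _ ->] := singop_atop pf' sD' r01; case: s sD ct sD' ct' => m s sD ct sD' ct'.
congr << existT _ m _ >>; apply: cont_ext => x; rewrite /= /packf /=.
by apply: fK; apply: sD; exists x.
Qed.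
End Transport.

(** Invariance under maps inverse to each other on [D] and [D'] only; outside, both may be
    discontinuous. *)
Lemma hr_transport (R : realType) (E E' : topologicalType) (D : set E) (D' : set E')
  (f : E -> E') (f' : E' -> E) (A B : set E) (A' B' : set E') n r :
  @plot2 R E E' D (fun e _ => f e) -> @plot2 R E' E D' (fun e _ => f' e) ->
  (forall e, D e -> f' (f e) = e) -> (forall e, D' e -> f (f' e) = e) ->
  (forall e, D e -> D' (f e)) -> (forall e, D' e -> D (f' e)) ->
  A `<=` D -> A' `<=` D' -> B `<=` A -> B' `<=` A' ->
  (forall e, A e -> A' (f e)) -> (forall e, A' e -> A (f' e)) ->
  (forall e, B e -> B' (f e)) -> (forall e, B' e -> B (f' e)) ->
  @hr R E n A B r <-> @hr R E' n A' B' r.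
Proof.
move=> pf pf' fK f'K fD f'D AD AD' BA BA' fA f'A fB f'B.
have r01 : 0 <= (0 : R) <= 1 by rewrite lexx ler01.
have mZ (E1 E2 : topologicalType) (D1 : set E1) (g : E1 -> E2) (pg : @plot2 R E1 E2 D1 (fun e _ => g e))
    (A1 B1 : set E1) (A2 B2 : set E2) m c : A1 `<=` D1 -> B1 `<=` A1 ->
    (forall e, A1 e -> A2 (g e)) -> (forall e, B1 e -> B2 (g e)) ->
    relZ m A1 B1 c -> relZ m A2 B2 (singop pg (atop (0 : R)) c).
  move=> AD1 BA1 gA gB [c1 c2]; split; first exact: (atop_supp pg r01 AD1 gA c1).
  rewrite bd_singop_atop //; last by apply: supp_sub_inD (supp_inD c1).
  case: m c1 c2 => [|m] c1 c2.
    by rewrite (bd_sP0 c1) raddf0; exact: supp0.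
  apply: supp_inD; apply: (atop_supp pg r01 _ gB (@supp_bdS _ _ m A1 B1 c _)) => //.
  by move=> x /BA1/AD1.
have mB (E1 E2 : topologicalType) (D1 : set E1) (g : E1 -> E2) (pg : @plot2 R E1 E2 D1 (fun e _ => g e))
    (A1 B1 : set E1) (A2 B2 : set E2) m c : A1 `<=` D1 -> B1 `<=` A1 ->
    (forall e, A1 e -> A2 (g e)) -> (forall e, B1 e -> B2 (g e)) ->
    relB m A1 B1 c -> relB m A2 B2 (singop pg (atop (0 : R)) c).
  move=> AD1 BA1 gA gB [w [u [wA uB ->]]].
  exists (singop pg (atop (0 : R)) w), (singop pg (atop (0 : R)) u); split.
  - exact: (atop_supp pg r01 AD1 gA wA).
  - by apply: (atop_supp pg r01 _ gB uB) => x /BA1/AD1.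
  - by rewrite raddfD /= bd_singop_atop //; apply: supp_sub_inD (supp_inD wA).
apply: (@srank_iso _ _ (singop pf (atop (0 : R)))).
- exact: relB_subgroup.
- by move=> c; apply: mZ.
- exact: relZ_subgroup.
- move=> c cZ; split; first exact: mB.
  move=> /(mB _ _ _ _ pf' _ _ A B _ _ AD' BA' f'A f'B).
  by rewrite (transportK pf pf' fK) //; apply: supp_sub_inD (supp_inD cZ.1).
- move=> c cZ; exists (singop pf' (atop (0 : R)) c); first exact: mZ cZ.
  have H := transportK pf' pf f'K f'D (supp_sub_inD AD' (supp_inD cZ.1)).
  have -> : c - singop pf (atop (0 : R)) (singop pf' (atop (0 : R)) c) = 0.
    by apply/eqP; rewrite subr_eq0 eq_sym; apply/eqP; exact: H.
  exact: (@relB_subgroup R E' n A' B').1.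
Qed.

(** * Chains on a point and augmentations *)

Section Point.
Variables (R : realType) (E : topologicalType) (e0 : E).
Local Notation C := {freeg (Sx R E) / int}.

Definition ptsimp n : Sx R E := existT _ n (pack (@cst_continuous (simp R n) E e0)).

Lemma sP_pt n s : sP n [set e0] s -> s = ptsimp n.
Proof.
case: s => m s [/= mn sA]; move: s sA; rewrite mn => s sA; congr existT.
by apply: cont_ext => x; apply: sA; exists x.
Qed.

Lemma supp_pt n (c : C) : supp (sP n [set e0]) c -> exists k : int, c = << ptsimp n >> *~ k.
Proof.
apply: (@supp_sub _ _ [set c | exists k : int, c = << ptsimp n >> *~ k]).
  split; first by exists 0; rewrite mulr0z.
  by move=> x y [k ->] [l ->]; exists (k - l); rewrite mulrzBr.
by move=> s /sP_pt ->; exists 1; rewrite mulr1z.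
Qed.

Lemma real_pt (V : normedModType R) n (l : seq V) : size l = n.+1 ->
  real (@cst_continuous V E e0) << l >> = << ptsimp n >>.
Proof.
by move=> ln; rewrite realU (reallE _ ln); congr << existT _ n _ >>; apply: cont_ext.
Qed.

Lemma sum_signs (c : C) m : \sum_(i < m) (-1) ^+ i *: c = if odd m then c else 0.
Proof.
elim: m => [|m IH]; first by rewrite big_ord0.
rewrite big_ord_recr /= IH -signr_odd; case: (odd m) => /=.
  by rewrite expr1 scaleN1r subrr.
by rewrite expr0 scale1r add0r.
Qed.

(** All [n + 2] faces coincide and their signs alternate, so that they cancel or leave one according
    to parity. *)
Lemma bd_pt n : bd << ptsimp n.+1 >> = if odd n then << ptsimp n >> else 0.
Proof.
rewrite -(@real_pt R^o _ (nseq n.+2 0)) ?size_nseq // bd_real dLU dlE size_nseq raddf_sum /=.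
rewrite (eq_bigr (fun i : 'I_n.+2 => (-1) ^+ i *: << ptsimp n >>)); last first.
  move=> i _; rewrite raddfZsign /= (@real_pt _ n) //.
  by rewrite size_rem_nth /= size_nseq.
by rewrite sum_signs /= negbK.
Qed.

Lemma pt_cycle n c : supp (sP n.+1 [set e0]) c -> bd c = 0 ->
  exists2 w : C, supp (sP n.+2 [set e0]) w & c = bd w.
Proof.
move=> /supp_pt[k ->]; rewrite (raddfMz (@bd R E)) /= bd_pt.
case: ifP => on c0.
  have k0 : k = 0.
    have := congr1 (coeff (ptsimp n)) c0; rewrite raddfMz /= coeffU eqxx coeff0 mul1r.
    by rewrite -mulrzr mul1r intz.
  by exists 0; rewrite ?raddf0 ?k0 ?mulr0z //; exact: supp0.
exists (<< ptsimp n.+2 >> *~ k); last by rewrite raddfMz /= bd_pt /= on.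
apply: (@subgroup_mulrz _ (supp (sP n.+2 [set e0]))); first exact: supp_subgroup.
by apply: suppU; split=> // _ [x _ <-].
Qed.

End Point.

Section Augmentation.
Variables (R : realType) (E : topologicalType).
Local Notation C := {freeg (Sx R E) / int}.

(* It vanishes on boundaries when [A] is a union of path components. *)
Definition aug (A : set E) : C -> int :=
  fglift (fun s : Sx R E => (`[< projT1 s = 0%N /\ range (simf s) `<=` A >]%:R : int^o)).
HB.instance Definition _ A :=
  GRing.isZmodMorphism.Build C int (aug A) (@lift_is_additive int (Sx R E) int^o _).

Lemma augE (A : set E) s : aug A << s >> = (`[< projT1 s = 0%N /\ range (simf s) `<=` A >])%:R.
Proof. exact: (@fgliftU (Sx R E) int^o). Qed.

Lemma sP_mulz n (A : set E) (s : Sx R E) (k : int) : sP n A s -> supp (sP n A) (<< s >> *~ k).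
Proof.
move=> sA; apply: (@subgroup_mulrz _ (supp (sP n A))); first exact: supp_subgroup.
exact: suppU.
Qed.

End Augmentation.

Lemma hausdorff_inj (T U : topologicalType) (f : T -> U) :
  continuous f -> injective f -> hausdorff_space U -> hausdorff_space T.
Proof.
move=> cf fi; rewrite !open_hausdorff => hU x y xy.
have /hU[[A B] /= [Ax By] [oA oB AB0]] : f x != f y by apply: contra_neq xy => /fi.
exists (f @^-1` A, f @^-1` B) => /=.
  by split; apply/mem_set; [exact: set_mem Ax|exact: set_mem By].
split; [by apply: open_comp|by apply: open_comp|].
move/eqP: AB0 => AB0; apply/eqP/seteqP; split=> // z [Az Bz].
have : (A `&` B) (f z) by split.
by rewrite AB0.
Qed.

(** * Path fibrations *)

Section UnitInterval.
Variable R : realType.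
Local Notation I := (unit_interval R).

Lemma clamp_in (t : R) : clamp t \in `[0, 1]%classic.
Proof. by apply/mem_set; rewrite /= in_itv /= clamp_itv. Qed.
Definition clampI (t : R) : I := SigSub (clamp_in t).

Definition ivl (s : I) : R := \val s.

Lemma ivl_itv (s : I) : 0 <= ivl s <= 1.
Proof. by have := set_mem (valP s); rewrite /= in_itv. Qed.

Lemma ivl_continuous : continuous ivl.
Proof. exact: initial_continuous. Qed.

Lemma clampI_continuous : continuous clampI.
Proof. by apply: continuous_comp_initial; exact: clamp_continuous. Qed.

Lemma clampI_val (s : I) : clampI (ivl s) = s.
Proof. by apply: val_inj; rewrite /= clamp_id // ivl_itv. Qed.

Lemma clampI0 : clampI 0 = zero :> I.
Proof. by apply: val_inj; rewrite /= clamp_id // lexx ler01. Qed.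
Lemma clampI1 : clampI 1 = one :> I.
Proof. by apply: val_inj; rewrite /= clamp_id // lexx ler01. Qed.
Lemma ivl0 : ivl zero = 0. Proof. by []. Qed.
Lemma ivl1 : ivl one = 1. Proof. by []. Qed.

Lemma I_compact : compact [set: I].
Proof.
have -> : [set: I] = clampI @` `[0, 1]%classic.
  apply/seteqP; split=> // s _; exists (ivl s); last exact: clampI_val.
  by rewrite /= in_itv /= ivl_itv.
apply: continuous_compact; last exact: segment_compact.
by apply: continuous_subspaceT; exact: clampI_continuous.
Qed.

Lemma I_hausdorff : hausdorff_space I.
Proof.
by apply: (hausdorff_inj ivl_continuous); [exact: val_inj|exact: norm_hausdorff].
Qed.

Lemma I_locally_compact : locally_compact [set: I].
Proof.
move=> s _; exists [set: I]; first exact: filterT.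
by split; [exact: I_compact|exact: closedT].
Qed.
End UnitInterval.

Section PathSpace.
Variables (R : realType) (Z X : topologicalType) (x0 : X) (g : Z -> X).
Local Notation I := (unit_interval R).
Definition pathT : topologicalType := {compact-open, I -> X}.
Definition totalT : topologicalType := (Z * pathT)%type.

(* The pull-back along g of the path fibration of X at x0, restricted to A. *)
Definition pE (A : set Z) : set totalT :=
  [set e | [/\ A e.1, continuous (e.2 : I -> X), e.2 zero = x0 & e.2 one = g e.1]].

(** Continuity on the subset [O], tested along continuous maps into it. Values outside [O] are
    unconstrained. *)
Definition pcont (U W : topologicalType) (O : set U) (f : U -> W) :=
  forall (T : topologicalType) (k : T -> U), continuous k -> (forall w, O (k w)) ->
  continuous (fun w => f (k w)).

Section Lift.
Variables (B O : set Z) (K : totalT -> R -> Z).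
Hypotheses (pK : plot2 (pE B) K) (pg : pcont O g).
Hypothesis K0 : forall e, pE B e -> K e 0 = e.1.
Hypothesis KO : forall e t, pE B e -> 0 <= t <= 1 -> O (K e t).

(* The path itself, followed by the trace of the homotopy up to time t: this lifts
   a homotopy of end points to the path fibration. *)
Definition lift_path (e : totalT) (t : R) (s : I) : X :=
  if ivl s * (1 + t) - 1 <= 0 then e.2 (clampI (ivl s * (1 + t)))
  else g (K e (clamp (ivl s * (1 + t) - 1))).

Definition Theta (e : totalT) (t : R) : totalT := (K e t, lift_path e t).

(** Evaluation of a path is jointly continuous because the interval is locally compact and
    Hausdorff; the two branches agree where the original path ends. *)
Lemma lift_path_continuous (W : topologicalType) (k : W -> totalT) (t : W -> R) :
  continuous k -> continuous t -> (forall w, pE B (k w)) -> (forall w, 0 <= t w <= 1) ->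
  continuous (fun ws : W * I => lift_path (k ws.1) (t ws.1) ws.2).
Proof.
move=> ck ct kB t01.
have ch : continuous (fun ws : W * I => ivl ws.2 * (1 + t ws.1)).
  apply: cntM; first exact: (cnt_comp (cnt_snd (@cnt_id _)) (@ivl_continuous R)).
  by apply: cntD; [exact: cnt_cst|exact: (cnt_comp (cnt_fst (@cnt_id _)) ct)].
have ch1 : continuous (fun ws : W * I => ivl ws.2 * (1 + t ws.1) - 1).
  by apply: cntB => //; exact: cnt_cst.
apply: cnt_glue => //.
- pose gam (w : W) : I -> X := (k w).2.
  have cu : continuous (uncurry gam).
    apply: continuous_uncurry.
    + exact: I_locally_compact.
    + exact: I_hausdorff.
    + exact: (cnt_snd ck).
    + by move=> w; have [] := kB w.
  apply: (cnt_comp (f := fun ws : W * I => (ws.1, clampI (ivl ws.2 * (1 + t ws.1)))) _ cu).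
  apply: cnt_pair; first exact: cnt_fst (@cnt_id _).
  exact: (cnt_comp ch (@clampI_continuous R)).
- apply: (pg (k := fun ws : W * I => K (k ws.1) (clamp (ivl ws.2 * (1 + t ws.1) - 1)))).
  + apply: (pK (k := fun ws : W * I => k ws.1)) => [||ws|ws].
    * exact: (cnt_comp (cnt_fst (@cnt_id _)) ck).
    * exact: (cnt_comp ch1 (@clamp_continuous R)).
    * exact: kB.
    * exact: clamp_itv.
  + by move=> ws; apply: KO => //; exact: clamp_itv.
- move=> ws /eqP; rewrite subr_eq0 => /eqP ->; rewrite subrr clampI1.
  rewrite clamp_id ?lexx ?ler01 // K0 //.
  by have [] := kB ws.1.
Qed.

Lemma Theta_plot : plot2 (pE B) Theta.
Proof.
move=> W k t ck ct kB t01; apply: cnt_pair; first exact: pK.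
exact: (continuous_curry_fun (lift_path_continuous ck ct kB t01)).
Qed.

Lemma Theta0 e : pE B e -> Theta e 0 = e.
Proof.
move=> eB; rewrite /Theta K0 // [RHS]surjective_pairing; congr (_, _).
apply: funext => s; rewrite /lift_path addr0 mulr1 clampI_val.
by have /andP[_ s1] := ivl_itv s; rewrite subr_le0 s1.
Qed.

Lemma Theta_pE A e t : pE B e -> 0 <= t <= 1 -> A (K e t) -> pE A (Theta e t).
Proof.
move=> eB t01 At; split=> //.
- have c := @lift_path_continuous R (fun=> e) (fun=> t) (@cnt_cst _ _ _)
    (@cnt_cst _ _ _) (fun=> eB) (fun=> t01).
  exact: (continuous_curry c).2 0.
- rewrite /= /lift_path ivl0 mul0r sub0r oppr_le0 ler01 clampI0.
  by case: eB.
- rewrite /= /lift_path ivl1 mul1r; have -> : 1 + t - 1 = t by rewrite addrAC subrr add0r.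
  rewrite clamp_id //; case: ifPn => // t0.
  have -> : t = 0 by apply/eqP; rewrite eq_le t0; case/andP: t01.
  by rewrite addr0 clampI1 K0 //; case: eB.
Qed.
End Lift.

Lemma pE_mono (A B : set Z) : A `<=` B -> pE A `<=` pE B.
Proof. by move=> AB e [eA ? ? ?]; split=> //; exact: AB. Qed.

Lemma pE_I (A B : set Z) : pE A `&` pE B = pE (A `&` B).
Proof.
apply/seteqP; split=> e; first by move=> [[? ? ? ?] []].
by move=> [[? ?] ? ? ?]; split.
Qed.

Lemma pE_U (A B : set Z) : pE A `|` pE B = pE (A `|` B).
Proof.
apply/seteqP; split=> e; first by move=> [] [? ? ? ?]; split=> //; [left|right].
by move=> [[?|?] ? ? ?]; [left|right].
Qed.

Lemma pE_sep (M U : set Z) : pE (M `&` U) = pE M `&` (fst @^-1` U).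
Proof.
apply/seteqP; split=> e; first by move=> [[? ?] ? ? ?].
by move=> [[? ? ? ?] ?].
Qed.

(* Homology of the path fibration pulled back along g, relative version. *)
Definition hp n A B r := @hr R totalT n (pE A) (pE B) r.
Definition pacyc A B := @acyc R totalT (pE A) (pE B).

Section LiftRep.
Variables (A B A' B' A1 B1 O : set Z) (K : totalT -> R -> Z).
Hypotheses (pK : plot2 (pE B) K) (pg : pcont O g) (AB : A `<=` B) (BO : B' `<=` O).
Hypothesis K0 : forall e, pE B e -> K e 0 = e.1.
Hypothesis KB : forall e t, pE B e -> 0 <= t <= 1 -> B' (K e t).
Hypothesis KA : forall e t, pE A e -> 0 <= t <= 1 -> A' (K e t).
Hypothesis KB1 : forall e, pE B e -> B1 (K e 1).
Hypothesis KA1 : forall e, pE A e -> A1 (K e 1).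

Let KO e t : pE B e -> 0 <= t <= 1 -> O (K e t).
Proof. by move=> eB t01; apply: BO; exact: KB. Qed.
Let r11 : 0 <= (1 : R) <= 1. Proof. by rewrite lexx ler01. Qed.

(** The motion [K] of the end point may depend on the whole path and not just on where it ends; the
    inertness argument relies on this freedom. *)
Lemma path_rep n (c : {freeg (Sx R totalT) / int}) : relZ n (pE B) (pE A) c ->
  exists2 c1, relZ n (pE B1) (pE A1) c1 & relB n (pE B') (pE A') (c - c1).
Proof.
have AB' := pE_mono AB.
apply: (homotopy_rep (Theta_plot pK pg K0 KO) AB') => e.
- exact: Theta0.
- by move=> t eB t01; apply: (Theta_pE pK pg K0 KO) => //; exact: KB.
- by move=> t eA t01; apply: (Theta_pE pK pg K0 KO (AB' _ eA) t01); exact: KA.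
- by move=> eB; apply: (Theta_pE pK pg K0 KO) => //; exact: KB1.
- by move=> eA; apply: (Theta_pE pK pg K0 KO (AB' _ eA) r11); exact: KA1.
Qed.
End LiftRep.

Lemma pacyc_deform (A B : set Z) (k : Z -> R -> Z) : pcont B g ->
  plot2 B k -> A `<=` B -> (forall z, B z -> k z 0 = z) ->
  (forall z t, B z -> 0 <= t <= 1 -> B (k z t)) ->
  (forall z t, A z -> 0 <= t <= 1 -> A (k z t)) ->
  (forall z, B z -> A (k z 1)) -> pacyc B A.
Proof.
move=> pg pk AB k0 kB kA kB1 n c cZ.
pose K (e : totalT) t := k e.1 t.
have pK : plot2 (pE B) K.
  move=> W q t cq ct qB t01; apply: pk => //; first exact: cnt_fst.
  by move=> w; have [] := qB w.
have [c1 [c1A _] cB] : exists2 c1, relZ n (pE A) (pE A) c1 & relB n (pE B) (pE A) (c - c1).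
  apply: (path_rep pK pg AB (@subset_refl _ B)) cZ => e.
  - by move=> [eB _ _ _]; exact: k0.
  - by move=> t [eB _ _ _]; exact: kB.
  - by move=> t [eA _ _ _]; exact: kA.
  - by move=> [eB _ _ _]; exact: kB1.
  - by move=> [eA _ _ _]; apply: kB1; exact: AB.
rewrite -[c](subrK c1); apply: subgroupD => //; first exact: relB_subgroup.
exact: relB_sub.
Qed.

Lemma hp_excision (U W : set Z) n r : (exists U' W', [/\ open U', open W',
    U = (U `|` W) `&` U' & W = (U `|` W) `&` W']) ->
  hp n U (U `&` W) r <-> hp n (U `|` W) W r.
Proof.
move=> [U' [W' [oU oW UE WE]]].
have := @hr_excision R totalT (pE (U `|` W)) (fst @^-1` U') (fst @^-1` W') _ _ n r.
rewrite -!pE_sep -UE -WE pE_I pE_U; apply.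
  by apply: open_comp => // x _; exact: cvg_fst.
by apply: open_comp => // x _; exact: cvg_fst.
Qed.

End PathSpace.
Arguments pE R {Z X} x0 g A.

(** * Exact sequences of triples *)

Section Triple.
Variables (R : realType) (E : topologicalType).
Local Notation C := {freeg (Sx R E) / int}.
Implicit Types (A B T Q : set E).

Lemma acyc_hr0 n A B : @acyc R E A B -> hr R n A B 0.
Proof. by move=> ac; apply: srank0_intro => c cZ; exists 1 => //; rewrite mulr1z; exact: ac. Qed.

(** The homology of the pair of [T] and [Q] vanishes, so the connecting map of the triple is an
    isomorphism; it is induced by [bd]. *)
Lemma triple_shift n T A Q r : Q `<=` A -> A `<=` T -> @acyc R E T Q ->
  hr R n.+1 T A r <-> hr R n A Q r.
Proof.
move=> QA AT ac; apply: (@srank_iso _ _ (@bd R E)).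
- exact: relB_subgroup.
- by move=> c cZ; split; [exact: supp_bdS cZ|rewrite bd_bd; exact: supp0].
- exact: relZ_subgroup.
- move=> c [c1 c2]; split.
    move=> [w [u [wT uA ->]]]; rewrite raddfD /= bd_bd add0r; exact: relB_bd.
  move=> [w [u [wA uQ bE]]].
  have [y [v [yT vQ vE]]] : relB n.+1 T Q (c - w).
    apply: ac; split; first by apply: suppB => //; exact: supp_sub_sP wA.
    by rewrite raddfB /= bE addrAC subrr add0r; exact: supp_inD uQ.
  exists y, (v + w); split=> //; last by rewrite addrA -vE subrK.
  by apply: suppD => //; exact: supp_sub_sP vQ.
- move=> c [c1 c2].
  have [w [u [wT uQ cE]]] : relB n T Q c by apply: ac; split=> //; exact: supp_sub_sP c1.
  exists w; last by rewrite cE addrAC subrr add0r; exact: relB_sub.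
  split=> //; have -> : bd w = c - u by rewrite cE addrK.
  by apply: suppB; [exact: supp_inD c1|apply: supp_sub_inD (supp_inD uQ)].
Qed.

Lemma hr0_triple T A Q : Q `<=` A -> @acyc R E T Q -> hr R 0 T A 0.
Proof.
move=> QA ac; apply: srank0_intro => c [c1 c2]; exists 1 => //; rewrite mulr1z.
apply: (@relB_mono R E 0 T Q) => //.
by apply: ac; split=> //; rewrite (bd_sP0 c1); exact: supp0.
Qed.
End Triple.

(** * Attaching cells *)

Section ChartDeform.
Variables (R : realType) (Z X : topologicalType) (x0 : X) (g : Z -> X).
Variables (V : topologicalType) (c : V -> Z) (c' : Z -> V).

Lemma pacyc_chart (A B : set V) (k : V -> R -> V) :
  pcont B c -> pcont (c @` B) c' -> (forall v, B v -> c' (c v) = v) -> pcont (c @` B) g ->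
  plot2 B k -> A `<=` B -> (forall z, B z -> k z 0 = z) ->
  (forall z t, B z -> 0 <= t <= 1 -> B (k z t)) ->
  (forall z t, A z -> 0 <= t <= 1 -> A (k z t)) ->
  (forall z, B z -> A (k z 1)) -> pacyc R x0 g (c @` B) (c @` A).
Proof.
move=> pc pc' cK pg pk AB k0 kB kA kB1.
apply: (pacyc_deform (k := fun z t => c (k (c' z) t))) => //.
- move=> W q t cq ct qB t01; apply: pc => [|w].
    by apply: pk => // [|w]; [exact: pc'|have [v Bv <-] := qB w; rewrite cK].
  by apply: kB => //; have [v Bv <-] := qB w; rewrite cK.
- by move=> _ [v Av <-]; exists v => //; exact: AB.
- by move=> _ [v Bv <-]; rewrite cK // k0.
- by move=> _ t [v Bv <-] t01; rewrite cK //; exists (k v t) => //; exact: kB.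
- move=> _ t [v Av <-] t01; rewrite cK; last exact: AB.
  by exists (k v t) => //; exact: kA.
- by move=> _ [v Bv <-]; rewrite cK //; exists (k v 1) => //; exact: kB1.
Qed.
End ChartDeform.

Section Local.
Variables (R : realType) (Z X : topologicalType) (x0 : X) (g : Z -> X).
Variables (d : nat).
Local Notation V := 'rV[R]_d.
Variables (c : V -> Z) (c' : Z -> V).
Hypotheses (cc : continuous c) (pc' : pcont (range c) c') (cK : forall v, c' (c v) = v).
Hypotheses (co : forall S, open S -> open (c @` S)) (pg : pcont (range c) g).

Lemma pcont_sub (U W : topologicalType) (A B : set U) (f : U -> W) : A `<=` B ->
  pcont B f -> pcont A f.
Proof. by move=> AB pf T k ck kA; apply: pf => // w; exact: AB. Qed.

Lemma cont_pcont (U W : topologicalType) (A : set U) (f : U -> W) : continuous f -> pcont A f.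
Proof. by move=> cf T k ck _; exact: cnt_comp. Qed.

Lemma c_inj : injective c.
Proof. by move=> v w /(congr1 c'); rewrite !cK. Qed.

Lemma img_I (A B : set V) : c @` A `&` c @` B = c @` (A `&` B).
Proof.
apply/seteqP; split=> z; last by move=> [v [Av Bv] <-]; split; exists v.
by move=> [[v Av <-] [w Bw /c_inj vw]]; exists v => //; split=> //; rewrite -vw.
Qed.

Lemma img_U (A B : set V) : c @` A `|` c @` B = c @` (A `|` B).
Proof. by rewrite image_setU. Qed.

Lemma img_sub (A B : set V) : A `<=` B -> c @` A `<=` c @` B.
Proof. by move=> AB _ [v Av <-]; exists v => //; exact: AB. Qed.

Lemma chart_acyc (A B : set V) (k : V -> R -> V) :
  (forall (W : topologicalType) (q : W -> V) (t : W -> R), continuous q -> continuous t ->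
    continuous (fun w => k (q w) (t w))) ->
  A `<=` B -> (forall z, B z -> k z 0 = z) ->
  (forall z t, B z -> 0 <= t <= 1 -> B (k z t)) ->
  (forall z t, A z -> 0 <= t <= 1 -> A (k z t)) ->
  (forall z, B z -> A (k z 1)) -> pacyc R x0 g (c @` B) (c @` A).
Proof.
move=> ck AB k0 kB kA kB1.
have sB : c @` B `<=` range c by move=> _ [v _ <-]; exists v.
apply: (pacyc_chart (c' := c') (k := k)) => //.
- exact: cont_pcont.
- exact: pcont_sub pc'.
- exact: pcont_sub pg.
- by move=> W q t cq ct _ _; exact: ck.
Qed.

Lemma line_cont (a : V) (W : topologicalType) (q : W -> V) (t : W -> R) :
  continuous q -> continuous t -> continuous (fun w => (1 - t w) *: q w + t w *: a).
Proof.
move=> cq ct; apply: cntD; apply: cntZ => //; last exact: cnt_cst.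
by apply: cntB => //; exact: cnt_cst.
Qed.

Lemma chart_star (B : set V) (a : V) : B a ->
  (forall v t, B v -> 0 <= t <= 1 -> B ((1 - t) *: v + t *: a)) ->
  pacyc R x0 g (c @` B) [set c a].
Proof.
move=> Ba st; have -> : [set c a] = c @` [set a] by rewrite image_set1.
apply: (chart_acyc (k := fun v t => (1 - t) *: v + t *: a)).
- exact: line_cont.
- by move=> _ ->.
- by move=> z _; rewrite subr0 scale1r scale0r addr0.
- exact: st.
- by move=> _ t -> _; rewrite -scalerDl subrK scale1r.
- by move=> z _; rewrite subrr scale0r scale1r add0r.
Qed.

(** The complement of the subspace where the coordinates in [J] vanish. The pair of the whole space
    and this set is a thickened disc of dimension [#|J|] with its boundary sphere. *)
Definition nzset (J : {set 'I_d}) : set V := [set v : V | exists2 i, i \in J & v ord0 i != 0].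

Lemma nzset_open J : open (nzset J).
Proof.
have -> : nzset J = \bigcup_(i in [set i | i \in J]) [set v | v ord0 i != 0].
  by apply/seteqP; split=> v [i iJ vi]; exists i.
apply: bigcup_open => i _.
apply: (@open_comp _ _ (fun v : V => v ord0 i) [set x | x != 0]).
  by move=> v _; apply: cnt_coord; exact: cnt_id.
exact: open_neq.
Qed.

Section Peel.
Variables (J : {set 'I_d}) (i : 'I_d).
Hypothesis iJ : i \in J.
Let J' := J :\ i.
Let P : set V := [set v : V | 0 < v ord0 i].
Let Q : set V := [set v : V | v ord0 i < 0] `|` nzset J'.
Let e : V := delta_mx ord0 i.

Let ei : e ord0 i = 1. Proof. by rewrite mxE !eqxx. Qed.
Let ej j : j != i -> e ord0 j = 0. Proof. by move=> ji; rewrite mxE eqxx (negPf ji). Qed.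

Lemma peel_cover : P `|` Q = nzset J.
Proof.
apply/seteqP; split=> v.
  case=> [vi|[vi|[j]]].
  - by exists i => //; rewrite gt_eqF.
  - by exists i => //; rewrite lt_eqF.
  - by rewrite !inE => /andP[_ jJ] vj; exists j.
move=> [j jJ vj]; have [ji|ji] := eqVneq j i.
  by move: vj; rewrite ji neq_lt => /orP[]; [right; left|left].
by right; right; exists j => //; rewrite !inE ji.
Qed.

Lemma peel_inter : P `&` Q = P `&` nzset J'.
Proof.
apply/seteqP; split=> v [Pv]; last by split=> //; right.
by case=> // vi; move: Pv; rewrite /P /= ltNge (ltW vi).
Qed.

Let Qstar v t : Q v -> 0 <= t <= 1 -> Q ((1 - t) *: v + t *: - e).
Proof.
move=> Qv /andP[t0 t1].
have [->|tn1] := eqVneq t 1.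
  left; rewrite /= subrr scale0r scale1r add0r mxE ei; lra.
have t1' : 0 < 1 - t by rewrite subr_gt0 lt_neqAle tn1.
case: Qv => [vi|[j jJ vj]].
  left; rewrite /= !mxE !eqxx /=.
  have : (1 - t) * v ord0 i < 0 by rewrite pmulr_rlt0.
  lra.
right; exists j => //; move: jJ; rewrite !inE => /andP[ji _].
rewrite !mxE eqxx (negPf ji) /= oppr0 mulr0 addr0; apply: mulf_neq0 => //.
by rewrite gt_eqF.
Qed.

Lemma peel_acycQ : pacyc R x0 g (range c) (c @` Q).
Proof.
apply: (chart_acyc (k := fun v t => (1 - t) *: v + t *: - e)) => //.
- exact: line_cont.
- by move=> z _; rewrite subr0 scale1r scale0r addr0.
- by move=> z _; left; rewrite /= subrr scale0r scale1r add0r mxE ei; lra.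
Qed.

Let push (v : V) (t : R) : V := v + (t * (1 - v ord0 i)) *: e.
Let push_cont (W : topologicalType) (q : W -> V) (t : W -> R) : continuous q -> continuous t ->
    continuous (fun w => push (q w) (t w)).
Proof.
move=> cq ct; apply: cntD => //; apply: cntZ; last exact: cnt_cst.
apply: cntM => //; apply: cntB; first exact: cnt_cst.
exact: cnt_coord.
Qed.
Let push_i v t : push v t ord0 i = (1 - t) * v ord0 i + t.
Proof. rewrite /push !mxE !eqxx /=; lra. Qed.
Let push_j v t j : j != i -> push v t ord0 j = v ord0 j.
Proof. by move=> ji; rewrite /push !mxE eqxx (negPf ji) mulr0 addr0. Qed.
Let push0 v : push v 0 = v.
Proof. by rewrite /push mul0r scale0r addr0. Qed.
Let pushP v t : P v -> 0 <= t <= 1 -> P (push v t).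
Proof. by rewrite /P /= push_i => v0 /andP[t0 t1]; nra. Qed.
Let pushO v t : nzset J' v -> nzset J' (push v t).
Proof.
by move=> [j jJ vj]; exists j => //; move: jJ; rewrite !inE => /andP[ji _]; rewrite push_j.
Qed.
Let push1 v : P (push v 1).
Proof. by rewrite /P /= push_i subrr mul0r add0r. Qed.

(** One coordinate accounts for one degree. The set [nzset J] is covered by the open half space [P]
    and by [Q], which is star-shaped about [- e]. The triple with [Q] lowers the degree, excision
    replaces [nzset J] and [Q] by [P] and [P] minus a subspace, and pushing coordinate [i] to 1
    compares this pair with the one for [J']. *)
Lemma peel_hp n r : hp R x0 g n.+1 (range c) (c @` nzset J) r <->
  hp R x0 g n (range c) (c @` nzset J') r.
Proof.
have oP : open P.
  apply: (@open_comp _ _ (fun v : V => v ord0 i) [set x | 0 < x]); last exact: open_gt.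
  by move=> v _; apply: cnt_coord; exact: cnt_id.
have oQ : open Q.
  apply: openU; last exact: nzset_open.
  apply: (@open_comp _ _ (fun v : V => v ord0 i) [set x | x < 0]); last exact: open_lt.
  by move=> v _; apply: cnt_coord; exact: cnt_id.
have QJ : c @` Q `<=` c @` nzset J by rewrite -peel_cover; apply: img_sub; right.
have UE : c @` P `|` c @` Q = c @` nzset J by rewrite img_U peel_cover.
apply: (iff_trans (B := hp R x0 g n (c @` nzset J) (c @` Q) r)).
  apply: triple_shift; [exact: pE_mono|apply: pE_mono; exact: img_sub|exact: peel_acycQ].
have H := @hp_excision R Z X x0 g (c @` P) (c @` Q) n r; rewrite UE in H.
apply: (iff_trans (iff_sym (H _))) => {H}.
  exists (c @` P), (c @` Q); split; try exact: co.
    by apply/seteqP; split=> z; [move=> zP; split=> //; rewrite -UE; left|case].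
  by apply/seteqP; split=> z; [move=> zP; split=> //; rewrite -UE; right|case].
rewrite img_I peel_inter.
have a1 : pacyc R x0 g (range c) (c @` P).
  by apply: (chart_acyc push_cont) => // *; exact: pushP.
have a2 : pacyc R x0 g (c @` nzset J') (c @` (P `&` nzset J')).
  apply: (chart_acyc push_cont) => //.
  - by move=> v t vO _; exact: pushO.
  - by move=> v t [vP vO] t01; split; [exact: pushP|exact: pushO].
  - by move=> v vO; split; [exact: push1|exact: pushO].
apply: (iff_trans (B := hp R x0 g n (range c) (c @` (P `&` nzset J')) r)).
  by apply: hr_acyc_left => //; apply: pE_mono; apply: img_sub => // v [].
by apply: hr_acyc_right => //; apply: pE_mono; apply: img_sub => // v [].
Qed.

Lemma peel_hp0 : hp R x0 g 0 (range c) (c @` nzset J) 0.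
Proof.
apply: (hr0_triple _ peel_acycQ).
by apply: pE_mono; rewrite -peel_cover; apply: img_sub; right.
Qed.
End Peel.

Definition shift_rank (a : nat -> nat) m n := if (m <= n)%N then a (n - m)%N else 0%N.

(** All coordinates of [J] are peeled off in turn. For empty [J] the chart contracts to any of its
    points [w], leaving the fibre over it. *)
Lemma hp_local (J : {set 'I_d}) (w : V) n a :
  ((#|J| <= n)%N -> hp R x0 g (n - #|J|) [set c w] set0 (a (n - #|J|)%N)) ->
  hp R x0 g n (range c) (c @` nzset J) (shift_rank a #|J| n).
Proof.
move: {2}#|J| (erefl #|J|) => m; elim: m J n => [|m IH] J n Jm Ha.
  have -> : c @` nzset J = set0.
    apply/seteqP; split=> // z [v [j jJ _] _].
    by move/eqP: Jm; rewrite cards_eq0 => /eqP J0; rewrite J0 inE in jJ.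
  rewrite /shift_rank Jm subn0 leq0n; rewrite Jm subn0 in Ha.
  apply: (iffLR (hr_acyc_left _ _ _ _ _) (Ha isT)).
  - by apply: pE_mono.
  - by apply: pE_mono => _ ->; exists w.
  - by apply: chart_star.
have [i iJ] : exists i, i \in J by apply/set0Pn; rewrite -cards_eq0 Jm.
have Jm' : #|J :\ i| = m by have := cardsD1 i J; rewrite iJ Jm => -[].
case: n Ha => [|n] Ha.
  by rewrite /shift_rank Jm; exact: peel_hp0 iJ.
apply/(peel_hp iJ); rewrite /shift_rank Jm ltnS subSS.
have := IH (J :\ i) n Jm'; rewrite /shift_rank Jm'; apply => mn.
by have := Ha; rewrite Jm subSS; apply.
Qed.
End Local.

Section Embed.
Variables (R : realType) (X : topologicalType) (x0 : X).

Lemma hp_embed (Z Z' : topologicalType) (g : Z -> X) (g' : Z' -> X) (f : Z -> Z') (f' : Z' -> Z)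
  (A B : set Z) (A' B' : set Z') n r :
  pcont A f -> pcont A' f' -> (forall z, A z -> f' (f z) = z) -> (forall z, A' z -> f (f' z) = z) ->
  (forall z, A z -> A' (f z)) -> (forall z, A' z -> A (f' z)) ->
  B `<=` A -> B' `<=` A' -> (forall z, B z -> B' (f z)) -> (forall z, B' z -> B (f' z)) ->
  (forall z, A z -> g' (f z) = g z) ->
  hp R x0 g n A B r <-> hp R x0 g' n A' B' r.
Proof.
move=> pf pf' fK f'K fA f'A BA BA' fB f'B gf.
have gf' z : A' z -> g (f' z) = g' z by move=> Az; rewrite -gf ?f'K //; exact: f'A.
have mv (C D : set Z) : C `<=` A -> forall e, pE R x0 g C e -> (forall z, C z -> D z) -> pE R x0 g D e.
  by move=> CA e [e1 e2 e3 e4] CD; split=> //; exact: CD.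
apply: (@hr_transport R (totalT R Z X) (totalT R Z' X) (pE R x0 g A) (pE R x0 g' A')
   (fun e => (f e.1, e.2)) (fun e => (f' e.1, e.2))) => //.
- move=> W k t ck ct kA _; apply: cnt_pair; last exact: cnt_snd.
  by apply: (pf W (fun w => (k w).1)); [exact: cnt_fst|move=> w; have [] := kA w].
- move=> W k t ck ct kA _; apply: cnt_pair; last exact: cnt_snd.
  by apply: (pf' W (fun w => (k w).1)); [exact: cnt_fst|move=> w; have [] := kA w].
- by move=> [z p] [/= Az _ _ _]; rewrite fK.
- by move=> [z p] [/= Az _ _ _]; rewrite f'K.
- by move=> [z p] [/= Az cp p0 p1]; split=> //=; [exact: fA|rewrite gf].
- by move=> [z p] [/= Az cp p0 p1]; split=> //=; [exact: f'A|rewrite gf'].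
- exact: pE_mono.
- exact: pE_mono.
- by move=> [z p] [/= Az cp p0 p1]; split=> //=; [exact: fA|rewrite gf].
- by move=> [z p] [/= Az cp p0 p1]; split=> //=; [exact: f'A|rewrite gf'].
- by move=> [z p] [/= Bz cp p0 p1]; split=> //=; [exact: fB|rewrite gf //; exact: BA].
- by move=> [z p] [/= Bz cp p0 p1]; split=> //=; [exact: f'B|rewrite gf' //; exact: BA'].
Qed.

Lemma pE_congr (Z : topologicalType) (g g' : Z -> X) (A : set Z) : (forall z, A z -> g z = g' z) ->
  pE R x0 g A = pE R x0 g' A.
Proof.
by move=> gg; apply/seteqP; split=> -[z p] [/= Az cp p0 p1]; split=> //=; rewrite p1 gg.
Qed.
End Embed.

Section CellStep.
Variables (R : realType) (Z X : topologicalType) (x0 : X) (g : Z -> X).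
Variables (d : nat).
Local Notation V := 'rV[R]_d.
Variables (c : V -> Z) (c' : Z -> V).
Hypotheses (cc : continuous c) (pc' : pcont (range c) c') (cK : forall v, c' (c v) = v).
Hypotheses (co : forall S, open S -> open (c @` S)).
Variables (A F : set Z) (z : Z) (J : {set 'I_d}) (S : set V) (k : V -> R -> V) (w : V).
Hypotheses (oA : open A) (pg : pcont (A `|` range c) g).
Hypothesis cA : forall v, A (c v) <-> nzset J v.
Hypothesis k_cont : forall (W : topologicalType) (q : W -> V) (t : W -> R), continuous q ->
  continuous t -> continuous (fun w => k (q w) (t w)).
Hypotheses (k0 : forall v, k v 0 = v) (kS : forall v, S (k v 1)).
Hypothesis kJ : forall v t, nzset J v -> 0 <= t <= 1 -> nzset J (k v t).
Hypotheses (SF : c @` (S `&` nzset J) `<=` F) (FA : F `<=` A) (Fz : F z).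
Hypotheses (aF : pacyc R x0 g F [set z]) (zw : z = c w).

Let U := range c.
Let UA : U `&` A = c @` nzset J.
Proof.
apply/seteqP; split=> y; first by move=> [[v _ <-] /cA vJ]; exists v.
by move=> [v vJ <-]; split; [exists v|apply/cA].
Qed.
Let oU : open U. Proof. exact: co openT. Qed.
Let exc : exists U' W', [/\ open U', open W', U = (U `|` A) `&` U' & A = (U `|` A) `&` W'].
Proof.
exists U, A; split=> //; apply/seteqP; split=> y; try by case.
- by move=> Uy; split=> //; left.
- by move=> Ay; split=> //; right.
Qed.
Let pgU : pcont U g. Proof. by apply: pcont_sub pg; right. Qed.

(** A relative cycle is excised into the chart and moved by [k] into the slice [S]. Its boundary
    then lies over [F], whose path fibration is acyclic relative to the fibre over [z], so it bounds
    modulo that fibre inside [A]. *)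
Lemma cell_dzero : dzero R (pE R x0 g (U `|` A)) (pE R x0 g A) (pE R x0 g [set z]).
Proof.
move=> n b bZ.
have zA : pE R x0 g [set z] `<=` pE R x0 g A by apply: pE_mono => _ ->; exact: FA.
have [b1 b1Z b1B] : exists2 b1, relZ n.+1 (pE R x0 g U) (pE R x0 g (U `&` A)) b1 &
    relB n.+1 (pE R x0 g (U `|` A)) (pE R x0 g A) (b - b1).
  have [U' [W' [oU' oW' UE WE]]] := exc.
  have := @excise_surj R _ (pE R x0 g (U `|` A)) (fst @^-1` U') (fst @^-1` W') _ _ n.+1 b.
  rewrite -!pE_sep -UE -WE pE_I pE_U; apply=> //.
    by apply: open_comp => // x _; exact: cvg_fst.
  by apply: open_comp => // x _; exact: cvg_fst.
rewrite UA in b1Z.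
pose K (e : totalT R Z X) (t : R) : Z := c (k (c' e.1) t).
have pK : plot2 (pE R x0 g U) K.
  move=> W q t cq ct qU t01; apply: (cnt_comp _ cc); apply: k_cont => //.
  by apply: pc' => [|w']; [exact: cnt_fst|have [] := qU w'].
have [b2 b2Z b2B] : exists2 b2, relZ n.+1 (pE R x0 g (c @` S)) (pE R x0 g (c @` (S `&` nzset J))) b2 &
    relB n.+1 (pE R x0 g U) (pE R x0 g (c @` nzset J)) (b1 - b2).
  apply: (@path_rep R Z X x0 g _ _ _ _ _ _ _ K pK pgU _ _ _ _ _ _ _ n.+1 b1 b1Z) => // [y|e|e t|e t|e|e].
  - by move=> [v _ <-]; exists v.
  - by move=> [[v _ ev] _ _ _]; rewrite /K -ev cK k0.
  - by move=> _ _; exists (k (c' e.1) t).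
  - by move=> [[v vJ ev] _ _ _] t01; exists (k (c' e.1) t) => //; rewrite -ev cK; exact: kJ.
  - by move=> _; exists (k (c' e.1) 1).
  - move=> [[v vJ ev] _ _ _]; exists (k (c' e.1) 1) => //; rewrite -ev cK; split=> //.
    by apply: kJ => //; rewrite lexx ler01.
have b2F : relB n (pE R x0 g A) (pE R x0 g [set z]) (bd b2).
  apply: (relB_mono (pE_mono FA) (@subset_refl _ _)); apply: aF; split.
    apply: (supp_sub_sP (pE_mono SF)); exact: supp_bdS b2Z.
  by rewrite bd_bd; exact: supp0.
have bdB (x : {freeg (Sx R (totalT R Z X)) / int}) :
    relB n.+1 (pE R x0 g (U `|` A)) (pE R x0 g A) x -> relB n (pE R x0 g A) (pE R x0 g [set z]) (bd x).
  by move=> [y [u [_ uA ->]]]; rewrite raddfD /= bd_bd add0r; exact: relB_bd.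
have -> : bd b = bd (b - b1) + (bd (b1 - b2) + bd b2).
  by rewrite -!raddfD /= !subrK.
apply: subgroupD; first exact: relB_subgroup.
  exact: bdB.
apply: subgroupD => //; first exact: relB_subgroup.
apply: bdB; apply: relB_mono b2B; apply: pE_mono; first by left.
by rewrite -UA => y [].
Qed.

Lemma cell_step n r a : hp R x0 g n A [set z] r ->
  ((#|J| <= n)%N -> hp R x0 g (n - #|J|) [set z] set0 (a (n - #|J|)%N)) ->
  hp R x0 g n (A `|` range c) [set z] (r + shift_rank a #|J| n).
Proof.
move=> hA ha; rewrite setUC.
apply: (hr_short_exact (A := pE R x0 g A)) cell_dzero hA _.
- by apply: pE_mono => _ ->; exact: FA.
- by apply: pE_mono; right.
- apply/(hp_excision R x0 g n _ exc); rewrite UA.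
  by have := @hp_local R Z X x0 g d c c' cc pc' cK co pgU J w n a; rewrite -zw; apply.
Qed.
End CellStep.

(** * Connectedness extracted from homology in degree 0 *)

Section Connectedness.
Variables (R : realType) (Y : topologicalType) (O : set Y) (rel : Y -> Y -> Prop).
Hypotheses (rel_refl : forall y, rel y y) (rel_sym : forall y z, rel y z -> rel z y).
Hypothesis rel_trans : forall x y z, rel x y -> rel y z -> rel x z.
Hypothesis rel_loc : forall y, O y -> nbhs y [set z | O z -> rel y z].

Lemma rel_path (u : R -> Y) : continuous u -> (forall t, O (u t)) -> rel (u 0) (u 1).
Proof.
move=> cu uO.
have loc t : nbhs t [set s | rel (u t) (u s)].
  have H : nbhs t (u @^-1` [set z | O z -> rel (u t) z]) by exact: cu t _ (rel_loc (uO t)).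
  by apply: filterS H => s /=; apply.
pose S := [set t | rel (u 0) (u t)].
have oS : open S.
  by rewrite openE => t ut; have := loc t; apply: filterS => s; exact: rel_trans.
have cS : closed S.
  rewrite closedE => t nt; apply: contrapT => nS; apply: nt.
  have := loc t; apply: filterS => s ts St; apply: nS; apply: (rel_trans St); exact: rel_sym.
have cT : connected [set: R] by apply/connected_intervalP.
have ST : S = [set: R].
  apply: cT; first by exists 0; exact: rel_refl.
  - by exists S => //; rewrite setTI.
  - by exists S => //; rewrite setTI.
by have : S 1 by rewrite ST.
Qed.

Variables (X : topologicalType) (x0 : X).

(** The two ends of a singular edge have related base points, so both or neither are counted by the
    augmentation. *)
Lemma aug_bd (g : Y -> X) (z : Y) (w : {freeg (Sx R (totalT R Y X)) / int}) : supp (sP 1 (pE R x0 g O)) w ->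
  aug [set e | rel z e.1] (bd w) = 0.
Proof.
move=> wP; apply: (@fg_ext_supp _ _ _ (@aug R (totalT R Y X) [set e | rel z e.1] \o @bd _ _) \0 _ wP).
move=> s [s1 sO] /=; rewrite -(real_hat s) bd_real dLU.
case: s s1 sO => m s /= s1; move: s; rewrite s1 => s sO.
set S : Sx R (totalT R Y X) := existT _ 1%N s.
pose a : 'rV[R]_2 := delta_mx ord0 ord0; pose b : 'rV[R]_2 := delta_mx ord0 (lift ord0 ord0).
have -> : iota_s R 1 = [:: a; b].
  by rewrite /iota_s enum_ordSl enum_ordSl /= enum_ord0.
have -> : dl [:: a; b] = << [:: b] >> - << [:: a] >>.
  by rewrite /= [consc b 0]raddf0 subr0 conscU.
rewrite raddfB raddfB /= !realU !(@reallE _ _ _ _ _ 0) // !augE.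
have pt v : range (simf (existT _ 0%N (asimp (@hat_continuous _ _ S) 0 [:: v]) : Sx R (totalT R Y X)))
    `<=` [set e | rel z e.1] <-> rel z (hat S v).1.
  have cv (x : simp R 0) : comb [:: v] (\val x) = v.
    by have [_] := set_mem (valP x); rewrite /comb !big_ord1 => ->; rewrite scale1r.
  split=> [H|H _ [x _ <-]]; last by rewrite /simf /= /packf /affine cv.
  have := H (hat S v); apply; exists (ret (delta_mx ord0 ord0)) => //.
  by rewrite /simf /= /packf /affine cv.
have uc : continuous (fun t : R => (hat S ((1 - t) *: a + t *: b)).1).
  apply: cnt_fst; apply: (cnt_comp _ (@hat_continuous _ _ S)).
  apply: cntD; apply: cntZ; try exact: cnt_cst; last exact: cnt_id.
  by apply: cntB; [exact: cnt_cst|exact: cnt_id].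
have r := rel_path uc _.
have {r}ab : rel (hat S a).1 (hat S b).1.
  have := r _; rewrite subr0 scale1r scale0r addr0 subrr scale0r scale1r add0r; apply.
  by move=> t; have [] := @hat_range R (totalT R Y X) S (pE R x0 g O) sO ((1 - t) *: a + t *: b).
apply/eqP; rewrite subr_eq0; apply/eqP; congr (nat_of_bool _)%:R.
apply/asboolP/asboolP => -[_ /pt H]; split=> //; apply/pt.
  by apply: (rel_trans H); exact: rel_sym.
exact: (rel_trans H).
Qed.

(** A nonzero multiple [k] of the point formed by [z'] and the constant path bounds modulo the fibre
    over [z]. If [z] and [z'] were unrelated, the augmentation counting the class of [z'] would give
    [k = 0]. *)
Lemma connected_of_hp (z z' : Y) : O z -> O z' -> hp R x0 (fun=> x0) 0 O [set z] 0 -> rel z z'.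
Proof.
set g := (fun=> x0); move=> Oz Oz' h0; apply: contrapT => nr.
pose e : totalT R Y X := (z', fun=> x0).
have eO : pE R x0 g O e by split=> //; exact: cnt_cst.
have eZ : relZ 0 (pE R x0 g O) (pE R x0 g [set z]) << ptsimp R e 0 >>.
  split; last by rewrite bdU0; exact: supp0.
  by apply: suppU; split=> // _ [x _ <-].
have [k k0 [w [u [wO uz kE]]]] := has_srank0 (@relB_subgroup _ _ 0 _ _) h0 eZ.
have := congr1 (aug [set e | rel z' e.1]) kE.
rewrite raddfMz raddfD /= (aug_bd _ wO) // add0r augE asboolT; last by split=> // _ [x _ <-].
have -> : aug [set e | rel z' e.1] u = 0.
  apply: (@fg_ext_supp _ _ _ (@aug R (totalT R Y X) [set e | rel z' e.1]) \0 _ uz).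
  move=> s [s0 sz] /=; rewrite augE asboolF // => -[_ H].
  have : rel z' (hat s 0).1 by apply: H; exists (ret 0).
  by have [-> _ _ _] := hat_range sz 0 => /rel_sym.
by move/eqP; rewrite -mulrzr mul1r intz (negPf k0).
Qed.

End Connectedness.

(** * The Euclidean square norm and continuity tested locally *)

Section SqNorm.
Variables (R : realType) (d : nat).
Local Notation V := 'rV[R]_d.
Implicit Types (v w : V).

Lemma sqnorm_ge0 v : 0 <= sqnorm v.
Proof. by apply: sumr_ge0 => i _; rewrite sqr_ge0. Qed.

Lemma sqnorm_eq0 v : (sqnorm v == 0) = (v == 0).
Proof.
apply/idP/eqP => [/eqP v0|->]; last by rewrite /sqnorm big1 // => i _; rewrite mxE expr0n.
apply/rowP => i; rewrite mxE; apply/eqP; rewrite -sqrf_eq0.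
by move: (psumr_eq0P (fun j _ => sqr_ge0 (v ord0 j)) v0) => /(_ i isT) ->.
Qed.

Lemma sqnorm0 : sqnorm (0 : V) = 0. Proof. by apply/eqP; rewrite sqnorm_eq0. Qed.

Lemma sqnorm_gt0 v : (0 < sqnorm v) = (v != 0).
Proof. by rewrite lt_def sqnorm_ge0 andbT sqnorm_eq0. Qed.

Lemma sqnormZ a v : sqnorm (a *: v) = a ^+ 2 * sqnorm v.
Proof. by rewrite /sqnorm mulr_sumr; apply: eq_bigr => i _; rewrite mxE exprMn. Qed.

Lemma sqnormN v : sqnorm (- v) = sqnorm v.
Proof. by rewrite -scaleN1r sqnormZ sqrrN expr1n mul1r. Qed.

Lemma sqnormD_le v w : sqnorm (v + w) <= 2 * (sqnorm v + sqnorm w).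
Proof.
rewrite /sqnorm -big_split mulr_sumr; apply: ler_sum => i _; rewrite mxE /=.
have := sqr_ge0 (v ord0 i - w ord0 i); nra.
Qed.

Lemma sqnorm_cont (T : topologicalType) (f : T -> V) : continuous f ->
  continuous (fun x => sqnorm (f x)).
Proof.
move=> cf; apply: cnt_sum => i; under eq_fun do rewrite expr2.
by apply: cntM; exact: cnt_coord.
Qed.

Lemma cball_compact v r : compact [set w : V | sqnorm (w - v) <= r].
Proof.
apply: (@subclosed_compact _ _ [set w : V | forall i,
    `[v ord0 i - (1 + r), v ord0 i + (1 + r)]%classic (w ord0 i)]).
- apply: (@preimage_closed _ _ (fun w : V => sqnorm (w - v)) [set x | x <= r]).
    by move=> w _; apply: sqnorm_cont; apply: cntB; [exact: cnt_id|exact: cnt_cst].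
  exact: closed_le.
- apply: (@rV_compact R d (fun i => `[v ord0 i - (1 + r), v ord0 i + (1 + r)]%classic)) => i.
  exact: segment_compact.
- move=> w /= wr i; rewrite in_itv /=.
  have : (w ord0 i - v ord0 i) ^+ 2 <= r.
    apply: le_trans wr; rewrite /sqnorm (bigD1 i) //= !mxE lerDl.
    by apply: sumr_ge0 => j _; rewrite sqr_ge0.
  move: (w ord0 i) (v ord0 i) => a b H; apply/andP.
  (* Nonnegativity of these squares bounds the absolute value of [a - b] by [r + 1 / 4], which
     explains the box of half-width [1 + r] without a square root. *)
  have h1 := sqr_ge0 (a - b - 1 / 2); have h2 := sqr_ge0 (a - b + 1 / 2).
  by rewrite !expr2 in H h1 h2; split; nra.
Qed.

Lemma sqball_open v r : open [set w : V | sqnorm (w - v) < r].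
Proof.
apply: (@open_comp _ _ (fun w : V => sqnorm (w - v)) [set x | x < r]); last exact: open_lt.
by move=> w _; apply: sqnorm_cont; apply: cntB; [exact: cnt_id|exact: cnt_cst].
Qed.

Lemma sqnorm_seg v w t r : 0 <= t <= 1 -> sqnorm v < r -> sqnorm w < r ->
  sqnorm ((1 - t) *: v + t *: w) < r.
Proof.
move=> /andP[t0 t1] vr wr.
have : sqnorm ((1 - t) *: v + t *: w) <= (1 - t) * sqnorm v + t * sqnorm w.
  rewrite /sqnorm !mulr_sumr -big_split; apply: ler_sum => i _; rewrite !mxE /=.
  have := mulr_ge0 (mulr_ge0 t0 (_ : 0 <= 1 - t)) (sqr_ge0 (v ord0 i - w ord0 i)).
  rewrite subr_ge0 => /(_ t1); nra.
move=> H; apply: (le_lt_trans H).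
have [->|tn0] := eqVneq t 0; first by rewrite subr0 mul1r mul0r addr0.
have tp : 0 < t by rewrite lt_def tn0.
have h1 : t * sqnorm w < t * r by rewrite ltr_pM2l.
have h2 : (1 - t) * sqnorm v <= (1 - t) * r by rewrite ler_wpM2l ?subr_ge0 // ltW.
lra.
Qed.
End SqNorm.

Lemma nbhs_sub_open (W : topologicalType) (D : set W) (x : D) (A : set D) : open D ->
  nbhs x A -> nbhs (\val x) [set w | exists2 y : D, A y & \val y = w].
Proof.
move=> oD; rewrite [nbhs x]nbhsE => -[B [[B' oB' BE] Bx] BA].
apply: (filterS (P := D `&` B')).
  move=> w [Dw Bw]; exists (SigSub (mem_set Dw)) => //; apply: BA.
  by rewrite -BE.
apply: filterI; apply: open_nbhs_nbhs; split=> //; first exact: (set_mem (valP x)).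
by move: Bx; rewrite -BE.
Qed.

Lemma cont_local (W Y : topologicalType) (f : W -> Y) :
  (forall w0, exists D : set W, [/\ open D, D w0 &
     continuous (fun x : D => f (\val x))]) -> continuous f.
Proof.
move=> H w0 A nA; have [D [oD Dw c]] := H w0.
pose x : D := SigSub (mem_set Dw).
by apply: filterS (nbhs_sub_open oD (c x A nA)) => _ [y yA <-].
Qed.

Lemma plot2_local (R : realType) (E E' : topologicalType) (B : set E) (H : E -> R -> E') :
  (forall b, B b -> exists D : set E, [/\ open D, D b & plot2 (B `&` D) H]) -> plot2 B H.
Proof.
move=> loc W q t cq ct qB t01; apply: cont_local => w0.
have [D [oD Db pD]] := loc _ (qB w0).
exists (q @^-1` D); split=> //; first by apply: open_comp.
have cv : continuous (fun x : (q @^-1` D) => \val x : W) by exact: initial_continuous.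
apply: (pD _ (fun x : (q @^-1` D) => q (\val x)) (fun x => t (\val x))) => //.
- exact: (cnt_comp cv cq).
- exact: (cnt_comp cv ct).
- by move=> x; split; [exact: qB|exact: (set_mem (valP x))].
Qed.

Lemma pcont_at (U W : topologicalType) (O : set U) (f : U -> W) :
  (forall u, O u -> {for u, continuous f}) -> pcont O f.
Proof.
move=> cf T k ck kO t; apply: (@continuous_comp _ _ _ k f t); first exact: ck.
exact: cf.
Qed.

Lemma pcont_open_at (U W : topologicalType) (O : set U) (f : U -> W) u : open O -> pcont O f ->
  O u -> {for u, continuous f}.
Proof.
move=> oO pf Ou A nA.
have cv : continuous (fun x : O => \val x : U) by exact: initial_continuous.
have c := pf O _ cv (fun x => set_mem (valP x)).
pose x : O := SigSub (mem_set Ou).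
by apply: filterS (nbhs_sub_open oO (c x A nA)) => _ [y yA <-].
Qed.

(** * Charts and radial deformations *)

Section Chart.
Variables (R : realType) (d : nat) (Y : topologicalType).
Local Notation V := 'rV[R]_d.

(** An open embedding bundled with a left inverse, whose values off the image are arbitrary. *)
Definition chart (e : V -> Y) (e' : Y -> V) :=
  [/\ continuous e, forall v, e' (e v) = v, pcont (range e) e' &
      forall S, open S -> open (e @` S)].

Lemma chart_of (e : V -> Y) : open_embedding e -> exists e', chart e e'.
Proof.
move=> [ce ie oe].
have /choice[e' eP] : forall y, exists v, (exists w, e w = y) -> e v = y.
  move=> y; have [[w <-]|n] := pselect (exists w, e w = y); first by exists w.
  by exists 0.
have e'K v : e' (e v) = v by apply: ie; apply: eP; exists v.
exists e'; split=> //; apply: pcont_at => _ [v _ <-] A; rewrite e'K => /=.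
rewrite nbhsE => -[B [oB Bv] BA].
apply: (filterS (P := e @` B)); first by move=> _ [w Bw <-] /=; rewrite e'K; exact: BA.
by apply: open_nbhs_nbhs; split; [exact: oe|exists v].
Qed.
End Chart.

Section Radial.
Variables (R : realType) (d : nat) (Y : topologicalType) (e : 'rV[R]_d -> Y) (e' : Y -> 'rV[R]_d).
Local Notation V := 'rV[R]_d.
Hypotheses (ch : chart e e') (hY : hausdorff_space Y).
Variables (v : V) (r : R).
Hypothesis r0 : 0 < r.

Let ce : continuous e. Proof. by case: ch. Qed.
Let e'K w : e' (e w) = w. Proof. by case: ch. Qed.
Let pe' : pcont (range e) e'. Proof. by case: ch. Qed.
Let oe S : open S -> open (e @` S). Proof. by case: ch => _ _ _; apply. Qed.

Definition scal (w : V) (t : R) : R := (1 - t) + t * Num.max 1 (r / sqnorm w).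
Definition radial (y : Y) (t : R) : Y :=
  if pselect (range e y) then e (v + scal (e' y - v) t *: (e' y - v)) else y.

Lemma scal_ge1 w t : 0 <= t <= 1 -> 1 <= scal w t.
Proof.
move=> /andP[t0 t1]; rewrite /scal.
have : 1 <= Num.max 1 (r / sqnorm w) by rewrite le_max lexx.
nra.
Qed.

Lemma scal1 w t : r <= sqnorm w -> scal w t = 1.
Proof.
move=> rw; have s0 : 0 < sqnorm w by exact: lt_le_trans rw.
rewrite /scal max_l ?mulr1 ?subrK //.
by rewrite ler_pdivrMr // mul1r.
Qed.

Lemma radial_e w t : radial (e w) t = e (v + scal (w - v) t *: (w - v)).
Proof. by rewrite /radial; case: pselect => [h|n]; [rewrite e'K|case: n; exists w]. Qed.

Lemma radial_id y t : (forall w, e w = y -> r <= sqnorm (w - v)) -> radial y t = y.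
Proof.
move=> H; have [[w _ wy]|n] := pselect (range e y); last by rewrite /radial; case: pselect.
by rewrite -wy radial_e scal1 ?scale1r 1?[v + _]addrC ?subrK //; exact: H.
Qed.

Lemma radial0 y : radial y 0 = y.
Proof.
have [[w _ <-]|n] := pselect (range e y); last by rewrite /radial; case: pselect.
by rewrite radial_e /scal mul0r subr0 addr0 scale1r addrC subrK.
Qed.

(** Off the chart the motion is locally trivial: the closed ball is compact, so its image is closed
    in the Hausdorff space [Y], and nothing moves outside it. *)
Lemma radial_plot (B : set Y) : ~ B (e v) -> plot2 B radial.
Proof.
move=> Bv; apply: plot2_local => b Bb.
have [[w0 _ wb]|nb] := pselect (range e b).
  exists (range e); split; [exact: oe openT|by exists w0|].
  move=> W q t cq ct qB t01.
  have -> : (fun w => radial (q w) (t w)) =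
      (fun w => e (v + scal (e' (q w) - v) (t w) *: (e' (q w) - v))).
    by apply: funext => w; rewrite /radial; case: pselect => // -[]; have [] := qB w.
  have ce' : continuous (fun w => e' (q w)) by apply: pe' => // w; have [] := qB w.
  have cd : continuous (fun w => e' (q w) - v) by apply: cntB => //; exact: cnt_cst.
  apply: (cnt_comp _ ce); apply: cntD; first exact: cnt_cst.
  apply: cntZ => //; apply: cntD; first by apply: cntB => //; exact: cnt_cst.
  apply: cntM => //; apply: cnt_max; first exact: cnt_cst.
  apply: cntM; first exact: cnt_cst.
  apply: cntV; last exact: sqnorm_cont.
  move=> w; rewrite sqnorm_eq0 subr_eq0; apply/eqP => E.
  have [Bq [u _ uq]] := qB w; apply: Bv; rewrite -E -uq e'K uq //.
exists (~` (e @` [set w | sqnorm (w - v) <= r])); split.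
- apply: closed_openC; apply: compact_closed => //.
  by apply: continuous_compact; [exact: continuous_subspaceT|exact: cball_compact].
- by move=> [w _ wb]; apply: nb; exists w.
- move=> W q t cq ct qB t01.
  rewrite (_ : (fun w => radial (q w) (t w)) = q) //; apply: funext => w.
  apply: radial_id => u uq; rewrite leNgt; apply/negP => ur.
  by have [_ []] := qB w; exists u => //; exact: ltW.
Qed.

Lemma radial_sq w t : 0 <= t <= 1 -> sqnorm (w - v) <= sqnorm (scal (w - v) t *: (w - v)).
Proof.
move=> t01; rewrite sqnormZ -[leLHS]mul1r ler_wpM2r ?sqnorm_ge0 //.
by apply: exprn_ege1; exact: scal_ge1.
Qed.

Lemma radial_sq1 w : w != v -> r <= sqnorm (scal (w - v) 1 *: (w - v)).
Proof.
move=> wv; have s0 : 0 < sqnorm (w - v) by rewrite sqnorm_gt0 subr_eq0.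
rewrite sqnormZ /scal subrr add0r mul1r.
set s := sqnorm (w - v) in s0 *.
have [rs|sr] := leP r s.
  apply: (le_trans rs); rewrite -[X in X <= _]mul1r; apply: ler_wpM2r; first exact: ltW.
  by apply: exprn_ege1; rewrite le_max lexx.
rewrite max_r; last by rewrite ler_pdivlMr // mul1r; exact: ltW.
have -> : (r / s) ^+ 2 * s = r * (r / s) by field; rewrite gt_eqF.
by rewrite -[X in X <= _]mulr1 ler_pM2l // ler_pdivlMr // mul1r; exact: ltW.
Qed.

Definition outer (s : R) : set Y := ~` (e @` [set w | sqnorm (w - v) < s]).

Lemma outer_radial s y t : 0 <= t <= 1 -> outer s y -> outer s (radial y t).
Proof.
move=> t01 sy [w ws wE].
have [[u _ uy]|n] := pselect (range e y); last first.
  by apply: sy; exists w => //; move: wE; rewrite /radial; case: pselect.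
apply: sy; exists u => //=; move: wE; rewrite -uy radial_e => /(congr1 e'); rewrite !e'K => wE.
apply: le_lt_trans ws => /=; rewrite wE [X in _ <= sqnorm X]addrAC subrr add0r.
exact: radial_sq.
Qed.

Lemma radial_outer y : y <> e v -> outer r (radial y 1).
Proof.
move=> yv [w ws wE].
have [[u _ uy]|n] := pselect (range e y); last first.
  by move: wE; rewrite /radial; case: pselect => // n' wE; apply: n; exists w.
move: wE; rewrite -uy radial_e => /(congr1 e'); rewrite !e'K => wE.
move: ws; rewrite /= wE addrAC subrr add0r ltNge radial_sq1 //.
by apply/eqP => uv; apply: yv; rewrite -uy uv.
Qed.

Lemma radial_id_outer y t : outer r y -> radial y t = y.
Proof. by move=> ry; apply: radial_id => w wy; rewrite leNgt; apply/negP => ws; apply: ry; exists w. Qed.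

Lemma outer_v s : 0 < s -> ~ outer s (e v).
Proof. by move=> s0; apply; exists v => //=; rewrite subrr sqnorm0. Qed.

Variables (X : topologicalType) (x0 : X) (g : Y -> X).

Lemma radial_acyc_pt : pcont (~` [set e v]) g -> pacyc R x0 g (~` [set e v]) (outer r).
Proof.
move=> pg; apply: (pacyc_deform pg (k := radial)) => //.
- by apply: radial_plot; apply.
- by move=> y ry yv; apply: (outer_v r0); rewrite -yv.
- by move=> z _; exact: radial0.
- move=> z t zv t01 zE.
  have [[u _ uy]|n] := pselect (range e z).
    move: zE; rewrite -uy radial_e => /(congr1 e'); rewrite !e'K => E.
    have := radial_sq u t01; have -> : scal (u - v) t *: (u - v) = 0.
      by apply: (addrI v); rewrite addr0.
    rewrite sqnorm0 => H; apply: zv; rewrite -uy; congr e; apply/eqP.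
    by rewrite -subr_eq0 -sqnorm_eq0 eq_le H sqnorm_ge0.
  by apply: zv; move: zE; rewrite /radial; case: pselect.
- by move=> z t zr t01; exact: outer_radial.
- by move=> z zv; exact: radial_outer.
Qed.

Lemma radial_acyc s : 0 < s -> s <= r -> pcont (outer s) g -> pacyc R x0 g (outer s) (outer r).
Proof.
move=> s0 sr pg; apply: (pacyc_deform pg (k := radial)) => //.
- by apply: radial_plot; exact: outer_v.
- by move=> y ry [w ws wy]; apply: ry; exists w => //; exact: lt_le_trans sr.
- by move=> z _; exact: radial0.
- by move=> z t zr t01; exact: outer_radial.
- by move=> z t zr t01; exact: outer_radial.
- by move=> z zs; apply: radial_outer => zv; apply: (outer_v s0); rewrite -zv.
Qed.

Lemma radial_pcont : pcont (~` [set e v]) (radial ^~ 1).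
Proof.
move=> W k ck kO; apply: (radial_plot (B := ~` [set e v])) => //; first by apply.
  exact: cnt_cst.
by move=> w; rewrite lexx ler01.
Qed.
End Radial.

Section HpLift.
Variables (R : realType) (Z X : topologicalType) (x0 : X) (g : Z -> X).

Lemma hp_left (A A' B : set Z) n r : B `<=` A -> A `<=` A' -> pacyc R x0 g A' A ->
  hp R x0 g n A B r <-> hp R x0 g n A' B r.
Proof. by move=> BA AA' ac; apply: hr_acyc_left ac; exact: pE_mono. Qed.

Lemma hp_right (T A A' : set Z) n r : A `<=` A' -> A' `<=` T -> pacyc R x0 g A' A ->
  hp R x0 g n T A r <-> hp R x0 g n T A' r.
Proof. by move=> BA AA' ac; apply: hr_acyc_right ac; exact: pE_mono. Qed.
End HpLift.

(** * Moving the base point and the puncture *)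

Section Moves.
Variables (R : realType) (d : nat).

Definition ssum (a : nat -> nat) (ms : seq nat) n := (\sum_(m <- ms) shift_rank a m n)%N.

(* The homology of the pull-back over O of every path fibration, relative to
   the fibre over z, is a sum of shifts of the homology of that fibre. *)
Definition Sprop (Y : topologicalType) (ms : seq nat) (O : set Y) (z : Y) :=
  forall (X : topologicalType) (x0 : X) (g : Y -> X), pcont O g -> forall n a,
  (forall i, (i.+1 < n)%N -> hp R x0 g i [set z] set0 (a i)) ->
  hp R x0 g n O [set z] (ssum a ms n).

Definition mfd (Y : topologicalType) := hausdorff_space Y /\
  forall y : Y, exists e e' (v : 'rV[R]_d), chart e e' /\ e v = y.

Variables (Y : topologicalType) (mY : mfd Y).

(** Interchangeability of two base points, for the fibre and for the pair at once. It is an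
    equivalence relation, locally constant on a manifold, to which the connectedness lemmas
    apply. *)
Definition base_equiv (O : set Y) (y z : Y) := forall (X : topologicalType) (x0 : X) (g : Y -> X),
  pcont O g -> forall n r, (hp R x0 g n [set y] set0 r <-> hp R x0 g n [set z] set0 r) /\
   (hp R x0 g n O [set y] r <-> hp R x0 g n O [set z] r).

Lemma base_equiv_sym O y z : base_equiv O y z -> base_equiv O z y.
Proof. by move=> h X x0 g pg n r; have [h1 h2] := h X x0 g pg n r; split; apply: iff_sym. Qed.
Lemma base_equiv_trans O x y z : base_equiv O x y -> base_equiv O y z -> base_equiv O x z.
Proof.
move=> h k X x0 g pg n r; have [h1 h2] := h X x0 g pg n r; have [k1 k2] := k X x0 g pg n r.
by split; [apply: iff_trans k1|apply: iff_trans k2].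
Qed.

Lemma ball_nbhs (v : 'rV[R]_d) (A : set 'rV[R]_d) : nbhs v A ->
  exists2 r : R, 0 < r & [set w | sqnorm (w - v) < r] `<=` A.
Proof.
move=> [P nP sPA].
have /choice[f fP] : forall i : 'I_d, exists s : R, 0 < s /\ forall x, `|x - v ord0 i| < s -> P ord0 i x.
  move=> i; have /nbhs_ballP[s /= s0 sP] := nP ord0 i; exists s; split=> // x xs.
  by apply: sP; rewrite /ball /= distrC.
pose r := \big[Num.min/1]_i (f i ^+ 2); exists r.
  rewrite /r; elim/big_ind: _ => // [x y x0 y0|i _]; first by rewrite lt_min x0.
  by rewrite exprn_gt0 //; have [] := fP i.
move=> w /= wr; apply: sPA => k i; rewrite [k]ord1; have [s0 H] := fP i; apply: H.
have : (w ord0 i - v ord0 i) ^+ 2 < f i ^+ 2.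
  apply: (@le_lt_trans _ _ (sqnorm (w - v))).
    rewrite /sqnorm (bigD1 i) //= !mxE lerDl.
    by apply: sumr_ge0 => j _; rewrite sqr_ge0.
  apply: (lt_le_trans wr); rewrite /r (bigD1 i) //=; by rewrite ge_min lexx.
by rewrite -real_normK ?num_real // ltr_pXn2r ?nnegrE // ltW.
Qed.

(** A small coordinate ball contracts linearly to any of its points, so the fibres over two of them
    are both compared with the part over the ball. *)
Lemma base_local (O : set Y) y : open O -> O y -> exists2 U, nbhs y U & forall z, U z ->
  [/\ O z, base_equiv O y z & True].
Proof.
move=> oO Oy; have [hY /(_ y)[e [e' [v [ch ev]]]]] := mY; have [ce e'K pe' oe] := ch.
have nv : nbhs v (e @^-1` O) by apply: ce; rewrite ev; apply: open_nbhs_nbhs.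
have [r r0 rO] := ball_nbhs nv.
pose B := [set w : 'rV[R]_d | sqnorm (w - v) < r].
have Bv : B v by rewrite /B /= subrr sqnorm0.
exists (e @` B).
  apply: open_nbhs_nbhs; split; last by exists v.
  by apply: oe; apply: sqball_open.
have BO : e @` B `<=` O by move=> _ [w Bw <-]; exact: rO.
have ac u (X : topologicalType) (x0 : X) (g : Y -> X) : B u -> pcont O g ->
    pacyc R x0 g (e @` B) [set e u].
  move=> Bu pg; rewrite -image_set1.
  apply: (pacyc_chart (c' := e') (k := fun w t => (1 - t) *: w + t *: u)) => //.
  - exact: cont_pcont.
  - by apply: pcont_sub pe' => _ [w _ <-]; exists w.
  - exact: pcont_sub pg.
  - move=> W q t cq ct _ _; apply: cntD; apply: cntZ => //; last exact: cnt_cst.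
    by apply: cntB => //; exact: cnt_cst.
  - by move=> _ ->.
  - by move=> w _; rewrite subr0 scale1r scale0r addr0.
  - move=> w t Bw t01; rewrite /B /=.
    have -> : (1 - t) *: w + t *: u - v = (1 - t) *: (w - v) + t *: (u - v).
      by apply/rowP => i; rewrite !mxE; ring.
    exact: sqnorm_seg.
  - by move=> _ t -> _; rewrite -scalerDl subrK scale1r.
  - by move=> w _; rewrite subrr scale0r scale1r add0r.
move=> _ [u Bu <-]; split=> //; first by apply: BO; exists u.
move=> X x0 g pg n r'.
have av := ac v X x0 g Bv pg; have au := ac u X x0 g Bu pg.
have sv : [set e v] `<=` e @` B by move=> _ ->; exists v.
have su : [set e u] `<=` e @` B by move=> _ ->; exists u.
rewrite -ev; split.
  apply: (iff_trans (hp_left n r' (@sub0set _ _) sv av)).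
  by apply: iff_sym; exact: hp_left.
apply: (iff_trans (hp_right n r' sv BO av)).
by apply: iff_sym; exact: hp_right.
Qed.

Lemma Sprop_base ms O y z : base_equiv O y z -> Sprop ms O y -> Sprop ms O z.
Proof.
move=> yz S X x0 g pg n a Ha; apply: (iffLR (yz X x0 g pg n _).2).
by apply: S => // i ni; apply: (iffRL (yz X x0 g pg i _).1); exact: Ha.
Qed.

Lemma ssum0 a ms : all (leq 1) ms -> ssum a ms 0 = 0%N.
Proof.
move=> /allP H; rewrite /ssum big_seq big1 // => m /H m1.
by rewrite /shift_rank leqNgt m1.
Qed.

(** [Sprop] for a constant map, in degree 0, gives rank 0 because all shifts are positive. Thus [O]
    is connected in the sense that a locally constant equivalence relation has one class on it. *)
Lemma Sprop_rel (ms : seq nat) O (rel : Y -> Y -> Prop) z z' : all (leq 1) ms -> Sprop ms O z ->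
  (forall y, rel y y) -> (forall y z, rel y z -> rel z y) ->
  (forall x y z, rel x y -> rel y z -> rel x z) ->
  (forall y, O y -> nbhs y [set z | O z -> rel y z]) -> O z -> O z' -> rel z z'.
Proof.
move=> ms1 S r1 r2 r3 r4 Oz Oz'.
apply: (@connected_of_hp R Y O rel r1 r2 r3 r4 Y z) => //.
have := S Y z (fun=> z) _ 0%N (fun=> 0%N); rewrite ssum0 //; apply=> //.
by move=> W k ck _; exact: cnt_cst.
Qed.

Lemma Sprop_move_base ms O z z' : all (leq 1) ms -> open O -> Sprop ms O z -> O z -> O z' ->
  base_equiv O z z'.
Proof.
move=> ms1 oO S Oz Oz'; apply: (Sprop_rel ms1 S) => //.
- exact: base_equiv_sym.
- exact: base_equiv_trans.
- by move=> y Oy; have [U nU UP] := base_local oO Oy; apply: filterS nU => u /UP[_ yu _] _.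
Qed.
End Moves.

Section Puncture.
Variables (R : realType) (d : nat) (Y : topologicalType).
Variables (e : 'rV[R]_d -> Y) (e' : Y -> 'rV[R]_d).
Hypotheses (ch : chart e e') (hY : hausdorff_space Y).
Variable ms : seq nat.

Lemma outer_not v r : 0 < r -> outer e v r `<=` ~` [set e v].
Proof. by move=> r0 y yo yv; apply: (outer_v r0 (e := e) (v := v)); rewrite -yv. Qed.

(** For the direct implication [g] is only continuous on the outside of the ball; composing with
    [radial] at time 1 extends it to the punctured space without changing it on the outside. *)
Lemma Sprop_outer v r z : 0 < r -> outer e v r z ->
  Sprop R ms (~` [set e v]) z <-> Sprop R ms (outer e v r) z.
Proof.
move=> r0 rz.
have zs : [set z] `<=` outer e v r by move=> _ ->.
have on := outer_not (v := v) r0.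
split=> S X x0 g pg n a Ha.
  pose g' y := g (radial e e' v r y 1).
  have gg y : outer e v r y -> g' y = g y by move=> yo; rewrite /g' (radial_id_outer ch).
  have pg' : pcont (~` [set e v]) g'.
    move=> W k ck kO; apply: (pg W (fun w => radial e e' v r (k w) 1)).
      exact: (radial_pcont ch hY r0 ck kO).
    by move=> w; apply: (radial_outer ch) => //; exact: kO.
  have E : pE R x0 g' (outer e v r) = pE R x0 g (outer e v r) by exact: pE_congr.
  have E1 : pE R x0 g' [set z] = pE R x0 g [set z] by apply: pE_congr => y /zs; exact: gg.
  have E0 : pE R x0 g' set0 = pE R x0 g set0 by exact: pE_congr.
  have : hp R x0 g' n (outer e v r) [set z] (ssum a ms n); last by rewrite /hp E E1.
  have ac : pacyc R x0 g' (~` [set e v]) (outer e v r) by exact: (radial_acyc_pt ch hY r0 pg').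
  have H := hp_left n (ssum a ms n) zs on ac.
  apply/H.
  by apply: S => // i /Ha; rewrite /hp E1 E0.
apply: (iffLR (hp_left n _ zs on (radial_acyc_pt ch hY r0 pg))).
by apply: S => //; exact: pcont_sub pg.
Qed.

Lemma outer_shift u v (r s : R) : 0 < r -> sqnorm (u - v) < r -> 2 * (s + r) <= 22 * r ->
  outer e v (2 * (s + r)) `<=` outer e u s.
Proof.
move=> r0 uv _ y yo [w ws wy]; apply: yo; exists w => //=.
have -> : w - v = (w - u) + (u - v) by rewrite addrA subrK.
apply: (le_lt_trans (sqnormD_le _ _)); move: ws => /= ws; lra.
Qed.

(** Outsides of balls about [v] and [u], of square radii [22 r], [10 r], [4 r], [r], alternate in
    centre and increase. Those with a common centre differ by a radial deformation, so the
    2-out-of-6 property compares the last two. Each constant comes from the next by [s] to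
    [2 * (s + r)], the loss in [sqnormD_le]. *)
Lemma Sprop_puncture u v r z : 0 < r -> sqnorm (u - v) < r -> outer e v (22 * r) z ->
  Sprop R ms (~` [set e v]) z -> Sprop R ms (~` [set e u]) z.
Proof.
move=> r0 uv zo S.
have vu : sqnorm (v - u) < r by rewrite -sqnormN opprB.
have s12 : outer e v (22 * r) `<=` outer e u (10 * r).
  by have := @outer_shift u v r (10 * r) r0 uv; (have -> : 2 * (10 * r + r) = 22 * r by ring); apply.
have s23 : outer e u (10 * r) `<=` outer e v (4 * r).
  have := @outer_shift v u r (4 * r) r0 vu; (have -> : 2 * (4 * r + r) = 10 * r by ring).
  by apply; lra.
have s34 : outer e v (4 * r) `<=` outer e u r.
  have := @outer_shift u v r r r0 uv; (have -> : 2 * (r + r) = 4 * r by ring).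
  by apply; lra.
have r4 : 0 < 4 * r by lra.
have z3 : outer e v (4 * r) z by apply: s23; exact: s12.
apply/(Sprop_outer r0 (s34 _ z3)).
have S4 : Sprop R ms (outer e v (4 * r)) z by apply/Sprop_outer.
move=> X x0 g pg n a Ha.
have p4 : pcont (outer e v (4 * r)) g by exact: pcont_sub pg.
have ac : pacyc R x0 g (outer e u r) (outer e v (4 * r)).
  apply: (@acyc_sandwich R _ (pE R x0 g (outer e v (22 * r))) (pE R x0 g (outer e u (10 * r)))).
  - exact: pE_mono.
  - exact: pE_mono.
  - exact: pE_mono.
  - by apply: (radial_acyc ch hY) => //; lra.
  - by apply: (radial_acyc ch hY) => //; lra.
apply: (iffLR (hp_left n _ _ s34 ac)); first by move=> _ ->.
exact: S4.
Qed.
End Puncture.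

Section AllPoints.
Variables (R : realType) (d : nat) (Y : topologicalType) (mY : mfd R d.+1 Y).
Variable ms : seq nat.
Hypothesis ms1 : all (leq 1) ms.

Lemma open_setC1 (y : Y) : open (~` [set y]).
Proof. by apply: closed_openC; apply: compact_closed; [case: mY|exact: compact_set1]. Qed.

Lemma Sprop_base_all (y z z' : Y) : y <> z -> y <> z' -> Sprop R ms (~` [set y]) z -> Sprop R ms (~` [set y]) z'.
Proof.
move=> yz yz' S; apply: Sprop_base (S).
by apply: (Sprop_move_base mY ms1 _ S); [exact: open_setC1|exact: nesym|exact: nesym].
Qed.

Let Sp (y : Y) := forall z, y <> z -> Sprop R ms (~` [set y]) z.

(** The value 46 exceeds the factor 22 needed by [Sprop_puncture] at [r = 1], while one eighth of
    this displacement has square norm [46 / 64], below 1. *)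
Let far v : exists w : 'rV[R]_d.+1, sqnorm (w - v) = 46.
Proof.
exists (v + \row_i (if i == ord0 then Num.sqrt 46 else 0)).
rewrite addrC addKr /sqnorm (bigD1 ord0) //= big1 => [|i /negPf i0]; rewrite !mxE ?eqxx ?i0 ?expr0n //.
by rewrite sqr_sqrtr ?addr0 //; lra.
Qed.

Lemma Sp_chart (e : 'rV[R]_d.+1 -> Y) e' v u : chart e e' -> sqnorm (u - v) < 1 -> Sp (e v) -> Sp (e u).
Proof.
move=> ch uv Sv z uz; have [w wv] := far v.
have einj x y : e x = e y -> x = y by move=> /(congr1 e'); case: ch => _ K _ _; rewrite !K.
apply: (@Sprop_base_all (e u) (e w)) => //.
  by move=> /einj E; move: uv; rewrite E wv; lra.
apply: (Sprop_puncture ch (proj1 mY) ltr01 uv).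
  by move=> [x /= xv /einj E]; move: xv; rewrite E wv; lra.
by apply: Sv => /einj E; move: wv; rewrite E subrr sqnorm0; lra.
Qed.

(** By [Sp_chart] the property [Sp] of a puncture is locally constant. It passes from [y0] to a
    nearby point [x1], and from there to every other point because the complement of [y0] is
    connected, by [S0] itself. *)
Lemma Sprop_all (y0 z0 y z : Y) : y0 <> z0 -> Sprop R ms (~` [set y0]) z0 -> y <> z ->
  Sprop R ms (~` [set y]) z.
Proof.
move=> yz0 S0; move: z; change (Sp y).
have S : Sp y0 by move=> z' yz'; apply: Sprop_base_all S0.
have loc x : nbhs x [set x' | Sp x <-> Sp x'].
  have [_ /(_ x)[e [e' [v [ch <-]]]]] := mY.
  apply: (filterS (P := e @` [set w | sqnorm (w - v) < 1])).
    move=> _ [u uv <-]; split; apply: (Sp_chart ch) => //.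
    by rewrite -sqnormN opprB.
  apply: open_nbhs_nbhs; split; first by case: ch => _ _ _; apply; exact: sqball_open.
  by exists v => //=; rewrite subrr sqnorm0.
have [x1 yx1 S1] : exists2 x1, y0 <> x1 & Sp x1.
  have [_ /(_ y0)[e [e' [v [ch ev]]]]] := mY; have [w wv] := far v.
  exists (e (v + (8^-1 : R) *: (w - v))).
    rewrite -ev => /(congr1 e'); case: ch => _ K _ _; rewrite !K => E.
    have : sqnorm ((8^-1 : R) *: (w - v)) = 0.
      by apply/eqP; rewrite sqnorm_eq0; apply/eqP/(addrI v); rewrite addr0.
    rewrite sqnormZ wv; lra.
  apply: (Sp_chart ch (v := v)); last by rewrite ev.
  by rewrite addrAC subrr add0r sqnormZ wv; lra.
have Sr x : y0 <> x -> Sp z0 <-> Sp x.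
  move=> yx; apply: (Sprop_rel (O := ~` [set y0]) (rel := fun a b => Sp a <-> Sp b) ms1 S0) => //.
  - by move=> a b [h k]; split.
  - by move=> a b c [h1 h2] [k1 k2]; split; auto.
  - by move=> a _; apply: filterS (loc a) => b h _.
  - exact: nesym.
  - exact: nesym.
have Sy x : y0 <> x -> Sp x by move=> /Sr H; apply/H/(Sr _ yx1).
have [->|/eqP yy] := eqVneq y y0; first exact: S.
by apply: Sy; exact: nesym.
Qed.
End AllPoints.

Lemma chart_intro (R : realType) d (Y : topologicalType) (e : 'rV[R]_d -> Y) e' :
  continuous e -> (forall v, e' (e v) = v) -> open (range e) -> pcont (range e) e' -> chart e e'.
Proof.
move=> ce e'K oe pe'; split=> // S oS.
rewrite openE => _ [v Sv <-].
have c : {for e v, continuous e'} by apply: pcont_open_at oe pe' _; exists v.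
have n1 : nbhs (e v) (e' @^-1` S) by apply: c; rewrite e'K; exact: open_nbhs_nbhs.
have n2 : nbhs (e v) (range e) by apply: open_nbhs_nbhs; split=> //; exists v.
by apply: filterS2 n1 n2 => y yS [w _ wy]; exists w => //; move: yS; rewrite -wy /= e'K.
Qed.

(** * Reflections and stereographic projection *)

Section Sphere.
Variables (R : realType) (p : nat).
Local Notation V := 'rV[R]_p.
Local Notation V1 := 'rV[R]_p.+1.
Local Notation S := (sphere R p).

Definition dot (n : nat) (v w : 'rV[R]_n) : R := \sum_i v ord0 i * w ord0 i.
Lemma dotC n (v w : 'rV[R]_n) : dot v w = dot w v.
Proof. by apply: eq_bigr => i _; rewrite mulrC. Qed.
Lemma dotBZ n (v w u : 'rV[R]_n) t : dot (v - t *: w) u = dot v u - t * dot w u.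
Proof. by rewrite /dot mulr_sumr -sumrB; apply: eq_bigr => i _; rewrite !mxE; ring. Qed.
Lemma dot_sq n (v : 'rV[R]_n) : dot v v = sqnorm v.
Proof. by apply: eq_bigr => i _; rewrite expr2. Qed.

(* The Householder reflection exchanging two vectors of the same norm. *)
Definition refl (c x : V1) : V1 := x - (2 * dot x c / sqnorm c) *: c.

Lemma refl_dot c x : dot (refl c x) c = - dot x c.
Proof.
rewrite /refl dotBZ dot_sq; have [->|c0] := eqVneq c 0.
  by rewrite /dot big1 ?mulr0 ?sqnorm0 ?mulr0 ?subr0 ?oppr0 // => i _; rewrite mxE mulr0.
have : sqnorm c != 0 by rewrite sqnorm_eq0.
by move=> s0; field.
Qed.
Lemma reflK c x : refl c (refl c x) = x.
Proof. by rewrite {1}/refl refl_dot mulrN mulNr scaleNr opprK /refl subrK. Qed.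
Lemma refl_sq c x : sqnorm (refl c x) = sqnorm x.
Proof.
rewrite -!dot_sq {1}/refl dotBZ [dot c _]dotC refl_dot dotC /refl dotBZ [dot c x]dotC.
ring.
Qed.
Lemma refl_swap a b : sqnorm a = sqnorm b -> refl (a - b) b = a.
Proof.
move=> ab; have [->|ne] := eqVneq a b.
  by rewrite /refl subrr scaler0 subr0.
have s0 : sqnorm (a - b) != 0 by rewrite sqnorm_eq0 subr_eq0.
have E1 : dot b (a - b) = dot a b - sqnorm b.
  by rewrite dotC -[a - b]/(a - b) -{1}[b]scale1r dotBZ mul1r dot_sq.
have E2 : sqnorm (a - b) = 2 * (sqnorm b - dot a b).
  rewrite -[LHS]dot_sq -{1}[b]scale1r dotBZ mul1r E1 dotC -{1}[b]scale1r dotBZ mul1r dot_sq ab.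
  by rewrite [dot b a]dotC; ring.
rewrite /refl E1; have -> : 2 * (dot a b - sqnorm b) / sqnorm (a - b) = -1.
  by apply: (mulIf s0); rewrite divfK // E2; ring.
by rewrite scaleN1r opprK addrC subrK.
Qed.
Lemma refl_cont c : continuous (refl c).
Proof.
apply: cntB; first exact: cnt_id.
apply: cntZ; last exact: cnt_cst.
apply: cntM; last exact: cnt_cst.
apply: cntM; first exact: cnt_cst.
by apply: cnt_sum => i; apply: cntM; [apply: cnt_coord; exact: cnt_id|exact: cnt_cst].
Qed.

Definition hd (v : V1) : R := v ord0 ord0.
Definition tl (v : V1) : V := \row_j v ord0 (lift ord0 j).
Definition cns (h : R) (x : V) : V1 := \row_j oapp (x ord0) h (unlift ord0 j).

Lemma hd_cns h x : hd (cns h x) = h. Proof. by rewrite /hd mxE unlift_none. Qed.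
Lemma tl_cns h x : tl (cns h x) = x. Proof. by apply/rowP => j; rewrite !mxE liftK. Qed.
Lemma cns_eta v : cns (hd v) (tl v) = v.
Proof. by apply/rowP => j; rewrite mxE; case: unliftP => [j' ->|->] //=; rewrite mxE. Qed.
Lemma sq_hdtl v : sqnorm v = hd v ^+ 2 + sqnorm (tl v).
Proof. by rewrite {1}/sqnorm big_ord_recl; congr (_ + _); apply: eq_bigr => j _; rewrite mxE. Qed.
Lemma sq_cns h x : sqnorm (cns h x) = h ^+ 2 + sqnorm x.
Proof. by rewrite sq_hdtl hd_cns tl_cns. Qed.
Lemma cns_cont (T : topologicalType) (h : T -> R) (x : T -> V) : continuous h -> continuous x ->
  continuous (fun w => cns (h w) (x w)).
Proof.
move=> ch cx; apply: cnt_mx => i j; under eq_fun do rewrite mxE.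
by case: unliftP => [j' _|_] //=; exact: cnt_coord.
Qed.

Let one_p (x : V) : sqnorm x + 1 != 0.
Proof. by rewrite gt_eqF // ltr_wpDl // sqnorm_ge0. Qed.

(* Stereographic projection from the pole of height [s] = 1 or -1. *)
Definition st (s : R) (x : V) : V1 :=
  cns (s * ((sqnorm x - 1) / (sqnorm x + 1))) ((2 / (sqnorm x + 1)) *: x).
Definition st' (s : R) (v : V1) : V := (1 - s * hd v)^-1 *: tl v.

Variable s : R.
Hypothesis s2 : s ^+ 2 = 1.

Lemma st_sq x : sqnorm (st s x) = 1.
Proof.
rewrite sq_cns sqnormZ; have := one_p x; move: (sqnorm x) => y y0.
by rewrite exprMn s2; field.
Qed.
Lemma st_hd x : 1 - s * hd (st s x) = 2 / (sqnorm x + 1).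
Proof.
rewrite hd_cns mulrA -expr2 s2; have := one_p x; move: (sqnorm x) => y y0; field.
exact: y0.
Qed.
Lemma stK x : st' s (st s x) = x.
Proof.
rewrite /st' st_hd tl_cns scalerA -[RHS]scale1r; congr (_ *: _).
by have := one_p x; move: (sqnorm x + 1) => y y0; field.
Qed.
Lemma st_cont : continuous (st s).
Proof.
have cs : continuous (fun x : V => sqnorm x) by apply: sqnorm_cont; exact: cnt_id.
have cp : continuous (fun x : V => (sqnorm x + 1)^-1).
  by apply: cntV; [exact: one_p|apply: cntD => //; exact: cnt_cst].
apply: cns_cont.
  apply: cntM; first exact: cnt_cst.
  by apply: cntM => //; apply: cntB => //; exact: cnt_cst.
apply: cntZ; last exact: cnt_id.
by apply: cntM => //; exact: cnt_cst.
Qed.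
Lemma st'K v : sqnorm v = 1 -> v <> cns s 0 -> st s (st' s v) = v.
Proof.
move=> v1 vs; have := sq_hdtl v; rewrite v1 => E.
have h1 : 1 - s * hd v != 0.
  apply/eqP => /eqP; rewrite subr_eq0 => /eqP H.
  have hs : hd v = s by rewrite -[hd v]mul1r -s2 expr2 -mulrA -H mulr1.
  apply: vs; rewrite -(cns_eta v) hs; congr cns; apply/eqP.
  by rewrite -sqnorm_eq0; move: E; rewrite hs s2; lra.
rewrite /st /st' sqnormZ.
have -> : sqnorm (tl v) = (1 - s * hd v) * (1 + s * hd v).
  have -> : sqnorm (tl v) = 1 - s ^+ 2 * hd v ^+ 2 by rewrite s2; lra.
  ring.
have E2 : (1 - s * hd v)^-1 ^+ 2 * ((1 - s * hd v) * (1 + s * hd v)) =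
   (1 + s * hd v) / (1 - s * hd v) by field.
rewrite E2 -[RHS]cns_eta; move: h1; set m := s * hd v => h1; congr cns.
  have -> : ((1 + m) / (1 - m) - 1) / ((1 + m) / (1 - m) + 1) = m.
    by field; rewrite h1 ?andbT; apply/eqP => H; lra.
  by rewrite /m mulrA -expr2 s2 mul1r.
rewrite scalerA -[RHS]scale1r; congr (_ *: _).
by field; rewrite h1 ?andbT; apply/eqP => H; lra.
Qed.

Lemma st_pole x : st s x <> cns s 0.
Proof.
move=> E; have := st_hd x; rewrite E hd_cns -expr2 s2 subrr => /esym/eqP.
by rewrite mulf_eq0 invr_eq0 (negPf (one_p x)) pnatr_eq0.
Qed.
Lemma st0 : st s 0 = cns (- s) 0.
Proof. by rewrite /st sqnorm0 scaler0 sub0r add0r divr1 mulrN1. Qed.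
(** The transition between the two stereographic charts is inversion in the unit sphere. *)
Lemma st_inv x : x != 0 -> st s x = st (- s) ((sqnorm x)^-1 *: x).
Proof.
rewrite -sqnorm_gt0 => x0; rewrite /st sqnormZ scalerA.
have : sqnorm x + 1 != 0 by exact: one_p.
have : sqnorm x != 0 by rewrite gt_eqF.
have : 1 + sqnorm x != 0 by rewrite addrC one_p.
move: (sqnorm x) => y y2 y0 y1.
have -> : y^-1 ^+ 2 * y = y^-1 by field.
by congr (cns _ (_ *: _)); field; rewrite ?y0 ?y1 ?y2.
Qed.
Lemma st'_pcont : pcont [set v | sqnorm v = 1 /\ v <> cns s 0] (st' s).
Proof.
move=> W k ck kO; apply: cntZ; last first.
  by apply: cnt_mx => i j; under eq_fun do rewrite mxE; exact: cnt_coord.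
apply: cntV => [w|]; last first.
  apply: cntB; first exact: cnt_cst.
  by apply: cntM; [exact: cnt_cst|exact: cnt_coord].
have [k1 ks] := kO w; apply/eqP => /eqP; rewrite subr_eq0 => /eqP H.
have hs : hd (k w) = s by rewrite -[hd (k w)]mul1r -s2 expr2 -mulrA -H mulr1.
apply: ks; rewrite -(cns_eta (k w)) hs; congr cns; apply/eqP.
by rewrite -sqnorm_eq0; move: (sq_hdtl (k w)); rewrite k1 hs s2; lra.
Qed.
End Sphere.

(** * Charts of the sphere *)

Section SphereCharts.
Variables (R : realType) (p : nat).
Local Notation S := (sphere R p).

Lemma sphere_hausdorff : hausdorff_space S.
Proof. by apply: (hausdorff_inj (@initial_continuous _ _ _)); [exact: val_inj|exact: norm_hausdorff]. Qed.

Lemma sphere_open (v : 'rV[R]_p.+1) : open (~` [set y : S | \val y = v]).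
Proof.
apply: (@open_comp _ _ (\val : S -> _) (~` [set v])); first by move=> y _; exact: initial_continuous.
by apply: closed_openC; apply: compact_closed; [exact: norm_hausdorff|exact: compact_set1].
Qed.

(** The two stereographic parametrisations, carried by a Householder reflection that takes the pole
    of height 1 to [a]. *)
Lemma sphere_charts (a : S) : exists (b : S) (f g : 'rV[R]_p -> S) f' g',
  [/\ chart f f', chart g g', range f = ~` [set a], range g = ~` [set b] &
   [/\ f 0 = b, g 0 = a & forall x, x != 0 -> f x = g ((sqnorm x)^-1 *: x)]].
Proof.
have a1 : sqnorm (\val a) = 1 by exact: (set_mem (valP a)).
pose pole (s : R) : 'rV[R]_p.+1 := cns s 0.
have p1 (s : R) : s ^+ 2 = 1 -> sqnorm (pole s) = 1 by move=> s2; rewrite sq_cns sqnorm0 addr0.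
pose H := refl (\val a - pole 1).
have H1 : H (pole 1) = \val a by apply: refl_swap; rewrite a1 p1 // expr1n.
have HK x : H (H x) = x by exact: reflK.
have HS x : sqnorm x = 1 -> H x \in [set v : 'rV[R]_p.+1 | sqnorm v = 1].
  by move=> x1; apply/mem_set; rewrite /= refl_sq.
have sq1 : (1 : R) ^+ 2 = 1 by rewrite expr1n.
have sqN : (-1 : R) ^+ 2 = 1 by rewrite sqrrN expr1n.
pose F s (s2 : s ^+ 2 = 1) (x : 'rV[R]_p) : S := SigSub (HS _ (st_sq s2 x)).
pose F' (s : R) (y : S) := st' s (H (\val y)).
pose P s (s2 : s ^+ 2 = 1) : S := SigSub (HS _ (p1 s s2)).
have rF s (s2 : s ^+ 2 = 1) : range (F s s2) = ~` [set P s s2].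
  apply/seteqP; split=> [_ [x _ <-] /= E|y yP].
    have := congr1 H (congr1 \val E); rewrite /= !HK; exact: st_pole.
  have y1 : sqnorm (H (\val y)) = 1 by rewrite refl_sq; exact: (set_mem (valP y)).
  exists (F' s y) => //; apply: val_inj; rewrite /= /F' st'K ?HK // => E.
  by apply: yP; apply: val_inj; rewrite /= -/(pole s) /pole -E HK.
have cF s (s2 : s ^+ 2 = 1) : chart (F s s2) (F' s).
  apply: chart_intro.
  - by apply: continuous_comp_initial; apply: (cnt_comp (@st_cont _ _ s) (@refl_cont _ _ _)).
  - by move=> x; rewrite /F' /= HK stK.
  - by rewrite rF; have := sphere_open (\val (P s s2)); congr open; apply/seteqP; split=> y /= h E; apply: h; [rewrite E|exact: val_inj].
  - rewrite rF => W k ck kO; apply: (st'_pcont s2 (k := fun w => H (\val (k w)))).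
      by apply: (cnt_comp (cnt_comp ck (@initial_continuous _ _ _)) (@refl_cont _ _ _)).
    move=> w; split; first by rewrite refl_sq; exact: (set_mem (valP (k w))).
    by move=> E; apply: (kO w); apply: val_inj; rewrite /= /pole -E HK.
have P1 : P 1 sq1 = a by apply: val_inj; rewrite /= H1.
exists (P (-1) sqN), (F 1 sq1), (F (-1) sqN), (F' 1), (F' (-1)); split; rewrite ?rF ?P1 //.
split.
- by apply: val_inj; rewrite /= st0.
- by rewrite -[RHS]P1; apply: val_inj; rewrite /= st0 opprK.
- by move=> x x0; apply: val_inj; rewrite /= st_inv.
Qed.

Lemma sphere_compact (a : S) : compact [set: S].
Proof.
have [b [f [g [f' [g' [[cf _ _ _] [cg _ _ _] rf rg [f0 g0 fg]]]]]]] := sphere_charts a.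
have -> : [set: S] = f @` [set x | sqnorm (x - 0) <= 1] `|` g @` [set x | sqnorm (x - 0) <= 1].
  apply/seteqP; split=> // y _; have [ya|/eqP ya] := eqVneq y a.
    by right; exists 0; [rewrite /= subr0 sqnorm0|rewrite g0].
  have [x _ xy] : range f y by rewrite rf.
  have [x1|x1] := leP (sqnorm x) 1; first by left; exists x => //=; rewrite subr0.
  have x0 : x != 0 by rewrite -sqnorm_gt0; lra.
  right; exists ((sqnorm x)^-1 *: x); last by rewrite -fg.
  rewrite /= subr0 sqnormZ expr2 -mulrA mulVf ?sqnorm_eq0 // mulr1.
  by rewrite invf_le1 ?ltW //; lra.
by apply: compactU; apply: continuous_compact; try exact: cball_compact; exact: continuous_subspaceT.
Qed.
End SphereCharts.

Section ChartProd.
Variables (R : realType) (p q : nat) (N1 N2 : topologicalType).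
Variables (g1 : 'rV[R]_p -> N1) (g1' : N1 -> 'rV[R]_p) (g2 : 'rV[R]_q -> N2) (g2' : N2 -> 'rV[R]_q).
Hypotheses (h1 : chart g1 g1') (h2 : chart g2 g2').

Definition prodc (w : 'rV[R]_(p + q)) : N1 * N2 := (g1 (lsubmx w), g2 (rsubmx w)).
Definition prodc' (y : N1 * N2) : 'rV[R]_(p + q) := row_mx (g1' y.1) (g2' y.2).

Lemma cnt_lsub (T : topologicalType) (k : T -> 'rV[R]_(p + q)) : continuous k ->
  continuous (fun t => lsubmx (k t)).
Proof.
move=> ck; apply: cnt_mx => i j.
by rewrite (_ : (fun _ => _) = fun x => k x i (lshift q j)) => [|]; [exact: cnt_coord|apply: funext => x; rewrite mxE].
Qed.
Lemma cnt_rsub (T : topologicalType) (k : T -> 'rV[R]_(p + q)) : continuous k ->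
  continuous (fun t => rsubmx (k t)).
Proof.
move=> ck; apply: cnt_mx => i j.
by rewrite (_ : (fun _ => _) = fun x => k x i (rshift p j)) => [|]; [exact: cnt_coord|apply: funext => x; rewrite mxE].
Qed.
Lemma cnt_row (T : topologicalType) (k : T -> 'rV[R]_p) (l : T -> 'rV[R]_q) : continuous k ->
  continuous l -> continuous (fun t => row_mx (k t) (l t)).
Proof.
move=> ck cl; apply: cnt_mx => i j.
rewrite (_ : (fun _ => _) = fun x => match fintype.split j with inl j1 => k x i j1 | inr j2 => l x i j2 end).
  by case: (fintype.split j) => j'; exact: cnt_coord.
by apply: funext => x; rewrite mxE.
Qed.

Lemma range_prodc : range prodc = range g1 `*` range g2.
Proof.
apply/seteqP; split=> [_ [w _ <-]|[y z] [/= [u _ <-] [v _ <-]]].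
  by split; [exists (lsubmx w)|exists (rsubmx w)].
by exists (row_mx u v) => //; rewrite /prodc row_mxKl row_mxKr.
Qed.

Lemma openX (A : set N1) (B : set N2) : open A -> open B -> open (A `*` B).
Proof.
move=> oA oB; have -> : A `*` B = fst @^-1` A `&` snd @^-1` B by [].
by apply: openI; apply: open_comp => // x _; [exact: cvg_fst|exact: cvg_snd].
Qed.

Lemma chart_prod : chart prodc prodc'.
Proof.
have [c1 k1 p1 o1] := h1; have [c2 k2 p2 o2] := h2; apply: chart_intro.
- by apply: cnt_pair; [apply: (cnt_comp _ c1); apply: cnt_lsub|apply: (cnt_comp _ c2); apply: cnt_rsub];
  exact: cnt_id.
- by move=> w; rewrite /prodc' /= k1 k2 hsubmxK.
- by rewrite range_prodc; apply: openX; [apply: o1|apply: o2]; exact: openT.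
- rewrite range_prodc => W k ck kO; apply: cnt_row.
    by apply: (p1 W (fun w => (k w).1)); [exact: cnt_fst|move=> w; have [] := kO w].
  by apply: (p2 W (fun w => (k w).2)); [exact: cnt_snd|move=> w; have [] := kO w].
Qed.
End ChartProd.

(** * Handles *)

Section Handle.
Variables (R : realType) (N X : topologicalType) (n : N) (b : N -> X) (b' : X -> N).

(* [b] is an open embedding of the punctured space; its value at [n] is junk. *)
Definition handle := [/\ pcont (~` [set n]) b, forall y, y <> n -> b' (b y) = y,
  pcont (b @` (~` [set n])) b' & forall S, open S -> ~ S n -> open (b @` S)].
Hypotheses (hb : handle) (hN : hausdorff_space N) (cN : compact [set: N]) (hX : hausdorff_space X).

Let pb : pcont (~` [set n]) b. Proof. by case: hb. Qed.
Let b'K y : y <> n -> b' (b y) = y. Proof. by case: hb => _ + _ _; apply. Qed.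
Let pb' : pcont (b @` (~` [set n])) b'. Proof. by case: hb. Qed.
Let ob S : open S -> ~ S n -> open (b @` S). Proof. by case: hb => _ _ _; apply. Qed.
Let b_inj y z : y <> n -> z <> n -> b y = b z -> y = z.
Proof. by move=> yn zn /(congr1 b'); rewrite !b'K. Qed.

Lemma open_punct : open (~` [set n]).
Proof. by apply: closed_openC; apply: compact_closed => //; exact: compact_set1. Qed.

(** A closed set of the compact [N] that avoids [n] has compact image, and [X] is Hausdorff. *)
Lemma handle_closed A : closed A -> ~ A n -> closed (b @` A).
Proof.
move=> cA An; apply: compact_closed => //; apply: continuous_compact; last first.
  by apply: (subclosed_compact _ cN).
apply: continuous_in_subspaceT => y /set_mem Ay; apply: pcont_open_at open_punct pb _.
by move=> yn; apply: An; rewrite -yn.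
Qed.

Lemma chart_handle d (c : 'rV[R]_d -> N) c' : chart c c' -> (forall w, c w <> n) ->
  chart (b \o c) (c' \o b').
Proof.
move=> [cc c'K pc' oc] cn; apply: chart_intro.
- by move=> w; apply: (pb (k := c)).
- by move=> v; rewrite /= b'K.
- have -> : range (b \o c) = b @` range c by rewrite image_comp.
  apply: ob; first exact: oc openT.
  by move=> [w _ /cn].
- move=> W k ck kO; apply: (pc' W (fun w => b' (k w))).
    by apply: pb' => // w; have [v _ <-] := kO w; exists (c v) => //; exact: cn.
  by move=> w; have [v _ <-] := kO w; exists v => //=; rewrite b'K.
Qed.

Section Shrink.
Variables (d : nat) (f : 'rV[R]_d -> N) (f' : N -> 'rV[R]_d).
Local Notation V := 'rV[R]_d.
Hypotheses (ch : chart f f') (f0 : f 0 = n).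

Let cf : continuous f. Proof. by case: ch. Qed.
Let f'K w : f' (f w) = w. Proof. by case: ch. Qed.
Let pf' : pcont (range f) f'. Proof. by case: ch. Qed.
Let opf S : open S -> open (f @` S). Proof. by case: ch => _ _ _; apply. Qed.
Let f_inj v w : f v = f w -> v = w.
Proof. by move=> /(congr1 f'); rewrite !f'K. Qed.
Let fn w : w <> 0 -> f w <> n. Proof. by move=> w0; rewrite -f0 => /f_inj. Qed.

(* The complement of [b (N \ f P)]: for [P] a neighbourhood of the origin this
   is the outside of the handle with a collar added. *)
Definition collar (P : set V) : set X := ~` (b @` (~` (f @` P))).

Lemma collar_f (P : set V) w : P 0 -> w <> 0 -> collar P (b (f w)) <-> P w.
Proof.
move=> P0 w0; split=> [H|Pw [y yP /b_inj E]].
  apply: contrapT => Pw; apply: H; exists (f w) => // -[v Pv /f_inj vw].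
  by apply: Pw; rewrite -vw.
have yn : y <> n by move=> yn; apply: yP; rewrite yn -f0; exists 0.
by apply: yP; exists w => //; rewrite E //; exact: fn.
Qed.

Lemma collar_sub (P P' : set V) x : P' 0 -> collar P x -> (forall w, w <> 0 -> x <> b (f w)) -> collar P' x.
Proof.
move=> P0 xP xf [y yP yx]; have [[w _ wy]|ny] := pselect (range f y).
  apply: (xf w); last by rewrite wy.
  by move=> w0; apply: yP; rewrite -wy w0; exists 0.
by apply: xP; exists y => // -[w _ wy]; apply: ny; exists w.
Qed.

Lemma collar_mono (P P' : set V) : P `<=` P' -> collar P `<=` collar P'.
Proof. by move=> PP x xP [y yP yx]; apply: xP; exists y => // -[w Pw wy]; apply: yP; exists w => //; exact: PP. Qed.

Variable r : R.
Hypothesis r0 : 0 < r.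

(** Counterpart of [scal], pulling inwards: outside the ball the square norm becomes
    [r ^ 2 / sqnorm w], at most [r]. The point [n] itself need not exist in [X]; the motion takes
    place in its collar. *)
Definition shr_fac (w : V) (t : R) : R := (1 - t) + t * Num.min 1 (r / sqnorm w).
Definition shr (x : X) (t : R) : X :=
  if pselect (((b \o f) @` [set w | w <> 0]) x)
  then b (f (shr_fac (f' (b' x)) t *: f' (b' x))) else x.

Lemma shr_f w t : w <> 0 -> shr (b (f w)) t = b (f (shr_fac w t *: w)).
Proof.
move=> w0; rewrite /shr; case: pselect => [h|n']; last by case: n'; exists w.
by rewrite b'K ?f'K //; exact: fn.
Qed.

Lemma shr_nf x t : (forall w, w <> 0 -> x <> b (f w)) -> shr x t = x.
Proof.
by move=> H; rewrite /shr; case: pselect => [h|] //=; have [w w0 wx] := h; case: (H w w0).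
Qed.

Lemma shr_fac01 w t : w <> 0 -> 0 <= t <= 1 -> 0 < shr_fac w t <= 1.
Proof.
move=> /eqP; rewrite -sqnorm_gt0 => w0 /andP[t0 t1]; rewrite /shr_fac.
have m0 : 0 < Num.min 1 (r / sqnorm w) by rewrite lt_min ltr01 divr_gt0.
have m1 : Num.min 1 (r / sqnorm w) <= 1 by rewrite ge_min lexx.
move: m0 m1; move: (Num.min _ _) => m m0 m1.
have h1 : t * m <= t by rewrite -[X in _ <= X]mulr1 ler_wpM2l.
have h2 : 0 <= t * m by rewrite mulr_ge0 // ltW.
have [tE|tn] := eqVneq t 1; first by rewrite tE; apply/andP; split; lra.
have t1' : t < 1 by rewrite lt_def eq_sym tn.
by apply/andP; split; lra.
Qed.

Lemma shr_fac_id w t : w <> 0 -> sqnorm w <= r -> shr_fac w t = 1.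
Proof.
move=> /eqP; rewrite -sqnorm_gt0 => w0 wr; rewrite /shr_fac min_l ?mulr1 ?subrK //.
by rewrite ler_pdivlMr // mul1r.
Qed.

Lemma shr_fac1 w : w <> 0 -> sqnorm (shr_fac w 1 *: w) <= r.
Proof.
move=> w0'; have [wr|rw] := leP (sqnorm w) r; first by rewrite shr_fac_id // scale1r.
have w0 : 0 < sqnorm w by exact: lt_trans rw.
rewrite sqnormZ /shr_fac subrr add0r mul1r min_r; last by rewrite ler_pdivrMr // mul1r ltW.
have -> : (r / sqnorm w) ^+ 2 * sqnorm w = r * (r / sqnorm w) by field; rewrite gt_eqF.
by rewrite -[X in _ <= X]mulr1 ler_pM2l // ler_pdivrMr // mul1r ltW.
Qed.

Definition starred (P : set V) := P 0 /\ forall w t, P w -> 0 <= t <= 1 -> P (t *: w).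

Lemma shr_collar (P : set V) x t : starred P -> collar P x -> 0 <= t <= 1 -> collar P (shr x t).
Proof.
move=> [P0 Ps] xP t01.
have [[w w0 wx]|nw] := pselect (((b \o f) @` [set w | w <> 0]) x); last first.
  by rewrite shr_nf // => w w0 xw; apply: nw; exists w.
move: xP; rewrite -wx /= => xP; have Pw := iffLR (collar_f P0 w0) xP; rewrite shr_f //.
have /andP[l0 l1] := shr_fac01 w0 t01.
apply/collar_f => //; last by apply: Ps => //; rewrite ltW.
by move=> /eqP; rewrite scaler_eq0 gt_eqF //= => /eqP.
Qed.

Lemma starred_ball s : 0 < s -> starred [set w : V | sqnorm w <= s].
Proof.
move=> s0; split=> [|w t /= ws /andP[t0 t1]]; first by rewrite /= sqnorm0 ltW.
by rewrite sqnormZ (le_trans _ ws) // ler_piMl ?sqnorm_ge0 // exprn_ile1.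
Qed.

(** A point of the collar that is not in the image of the punctured chart has as neighbourhood the
    collar of the open ball, where nothing moves. *)
Lemma shr_plot : plot2 (collar setT) shr.
Proof.
apply: plot2_local => x xB.
have [[w0 w00 wx]|nx] := pselect (((b \o f) @` [set w | w <> 0]) x).
  exists (b @` (f @` [set w | w <> 0])); split.
  - apply: ob; last by move=> [u u0 /(fn u0)].
    apply: opf; have -> : [set w : V | w <> 0] = sqnorm (n:=d) @^-1` [set x | 0 < x].
      by apply/seteqP; split=> w /=; rewrite sqnorm_gt0 => /eqP.
    by apply: open_comp; [move=> w _; apply: sqnorm_cont; exact: cnt_id|exact: open_gt].
  - by exists (f w0) => //; exists w0.
  move=> W k t ck ct kB t01.
  have kE w : exists2 u, u <> 0 & b (f u) = k w by have [_ [_ [u u0 <-] E]] := kB w; exists u.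
  have -> : (fun w => shr (k w) (t w)) =
     (fun w => b (f (shr_fac (f' (b' (k w))) (t w) *: f' (b' (k w))))).
    apply: funext => w; have [u u0 uE] := kE w; rewrite -uE shr_f // b'K ?f'K //; exact: fn.
  have fb w : f' (b' (k w)) <> 0 by have [u u0 uE] := kE w; rewrite -uE b'K ?f'K //; exact: fn.
  have cb' : continuous (fun w => b' (k w)).
    by apply: pb' => // w; have [u u0 uE] := kE w; exists (f u) => //; exact: fn.
  have cf'b' : continuous (fun w => f' (b' (k w))).
    apply: (pf' (k := fun w => b' (k w))) => // w; have [u u0 uE] := kE w.
    by exists u => //; rewrite -uE b'K //; exact: fn.
  apply: (pb (k := fun w => f (shr_fac (f' (b' (k w))) (t w) *: f' (b' (k w))))).
    apply: (cnt_comp _ cf); apply: cntZ => //; apply: cntD.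
      by apply: cntB => //; exact: cnt_cst.
    apply: cntM => //; apply: cnt_min; first exact: cnt_cst.
    apply: cntM; first exact: cnt_cst.
    apply: cntV; last exact: sqnorm_cont.
    by move=> w; rewrite sqnorm_eq0; apply/eqP.
  move=> w; apply: fn => /eqP; rewrite scaler_eq0 => /orP[|/eqP]; last exact: fb.
  by have /andP[] := shr_fac01 (fb w) (t01 w) => /gt_eqF ->.
exists (~` (b @` (~` (f @` [set w | sqnorm (w - 0) < r])))); split.
- apply: closed_openC; apply: handle_closed.
    by apply: open_closedC; apply: opf; exact: sqball_open.
  by apply; exists 0 => //=; rewrite subrr sqnorm0.
- move=> [y yr yx]; apply: xB; exists y => // -[w _ wy]; apply: nx; exists w; last by rewrite /= wy.
  by move=> w0; apply: yr; exists w => //=; rewrite w0 subrr sqnorm0.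
- move=> W k t ck ct kB t01.
  rewrite (_ : (fun w => shr (k w) (t w)) = k) //; apply: funext => w.
  have [[u u0 uk]|nu] := pselect (((b \o f) @` [set w | w <> 0]) (k w)); last first.
    by rewrite shr_nf // => u u0 E; apply: nu; exists u.
  rewrite -uk /= shr_f // shr_fac_id ?scale1r //.
  have [_ kr] := kB w; rewrite leNgt; apply/negP => ru; apply: kr; exists (f u) => // -[v /= vr /f_inj E].
  by move: vr; rewrite E subr0; lra.
Qed.

Lemma shrink_acyc (Z : topologicalType) (x0 : Z) (g : X -> Z) (P : set V) : starred P ->
  (forall w, sqnorm w <= r -> P w) -> pcont (collar P) g ->
  pacyc R x0 g (collar P) (collar [set w | sqnorm w <= r]).
Proof.
move=> sP rP pg; have sr := starred_ball r0.
have PT : collar P `<=` collar setT by exact: collar_mono.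
apply: (pacyc_deform pg (k := shr)).
- by move=> W k t ck ct kB t01; apply: shr_plot => // w; exact: PT.
- by apply: collar_mono => w; exact: rP.
- move=> x _; have [[w w0 <-]|nx] := pselect (((b \o f) @` [set w | w <> 0]) x).
    by rewrite /= shr_f // /shr_fac subr0 mul0r addr0 scale1r.
  by rewrite shr_nf // => w w0 xw; apply: nx; exists w.
- by move=> x t xP t01; exact: shr_collar.
- by move=> x t xP t01; exact: shr_collar.
- move=> x xP; have [[w w0 <-]|nx] := pselect (((b \o f) @` [set w | w <> 0]) x); last first.
    have nx' w : w <> 0 -> x <> b (f w) by move=> w0 xw; apply: nx; exists w.
    by rewrite shr_nf //; apply: collar_sub xP nx'; case: sr.
  rewrite /= shr_f //; apply/collar_f; [by case: sr| |exact: shr_fac1].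
  have /andP[l0 _] : 0 < shr_fac w 1 <= 1 by apply: shr_fac01 => //; rewrite lexx ler01.
  by move=> /eqP; rewrite scaler_eq0 gt_eqF //= => /eqP.
Qed.
End Shrink.

Section Compare.
Variables (d : nat) (f c : 'rV[R]_d -> N) (f' c' : N -> 'rV[R]_d).
Hypotheses (hf : chart f f') (hc : chart c c') (f0 : f 0 = n) (c0 : c 0 = n).

Lemma ball_shrink (h k : 'rV[R]_d -> N) h' k' r : chart h h' -> chart k k' -> h 0 = n -> k 0 = n ->
  0 < r -> exists2 s : R, 0 < s <= r & h @` [set w | sqnorm w <= s] `<=` k @` [set w | sqnorm w <= r].
Proof.
move=> [ch _ _ _] [_ _ _ ok] h0 k0 r0.
have nk : nbhs (0 : 'rV[R]_d) (h @^-1` (k @` [set w | sqnorm (w - 0) < r])).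
  apply: ch; rewrite h0 -k0; apply: open_nbhs_nbhs; split; first by apply: ok; exact: sqball_open.
  by exists 0 => //=; rewrite subrr sqnorm0.
have [s s0 sP] := ball_nbhs nk; exists (Num.min (s / 2) r).
  by rewrite ge_min lexx orbT lt_min r0 divr_gt0.
move=> _ [w /= ws <-]; have [|v /= vr vw] := sP w.
  by move: ws; rewrite /= subr0 le_min => /andP[ws _]; lra.
by exists v => //; rewrite -[v]subr0 ltW.
Qed.

(** Two unrelated charts about [n]. Balls of [c] and [f] are nested alternately, with radii 1, [r3],
    [r2], [r1]; shrinking within one chart is a deformation, and the 2-out-of-6 property compares
    collars of different charts. *)
Lemma collar_compare : exists r : R, [/\ 0 < r,
  collar f [set w | sqnorm w <= r] `<=` collar c setT &
  forall (Z : topologicalType) (x0 : Z) (g : X -> Z), pcont (collar c setT) g ->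
    pacyc R x0 g (collar c setT) (collar f [set w | sqnorm w <= r])].
Proof.
have cm (h k : 'rV[R]_d -> N) (P P' : set 'rV[R]_d) : h @` P `<=` k @` P' -> collar h P `<=` collar k P'.
  by move=> PP x xP [y yP yx]; apply: xP; exists y => //; exact: contra_not (PP y) yP.
have [r3 /andP[r30 l3] s3] := ball_shrink hf hc f0 c0 ltr01.
have [r2 /andP[r20 l2] s2] := ball_shrink hc hf c0 f0 r30.
have [r1 /andP[r10 l1] s1] := ball_shrink hf hc f0 c0 r20.
have T1 : collar c [set w | sqnorm w <= 1] `<=` collar c setT by exact: collar_mono.
exists r3; split=> //; first exact: subset_trans (cm _ _ _ _ s3) T1.
move=> Z x0 g pg.
have pg1 : pcont (collar c [set w | sqnorm w <= 1]) g by exact: pcont_sub pg.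
have pg3 : pcont (collar f [set w | sqnorm w <= r3]) g by apply: pcont_sub pg1; exact: cm.
apply: (acyc_trans (A := pE R x0 g (collar c [set w | sqnorm w <= 1]))).
- by apply: pE_mono; exact: cm.
- exact: pE_mono.
- exact: (shrink_acyc hc c0 ltr01 (P := setT)).
have fi v w : f v = f w -> v = w by move=> /(congr1 f'); case: hf => _ K _ _; rewrite !K.
have ci v w : c v = c w -> v = w by move=> /(congr1 c'); case: hc => _ K _ _; rewrite !K.
apply: (@acyc_sandwich R _ (pE R x0 g (collar f [set w | sqnorm w <= r1]))
   (pE R x0 g (collar c [set w | sqnorm w <= r2]))).
- by apply: pE_mono; exact: cm.
- by apply: pE_mono; exact: cm.
- by apply: pE_mono; exact: cm.
- apply: (shrink_acyc hf f0 r10) pg3; first exact: starred_ball.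
  by move=> w wr /=; lra.
- apply: (shrink_acyc hc c0 r20) pg1; first by apply: starred_ball; exact: ltr01.
  by move=> w wr /=; lra.
Qed.
End Compare.
End Handle.

(* [g] is centred at [a] and misses [b]; [f] is centred at [b] and misses [a]. *)
Definition two_charts (R : realType) p (S : topologicalType) (a b : S)
    (f g : 'rV[R]_p -> S) (f' g' : S -> 'rV[R]_p) :=
  [/\ chart f f', chart g g', range f = ~` [set a], range g = ~` [set b] &
   [/\ f 0 = b, g 0 = a & forall x, x != 0 -> f x = g ((sqnorm x)^-1 *: x)]].

Lemma two_charts_inv (R : realType) p (S : topologicalType) (a b : S) (f g : 'rV[R]_p -> S) f' g' x :
  two_charts a b f g f' g' -> x != 0 -> g x = f ((sqnorm x)^-1 *: x).
Proof.
move=> [_ _ _ _ [_ _ H]] x0; have s0 : sqnorm x != 0 by rewrite sqnorm_eq0.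
rewrite H; last by rewrite scaler_eq0 negb_or invr_eq0 s0.
rewrite sqnormZ scalerA; have -> : ((sqnorm x)^-1 ^+ 2 * sqnorm x)^-1 / sqnorm x = 1 by field.
by rewrite scale1r.
Qed.

Lemma pcont_comp_chart (R : realType) d (N X : topologicalType) (n : N) (b : N -> X) (c : 'rV[R]_d -> N)
   (B : set 'rV[R]_d) : pcont (~` [set n]) b -> continuous c -> (forall w, B w -> c w <> n) ->
  pcont B (b \o c).
Proof.
move=> pb cc Bn W k ck kB; apply: (pb W (fun w => c (k w))); first exact: (cnt_comp ck cc).
by move=> w; apply: Bn.
Qed.

(** * The cells of a product of two spheres with a puncture *)

Section Coordinates.
Variables (R : realType) (p q : nat).
Definition Jl : {set 'I_(p + q)} := [set lshift q i | i in 'I_p].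
Definition Jr : {set 'I_(p + q)} := [set rshift p i | i in 'I_q].

Lemma card_Jl : #|Jl| = p.
Proof. by rewrite card_imset ?card_ord //; exact: lshift_inj. Qed.
Lemma card_Jr : #|Jr| = q.
Proof. by rewrite card_imset ?card_ord //; exact: rshift_inj. Qed.

Lemma nzset_l (w : 'rV[R]_(p + q)) : nzset Jl w <-> lsubmx w <> 0.
Proof.
split=> [[_ /imsetP[i _ ->] wi] /rowP /(_ i)|]; first by rewrite !mxE; apply/eqP.
move=> /eqP /rV0Pn[i wi]; exists (lshift q i); first by apply/imsetP; exists i.
by move: wi; rewrite mxE.
Qed.
Lemma nzset_r (w : 'rV[R]_(p + q)) : nzset Jr w <-> rsubmx w <> 0.
Proof.
split=> [[_ /imsetP[i _ ->] wi] /rowP /(_ i)|]; first by rewrite !mxE; apply/eqP.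
move=> /eqP /rV0Pn[i wi]; exists (rshift p i); first by apply/imsetP; exists i.
by move: wi; rewrite mxE.
Qed.
Lemma nzset_T d (w : 'rV[R]_d) : nzset [set: 'I_d]%SET w <-> w <> 0.
Proof.
split=> [[i _ wi] w0|]; first by move: wi; rewrite w0 mxE eqxx.
by move=> /eqP /rV0Pn[i wi]; exists i.
Qed.
End Coordinates.

Section ProductHandle.
Variables (R : realType) (p q : nat) (N1 N2 X : topologicalType).
Variables (a1 b1 : N1) (f1 g1 : 'rV[R]_p -> N1) (f1' g1' : N1 -> 'rV[R]_p).
Variables (a2 b2 : N2) (f2 g2 : 'rV[R]_q -> N2) (f2' g2' : N2 -> 'rV[R]_q).
Hypotheses (t1 : two_charts a1 b1 f1 g1 f1' g1') (t2 : two_charts a2 b2 f2 g2 f2' g2').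
Hypotheses (hN : hausdorff_space (N1 * N2)%type) (cN : compact [set: (N1 * N2)%type]).
Variables (b : N1 * N2 -> X) (b' : X -> N1 * N2).
Hypotheses (hb : handle (a1, a2) b b') (hX : hausdorff_space X).

Let n := (a1, a2).
Let pb : pcont (~` [set n]) b. Proof. by case: hb. Qed.
Let b'K y : y <> n -> b' (b y) = y. Proof. by case: hb => _ + _ _; apply. Qed.
Let pb' : pcont (b @` (~` [set n])) b'. Proof. by case: hb. Qed.
Let b_inj y z : y <> n -> z <> n -> b y = b z -> y = z.
Proof. by move=> yn zn /(congr1 b'); rewrite !b'K. Qed.

Let f1a x : f1 x <> a1. Proof. by have [_ _ H _ _] := t1; have : range f1 (f1 x) by []; rewrite H. Qed.
Let g1b x : g1 x <> b1. Proof. by have [_ _ _ H _] := t1; have : range g1 (g1 x) by []; rewrite H. Qed.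
Let f2a x : f2 x <> a2. Proof. by have [_ _ H _ _] := t2; have : range f2 (f2 x) by []; rewrite H. Qed.
Let g2b x : g2 x <> b2. Proof. by have [_ _ _ H _] := t2; have : range g2 (g2 x) by []; rewrite H. Qed.
Let g1E y : y <> b1 -> exists x, g1 x = y.
Proof. by have [_ _ _ H _] := t1 => yb; have [x _ xy] : range g1 y; [by rewrite H|by exists x]. Qed.
Let g2E y : y <> b2 -> exists x, g2 x = y.
Proof. by have [_ _ _ H _] := t2 => yb; have [x _ xy] : range g2 y; [by rewrite H|by exists x]. Qed.
Let f10 : f1 0 = b1. Proof. by case: t1 => _ _ _ _ []. Qed.
Let f20 : f2 0 = b2. Proof. by case: t2 => _ _ _ _ []. Qed.
Let g10 : g1 0 = a1. Proof. by case: t1 => _ _ _ _ []. Qed.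
Let g20 : g2 0 = a2. Proof. by case: t2 => _ _ _ _ []. Qed.
Let cf1 : chart f1 f1'. Proof. by case: t1. Qed.
Let cg1 : chart g1 g1'. Proof. by case: t1. Qed.
Let cf2 : chart f2 f2'. Proof. by case: t2. Qed.
Let cg2 : chart g2 g2'. Proof. by case: t2. Qed.
Let b1a1 : b1 <> a1. Proof. by rewrite -f10; exact: f1a. Qed.
Let b2a2 : b2 <> a2. Proof. by rewrite -f20; exact: f2a. Qed.
Let f1_inj x y : f1 x = f1 y -> x = y.
Proof. by move=> /(congr1 f1'); case: cf1 => _ K _ _; rewrite !K. Qed.
Let f2_inj x y : f2 x = f2 y -> x = y.
Proof. by move=> /(congr1 f2'); case: cf2 => _ K _ _; rewrite !K. Qed.

Definition hchart : 'rV[R]_(p + q) -> (N1 * N2)%type := prodc g1 g2.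
Definition hchart' := prodc' g1' g2'.
Lemma hchartP : chart hchart hchart'. Proof. exact: chart_prod. Qed.
Lemma hchart0 : hchart 0 = n.
Proof. by rewrite /hchart /prodc linear0 linear0 g10 g20. Qed.

Definition htop : X := b (b1, b2).
(** The middle stage of a filtration of [X]. Besides what lies outside the handle, the stages
    contain the handle points with neither coordinate central, then those with [y.2 <> b2], then all
    except [(b1, b2)]; a cell of dimension [p] and one of dimension [q] are added. *)
Definition hA1 : set X := ~` (b @` [set y | y.2 = b2]).

Lemma htop_n : (b1, b2) <> n. Proof. by move=> [/b1a1]. Qed.

Let A0 := collar b hchart setT.
Let A2 := ~` [set htop].

Let c0_inj w w' : hchart w = hchart w' -> w = w'.
Proof. by move=> /(congr1 hchart'); case: hchartP => _ K _ _; rewrite !K. Qed.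
Let c0n w : w <> 0 -> hchart w <> n.
Proof. by move=> w0; rewrite -hchart0 => /c0_inj. Qed.
(** [c1], [c2] and [c3] are centred at [(b1, a2)], [(a1, b2)] and [(b1, b2)]; with [hchart], centred
    at the puncture, they are the four product charts. *)
Let c1 : 'rV[R]_(p + q) -> (N1 * N2)%type := prodc f1 g2.
Let c2 : 'rV[R]_(p + q) -> (N1 * N2)%type := prodc g1 f2.
Let c3 : 'rV[R]_(p + q) -> (N1 * N2)%type := prodc f1 f2.
Let c1n w : c1 w <> n. Proof. by move=> [/f1a]. Qed.
Let c2n w : c2 w <> n. Proof. by move=> [_ /f2a]. Qed.
Let c3n w : c3 w <> n. Proof. by move=> [/f1a]. Qed.

Let A0P y : y <> n -> A0 (b y) <-> y.1 <> b1 /\ y.2 <> b2.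
Proof.
move=> yn; split=> [H|[y1 y2] [z zr zy]].
  apply: contrapT => Hn; apply: H; exists y => // -[w _ wy]; apply: Hn.
  by rewrite -wy; split; [exact: g1b|exact: g2b].
have zn : z <> n by move=> zn; apply: zr; rewrite zn -hchart0; exists 0.
have [u uE] := g1E y1; have [v vE] := g2E y2.
apply: zr; rewrite (b_inj zn yn zy); exists (row_mx u v) => //.
by rewrite /hchart /prodc row_mxKl row_mxKr uE vE -surjective_pairing.
Qed.
Let A1P y : y <> n -> hA1 (b y) <-> y.2 <> b2.
Proof.
move=> yn; split=> [H y2|y2 [z /= z2 zy]]; first by apply: H; exists y.
by apply: y2; rewrite -(b_inj _ yn zy) // => zn; apply: b2a2; rewrite -z2 zn.
Qed.
Let A2P y : y <> n -> A2 (b y) <-> y <> (b1, b2).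
Proof.
move=> yn; split=> [H yE|yE]; first by apply: H; rewrite yE.
by move=> /(b_inj yn htop_n).
Qed.

Let A0c0 w : w <> 0 -> A0 (b (hchart w)).
Proof. by move=> w0; apply/A0P; [exact: c0n|split; [exact: g1b|exact: g2b]]. Qed.

Lemma A01 : A0 `|` range (b \o c1) = hA1.
Proof.
apply/seteqP; split=> [x [xA|[w _ <-]]|x xA].
- by move=> [y /= y2 yx]; apply: xA; exists y => // -[w _ wy]; apply: (@g2b (rsubmx w)); rewrite -y2 -wy.
- by apply/A1P; [exact: c1n|exact: g2b].
have [|nA] := pselect (A0 x); first by left.
right; have [y yr yx] : (b @` (~` (hchart @` setT))) x by exact: contrapT.
have y2 : y.2 <> b2 by move=> y2; apply: xA; exists y.
have [v vE] := g2E y2.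
have [y1|/eqP y1] := eqVneq y.1 b1.
  exists (row_mx 0 v) => //=.
  by rewrite /c1 /prodc row_mxKl row_mxKr f10 vE -y1 -surjective_pairing.
have [u uE] := g1E y1; case: yr; exists (row_mx u v) => //.
by rewrite /hchart /prodc row_mxKl row_mxKr uE vE -surjective_pairing.
Qed.

Lemma A12 : hA1 `|` range (b \o c2) = A2.
Proof.
apply/seteqP; split=> [x [xA|[w _ <-]]|x xA].
- by move=> /= xE; apply: xA; exists (b1, b2).
- by apply/A2P; [exact: c2n|move=> [/g1b]].
have [|nA] := pselect (hA1 x); first by left.
right; have [y y2 yx] : (b @` [set y | y.2 = b2]) x by exact: contrapT.
have y1 : y.1 <> b1 by move=> y1; apply: xA; rewrite /= -yx /htop -y1 -y2 -surjective_pairing.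
have [u uE] := g1E y1; exists (row_mx u 0) => //=.
by rewrite /c2 /prodc row_mxKl row_mxKr uE f20 -y2 -surjective_pairing.
Qed.

Lemma A0_open : open A0.
Proof.
apply: closed_openC; apply: (handle_closed hb hN cN hX); last by apply; exists 0 => //; exact: hchart0.
by apply: open_closedC; case: hchartP => _ _ _; apply; exact: openT.
Qed.

Lemma A1_open : open hA1.
Proof.
apply: closed_openC; apply: (handle_closed hb hN cN hX); last exact: nesym.
apply: (@preimage_closed _ _ snd [set b2]); first by move=> y _; exact: cvg_snd.
have -> : [set b2] = ~` (range g2) by have [_ _ _ -> _] := t2; rewrite setCK.
by apply: open_closedC; case: cg2 => _ _ _; apply; exact: openT.
Qed.

Lemma A2_open : open A2.
Proof. by apply: closed_openC; apply: compact_closed => //; exact: compact_set1. Qed.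

Variables (u : 'rV[R]_p) (v : 'rV[R]_q).
Hypotheses (u0 : u <> 0) (v0 : v <> 0).
(** With [u] and [v] nonzero this point lies in all four product charts, and so serves as base point
    at every stage. *)
Definition hpt : X := b (hchart (row_mx u v)).

Lemma slice_acyc (Z : topologicalType) (x0 : Z) (g : X -> Z) (B : set 'rV[R]_(p + q)) :
  B (row_mx u v) -> (forall w, B w -> w <> 0) ->
  (forall w t, B w -> B ((1 - t) *: w + t *: row_mx u v)) -> pcont ((b \o hchart) @` B) g ->
  pacyc R x0 g ((b \o hchart) @` B) [set hpt].
Proof.
move=> Bw B0 Bs pg; have [ch hK ph _] := hchartP.
have -> : [set hpt] = (b \o hchart) @` [set row_mx u v] by rewrite image_set1.
apply: (pacyc_chart (c' := hchart' \o b') (k := fun w t => (1 - t) *: w + t *: row_mx u v)) => //.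
- by apply: (pcont_comp_chart pb ch) => w /B0; exact: c0n.
- move=> W k ck kB; apply: (ph W (fun w => b' (k w))).
    by apply: pb' => // w; have [x /B0 x0' <-] := kB w; exists (hchart x) => //; exact: c0n.
  by move=> w; have [x /B0 x0' <-] := kB w; rewrite /= b'K //; [exists x|exact: c0n].
- by move=> w /B0 w0; rewrite /= b'K ?hK //; exact: c0n.
- move=> W k t ck ct _ _; apply: cntD; apply: cntZ => //; last exact: cnt_cst.
  by apply: cntB => //; exact: cnt_cst.
- by move=> _ ->.
- by move=> w _; rewrite subr0 scale1r scale0r addr0.
- by move=> w t Bw' _; exact: Bs.
- by move=> _ t -> _; rewrite /= -scalerDl subrK scale1r.
- by move=> w _; rewrite /= subrr scale0r scale1r add0r.
Qed.

Variables (Z : topologicalType) (x0 : Z) (g : X -> Z).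

(** The boundary sphere of the [p]-cell is slid along the second factor to height [v]. There it lies
    in the slice of [hchart] with second coordinate [v], which contracts to the base point and
    avoids the puncture because [v] is nonzero. *)
Lemma step1 m r a : pcont hA1 g -> hp R x0 g m A0 [set hpt] r ->
  ((p <= m)%N -> hp R x0 g (m - p) [set hpt] set0 (a (m - p)%N)) ->
  hp R x0 g m hA1 [set hpt] (r + shift_rank a p m).
Proof.
move=> pg h0 ha; have -> : shift_rank a p m = shift_rank a #|Jl p q| m by rewrite card_Jl.
rewrite -A01.
have [cc cK pc' co] := chart_handle hb (chart_prod cf1 cg2) c1n.
pose B := [set w : 'rV[R]_(p + q) | rsubmx w = v].
have B0 w : B w -> w <> 0 by move=> + w0; rewrite /B /= w0 linear0 => /esym.
have FA : (b \o hchart) @` B `<=` A0 by move=> _ [w /B0 w0 <-]; exact: A0c0.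
apply: (@cell_step R X Z x0 g _ _ _ cc pc' cK co A0 ((b \o hchart) @` B) hpt (Jl p q) B
   (fun w t => row_mx (lsubmx w) ((1 - t) *: rsubmx w + t *: v)) (row_mx ((sqnorm u)^-1 *: u) v)) => //.
- exact: A0_open.
- by rewrite A01.
- move=> w; rewrite nzset_l; apply: (iff_trans (A0P (@c1n w))); split=> [[h _] l0|l0]; last first.
    by split; [rewrite -f10 => /f1_inj|exact: g2b].
  by apply: h; rewrite /= l0.
- move=> W k t ck ct; apply: cnt_row; first exact: cnt_lsub.
  apply: cntD; apply: cntZ => //; [|exact: cnt_rsub|exact: cnt_cst].
  by apply: cntB => //; exact: cnt_cst.
- by move=> w; rewrite subr0 scale1r scale0r addr0 hsubmxK.
- by move=> w; rewrite /B /= row_mxKr subrr scale0r scale1r add0r.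
- by move=> w t /nzset_l w0 _; apply/nzset_l; rewrite row_mxKl.
- move=> _ [w [Bw /nzset_l w0] <-]; exists (row_mx ((sqnorm (lsubmx w))^-1 *: lsubmx w) v).
    by rewrite /B /= row_mxKr.
  rewrite /= /hchart /c1 /prodc row_mxKl row_mxKr -Bw; congr (b (_, _)).
  by have [_ _ _ _ [_ _ ->]] := t1 => //; apply/eqP.
- by exists (row_mx u v) => //; rewrite /B /= row_mxKr.
- apply: slice_acyc => //; first by rewrite /B /= row_mxKr.
    by move=> w t; rewrite /B /= linearD !linearZ /= row_mxKr => ->; rewrite -scalerDl subrK scale1r.
  by apply: pcont_sub pg; apply: subset_trans FA _; rewrite -A01; left.
- rewrite /hpt /= /hchart /c1 /prodc !row_mxKl !row_mxKr; congr (b (_, _)).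
  by apply: (two_charts_inv t1); apply/eqP.
- by rewrite card_Jl.
Qed.

(** The same argument with the factors exchanged: the [q]-cell has its boundary slid along the first
    factor to [u]. *)
Lemma step2 m r a : pcont A2 g -> hp R x0 g m hA1 [set hpt] r ->
  ((q <= m)%N -> hp R x0 g (m - q) [set hpt] set0 (a (m - q)%N)) ->
  hp R x0 g m A2 [set hpt] (r + shift_rank a q m).
Proof.
move=> pg h0 ha; have -> : shift_rank a q m = shift_rank a #|Jr p q| m by rewrite card_Jr.
rewrite -A12.
have [cc cK pc' co] := chart_handle hb (chart_prod cg1 cf2) c2n.
pose B := [set w : 'rV[R]_(p + q) | lsubmx w = u].
have B0 w : B w -> w <> 0 by move=> + w0; rewrite /B /= w0 linear0 => /esym.
have FA : (b \o hchart) @` B `<=` hA1 by move=> _ [w /B0 w0 <-]; rewrite -A01; left; exact: A0c0.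
apply: (@cell_step R X Z x0 g _ _ _ cc pc' cK co hA1 ((b \o hchart) @` B) hpt (Jr p q) B
   (fun w t => row_mx ((1 - t) *: lsubmx w + t *: u) (rsubmx w)) (row_mx u ((sqnorm v)^-1 *: v))) => //.
- exact: A1_open.
- by rewrite A12.
- move=> w; rewrite nzset_r; apply: (iff_trans (A1P (@c2n w))); split=> [h l0|l0]; last first.
    by rewrite -f20 => /f2_inj.
  by apply: h; rewrite /= l0.
- move=> W k t ck ct; apply: cnt_row; last exact: cnt_rsub.
  apply: cntD; apply: cntZ => //; [|exact: cnt_lsub|exact: cnt_cst].
  by apply: cntB => //; exact: cnt_cst.
- by move=> w; rewrite subr0 scale1r scale0r addr0 hsubmxK.
- by move=> w; rewrite /B /= row_mxKl subrr scale0r scale1r add0r.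
- by move=> w t /nzset_r w0 _; apply/nzset_r; rewrite row_mxKr.
- move=> _ [w [Bw /nzset_r w0] <-]; exists (row_mx u ((sqnorm (rsubmx w))^-1 *: rsubmx w)).
    by rewrite /B /= row_mxKl.
  rewrite /= /hchart /c2 /prodc row_mxKl row_mxKr -Bw; congr (b (_, _)).
  by have [_ _ _ _ [_ _ ->]] := t2 => //; apply/eqP.
- by exists (row_mx u v) => //; rewrite /B /= row_mxKl.
- apply: slice_acyc => //; first by rewrite /B /= row_mxKl.
    by move=> w t; rewrite /B /= linearD !linearZ /= row_mxKl => ->; rewrite -scalerDl subrK scale1r.
  by apply: pcont_sub pg; apply: subset_trans FA _; rewrite -A12; left.
- rewrite /hpt /= /hchart /c2 /prodc !row_mxKl !row_mxKr; congr (b (_, _)).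
  by apply: (two_charts_inv t2); apply/eqP.
- by rewrite card_Jr.
Qed.

(** Excision to the chart [c3], where the complement of the puncture is the set of nonzero vectors,
    so that all [p + q] coordinates are peeled off. *)
Lemma top_cell m a : pcont setT g ->
  ((p + q <= m)%N -> hp R x0 g (m - (p + q)) [set hpt] set0 (a (m - (p + q))%N)) ->
  hp R x0 g m setT A2 (shift_rank a (p + q) m).
Proof.
move=> pg ha.
have [cc cK pc' co] := chart_handle hb (chart_prod cf1 cf2) c3n.
pose U := range (b \o c3).
have A2c3 w : A2 (b (c3 w)) <-> nzset [set: 'I_(p + q)]%SET w.
  rewrite nzset_T; apply: (iff_trans (A2P (@c3n w))); split=> [h w0|w0 [e1 e2]].
    by apply: h; rewrite /c3 /prodc w0 !linear0 f10 f20.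
  apply: w0; rewrite -[w]hsubmxK -row_mx0; congr row_mx.
    by apply: f1_inj; rewrite f10.
  by apply: f2_inj; rewrite f20.
have UT : U `|` A2 = setT.
  apply/seteqP; split=> // x _; have [xt|/eqP xt] := eqVneq x htop; last by right.
  by left; exists 0 => //; rewrite /= /c3 /prodc !linear0 f10 f20 xt.
have UA : U `&` A2 = (b \o c3) @` nzset [set: 'I_(p + q)]%SET.
  apply/seteqP; split=> y; first by move=> [[w _ <-] /A2c3 wJ]; exists w.
  by move=> [w wJ <-]; split; [exists w|apply/A2c3].
rewrite -UT; apply/hp_excision.
  exists U, A2; split; [exact: co openT|exact: A2_open| |]; by rewrite UT setTI.
rewrite UA; have cT : #|[set: 'I_(p + q)]%SET| = (p + q)%N by rewrite cardsT card_ord.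
have E : hpt = (b \o c3) (row_mx ((sqnorm u)^-1 *: u) ((sqnorm v)^-1 *: v)).
  rewrite /hpt /= /hchart /c3 /prodc !row_mxKl !row_mxKr; congr (b (_, _)).
    by apply: (two_charts_inv t1); apply/eqP.
  by apply: (two_charts_inv t2); apply/eqP.
have := @hp_local R X Z x0 g _ _ _ cc pc' cK co (pcont_sub (@subsetT _ _) pg) [set: 'I_(p + q)]%SET
  (row_mx ((sqnorm u)^-1 *: u) ((sqnorm v)^-1 *: v)) m a.
by rewrite cT -E; apply.
Qed.
End ProductHandle.

(** * Contractibility of the path space *)

Section PathEval.
Variables (R : realType) (Z X : topologicalType).

Lemma path_eval (W : topologicalType) (k : W -> totalT R Z X) (s : W -> R) : continuous k ->
  continuous s -> (forall w, continuous ((k w).2 : unit_interval R -> X)) ->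
  continuous (fun w => (k w).2 (clampI (s w))).
Proof.
move=> ck cs kc; pose gam (w : W) : unit_interval R -> X := (k w).2.
have cu : continuous (uncurry gam).
  apply: continuous_uncurry; [exact: I_locally_compact|exact: I_hausdorff| |exact: kc].
  exact: (cnt_snd ck).
apply: (cnt_comp (f := fun w => (w, clampI (s w))) _ cu).
by apply: cnt_pair; [exact: cnt_id|exact: (cnt_comp cs (@clampI_continuous R))].
Qed.
End PathEval.

Section Contract.
Variables (R : realType) (X : topologicalType) (x0 : X).
Local Notation E := (totalT R X X).
Local Notation I := (unit_interval R).

Definition const_pt : E := (x0, fun=> x0).

(** Each path is shortened from its end until only the starting point [x0] remains. *)
Definition retract (e : E) (t : R) : E :=
  (e.2 (clampI (1 - t)), fun s => e.2 (clampI (ivl s * (1 - t)))).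

Lemma retract_plot : plot2 (pE R x0 id setT) retract.
Proof.
move=> W k t ck ct kB t01.
have c1 : continuous (fun w => 1 - t w) by apply: cntB => //; exact: cnt_cst.
apply: cnt_pair; first by apply: path_eval => // w; have [] := kB w.
have cc : continuous (fun ws : W * I => (k ws.1).2 (clampI (ivl ws.2 * (1 - t ws.1)))).
  apply: (path_eval (k := fun ws : W * I => k ws.1)
    (s := fun ws : W * I => ivl ws.2 * (1 - t ws.1))).
  - exact: (cnt_comp (cnt_fst (@cnt_id _)) ck).
  - apply: cntM; first exact: (cnt_comp (cnt_snd (@cnt_id _)) (@ivl_continuous R)).
    exact: (cnt_comp (cnt_fst (@cnt_id _)) c1).
  - by move=> w; have [] := kB w.1.
exact: (continuous_curry_fun cc).
Qed.

Lemma path_space_acyc : @acyc R E (pE R x0 id setT) [set const_pt].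
Proof.
apply: (homotopy_acyc (H := retract)).
- exact: retract_plot.
- by move=> _ ->; split=> //; exact: cnt_cst.
- move=> [z p] [_ /= pc p0 p1]; rewrite /retract /= subr0 clampI1 p1; congr (_, _).
  by apply: funext => s; rewrite mulr1 clampI_val.
- move=> e t [_ ec e0 e1] t01; split=> //=.
  + apply: (path_eval (k := fun=> e) (s := fun s => ivl s * (1 - t))) => //; first exact: cnt_cst.
    by apply: cntM; [exact: ivl_continuous|exact: cnt_cst].
  + by rewrite ivl0 mul0r clampI0.
  + by rewrite ivl1 mul1r.
- by move=> _ t ->.
- move=> [z p] [_ /= pc p0 p1]; rewrite /retract subrr /= clampI0 p0; congr (_, _).
  by apply: funext => s; rewrite mulr0 clampI0.
Qed.

Lemma path_space_bound n (c : {freeg (Sx R E) / int}) : supp (sP n.+1 (pE R x0 id setT)) c -> bd c = 0 ->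
  exists2 y, supp (sP n.+2 (pE R x0 id setT)) y & c = bd y.
Proof.
move=> cE c0.
have [w [u [wE uE cwu]]] := path_space_acyc (relZ_cycle _ cE c0).
have u0 : bd u = 0 by move: c0; rewrite cwu raddfD /= bd_bd add0r.
have [v vE uv] := pt_cycle uE u0.
exists (w + v); last by rewrite raddfD /= -uv.
apply: suppD => //; apply: supp_sub_sP vE => _ ->; split=> //; exact: cnt_cst.
Qed.

Lemma pt_aug0 (A : set E) (u : {freeg (Sx R E) / int}) : A const_pt -> supp (sP 0 [set const_pt]) u -> aug A u = 0 -> u = 0.
Proof.
move=> Ae /supp_pt[k ->]; rewrite raddfMz /= augE asboolT; last by split=> // _ [x _ <-].
by rewrite -mulrzr mul1r intz => ->; rewrite mulr0z.
Qed.
End Contract.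

(** * Counting *)

Section Count.
Variables (R : realType) (X : topologicalType) (x0 z : X) (A : set X).
Local Notation E := (totalT R X X).
Let T := pE R x0 id (setT : set X).
Let C := pE R x0 id A.
Let F := pE R x0 id [set z].
Hypothesis Az : A z.
Hypothesis inert : forall n (c : {freeg (Sx R E) / int}), supp (sP n.+1 F) c -> bd c = 0 ->
  exists2 y, supp (sP n.+2 C) y & c = bd y.

Let FC : F `<=` C. Proof. by apply: pE_mono => _ ->. Qed.
Let CT : C `<=` T. Proof. exact: pE_mono. Qed.

Let sub0 n (c : {freeg (Sx R E) / int}) : supp (sP n (pE R x0 id (set0 : set X))) c -> c = 0.
Proof.
apply: (@supp_sub _ _ [set 0]); first by split=> // x y -> ->; rewrite subrr.
by move=> s sA; have [] := @hat_range R E s _ sA.2 0.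
Qed.

Let relZ0 n D (c : {freeg (Sx R E) / int}) : @relZ R E n (pE R x0 id D) (pE R x0 id (set0 : set X)) c ->
  supp (sP n (pE R x0 id D)) c /\ bd c = 0.
Proof.
case: n => [|n] [c1 c2]; split=> //; first by rewrite (bd_sP0 c1).
by apply: (sub0 (n := n)); apply: (@supp_bdS _ _ n (pE R x0 id D)).
Qed.

Let relB0 n D (c : {freeg (Sx R E) / int}) : @relB R E n (pE R x0 id D) (pE R x0 id (set0 : set X)) c ->
  exists2 w, supp (sP n.+1 (pE R x0 id D)) w & c = bd w.
Proof. by move=> [w [u [wD /sub0 -> ->]]]; exists w; rewrite ?addr0. Qed.

(** The total space [T] is contractible, so the connecting map is an isomorphism in positive
    degrees. *)
Lemma hp_connecting n r : hp R x0 id n.+2 setT A r <-> hp R x0 id n.+1 A set0 r.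
Proof.
apply: (@srank_iso _ _ (@bd R E)).
- exact: relB_subgroup.
- by move=> c cZ; apply: relZ_cycle; [exact: supp_bdS cZ|exact: bd_bd].
- exact: relZ_subgroup.
- move=> c cZ; split.
    move=> [w [u [wT uA ->]]]; rewrite raddfD /= bd_bd add0r; exact: relB_bd.
  move=> /relB0[w wA cw].
  have [||y yT yE] := @path_space_bound R X x0 n.+1 (c - w).
  + by apply: suppB; [case: cZ|exact: supp_sub_sP wA].
  + by rewrite raddfB /= cw subrr.
  by exists y, w; split=> //; rewrite -yE subrK.
- move=> c /relZ0[cA c0]; have [y yT yE] := path_space_bound (supp_sub_sP CT cA) c0.
  exists y; last by rewrite yE subrr; case: (@relB_subgroup R E n.+1 C (pE R x0 id set0)).
  by split=> //; rewrite -yE; exact: supp_inD cA.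
Qed.

(** Inertness makes the map from the homology of [F] to that of [C] zero in positive degrees, so the
    exact sequence of the pair is short and ranks subtract. [K] is the kernel of the connecting map,
    identified with the homology of [C]. *)
Lemma hp_inert n r s : hp R x0 id n.+2 A [set z] r -> hp R x0 id n.+2 A set0 s ->
  hp R x0 id n.+1 [set z] set0 (r - s) /\ (s <= r)%N.
Proof.
move=> hCF hC; set O := pE R x0 id (set0 : set X).
pose K := @relZ R E n.+2 C F `&` [set c | @relB R E n.+1 F O (bd c)].
have sZ : subgroup (@relZ R E n.+2 C F) by exact: relZ_subgroup.
have sK : subgroup K.
  split; first by split; [exact: sZ.1|rewrite /= raddf0; exact: (@relB_subgroup R E n.+1 F O).1].
  move=> x y [x1 x2] [y1 y2]; split; first exact: sZ.2.
  by rewrite /= raddfB; apply: (@relB_subgroup R E n.+1 F O).2.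
have KZ : K `<=` @relZ R E n.+2 C F by move=> c [].
have BK : @relZ R E n.+2 C F `&` @relB R E n.+2 C F `<=` K.
  move=> c [cZ [w [u [wC uF cE]]]]; split=> //=.
  by rewrite cE raddfD /= bd_bd add0r; exact: relB_bd.
have hK : has_srank K (@relB R E n.+2 C F) s.
  apply/(srank_incl (Z := @relZ R E n.+2 C O) (B := @relB R E n.+2 C O)) => //.
  - exact: relB_subgroup.
  - move=> c /relZ0[cC c0]; split; first exact: relZ_cycle.
    by rewrite /= c0; exact: (@relB_subgroup R E n.+1 F O).1.
  - exact: relZ_subgroup.
  - move=> c /relZ0[cC c0]; split; first by move=> /relB0[w wC ->]; exact: relB_bd.
    move=> [w [u [wC uF cE]]].
    have [|y yC uy] := inert uF; first by move: c0; rewrite cE raddfD /= bd_bd add0r.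
    have -> : c = bd (w + y) by rewrite raddfD /= -uy.
    by apply: relB_bd; exact: suppD.
  - move=> c [[cC cF] /relB0[w wF cw]]; exists (c - w).
      apply: relZ_cycle; first by apply: suppB => //; exact: supp_sub_sP wF.
      by rewrite raddfB /= cw subrr.
    by rewrite opprB addrC subrK; exact: relB_sub.
have [h1 h2] := srank_quot sZ sK (@relB_subgroup R E n.+2 C F) KZ BK hCF hK; split=> //.
apply: (iffLR (srank_iso (f := @bd R E) (Z := @relZ R E n.+2 C F) (B := K) _ _ _ _ _ _) h1) => //.
- exact: relB_subgroup.
- by move=> c cZ; apply: relZ_cycle; [exact: supp_bdS cZ|exact: bd_bd].
- by move=> c cZ; split=> [[]|cB] //; split.
- move=> c /relZ0[cF c0]; have [y yC cy] := inert cF c0.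
  exists y; last by rewrite cy subrr; case: (@relB_subgroup R E n.+1 F O).
  by split=> //; rewrite -cy; exact: supp_inD cF.
Qed.

(** A 0-cycle of [F] of augmentation 0 bounds in the contractible [T]. The two hypotheses of rank 0
    move the bounding chain into [C] and then into [F], at the price of the nonzero multiples [k]
    and [l]. *)
Lemma hp0_one : F (const_pt R x0) -> hp R x0 id 1 A [set z] 0 -> hp R x0 id 1 setT A 0 ->
  hp R x0 id 0 [set z] set0 1.
Proof.
move=> Fe hCF hTC; set O := pE R x0 id (set0 : set X).
have sZ : subgroup (@relZ R E 0 F O) by exact: relZ_subgroup.
pose U : set E := [set e | True].
pose K := @relZ R E 0 F O `&` [set c | aug U c = 0].
have sK : subgroup K.
  split; first by split; [exact: sZ.1|rewrite /= raddf0].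
  move=> x y [x1 /= x2] [y1 /= y2]; split; [exact: sZ.2|by rewrite /= raddfB /= x2 y2 subrr].
have augB (w : {freeg (Sx R E) / int}) : supp (sP 1 T) w -> aug U (bd w) = 0.
  move=> wT; apply: (@aug_bd R X setT (fun _ _ => True) _ _ _ _ X x0 id z w wT) => // y _.
  exact: filterS filterT.
have hK : has_srank K (@relB R E 0 F O) 0.
  apply: srank0_intro => c [/relZ0[cF c0] c1].
  have [y [u [yT uE cE]]] : @relB R E 0 T [set const_pt R x0] c.
    apply: path_space_acyc; apply: relZ_cycle => //; apply: supp_sub_sP cF; exact: subset_trans CT.
  have u0 : u = 0.
    apply: (pt_aug0 (A := U)) uE _ => //.
    by move: c1 => /=; rewrite cE raddfD /= augB // add0r.
  have [k k0 [w [v [wT vC kE]]]] : exists2 k : int, k != 0 & @relB R E 1 T C (y *~ k).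
    apply: (has_srank0 _ hTC); first exact: relB_subgroup.
    split=> //; have -> : bd y = c by rewrite cE u0 addr0.
    by apply: supp_inD; apply: supp_sub_sP cF.
  have vE : bd v = c *~ k.
    by rewrite cE u0 addr0 -raddfMz /= kE raddfD /= bd_bd add0r.
  have [l l0 [w' [v' [wC vF lE]]]] : exists2 l : int, l != 0 & @relB R E 1 C F (v *~ l).
    apply: (has_srank0 _ hCF); first exact: relB_subgroup.
    split=> //; rewrite vE; apply: (@supp_inD _ _ 0).
    by apply: (@subgroup_mulrz _ (supp (sP 0 F))) => //; exact: supp_subgroup.
  exists (k * l); first by rewrite mulf_neq0.
  have -> : c *~ (k * l) = bd v'.
    by rewrite mulrzA -vE -raddfMz /= lE raddfD /= bd_bd add0r.
  exact: relB_bd.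
have h1 : has_srank (@relZ R E 0 F O) K 1.
  apply/(srank_iso (f := @aug R E U) (Z' := setT) (B' := [set 0])) => //.
  - by split=> // x y -> ->; rewrite subrr.
  - by move=> c cZ; split=> [[]|] //; split.
  - move=> k _; exists (<< ptsimp R (const_pt R x0) 0 >> *~ k).
      apply: relZ_cycle; last by rewrite raddfMz /= bdU0 mul0rz.
      by apply: sP_mulz; split=> // _ [x _ <-].
    rewrite raddfMz /= augE asboolT; first by rewrite -mulrzr mul1r intz subrr.
    by split=> // _ [x _ <-].
  split; first by exists (fun=> 1); split=> // c; rewrite big_ord1 /= -mulrzr mul1r intz => c0 i; rewrite [i]ord1.
  move=> v [_ H].
  have zz (x y : int) : x *~ y = x * y by rewrite -mulrzr intz.
  (* Two integers satisfy the relation with coefficients [- v0] and [v1] exchanged; independence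
     would force [v0 = 0], and then the coefficients 1 and 0 give a second relation. *)
  have vv : \sum_i v i *~ (if i == ord0 then v ord_max else - v ord0) = 0.
    rewrite !big_ord_recl big_ord0 /= !zz addr0 (_ : lift _ _ = ord_max); [ring|exact: val_inj].
  have E1 := H _ vv ord_max; move: E1 => /= /eqP; rewrite oppr_eq0 => /eqP v0.
  have v1 : \sum_i v i *~ (if i == ord0 then 1 else 0) = 0.
    by rewrite !big_ord_recl big_ord0 /= !zz mulr0 !addr0 v0 mul0r.
  by have /eqP := H _ v1 ord0; rewrite /= oner_eq0.
have KB : @relZ R E 0 F O `&` @relB R E 0 F O `<=` K.
  by move=> c [cZ /relB0[w wF cE]]; split=> //=; rewrite cE augB //; apply: supp_sub_sP wF; exact: subset_trans CT.
have KZ : K `<=` @relZ R E 0 F O by move=> c [].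
exact: (srank_add sZ sK (@relB_subgroup R E 0 F O) KZ KB hK h1).
Qed.
End Count.

Section Recursion.
Variables (R : realType) (X : topologicalType) (z : X) (A : set X) (ms : seq nat) (d : nat).
Local Notation E := (totalT R X X).
Hypothesis Az : A z.
Hypothesis inert : forall n (c : {freeg (Sx R E) / int}),
  supp (sP n.+1 (pE R z id [set z])) c -> bd c = 0 ->
  exists2 y, supp (sP n.+2 (pE R z id A)) y & c = bd y.
Hypothesis hA : forall n a, (forall i, (i.+1 < n)%N -> hp R z id i [set z] set0 (a i)) ->
  hp R z id n A [set z] (ssum a ms n).
Hypothesis hT : forall n a, ((d <= n)%N -> hp R z id (n - d) [set z] set0 (a (n - d)%N)) ->
  hp R z id n setT A (shift_rank a d n).
Hypotheses (ms2 : all (leq 2) ms) (d3 : (3 <= d)%N).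

(** The rank in degree [n + 1] is the difference of two terms that involve degrees at most [n] only:
    the cells of [A] have dimension at least 2, and [n + 3 - d <= n]. Existence of the ranks and the
    recursion are thus proved together. *)
Lemma hp_loop_rec : exists a : nat -> nat, [/\ forall n, hp R z id n [set z] set0 (a n), a 0%N = 1%N &
  forall n, (a n.+1 + shift_rank a d n.+3)%N = ssum a ms n.+2].
Proof.
pose a n := xget 0%N [set r | hp R z id n [set z] set0 r].
have aP n r : hp R z id n [set z] set0 r -> hp R z id n [set z] set0 (a n).
  by move=> h; apply: (@xgetPex _ 0%N [set r | hp R z id n [set z] set0 r]); exists r.
have aE n r : hp R z id n [set z] set0 r -> a n = r.
  by move=> h; apply: has_srank_uniq (aP _ _ h) h.
have h0 : hp R z id 0 [set z] set0 1.
  apply: (@hp0_one R X z z A) => //; first by split=> //; exact: cnt_cst.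
    have := @hA 1 a; have -> : ssum a ms 1 = 0%N; last by apply.
    rewrite /ssum big_seq big1 // => m /(allP ms2) m2; rewrite /shift_rank leqNgt m2 //.
  have := @hT 1 a; rewrite /shift_rank (_ : (d <= 1)%N = false); last by lia.
  by apply.
have step n : (forall i, (i <= n)%N -> hp R z id i [set z] set0 (a i)) ->
    hp R z id n.+1 [set z] set0 (ssum a ms n.+2 - shift_rank a d n.+3) /\
    (shift_rank a d n.+3 <= ssum a ms n.+2)%N.
  move=> IH; apply: (hp_inert Az inert); first by apply: hA => i; rewrite ltnS; exact: IH.
  by apply/hp_connecting; apply: hT => dn; apply: IH; lia.
have all n : forall i, (i <= n)%N -> hp R z id i [set z] set0 (a i).
  elim: n => [|n IH] i; first by rewrite leqn0 => /eqP ->; exact: aP h0.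
  rewrite leq_eqVlt => /orP[/eqP ->|]; last by rewrite ltnS; exact: IH.
  by have [h _] := step n IH; exact: aP h.
exists a; split; [by move=> n; exact: (all n n)|exact: aE|move=> n].
by have [/aE -> sr] := step n (all n); rewrite subnK.
Qed.
End Recursion.

(** * Inertness of the top cell *)

Section Inert.
Variables (R : realType) (N1 N2 X : topologicalType) (a1 b1 : N1) (a2 b2 : N2).
Hypotheses (hN : hausdorff_space (N1 * N2)%type) (cN : compact [set: (N1 * N2)%type]).
Variables (b : N1 * N2 -> X) (b' : X -> N1 * N2).
Hypotheses (hb : handle (a1, a2) b b') (hX : hausdorff_space X).
Variables (rho : N1 * N2 -> N2) (W : set (N1 * N2)) (D : set N1).
Hypotheses (crho : continuous rho) (oW : open W) (Wn : W (a1, a2)) (rW : forall y, W y -> rho y = a2).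
Hypotheses (oD : open D) (Db : D b1) (Da : ~ D a1) (rD : forall y, D y.1 -> rho y = y.2).
Hypotheses (rb : forall y, rho y = b2 -> y.2 = b2) (ba : b2 <> a2) (cl1 : closed [set b1]).
Local Notation E := (totalT R X X).

Let n := (a1, a2).
Let pb : pcont (~` [set n]) b. Proof. by case: hb. Qed.
Let b'K y : y <> n -> b' (b y) = y. Proof. by case: hb => _ + _ _; apply. Qed.
Let pb' : pcont (b @` (~` [set n])) b'. Proof. by case: hb. Qed.
Let ob S : open S -> ~ S n -> open (b @` S). Proof. by case: hb => _ _ _; apply. Qed.
Let b_inj y z : y <> n -> z <> n -> b y = b z -> y = z.
Proof. by move=> yn zn /(congr1 b'); rewrite !b'K. Qed.

(** The map [rho] on the handle, extended by [a2]. The extension is continuous because [rho] is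
    already constant on the neighbourhood [W] of the puncture of the handle. *)
Definition rmap (x : X) : N2 := if pselect ((b @` (~` [set n])) x) then rho (b' x) else a2.

Lemma rmap_b y : y <> n -> rmap (b y) = rho y.
Proof.
by move=> yn; rewrite /rmap; case: pselect => [h|h]; [rewrite b'K|case: h; exists y].
Qed.

Lemma rmap_cont : continuous rmap.
Proof.
apply: cont_local => x; have [xb|xb] := pselect ((b @` (~` [set n])) x).
  exists (b @` (~` [set n])); split=> //; first by apply: ob; [exact: open_punct|apply].
  have -> : (fun x : (b @` (~` [set n])) => rmap (\val x)) = (fun x => rho (b' (\val x))).
    apply: funext => y; have [u un uE] := set_mem (valP y).
    by rewrite -uE rmap_b // b'K.
  apply: (cnt_comp _ crho); apply: pb' => [|y]; first exact: initial_continuous.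
  exact: (set_mem (valP y)).
exists (~` (b @` (~` W))); split.
- by apply: closed_openC; apply: (handle_closed hb hN cN hX); [exact: open_closedC|apply].
- by move=> [y yW yx]; apply: xb; exists y => // yn; apply: yW; rewrite yn.
rewrite (_ : (fun x : (~` (b @` (~` W))) => rmap (\val x)) = (fun=> a2)); first exact: cnt_cst.
apply: funext => y; have [h|h] := pselect ((b @` (~` [set n])) (\val y)); last first.
  by rewrite /rmap; case: pselect.
have [u un uE] := h; rewrite -uE rmap_b //; apply: rW; apply: contrapT => uW.
by apply: (set_mem (valP y)); exists u.
Qed.

Let L := b @` [set y | y.1 = b1].
Let U := b @` [set y | D y.1].
Let Dn y : D y.1 -> y <> n. Proof. by move=> Dy yn; apply: Da; rewrite yn in Dy. Qed.
Let A := ~` [set b (b1, b2)].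

Let b1a1 : b1 <> a1. Proof. by move=> E1; apply: Da; rewrite -E1. Qed.
Let oU : open U.
Proof. by apply: ob => //; apply: open_comp => // y _; exact: cvg_fst. Qed.
Let oL : open (~` L).
Proof.
apply: closed_openC; apply: (handle_closed hb hN cN hX); last exact: nesym.
by apply: (@preimage_closed _ _ fst [set b1]) => // y _; exact: cvg_fst.
Qed.
Let LU : L `<=` U. Proof. by move=> _ [y /= y1 <-]; exists y => //=; rewrite y1. Qed.
Let UL : U `|` ~` L = setT.
Proof. by apply/seteqP; split=> // x _; have [/LU|] := pselect (L x); [left|right]. Qed.
Let LA : ~` L `<=` A.
Proof. by move=> x xL xE; apply: xL; exists (b1, b2). Qed.

Variable x0 : X.
Hypothesis x0b : forall y, y.2 = b2 -> x0 <> b y.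

Lemma rmap_x0 : rmap x0 <> b2.
Proof.
have [[y yn yx]|nb] := pselect ((b @` (~` [set n])) x0); last first.
  by rewrite /rmap; case: pselect => [h|h] /=; [case: nb|exact: nesym].
by rewrite -yx rmap_b // => /rb /x0b; apply; rewrite yx.
Qed.

(* Slide the end point of a path along the slices [{x} x N2] of the tube, following
   the image under [rmap] of the path run backwards. *)
Let K (e : E) (t : R) : X := b ((b' e.1).1, rmap (e.2 (clampI (1 - t)))).

Let pK : plot2 (pE R x0 id U) K.
Proof.
move=> V k t ck ct kB t01.
have c2 : continuous (fun w => rmap ((k w).2 (clampI (1 - t w)))).
  apply: (cnt_comp _ rmap_cont); apply: path_eval => //; last by move=> w; have [] := kB w.
  by apply: cntB => //; exact: cnt_cst.
have kE w : exists2 y, D y.1 & b y = (k w).1 by have [[y Dy yE] _ _ _] := kB w; exists y.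
have c1 : continuous (fun w => (b' (k w).1).1).
  apply: cnt_fst; apply: pb' => [|w]; first exact: cnt_fst.
  by have [y Dy yE] := kE w; exists y => //; exact: Dn.
apply: (pb (k := fun w => ((b' (k w).1).1, rmap ((k w).2 (clampI (1 - t w)))))).
  exact: cnt_pair.
by move=> w; apply: Dn => /=; have [y Dy yE] := kE w; rewrite -yE b'K //; exact: Dn.
Qed.

(** The chain is excised into the tube [U] about [L]. The motion [K] starts at the end point, since
    [rmap] is the second coordinate on the tube; it preserves the first coordinate, so points off
    [L] remain off [L]; it ends at second coordinate [rmap x0], which differs from [b2]. All error
    terms have boundaries that bound in [A]. *)
Lemma inert_step m (y : {freeg (Sx R E) / int}) :
  @relZ R E m.+1 (pE R x0 id setT) (pE R x0 id (~` L)) y ->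
  @relB R E m (pE R x0 id A) (pE R x0 id set0) (bd y).
Proof.
move=> yZ.
have [y1 y1Z y1B] : exists2 y1, @relZ R E m.+1 (pE R x0 id U) (pE R x0 id (U `&` ~` L)) y1 &
    @relB R E m.+1 (pE R x0 id setT) (pE R x0 id (~` L)) (y - y1).
  have := @excise_surj R E (pE R x0 id setT) (fst @^-1` U) (fst @^-1` (~` L)) _ _ m.+1 y.
  rewrite -!pE_sep !setTI pE_I pE_U UL; apply=> //.
    by apply: open_comp => // x _; exact: cvg_fst.
  by apply: open_comp => // x _; exact: cvg_fst.
pose B1 := b @` [set y | D y.1 /\ y.2 = rmap x0].
have B1A : B1 `<=` A.
  move=> _ [w [wD w2] <-] /= /(b_inj (Dn wD)) => wE.
  by apply: rmap_x0; rewrite -w2 wE //; apply: Dn.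
have [y2 y2Z y2B] : exists2 y2, @relZ R E m.+1 (pE R x0 id B1) (pE R x0 id B1) y2 &
    @relB R E m.+1 (pE R x0 id U) (pE R x0 id (U `&` ~` L)) (y1 - y2).
  apply: (@path_rep R X X x0 id (U `&` ~` L) U (U `&` ~` L) U B1 B1 setT K pK _ _ _ _ _ _ _ _ m.+1 y1 y1Z) => //.
  - move=> e [[w Dw we] _ _ e1]; rewrite /K subr0 clampI1 e1 -we b'K; last exact: Dn.
    by rewrite rmap_b ?rD //; [rewrite -surjective_pairing|exact: Dn].
  - move=> e t [[w Dw we] _ _ _] t01; rewrite /K -we b'K; last exact: Dn.
    by exists (w.1, rmap (e.2 (clampI (1 - t)))).
  - move=> e t [[[w Dw we] nL] _ _ _] t01; rewrite /K -we b'K; last exact: Dn.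
    split; first by exists (w.1, rmap (e.2 (clampI (1 - t)))).
    move=> [v /= v1 vE]; apply: nL; rewrite -we; exists w => //=.
    have := b_inj _ _ vE => /(_ _ _) H; rewrite -v1 H //; apply: Dn => //=; by rewrite v1.
  - move=> e [[w Dw we] _ e0 _]; rewrite /K subrr clampI0 e0 -we b'K; last exact: Dn.
    by exists (w.1, rmap x0).
  - move=> e [[[w Dw we] _] _ e0 _]; rewrite /K subrr clampI0 e0 -we b'K; last exact: Dn.
    by exists (w.1, rmap x0).
have bdB (x : {freeg (Sx R E) / int}) (C C' : set X) : C' `<=` A ->
    @relB R E m.+1 (pE R x0 id C) (pE R x0 id C') x -> @relB R E m (pE R x0 id A) (pE R x0 id set0) (bd x).
  move=> CA [w [u [_ uC ->]]]; rewrite raddfD /= bd_bd add0r; apply: relB_bd.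
  by apply: supp_sub_sP uC; exact: pE_mono.
have -> : bd y = bd (y - y1) + (bd (y1 - y2) + bd y2) by rewrite -!raddfD /= !subrK.
apply: subgroupD; [exact: relB_subgroup|exact: bdB y1B|].
apply: subgroupD; [exact: relB_subgroup| |].
  by apply: bdB y2B => x [_ /LA].
by apply: relB_bd; apply: supp_sub_sP y2Z.1; exact: pE_mono.
Qed.

Lemma handle_inert z : (forall y, y.1 = b1 -> z <> b y) ->
  forall m (c : {freeg (Sx R E) / int}), supp (sP m.+1 (pE R x0 id [set z])) c -> bd c = 0 ->
  exists2 y, supp (sP m.+2 (pE R x0 id A)) y & c = bd y.
Proof.
move=> zL m c cz c0.
have zT : pE R x0 id [set z] `<=` pE R x0 id setT by exact: pE_mono.
have [y yT cy] := path_space_bound (supp_sub_sP zT cz) c0.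
have [|w [u [wA uO E1]]] := @inert_step m.+1 y.
  split=> //; rewrite -cy; apply: supp_inD; apply: supp_sub_sP cz; apply: pE_mono => _ ->.
  by move=> [w w1 wz]; apply: (zL w).
exists w => //; rewrite cy E1.
suff -> : u = 0 by rewrite addr0.
apply: (@supp_sub _ _ [set 0]) uO; first by split=> // ? ? -> ->; rewrite subrr.
by move=> s sA; have [] := @hat_range R E s _ sA.2 0.
Qed.
End Inert.

Lemma clamp_le0 (R : realType) (t : R) : t <= 0 -> clamp t = 0.
Proof. by rewrite /clamp => t0; rewrite min_l ?max_l //; lra. Qed.
Lemma clamp_ge1 (R : realType) (t : R) : 1 <= t -> clamp t = 1.
Proof. by rewrite /clamp => t0; rewrite min_r ?max_r. Qed.

Section Squeeze.
Variables (R : realType) (q : nat) (N2 : topologicalType) (a2 b2 : N2).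
Variables (f2 g2 : 'rV[R]_q -> N2) (f2' g2' : N2 -> 'rV[R]_q).
Hypotheses (t2 : two_charts a2 b2 f2 g2 f2' g2') (hN2 : hausdorff_space N2).

Let cg2 : continuous g2. Proof. by case: t2 => _ []. Qed.
Let g2K w : g2' (g2 w) = w. Proof. by case: t2 => _ []. Qed.
Let pg2 : pcont (range g2) g2'. Proof. by case: t2 => _ []. Qed.
Let og2 S : open S -> open (g2 @` S). Proof. by case: t2 => _ [_ _ _ H] _ _ _; exact: H. Qed.

(** At time 1 the factor is 0 up to square norm 1/2 and is 1 from square norm 1 on. *)
Definition sqz_fac (w : 'rV[R]_q) (t : R) : R := 1 - t * clamp (2 - 2 * sqnorm w).
(* At time 1 a neighbourhood of [a2] is collapsed; points far from [a2] do not move. *)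
Definition sqz (y : N2) (t : R) : N2 :=
  if pselect (range g2 y) then g2 (sqz_fac (g2' y) t *: g2' y) else y.

Lemma sqz_g w t : sqz (g2 w) t = g2 (sqz_fac w t *: w).
Proof. by rewrite /sqz; case: pselect => [h|h]; [rewrite g2K|case: h; exists w]. Qed.

Lemma sqz_n y t : ~ range g2 y -> sqz y t = y.
Proof. by rewrite /sqz; case: pselect. Qed.

Lemma sqz0 y : sqz y 0 = y.
Proof.
have [[w _ <-]|h] := pselect (range g2 y); last exact: sqz_n.
by rewrite sqz_g /sqz_fac mul0r subr0 scale1r.
Qed.

Lemma sqz1 w : sqnorm w < 1 / 2 -> sqz (g2 w) 1 = a2.
Proof.
move=> w1; rewrite sqz_g /sqz_fac clamp_ge1; last lra.
by rewrite mulr1 subrr scale0r; case: t2 => _ _ _ _ [].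
Qed.

Lemma sqz_b y t : sqz y t = b2 -> y = b2.
Proof.
have [[w _ <-]|h] := pselect (range g2 y); last by rewrite sqz_n.
rewrite sqz_g => E; have [_ _ _ H _] := t2.
have : range g2 b2 by rewrite -E; exists (sqz_fac w t *: w).
by rewrite H => /(_ erefl).
Qed.

Lemma sqz_plot : plot2 setT sqz.
Proof.
apply: plot2_local => y _; have [yr|yr] := pselect (range g2 y).
  exists (range g2); split; [exact: og2 openT|by []|].
  move=> W k t ck ct kB t01.
  have kr w : range g2 (k w) by have [] := kB w.
  have -> : (fun w => sqz (k w) (t w)) = (fun w => g2 (sqz_fac (g2' (k w)) (t w) *: g2' (k w))).
    by apply: funext => w; have [u _ uE] := kr w; rewrite -uE sqz_g g2K.
  have cg' : continuous (fun w => g2' (k w)) by exact: pg2.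
  apply: (cnt_comp _ cg2); apply: cntZ => //; apply: cntB; first exact: cnt_cst.
  apply: cntM => //; apply: (cnt_comp _ (@clamp_continuous R)).
  apply: cntB; first exact: cnt_cst.
  by apply: cntM; [exact: cnt_cst|exact: sqnorm_cont].
exists (~` (g2 @` [set w | sqnorm (w - 0) <= 1])); split.
- apply: closed_openC; apply: compact_closed => //.
  by apply: continuous_compact; [exact: continuous_subspaceT|exact: cball_compact].
- by move=> [w _ wy]; apply: yr; exists w.
- move=> W k t ck ct kB t01.
  rewrite (_ : (fun w => sqz (k w) (t w)) = k) //; apply: funext => w.
  have [[u _ uE]|h] := pselect (range g2 (k w)); last exact: sqz_n.
  have [_ nu] := kB w; rewrite -uE sqz_g /sqz_fac clamp_le0; first by rewrite mulr0 subr0 scale1r.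
  suff : ~ (sqnorm u <= 1) by move/negP; rewrite -ltNge; lra.
  by move=> u1; apply: nu; exists u => //=; rewrite subr0.
Qed.

Variables (N1 : topologicalType) (k : nat) (h : N1 -> 'rV[R]_k) (a1 b1 : N1).
Hypotheses (ch : continuous h) (hi : injective h) (ab : a1 <> b1).

Let del : R := sqnorm (h a1 - h b1).
Let del0 : 0 < del.
Proof. by rewrite sqnorm_gt0 subr_eq0; apply/eqP => /hi. Qed.
(** A cut-off on [N1]: it is 0 when the squared distance to [b1] is at most one third of that of
    [a1], and 1 from two thirds on. The map [h] only serves to measure distances. *)
Definition cut (x : N1) : R := clamp (3 * sqnorm (h x - h b1) / del - 1).
Let cdist : continuous (fun x => 3 * sqnorm (h x - h b1) / del).
Proof.
apply: cntM; last exact: cnt_cst.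
by apply: cntM; [exact: cnt_cst|apply: sqnorm_cont; apply: cntB => //; exact: cnt_cst].
Qed.

(** The second projection followed by the squeeze, whose time is the cut-off of the first
    coordinate: the plain projection near [b1], and constant [a2] near [(a1, a2)]. Since [sqz] takes
    the value [b2] only at [b2], no new point is sent there. *)
Lemma squeeze_map : exists (rho : N1 * N2 -> N2) (W : set (N1 * N2)) (D : set N1),
  [/\ continuous rho, open W, W (a1, a2) & forall y, W y -> rho y = a2] /\
  [/\ open D, D b1, ~ D a1, forall y, D y.1 -> rho y = y.2 & forall y, rho y = b2 -> y.2 = b2].
Proof.
exists (fun y => sqz y.2 (cut y.1)),
  ([set x | 2 < 3 * sqnorm (h x - h b1) / del] `*` (g2 @` [set w | sqnorm (w - 0) < 1 / 2])),
  [set x | 3 * sqnorm (h x - h b1) / del < 1].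
have Ea : 3 * sqnorm (h a1 - h b1) / del = 3 by rewrite -/del -mulrA divff ?mulr1 // gt_eqF.
split; split.
- apply: sqz_plot => //; first exact: cnt_snd (@cnt_id _).
    apply: (cnt_comp (f := fun y : N1 * N2 => 3 * sqnorm (h y.1 - h b1) / del - 1) _ (@clamp_continuous R)).
    apply: cntB; last exact: cnt_cst.
    exact: (cnt_comp (cnt_fst (@cnt_id _)) cdist).
  by move=> w; exact: clamp_itv.
- apply: openX; last by apply: og2; exact: sqball_open.
  by apply: (@open_comp _ _ (fun x => 3 * sqnorm (h x - h b1) / del) [set x : R | 2 < x]); [move=> x _; exact: cdist|exact: open_gt].
- split => /=; first by rewrite Ea; lra.
  by exists 0; [rewrite /= subr0 sqnorm0; lra|case: t2 => _ _ _ _ []].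
- move=> [x y] [/= x2 [w w1 <-]]; rewrite /cut clamp_ge1; last lra.
  by apply: sqz1; move: w1; rewrite /= subr0.
- by apply: (@open_comp _ _ (fun x => 3 * sqnorm (h x - h b1) / del) [set x : R | x < 1]); [move=> x _; exact: cdist|exact: open_lt].
- by rewrite /= subrr sqnorm0 mulr0 mul0r ltr01.
- by rewrite /= Ea; lra.
- by move=> [x y] /= x1; rewrite /cut clamp_le0 ?sqz0 //; lra.
- by move=> [x y] /= /sqz_b.
Qed.
End Squeeze.

(* [j1] and [j2] are the two canonical maps into a connected sum, extended
   arbitrarily inside the removed discs. *)
Definition glued (R : realType) d (M1 M2 Q : topologicalType) (e1 : 'rV[R]_d -> M1) (e2 : 'rV[R]_d -> M2)
    (j1 : M1 -> Q) (j2 : M2 -> Q) :=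
  let D1 := disc_complement e1 in let D2 := disc_complement e2 in
  [/\ pcont D1 j1 /\ pcont D2 j2,
   (forall x y, D1 x -> D1 y -> j1 x = j1 y -> x = y) /\
     (forall x y, D2 x -> D2 y -> j2 x = j2 y -> x = y),
   (forall x y, D1 x -> D2 y -> j1 x = j2 y <-> exists v, [/\ sqnorm v = 1, x = e1 v & y = e2 v]),
   (forall q, (exists2 x, D1 x & j1 x = q) \/ (exists2 y, D2 y & j2 y = q)) &
   (forall (S : set Q) O1 O2, open O1 -> open O2 -> (forall x, D1 x -> S (j1 x) <-> O1 x) ->
     (forall y, D2 y -> S (j2 y) <-> O2 y) -> open S)].

Lemma glued_sym (R : realType) d (M1 M2 Q : topologicalType) (e1 : 'rV[R]_d -> M1) (e2 : 'rV[R]_d -> M2)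
    (j1 : M1 -> Q) (j2 : M2 -> Q) : glued e1 e2 j1 j2 -> glued e2 e1 j2 j1.
Proof.
move=> [[p1 p2] [i1 i2] g c o]; split=> //.
- move=> x y Dx Dy; split=> [/esym /g [] // v [v1 ? ?]|[v [v1 xv yv]]]; first by exists v.
  by apply/esym/g => //; exists v.
- by move=> q; case: (c q); [right|left].
- by move=> S O1 O2 oO1 oO2 H1 H2; apply: (o S O2 O1).
Qed.

(** * Connected sums *)

Section FromCsum.
Variables (R : realType) (d : nat) (M N X : topologicalType).
Variables (e : 'rV[R]_d -> M) (f : 'rV[R]_d -> N).
Hypotheses (ei : injective e) (fi : injective f).
Local Notation P := {b : bool & csum_piece e f b}.
Local Notation De := (disc_complement e).
Local Notation Df := (disc_complement f).

Let inT (x : De) : P := existT (csum_piece e f) true x.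
Let inF (y : Df) : P := existT (csum_piece e f) false y.
Let getT (p : P) : option M := match p with existT b x =>
  (if b as b' return csum_piece e f b' -> option M then fun x => Some (\val x) else fun=> None) x end.
Let getF (p : P) : option N := match p with existT b x =>
  (if b as b' return csum_piece e f b' -> option N then fun=> None else fun y => Some (\val y)) x end.

Let inT_inj x x' : inT x = inT x' -> \val x = \val x'.
Proof. by move=> /(congr1 getT) []. Qed.
Let inF_inj x x' : inF x = inF x' -> \val x = \val x'.
Proof. by move=> /(congr1 getF) []. Qed.
Let inTF x y : inT x <> inF y.
Proof. by move=> /(congr1 (@projT1 _ _)). Qed.

(** Each point is glued to at most one other, because [e] and [f] are injective; longer chains of
    identifications therefore collapse. *)
Lemma csum_rstP (p q : P) : clos_refl_sym_trans P (@csum_glue R d M N e f) p q ->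
  [\/ p = q, @csum_glue R d M N e f p q | @csum_glue R d M N e f q p].
Proof.
elim=> [x y xy|x|x y _ [->|xy|xy]|x y z _ [->|xy|xy] _ IH //].
- exact: Or32.
- exact: Or31.
- exact: Or31.
- exact: Or33.
- exact: Or32.
- case: IH xy => [<-|yz|zy]; first by move=> xy; exact: Or32.
    move: yz => [x1 [y1 [v1 [_ _ _ yE _]]]] [x2 [y2 [v2 [_ _ _ _ yE']]]].
    by case: (@inTF x1 y2); rewrite /inT -yE yE'.
  move: zy => [x1 [y1 [v1 [_ xv1 yv1 zE yE]]]] [x2 [y2 [v2 [_ xv2 yv2 xE yE']]]].
  apply: Or31; rewrite xE zE; congr existT; apply: val_inj.
  rewrite /= xv1 xv2; congr e; apply: fi; rewrite -yv1 -yv2.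
  by apply: inF_inj; rewrite /inF -yE -yE'.
- case: IH xy => [<-|yz|zy]; first by move=> xy; exact: Or33.
    move: yz => [x1 [y1 [v1 [_ xv1 yv1 yE zE]]]] [x2 [y2 [v2 [_ xv2 yv2 yE' xE]]]].
    apply: Or31; rewrite xE zE; congr existT; apply: val_inj.
    rewrite /= yv1 yv2; congr f; apply: ei; rewrite -xv1 -xv2.
    by apply: inT_inj; rewrite /inT -yE -yE'.
  move: zy => [x1 [y1 [v1 [_ _ _ _ yE]]]] [x2 [y2 [v2 [_ _ _ yE' _]]]].
  by case: (@inTF x2 y1); rewrite /inF -yE yE'.
Qed.

Variables (phi : X -> csum e f) (psi : csum e f -> X).
Hypotheses (cphi : continuous phi) (cpsi : continuous psi) (phiK : cancel phi psi) (psiK : cancel psi phi).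
Variable q0 : X.

Let cl (p : P) : csum e f := (\pi_({eq_quot (@csum_rel R d M N e f)}) p)%qT.
Let jT (x : M) : X := match pselect (De x) with
  | left h => psi (cl (inT (SigSub (mem_set h)))) | right _ => q0 end.
Let jF (y : N) : X := match pselect (Df y) with
  | left h => psi (cl (inF (SigSub (mem_set h)))) | right _ => q0 end.

Let jTE (x : De) : jT (\val x) = psi (cl (inT x)).
Proof.
rewrite /jT; case: pselect => [h|n].
  by congr (psi (cl (inT _))); apply: val_inj.
by case: n; exact: (set_mem (valP x)).
Qed.
Let jFE (x : Df) : jF (\val x) = psi (cl (inF x)).
Proof.
rewrite /jF; case: pselect => [h|n].
  by congr (psi (cl (inF _))); apply: val_inj.
by case: n; exact: (set_mem (valP x)).
Qed.

Let cl_cont : continuous cl.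
Proof. exact: pi_continuous. Qed.

Let clP p q : cl p = cl q <-> [\/ p = q, @csum_glue R d M N e f p q | @csum_glue R d M N e f q p].
Proof.
split=> [/eqmodP /asboolP /csum_rstP //|H].
apply/eqmodP/asboolP; case: H => [->|h|h]; [exact: rst_refl|exact: rst_step|apply: rst_sym; exact: rst_step].
Qed.

Let psi_inj : injective psi. Proof. exact: can_inj psiK. Qed.

Lemma csum_glued : exists (j1 : M -> X) (j2 : N -> X), glued e f j1 j2.
Proof.
exists jT, jF; split.
- split=> W k ck kD.
    have -> : (fun w => jT (k w)) = (fun w => psi (cl (inT (SigSub (mem_set (kD w)))))).
      by apply: funext => w; rewrite -jTE.
    apply: (cnt_comp _ cpsi); apply: (cnt_comp _ cl_cont).
    apply: (@cnt_comp _ _ _ (fun w => SigSub (mem_set (kD w)) : De) inT); last exact: (@existT_continuous bool (csum_piece e f) true).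
    exact: continuous_comp_initial.
  have -> : (fun w => jF (k w)) = (fun w => psi (cl (inF (SigSub (mem_set (kD w)))))).
    by apply: funext => w; rewrite -jFE.
  apply: (cnt_comp _ cpsi); apply: (cnt_comp _ cl_cont).
  apply: (@cnt_comp _ _ _ (fun w => SigSub (mem_set (kD w)) : Df) inF); last exact: (@existT_continuous bool (csum_piece e f) false).
  exact: continuous_comp_initial.
- split=> x y Dx Dy.
    rewrite -[x]/(\val (SigSub (mem_set Dx) : De)) -[y]/(\val (SigSub (mem_set Dy) : De)) !jTE.
    move=> /psi_inj /clP [/inT_inj //|[x1 [y1 [v [_ _ _ _ E]]]]|[x1 [y1 [v [_ _ _ _ E]]]]].
      by case: (@inTF _ _ E).
    by case: (@inTF _ _ E).
  rewrite -[x]/(\val (SigSub (mem_set Dx) : Df)) -[y]/(\val (SigSub (mem_set Dy) : Df)) !jFE.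
  move=> /psi_inj /clP [/inF_inj //|[x1 [y1 [v [_ _ _ E _]]]]|[x1 [y1 [v [_ _ _ E _]]]]].
    by case: (@inTF _ _ (esym E)).
  by case: (@inTF _ _ (esym E)).
- move=> x y Dx Dy.
  rewrite -[x]/(\val (SigSub (mem_set Dx) : De)) -[y]/(\val (SigSub (mem_set Dy) : Df)) jTE jFE.
  split=> [/psi_inj /clP [/inTF //|[x1 [y1 [v [v1 xv yv /inT_inj xE /inF_inj yE]]]]|]|[v [v1 xv yv]]].
  + by exists v; rewrite xE yE xv yv.
  + by move=> [x1 [y1 [v [_ _ _ E _]]]]; case: (@inTF _ _ (esym E)).
  + by congr psi; apply/clP/Or32; exists (SigSub (mem_set Dx)), (SigSub (mem_set Dy)), v.
- move=> q; rewrite -(phiK q) -[phi q]reprK; case: (repr (phi q)) => -[] x.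
    by left; exists (\val x); [exact: (set_mem (valP x))|rewrite jTE].
  by right; exists (\val x); [exact: (set_mem (valP x))|rewrite jFE].
- move=> S O1 O2 oO1 oO2 H1 H2.
  have -> : S = phi @^-1` (psi @^-1` S) by apply/seteqP; split=> x /=; rewrite phiK.
  apply: open_comp; first by move=> x _; exact: cphi.
  change (open (cl @^-1` (psi @^-1` S))).
  apply/sigT_openP => -[].
    have -> : existT (csum_piece e f) true @^-1` (cl @^-1` (psi @^-1` S)) = (\val : De -> M) @^-1` O1.
      apply/seteqP; split=> x /= h.
        by apply/H1; [exact: (set_mem (valP x))|rewrite jTE].
      by have := iffRL (H1 _ (set_mem (valP x))) h; rewrite jTE.
    by apply: open_comp => // x _; exact: initial_continuous.
  have -> : existT (csum_piece e f) false @^-1` (cl @^-1` (psi @^-1` S)) = (\val : Df -> N) @^-1` O2.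
    apply/seteqP; split=> x /= h.
      by apply/H2; [exact: (set_mem (valP x))|rewrite jFE].
    by have := iffRL (H2 _ (set_mem (valP x))) h; rewrite jFE.
  by apply: open_comp => // x _; exact: initial_continuous.
Qed.
End FromCsum.

(** * Punctured summands inside a connected sum *)

Section Inversion.
Variables (R : realType) (d : nat).
Local Notation V := 'rV[R]_d.
Implicit Types v : V.

Definition sinv v : V := (sqnorm v)^-1 *: v.

Lemma sqnorm_sinv v : v <> 0 -> sqnorm (sinv v) = (sqnorm v)^-1.
Proof.
move=> /eqP; rewrite -sqnorm_eq0 => v0; rewrite sqnormZ expr2 -mulrA mulVf // mulr1 //.
Qed.
Lemma sinv_neq0 v : v <> 0 -> sinv v <> 0.
Proof.
by move=> /eqP v0 /eqP; rewrite scaler_eq0 invr_eq0 sqnorm_eq0 (negPf v0).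
Qed.
Lemma sinvK v : v <> 0 -> sinv (sinv v) = v.
Proof.
move=> v0; rewrite {1}/sinv sqnorm_sinv // /sinv invrK scalerA divff ?scale1r //.
by rewrite sqnorm_eq0; apply/eqP.
Qed.
Lemma sinv_id v : sqnorm v = 1 -> sinv v = v.
Proof. by move=> v1; rewrite /sinv v1 invr1 scale1r. Qed.
Lemma sqnorm_pos v : v <> 0 -> 0 < sqnorm v.
Proof. by move=> /eqP; rewrite sqnorm_gt0. Qed.
Lemma sinv_gt1 v : v <> 0 -> sqnorm v < 1 -> 1 < sqnorm (sinv v).
Proof. by move=> v0 v1; rewrite sqnorm_sinv // invf_gt1 // sqnorm_pos. Qed.
Lemma sinv_lt1 v : v <> 0 -> 1 < sqnorm v -> sqnorm (sinv v) < 1.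
Proof. by move=> v0 v1; rewrite sqnorm_sinv // invf_lt1 // sqnorm_pos. Qed.

Lemma sinv_cont (T : topologicalType) (k : T -> V) : continuous k -> (forall t, k t <> 0) ->
  continuous (fun t => sinv (k t)).
Proof.
move=> ck k0; apply: cntZ => //; apply: cntV; last exact: sqnorm_cont.
by move=> t; rewrite sqnorm_eq0; apply/eqP.
Qed.

(** Folds the punctured space onto the outside of the unit ball, by inversion inside and the
    identity outside. One formula thus gives arguments that are legitimate in both branches of
    [cnt_glue]. *)
Definition outw v : V := Num.max 1 (sqnorm v)^-1 *: v.

Lemma outw_ge1 v : 1 <= sqnorm v -> outw v = v.
Proof.
move=> v1; rewrite /outw max_l ?scale1r // invf_le1 //; exact: lt_le_trans v1.
Qed.
Lemma outw_le1 v : v <> 0 -> sqnorm v <= 1 -> outw v = sinv v.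
Proof.
by move=> v0 v1; rewrite /outw max_r // invf_ge1 // sqnorm_pos.
Qed.
Lemma outw_sq v : v <> 0 -> 1 <= sqnorm (outw v).
Proof.
move=> v0; have [v1|/ltW v1] := leP 1 (sqnorm v); first by rewrite outw_ge1.
by rewrite outw_le1 // sqnorm_sinv // invf_ge1 // sqnorm_pos.
Qed.
End Inversion.

Section Alpha.
Variables (R : realType) (d : nat) (M1 M2 Q : topologicalType).
Local Notation V := 'rV[R]_d.
Variables (e1 : V -> M1) (e1' : M1 -> V) (e2 : V -> M2) (e2' : M2 -> V) (j1 : M1 -> Q) (j2 : M2 -> Q).
Hypotheses (c1 : chart e1 e1') (c2 : chart e2 e2') (hM1 : hausdorff_space M1).
Hypothesis gl : glued e1 e2 j1 j2.

Let ce1 : continuous e1. Proof. by case: c1. Qed.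
Let ce2 : continuous e2. Proof. by case: c2. Qed.
Let e1K v : e1' (e1 v) = v. Proof. by case: c1. Qed.
Let e2K v : e2' (e2 v) = v. Proof. by case: c2. Qed.
Let pe1 : pcont (range e1) e1'. Proof. by case: c1. Qed.
Let oe1 S : open S -> open (e1 @` S). Proof. by case: c1 => _ _ _; apply. Qed.
Let oe2 S : open S -> open (e2 @` S). Proof. by case: c2 => _ _ _; apply. Qed.
Let e1i v w : e1 v = e1 w -> v = w. Proof. by move=> /(congr1 e1'); rewrite !e1K. Qed.
Let e2i v w : e2 v = e2 w -> v = w. Proof. by move=> /(congr1 e2'); rewrite !e2K. Qed.
Let D1 := disc_complement e1.
Let D2 := disc_complement e2.
Let D1e v : D1 (e1 v) <-> 1 <= sqnorm v.
Proof.
split=> [H|v1 [w /= w1 /e1i wv]]; last by move: w1; rewrite wv ltNge v1.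
by rewrite leNgt; apply/negP => v1; apply: H; exists v.
Qed.
Let D2e v : D2 (e2 v) <-> 1 <= sqnorm v.
Proof.
split=> [H|v1 [w /= w1 /e2i wv]]; last by move: w1; rewrite wv ltNge v1.
by rewrite leNgt; apply/negP => v1; apply: H; exists v.
Qed.
Let pj1 : pcont D1 j1. Proof. by case: gl => -[]. Qed.
Let pj2 : pcont D2 j2. Proof. by case: gl => -[]. Qed.
Let j1i x y : D1 x -> D1 y -> j1 x = j1 y -> x = y. Proof. by case: gl => _ [H _] _ _ _; exact: H. Qed.
Let j2i x y : D2 x -> D2 y -> j2 x = j2 y -> x = y. Proof. by case: gl => _ [_ H] _ _ _; exact: H. Qed.
Let j12 x y : D1 x -> D2 y -> j1 x = j2 y <-> exists v, [/\ sqnorm v = 1, x = e1 v & y = e2 v].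
Proof. by case: gl => _ _ H _ _; exact: H. Qed.
Let oQ (S : set Q) O1 O2 : open O1 -> open O2 -> (forall x, D1 x -> S (j1 x) <-> O1 x) ->
     (forall y, D2 y -> S (j2 y) <-> O2 y) -> open S.
Proof. by case: gl => _ _ _ _; apply. Qed.
Let n1 := e1 0.

(** Continues [j1] into the removed disc, except at its centre, by inverting the disc into the
    outside of the disc of the other summand. The whole punctured summand becomes an open subset of
    the sum. *)
Definition amap (y : M1) : Q :=
  if pselect ((e1 @` [set v | sqnorm v < 1]) y) then j2 (e2 (sinv (e1' y))) else j1 y.

Lemma amap_D1 y : D1 y -> amap y = j1 y.
Proof. by move=> yD; rewrite /amap; case: pselect => [h|h] //; case: yD. Qed.

Lemma amap_in v : v <> 0 -> sqnorm v <= 1 -> amap (e1 v) = j2 (e2 (sinv v)).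
Proof.
move=> v0; rewrite le_eqVlt => /orP[/eqP v1|v1].
  rewrite amap_D1; last by apply/D1e; rewrite v1.
  by rewrite sinv_id //; apply/j12; [apply/D1e; rewrite v1|apply/D2e; rewrite v1|exists v].
by rewrite /amap; case: pselect => [h|h] /=; [rewrite e1K|case: h; exists v].
Qed.

Lemma D1_or y : y <> n1 -> D1 y \/ exists v, [/\ v <> 0, sqnorm v < 1 & y = e1 v].
Proof.
move=> yn; have [[v v1 vy]|h] := pselect ((e1 @` [set v | sqnorm v < 1]) y); [right|by left].
by exists v; split=> // v0; apply: yn; rewrite -vy v0.
Qed.
Let D1n y : D1 y -> y <> n1.
Proof. by move=> /[swap] -> /D1e; rewrite sqnorm0; apply/negP; rewrite -ltNge ltr01. Qed.
Let D2inv v : v <> 0 -> sqnorm v <= 1 -> D2 (e2 (sinv v)).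
Proof. by move=> v0 v1; apply/D2e; rewrite sqnorm_sinv // invf_ge1 // sqnorm_pos. Qed.

Lemma amap_inj y z : y <> n1 -> z <> n1 -> amap y = amap z -> y = z.
Proof.
have aux y' v : D1 y' -> v <> 0 -> sqnorm v < 1 -> j1 y' = j2 (e2 (sinv v)) -> False.
  move=> yD v0 v1 /(iffLR (j12 yD (D2inv v0 (ltW v1)))) [w [w1 _ /e2i E]].
  by have := sinv_gt1 v0 v1; rewrite E w1 ltxx.
move=> /D1_or[yD|[v [v0 v1 ->]]] /D1_or[zD|[w [w0 w1 ->]]].
- by rewrite !amap_D1 //; exact: j1i.
- by rewrite amap_D1 // amap_in // ?ltW // => /aux [].
- by rewrite (amap_D1 zD) amap_in // ?ltW // => /esym /aux [].
- rewrite !amap_in ?ltW // => /j2i; move/(_ (D2inv v0 (ltW v1)) (D2inv w0 (ltW w1))) => /e2i E.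
  by rewrite -(sinvK v0) E sinvK.
Qed.

Lemma amap_pcont : pcont (~` [set n1]) amap.
Proof.
move=> W k ck kn; apply: cont_local => w0.
have [[v0 _ vE]|nr] := pselect (range e1 (k w0)).
  exists (k @^-1` range e1); split; [by apply: open_comp => //; exact: oe1 openT|by exists v0|].
  pose kv (w : (k @^-1` range e1)) := e1' (k (\val w)).
  have kE w : k (\val w) = e1 (kv w) by have [v _ E] := set_mem (valP w); rewrite /kv -E e1K.
  have kv0 w : kv w <> 0 by move=> E; apply: (kn (\val w)); rewrite /= kE E.
  have cval : continuous (fun w : (k @^-1` range e1) => k (\val w)).
    exact: (cnt_comp (@initial_continuous _ _ _) ck).
  have ckv : continuous kv by apply: pe1 => // w; exact: (set_mem (valP w)).
  have co : continuous (fun w => outw (kv w)).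
    apply: cntZ => //; apply: cnt_max; first exact: cnt_cst.
    apply: cntV; last exact: sqnorm_cont.
    by move=> w; rewrite sqnorm_eq0; apply/eqP.
  have -> : (fun w : (k @^-1` range e1) => amap (k (\val w))) = (fun w =>
     if 1 - sqnorm (kv w) <= 0 then j1 (e1 (outw (kv w))) else j2 (e2 (outw (kv w)))).
    apply: funext => w; rewrite kE; case: ifPn => h.
      have h1 : 1 <= sqnorm (kv w) by move: h; rewrite subr_le0.
      by rewrite amap_D1 ?outw_ge1 //; apply/D1e.
    have h1 : sqnorm (kv w) < 1 by move: h; rewrite subr_le0 -ltNge.
    by rewrite amap_in ?outw_le1 // ltW.
  apply: cnt_glue.
  - apply: cntB; [exact: cnt_cst|exact: sqnorm_cont].
  - apply: (pj1 (k := fun w => e1 (outw (kv w)))); first exact: (cnt_comp co ce1).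
    by move=> w; apply/D1e; exact: outw_sq.
  - apply: (pj2 (k := fun w => e2 (outw (kv w)))); first exact: (cnt_comp co ce2).
    by move=> w; apply/D2e; exact: outw_sq.
  - move=> w /eqP; rewrite subr_eq0 eq_sym => /eqP w1; rewrite outw_ge1 ?w1 //.
    by apply/j12; [apply/D1e; rewrite w1|apply/D2e; rewrite w1|exists (kv w)].
exists (k @^-1` (~` (e1 @` [set w | sqnorm (w - 0) <= 1]))); split.
- apply: open_comp => //; apply: closed_openC; apply: compact_closed => //.
  by apply: continuous_compact; [exact: continuous_subspaceT|exact: cball_compact].
- by move=> [v _ vE]; apply: nr; exists v.
have kD (w : (k @^-1` (~` (e1 @` [set w | sqnorm (w - 0) <= 1])))) : D1 (k (\val w)).
  move=> [v /= v1 vE]; apply: (set_mem (valP w)); exists v => //=.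
  by rewrite subr0 ltW.
rewrite (_ : (fun w : (k @^-1` _) => amap (k (\val w))) = (fun w => j1 (k (\val w)))).
  by apply: pj1 => //; exact: (cnt_comp (@initial_continuous _ _ _) ck).
by apply: funext => w; rewrite amap_D1.
Qed.

(** Openness in the sum is tested on the two pieces: the trace on [M1] is [S], and the trace on [M2]
    is the inversion of the part of [S] in the chart. *)
Lemma amap_open S : open S -> ~ S n1 -> open (amap @` S).
Proof.
move=> oS Sn; pose O2 := e2 @` [set w | w <> 0 /\ S (e1 (sinv w))].
apply: (oQ (O1 := S) (O2 := O2)) => //.
- apply: oe2; rewrite openE => w [w0 wS].
  have nS : nbhs (e1 (sinv w)) S by exact: open_nbhs_nbhs.
  have oz : open [set w : V | w <> 0].
    have -> : [set w : V | w <> 0] = sqnorm (n:=d) @^-1` [set x | 0 < x].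
      by apply/seteqP; split=> u /=; rewrite sqnorm_gt0 => /eqP.
    by apply: open_comp; [move=> u _; apply: sqnorm_cont; exact: cnt_id|exact: open_gt].
  have ps : pcont [set w : V | w <> 0] (fun w => e1 (sinv w)).
    by move=> W k ck k0; apply: (cnt_comp _ ce1); exact: sinv_cont.
  have n2 : nbhs w (fun w => S (e1 (sinv w))) by exact: (pcont_open_at oz ps w0).
  have n3 : nbhs w [set w : V | w <> 0] by exact: open_nbhs_nbhs.
  by apply: filterS2 n2 n3 => u uS u0; split.
- move=> x xD; split=> [[s sS E]|xS]; last by exists x => //; exact: amap_D1.
  have sn : s <> n1 by move=> sn; apply: Sn; rewrite -sn.
  suff -> : x = s by [].
  by apply: amap_inj => //; [exact: D1n|rewrite (amap_D1 xD)].
- move=> y yD; split=> [[s sS E]|[w [w0 wS] wy]].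
    have sn : s <> n1 by move=> sn; apply: Sn; rewrite -sn.
    have [sD|[v [v0 v1 sE]]] := D1_or sn.
      move: E; rewrite amap_D1 // => /(iffLR (j12 sD yD)) [v [v1 sE yE]].
      exists v => //; split; last by rewrite sinv_id // -sE.
      by move=> v0; move: v1; rewrite v0 sqnorm0 => /esym/eqP; rewrite oner_eq0.
    move: E; rewrite sE amap_in // ?ltW // => /j2i E; exists (sinv v).
      by split; [exact: sinv_neq0|rewrite sinvK // -sE].
    by apply: E => //; apply: D2inv => //; exact: ltW.
  exists (e1 (sinv w)) => //; have w1 : 1 <= sqnorm w by apply/D2e; rewrite wy.
  rewrite amap_in; first by rewrite sinvK // wy.
    exact: sinv_neq0.
  by rewrite sqnorm_sinv // invf_le1 // sqnorm_pos.
Qed.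

Lemma amap_handle (y0 : M1) : exists a', handle n1 amap a'.
Proof.
have /choice[a' aP] : forall q, exists y, (amap @` (~` [set n1])) q -> y <> n1 /\ amap y = q.
  move=> q; have [[y yn yq]|h] := pselect ((amap @` (~` [set n1])) q); last by exists y0.
  by exists y.
have aK y : y <> n1 -> a' (amap y) = y.
  by move=> yn; have [|h1 h2] := aP (amap y); [exists y|apply: amap_inj].
exists a'; split=> //; [exact: amap_pcont| |exact: amap_open].
apply: pcont_at => _ [y yn <-] A; rewrite aK // nbhsE => -[B [oB By] BA].
have on : open (~` [set n1]) by exact: open_punct.
apply: (filterS (P := amap @` (B `&` ~` [set n1]))).
  by move=> _ [z [Bz zn] <-] /=; rewrite aK //; exact: BA.
apply: open_nbhs_nbhs; split; last by exists y.
by apply: amap_open; [exact: openI|by move=> [_ H]; exact: H].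
Qed.
End Alpha.

Section Beta.
Variables (R : realType) (d : nat) (M1 M2 Q : topologicalType).
Local Notation V := 'rV[R]_d.
Variables (e1 : V -> M1) (e1' : M1 -> V) (e2 : V -> M2) (e2' : M2 -> V) (j1 : M1 -> Q) (j2 : M2 -> Q).
Hypotheses (c1 : chart e1 e1') (c2 : chart e2 e2') (hM1 : hausdorff_space M1) (hM2 : hausdorff_space M2).
Hypothesis gl : glued e1 e2 j1 j2.
Let gl' := glued_sym gl.
Let A := amap e1 e1' e2 j1 j2.
Let B := amap e2 e2' e1 j2 j1.

Let e1K v : e1' (e1 v) = v. Proof. by case: c1. Qed.
Let e2K v : e2' (e2 v) = v. Proof. by case: c2. Qed.

Let D1e v : 1 <= sqnorm v -> disc_complement e1 (e1 v).
Proof.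
move=> v1 [w /= w1 /(congr1 e1')]; rewrite !e1K => wv.
by move: w1; rewrite wv ltNge v1.
Qed.
Let D2e v : 1 <= sqnorm v -> disc_complement e2 (e2 v).
Proof.
move=> v1 [w /= w1 /(congr1 e2')]; rewrite !e2K => wv.
by move: w1; rewrite wv ltNge v1.
Qed.

(** The two punctured summands overlap in the collar, with inversion as transition map. *)
Lemma amap_bmap v : v <> 0 -> A (e1 v) = B (e2 (sinv v)).
Proof.
move=> v0; have [v1|v1] := leP (sqnorm v) 1.
  rewrite /A (amap_in c1 c2 gl) // /B amap_D1 //; apply: D2e.
  by rewrite sqnorm_sinv // invf_ge1 // sqnorm_pos.
have i1 : sqnorm (sinv v) <= 1 by rewrite ltW // sinv_lt1.
rewrite /A amap_D1; last by apply: D1e; exact: ltW.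
rewrite /B (amap_in c2 c1 gl') ?sinvK //; exact: sinv_neq0.
Qed.

Lemma amap_cover q : (exists2 y, y <> e1 0 & A y = q) \/ (exists2 z, z <> e2 0 & B z = q).
Proof.
have s01 : sqnorm (0 : V) < 1 by rewrite sqnorm0 ltr01.
have [_ _ _ /(_ q)[[x xD <-]|[y yD <-]] _] := gl.
  left; exists x; last exact: amap_D1.
  by move=> xE; apply: xD; rewrite xE; exists 0.
right; exists y; last exact: amap_D1.
by move=> xE; apply: yD; rewrite xE; exists 0.
Qed.

Lemma amap_overlap y z : y <> e1 0 -> z <> e2 0 -> A y = B z ->
  exists2 v, v <> 0 & y = e1 v /\ z = e2 (sinv v).
Proof.
move=> yn zn E; have [[v _ vE]|ny] := pselect (range e1 y).
  have v0 : v <> 0 by move=> v0; apply: yn; rewrite -vE v0.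
  exists v => //; split=> //; apply: (amap_inj c2 c1 gl') => //.
    by move=> /(congr1 e2'); rewrite !e2K; exact: sinv_neq0.
  by change (B z = B (e2 (sinv v))); rewrite -E -vE; exact: amap_bmap.
have [[w _ wE]|nz] := pselect (range e2 z).
  have w0 : w <> 0 by move=> w0; apply: zn; rewrite -wE w0.
  case: ny; exists (sinv w) => //; apply: (amap_inj c1 c2 gl) => //.
    by move=> /(congr1 e1'); rewrite !e1K; exact: sinv_neq0.
  change (A (e1 (sinv w)) = A y); rewrite E -wE amap_bmap ?sinvK //; exact: sinv_neq0.
have yD : disc_complement e1 y by move=> [v _ vE]; apply: ny; exists v.
have zD : disc_complement e2 z by move=> [v _ vE]; apply: nz; exists v.
move: E; rewrite /A /B !amap_D1 //; have [_ _ H _ _] := gl.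
by move=> /(iffLR (H _ _ yD zD)) [v [_ yE _]]; case: ny; exists v.
Qed.

(** Two points of one punctured summand are separated there. In the remaining case the outsides of
    the closed unit balls separate them: these could only meet at a collar point where both [v] and
    [sinv v] have norm greater than 1. *)
Lemma glued_hausdorff : hausdorff_space Q.
Proof.
have on1 : open (~` [set e1 0]) by exact: open_punct.
have on2 : open (~` [set e2 0]) by exact: open_punct.
have sepH (M : topologicalType) (u v : M) : hausdorff_space M -> u <> v ->
    exists S T, [/\ open S, open T, S u, T v & forall z, S z -> T z -> False].
  rewrite open_hausdorff => hM /eqP /hM [[S T] /= [Su Tv] [oS oT /eqP ST]].
  exists S, T; split=> //; [exact: set_mem|exact: set_mem|move=> z Sz Tz].
  by have : (S `&` T) z by []; rewrite ST.
have sep (M : topologicalType) (n : M) (a : M -> Q) : hausdorff_space M -> open (~` [set n]) ->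
    (forall y z, y <> n -> z <> n -> a y = a z -> y = z) ->
    (forall S, open S -> ~ S n -> open (a @` S)) -> forall u v, u <> n -> v <> n -> u <> v ->
    exists S T, [/\ open S, open T, S (a u), T (a v) & forall z, S z -> T z -> False].
  move=> hM on ai oa u v un vn uv; have [S [T [oS oT Su Tv ST]]] := sepH M u v hM uv.
  exists (a @` (S `&` ~` [set n])), (a @` (T `&` ~` [set n])); split.
  - by apply: oa; [exact: openI|by move=> [_ H]; exact: H].
  - by apply: oa; [exact: openI|by move=> [_ H]; exact: H].
  - by exists u.
  - by exists v.
  - move=> _ [w [Sw wn] <-] [w' [Tw wn'] E]; apply: (ST w) => //.
    by rewrite -(ai _ _ wn' wn E).
have sepE (M : topologicalType) (e : V -> M) e' (a : M -> Q) : chart e e' -> hausdorff_space M ->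
    (forall S, open S -> ~ S (e 0) -> open (a @` S)) ->
    open (a @` (~` (e @` [set w | sqnorm (w - 0) <= 1]))).
  move=> [ce _ _ _] hM oa; apply: oa; last by apply; exists 0 => //=; rewrite subrr sqnorm0 ler01.
  apply: closed_openC; apply: compact_closed => //.
  by apply: continuous_compact; [exact: continuous_subspaceT|exact: cball_compact].
have oA := amap_open c1 c2 gl.
have oB := amap_open c2 c1 gl'.
have iA := amap_inj c1 c2 gl.
have iB := amap_inj c2 c1 gl'.
have mixed y z : y <> e1 0 -> z <> e2 0 -> A y <> B z ->
    exists S T, [/\ open S, open T, S (A y), T (B z) & forall q, S q -> T q -> False].
  move=> yn zn yz; have [[v _ vE]|ny] := pselect (range e1 y).
    have v0 : v <> 0 by move=> v0; apply: yn; rewrite -vE v0.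
    rewrite -vE amap_bmap // in yz *; apply: (sep _ (e2 0)) => //; last by move=> E; apply: yz; rewrite E.
    by move=> /(congr1 e2'); rewrite !e2K; exact: sinv_neq0.
  have [[w _ wE]|nz] := pselect (range e2 z).
    have w0 : w <> 0 by move=> w0; apply: zn; rewrite -wE w0.
    have E : B z = A (e1 (sinv w)) by rewrite -wE amap_bmap ?sinvK //; exact: sinv_neq0.
    rewrite E in yz *; apply: (sep _ (e1 0)) => //; last by move=> E'; apply: yz; rewrite E'.
    by move=> /(congr1 e1'); rewrite !e1K; exact: sinv_neq0.
  exists (A @` (~` (e1 @` [set w | sqnorm (w - 0) <= 1]))), (B @` (~` (e2 @` [set w | sqnorm (w - 0) <= 1]))).
  split.
  - exact: (sepE _ _ _ _ c1).
  - exact: (sepE _ _ _ _ c2).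
  - by exists y => // -[v _ vE]; apply: ny; exists v.
  - by exists z => // -[v _ vE]; apply: nz; exists v.
  - move=> _ [u uD <-] [w wD E].
    have un : u <> e1 0 by move=> un; apply: uD; exists 0 => //=; rewrite subrr sqnorm0 ler01.
    have wn : w <> e2 0 by move=> wn; apply: wD; exists 0 => //=; rewrite subrr sqnorm0 ler01.
    have [v v0 [uE wE]] := amap_overlap un wn (esym E).
    have [v1|v1] := leP (sqnorm v) 1; first by apply: uD; exists v => //=; rewrite subr0.
    by apply: wD; exists (sinv v) => //=; rewrite subr0 ltW // sinv_lt1.
suff H (x y : Q) : x <> y -> exists S T, [/\ open S, open T, S x, T y & forall q, S q -> T q -> False].
  rewrite open_hausdorff => x y /eqP /H [S [T [oS oT Sx Ty ST]]].
  exists (S, T) => /=; first by split; apply/mem_set.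
  by split=> //; apply/eqP/seteqP; split=> // z [Sz Tz]; exact: (ST z).
move=> xy; case: (amap_cover x) => [[u un ux]|[u un ux]]; case: (amap_cover y) => [[v vn vy]|[v vn vy]];
  rewrite -ux -vy in xy *.
- by apply: (sep _ (e1 0)) => // E; apply: xy; rewrite E.
- exact: mixed.
- have [|S [T [oS oT Sv Tu ST]]] := mixed v u vn un; first by move=> E; apply: xy.
  by exists T, S; split=> // q Tq Sq; exact: (ST q).
- by apply: (sep _ (e2 0)) => // E; apply: xy; rewrite E.
Qed.
End Beta.

Section ChartTools.
Variables (R : realType) (d : nat).
Local Notation V := 'rV[R]_d.

Lemma chart_homeo (Y Q : topologicalType) (e : V -> Y) e' (phi : Q -> Y) (psi : Y -> Q) :
  chart e e' -> continuous phi -> continuous psi -> cancel phi psi -> cancel psi phi ->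
  chart (psi \o e) (e' \o phi).
Proof.
move=> [ce eK pe oe] cphi cpsi phiK psiK; split.
- exact: (cnt_comp ce cpsi).
- by move=> v; rewrite /= psiK eK.
- move=> W k ck kr; apply: (pe W (fun w => phi (k w))); first exact: (cnt_comp ck cphi).
  by move=> w; have [v _ <-] := kr w; exists v => //=; rewrite psiK.
- move=> S oS; have -> : (psi \o e) @` S = phi @^-1` (e @` S).
    apply/seteqP; split=> [_ [v Sv <-]|q [v Sv vq]]; first by exists v => //=; rewrite psiK.
    by exists v => //=; rewrite vq phiK.
  by apply: open_comp; [move=> q _; exact: cphi|exact: oe].
Qed.

(** The chart is precomposed with the homeomorphism [phi] from the whole space onto the ball of
    square radius [r] about [v], for which [sqnorm (phi w - v)] is
    [r * sqnorm w / (1 + sqnorm w)]. *)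
Lemma chart_near (Y : topologicalType) (e : V -> Y) e' v A : chart e e' -> nbhs (e v) A ->
  exists (c : V -> Y) c' w, [/\ chart c c', c w = e v & range c `<=` A].
Proof.
move=> [ce eK pe oe] nA; have [r r0 rA] := ball_nbhs (ce v A nA).
have q0 (w : V) : 0 < 1 + sqnorm w by rewrite ltr_wpDr ?sqnorm_ge0.
pose phi (w : V) : V := v + Num.sqrt (r / (1 + sqnorm w)) *: w.
pose phi' (x : V) : V := (Num.sqrt (r - sqnorm (x - v)))^-1 *: (x - v).
have pv w : phi w - v = Num.sqrt (r / (1 + sqnorm w)) *: w by rewrite /phi addrAC subrr add0r.
have sq w : sqnorm (phi w - v) = r * sqnorm w / (1 + sqnorm w).
  by rewrite pv sqnormZ sqr_sqrtr; [ring|rewrite divr_ge0 ?ltW].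
have sqr' w : r - sqnorm (phi w - v) = r / (1 + sqnorm w).
  by rewrite sq; field; rewrite gt_eqF.
have phiK w : phi' (phi w) = w.
  rewrite /phi' sqr' pv scalerA mulVf ?scale1r //.
  by rewrite sqrtr_eq0 -ltNge divr_gt0.
have rng : range (e \o phi) = e @` [set w | sqnorm (w - v) < r].
  apply/seteqP; split=> [_ [w _ <-]|_ [x /= xr <-]].
    exists (phi w) => //=; rewrite -subr_gt0 sqr'; exact: divr_gt0.
  exists (phi' x) => //=; congr e.
  have s0 : 0 < r - sqnorm (x - v) by rewrite subr_gt0.
  have sn : Num.sqrt (r - sqnorm (x - v)) != 0 by rewrite sqrtr_eq0 -ltNge.
  have E : 1 + sqnorm (phi' x) = r / (r - sqnorm (x - v)).
    by rewrite /phi' sqnormZ exprVn sqr_sqrtr ?ltW //; field; rewrite gt_eqF.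
  have E2 : r / (1 + sqnorm (phi' x)) = r - sqnorm (x - v).
    by rewrite E; field; rewrite !gt_eqF.
  by rewrite /phi E2 /phi' scalerA divff // scale1r addrC subrK.
have csq (T : topologicalType) (f : T -> R) : continuous f -> continuous (fun t => Num.sqrt (f t)).
  by move=> cf; apply: (cnt_comp cf); exact: sqrt_continuous.
exists (e \o phi), (phi' \o e'), 0; split.
- apply: chart_intro.
  + apply: (cnt_comp _ ce); apply: cntD; first exact: cnt_cst.
    apply: cntZ; last exact: cnt_id.
    apply: csq; apply: cntM; first exact: cnt_cst.
    apply: cntV; first by move=> w; rewrite gt_eqF.
    by apply: cntD; [exact: cnt_cst|apply: sqnorm_cont; exact: cnt_id].
  + by move=> w; rewrite /= eK phiK.
  + by rewrite rng; apply: oe; exact: sqball_open.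
  + rewrite rng => W k ck kr.
    have ck' : continuous (fun w => e' (k w)).
      by apply: pe => // w; have [x _ <-] := kr w; exists x.
    have cd : continuous (fun w => e' (k w) - v) by apply: cntB => //; exact: cnt_cst.
    apply: cntZ => //; apply: cntV.
      move=> w; have [x xr <-] := kr w; rewrite eK sqrtr_eq0 -ltNge subr_gt0 //.
    by apply: csq; apply: cntB; [exact: cnt_cst|exact: sqnorm_cont].
- by rewrite /= /phi scaler0 addr0.
- by rewrite rng => _ [w wr <-]; exact: rA.
Qed.
End ChartTools.

Section MfdGlued.
Variables (R : realType) (d : nat) (M1 M2 Q : topologicalType).
Local Notation V := 'rV[R]_d.
Variables (e1 : V -> M1) (e1' : M1 -> V) (e2 : V -> M2) (e2' : M2 -> V) (j1 : M1 -> Q) (j2 : M2 -> Q).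
Hypotheses (c1 : chart e1 e1') (c2 : chart e2 e2') (m1 : mfd R d M1) (m2 : mfd R d M2).
Hypothesis gl : glued e1 e2 j1 j2.

Lemma mfd_handle (M : topologicalType) (n : M) (a : M -> Q) a' y : mfd R d M -> handle n a a' ->
  y <> n -> exists e e' (v : V), chart e e' /\ e v = a y.
Proof.
move=> [hM /(_ y)[e [e' [v [ch ev]]]]] ha yn.
have nn : nbhs (e v) (~` [set n]).
  by rewrite ev; apply: open_nbhs_nbhs; split; [exact: open_punct|].
have [c [c' [w [cc cw cn]]]] := chart_near ch nn.
exists (a \o c), (c' \o a'), w; split; last by rewrite /= cw ev.
by apply: (chart_handle ha cc) => u; apply: cn; exists u.
Qed.

Lemma mfd_glued : mfd R d Q.
Proof.
split; first by apply: (glued_hausdorff c1 c2 _ _ gl); [case: m1|case: m2].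
move=> q; have [h1 _] := m1; have [h2 _] := m2.
have [a' ha] := amap_handle c1 c2 h1 gl (e1 0).
have [b' hb] := amap_handle c2 c1 h2 (glued_sym gl) (e2 0).
by have [[y yn <-]|[z zn <-]] := amap_cover e1' e2' gl q; apply: mfd_handle; eauto.
Qed.
End MfdGlued.

(** A base map on the image is pulled back along [a]; this is where the quantification over all base
    maps in [Sprop] is needed. *)
Lemma Sprop_embed (R : realType) (M Q : topologicalType) (n : M) (a : M -> Q) a' ms O z : handle n a a' ->
  O `<=` ~` [set n] -> O z -> Sprop R ms O z -> Sprop R ms (a @` O) (a z).
Proof.
move=> [pa aK pa' _] On Oz S X x0 g pg m r Hr.
pose g' y := g (a y).
have pO : pcont O a by exact: pcont_sub pa.
have pO' : pcont (a @` O) a'.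
  by apply: pcont_sub pa' => _ [y Oy <-]; exists y => //; exact: On.
have pg' : pcont O g'.
  move=> W k ck kO; apply: (pg W (fun w => a (k w))); first exact: pO.
  by move=> w; exists (k w).
have aK' y : O y -> a' (a y) = y by move=> /On; exact: aK.
have zO : [set z] `<=` O by move=> _ ->.
have azO : [set a z] `<=` a @` O by move=> _ ->; exists z.
apply: (iffLR (@hp_embed R X x0 M Q g' g a a' O [set z] (a @` O) [set a z] m _ _ _ _ _ _ _ _ _ _ _ _)) => //.
- by move=> _ [y Oy <-]; rewrite aK'.
- by move=> _ [y Oy <-]; rewrite aK'.
- by move=> _ ->.
- by move=> _ ->; rewrite aK'.
apply: S => // i im.
apply: (iffRL (@hp_embed R X x0 M Q g' g a a' [set z] set0 [set a z] set0 i _ _ _ _ _ _ _ _ _ _ _ _)) (Hr i im) => //.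
- exact: pcont_sub pO.
- exact: pcont_sub pO'.
- by move=> y /zO; exact: aK'.
- by move=> _ ->; rewrite aK'.
- by move=> _ ->.
- by move=> _ ->; rewrite aK'.
Qed.

Lemma hausdorff_pair (A B : topologicalType) : hausdorff_space A -> hausdorff_space B ->
  hausdorff_space (A * B)%type.
Proof.
rewrite !open_hausdorff => hA hB [x1 x2] [y1 y2] xy.
have [E1|n1] := eqVneq x1 y1.
  have n2 : x2 != y2 by apply: contra_neq xy => E2; rewrite E1 E2.
  have [[S T] /= [Sx Ty] [oS oT /eqP ST]] := hB _ _ n2.
  exists (snd @^-1` S, snd @^-1` T) => /=.
    by split; apply/mem_set; [exact: set_mem Sx|exact: set_mem Ty].
  split; [by apply: open_comp => // z _; exact: cvg_snd|by apply: open_comp => // z _; exact: cvg_snd|].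
  by rewrite -preimage_setI ST preimage_set0.
have [[S T] /= [Sx Ty] [oS oT /eqP ST]] := hA _ _ n1.
exists (fst @^-1` S, fst @^-1` T) => /=.
  by split; apply/mem_set; [exact: set_mem Sx|exact: set_mem Ty].
split; [by apply: open_comp => // z _; exact: cvg_fst|by apply: open_comp => // z _; exact: cvg_fst|].
by rewrite -preimage_setI ST preimage_set0.
Qed.

Section CollarOuter.
Variables (R : realType) (d : nat) (M1 M2 Q : topologicalType).
Local Notation V := 'rV[R]_d.
Variables (e1 : V -> M1) (e1' : M1 -> V) (e2 : V -> M2) (e2' : M2 -> V) (j1 : M1 -> Q) (j2 : M2 -> Q).
Hypotheses (c1 : chart e1 e1') (c2 : chart e2 e2') (hM1 : hausdorff_space M1) (hM2 : hausdorff_space M2).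
Hypothesis gl : glued e1 e2 j1 j2.
Let A := amap e1 e1' e2 j1 j2.
Let B := amap e2 e2' e1 j2 j1.

(** One region described from both summands: the outside of a ball in [M1] is everything in the sum
    except the part of [M2] beyond the collar. Inversion turns the radius [r^-1] into [r]. *)
Lemma collar_outer r : 0 < r ->
  A @` outer e1 0 r^-1 = collar B e2 [set w | sqnorm w <= r].
Proof.
move=> r0; have e1K v : e1' (e1 v) = v by case: c1.
have e2K v : e2' (e2 v) = v by case: c2.
have ri : 0 < r^-1 by rewrite invr_gt0.
apply/seteqP; split=> [_ [y yo <-] [z zr E]|q qc].
  have yn : y <> e1 0 by move=> yn; apply: yo; exists 0 => //=; rewrite subrr sqnorm0.
  have zn : z <> e2 0 by move=> zn; apply: zr; exists 0 => //=; rewrite sqnorm0 ltW.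
  have [v v0 [yE zE]] := amap_overlap c1 c2 gl yn zn (esym E).
  apply: yo; exists v => //=; rewrite subr0 ltNge; apply/negP => rv.
  apply: zr; exists (sinv v) => //=; rewrite sqnorm_sinv //.
  by rewrite -[leRHS]invrK lef_pV2 ?posrE // sqnorm_pos.
have inner v : v <> 0 -> A (e1 v) = q -> outer e1 0 r^-1 (e1 v).
  move=> v0 E [w /= wr /(congr1 e1')]; rewrite !e1K => wv.
  apply: qc; exists (e2 (sinv v)); last by rewrite -E; apply/esym/amap_bmap.
  move=> [w' /= w'r /(congr1 e2')]; rewrite !e2K => w'v.
  move: w'r; rewrite w'v sqnorm_sinv // leNgt; move/negP; apply.
  by rewrite -[ltLHS]invrK ltf_pV2 ?posrE ?sqnorm_pos // -wv; move: wr; rewrite subr0.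
have [[y yn E]|[z zn E]] := amap_cover e1' e2' gl q.
  have [[v _ vy]|nr] := pselect (range e1 y).
    have v0 : v <> 0 by move=> v0; apply: yn; rewrite -vy v0.
    by exists y => //; rewrite -vy; apply: inner => //; rewrite vy.
  by exists y => // -[w _ wy]; apply: nr; exists w.
have zf : (e2 @` [set w | sqnorm w <= r]) z by apply: contrapT => zf; apply: qc; exists z.
have [w /= wr wz] := zf.
have w0 : w <> 0 by move=> w0; apply: zn; rewrite -wz w0.
have E' : A (e1 (sinv w)) = q.
  rewrite -E -wz -{2}(sinvK w0); apply: (amap_bmap c1 c2 gl); exact: sinv_neq0.
by exists (e1 (sinv w)) => //; apply: inner => //; exact: sinv_neq0.
Qed.
End CollarOuter.

(** * Induction on the summands *)

(** The induction invariant: punctured anywhere, the manifold behaves as if built from one point and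
    cells of the dimensions listed in [ms]. *)
Definition Good (R : realType) d ms (Y : topologicalType) :=
  [/\ mfd R d Y, all (leq 2) ms & forall y z : Y, y <> z -> Sprop R ms (~` [set y]) z].

(** The conclusion for some base point [z]: [a n] is the rank in degree [n] of the loops at [z]. It
    is kept apart from [Good], since inertness comes only from a handle that was attached last. *)
Definition Loop (R : realType) d ms (X : topologicalType) := exists (z : X) (a : nat -> nat),
  [/\ forall n, hp R z id n [set z] set0 (a n), a 0%N = 1%N &
    forall n, (a n.+1 + shift_rank a d n.+3)%N = ssum a ms n.+2].

Section SphereHandle.
Variables (R : realType) (p q : nat).
Local Notation N1 := (sphere R p).
Local Notation N2 := (sphere R q).
Local Notation N := (N1 * N2)%type.

Lemma N_hausdorff : hausdorff_space N.
Proof. by apply: hausdorff_pair; exact: sphere_hausdorff. Qed.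

Lemma N_compact (a : N) : compact [set: N].
Proof.
rewrite -setXTT; apply: compact_setX; [exact: (sphere_compact a.1)|exact: (sphere_compact a.2)].
Qed.

Lemma N_mfd : mfd R (p + q) N.
Proof.
split=> [|[a1 a2]]; first exact: N_hausdorff.
have [b1 [f1 [g1 [f1' [g1' [_ cg1 _ _ [_ g10 _]]]]]]] := sphere_charts a1.
have [b2 [f2 [g2 [f2' [g2' [_ cg2 _ _ [_ g20 _]]]]]]] := sphere_charts a2.
exists (prodc g1 g2), (prodc' g1' g2'), 0; split; first exact: chart_prod.
by rewrite /prodc !linear0 g10 g20.
Qed.

Variables (X : topologicalType).
Variables (a1 b1 : N1) (f1 g1 : 'rV[R]_p -> N1) (f1' g1' : N1 -> 'rV[R]_p).
Variables (a2 b2 : N2) (f2 g2 : 'rV[R]_q -> N2) (f2' g2' : N2 -> 'rV[R]_q).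
Hypotheses (t1 : two_charts a1 b1 f1 g1 f1' g1') (t2 : two_charts a2 b2 f2 g2 f2' g2').
Variables (b : N -> X) (b' : X -> N).
Hypotheses (hb : handle (a1, a2) b b') (mX : mfd R (p + q) X) (p2 : (2 <= p)%N) (q2 : (2 <= q)%N).
Variables (u : 'rV[R]_p) (v : 'rV[R]_q).
Hypotheses (u0 : u <> 0) (v0 : v <> 0).
Variable ms : seq nat.
Hypothesis ms2 : all (leq 2) ms.
Hypothesis S0 : Sprop R ms (collar b (hchart g1 g2) setT) (hpt g1 g2 b u v).

Let hX : hausdorff_space X. Proof. by case: mX. Qed.
Let hN := N_hausdorff.
Let cN := N_compact (a1, a2).
Let z := hpt g1 g2 b u v.
Let top := htop b1 b2 b.

(** [S0] concerns what lies outside the handle, with a collar added; the two cells of the handle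
    then contribute their dimensions [p] and [q]. *)
Lemma handle_Sprop : Sprop R (q :: p :: ms) (~` [set top]) z.
Proof.
move=> Z x0 g pg n a Ha; rewrite /ssum !big_cons -/(ssum a ms n).
have s1 : collar b (hchart g1 g2) setT `<=` hA1 b2 b.
  by rewrite -(A01 t1 t2 hb); left.
have s2 : hA1 b2 b `<=` ~` [set top] by rewrite -(A12 t1 t2 hb); left.
rewrite addnC; apply: (step2 t1 t2 hN cN hb hX u0 v0) => //.
  rewrite addnC; apply: (step1 t1 t2 hN cN hb hX u0 v0) => //.
  - exact: pcont_sub pg.
  - by apply: S0 => //; apply: pcont_sub pg; exact: subset_trans s2.
  - by move=> pn; apply: Ha; lia.
by move=> qn; apply: Ha; lia.
Qed.

Let base y : y <> (a1, a2) -> z = b y -> y = (g1 u, g2 v).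
Proof.
move=> yn; rewrite /z /hpt /hchart /prodc row_mxKl row_mxKr => E.
have gn : (g1 u, g2 v) <> (a1, a2).
  have [_ [_ K _ _] _ _ [_ g0 _]] := t1.
  by move=> [/(congr1 g1')]; rewrite -g0 !K => /u0.
by have [_ bK _ _] := hb; rewrite -(bK _ yn) -E bK.
Qed.

Let ab1 : a1 <> b1.
Proof.
have [_ _ r _ [f0 _ _]] := t1; have : range f1 (f1 0) by [].
by rewrite r f0 => /nesym.
Qed.
Let ab2 : a2 <> b2.
Proof.
have [_ _ r _ [f0 _ _]] := t2; have : range f2 (f2 0) by [].
by rewrite r f0 => /nesym.
Qed.
Let g1b : g1 u <> b1.
Proof. by have [_ _ _ r _] := t1; have : range g1 (g1 u) by []; rewrite r. Qed.
Let g2b : g2 v <> b2.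
Proof. by have [_ _ _ r _] := t2; have : range g2 (g2 v) by []; rewrite r. Qed.
Let z1 y : y.1 = b1 -> z <> b y.
Proof.
move=> y1 /(base _) H; apply: g1b; rewrite -y1 H // => yn; apply: ab1.
by rewrite -y1 yn.
Qed.
Let z2 y : y.2 = b2 -> z <> b y.
Proof.
move=> y1 /(base _) H; apply: g2b; rewrite -y1 H // => yn; apply: ab2.
by rewrite -y1 yn.
Qed.

Lemma handle_good : Good R (p + q) (q :: p :: ms) X.
Proof.
have ms2' : all (leq 2) (q :: p :: ms) by rewrite /= q2 p2.
split=> // y y' yy.
have S := handle_Sprop; have tz : top <> z by move=> /esym; exact: z1.
have ms1 : all (leq 1) (q :: p :: ms) by apply: sub_all ms2' => i; exact: ltnW.
(* The dimension is put in successor form, as [Sprop_all] requires. *)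
case: (p) p2 mX => // p' _ mX' in S tz ms1 *.
exact: (Sprop_all mX' ms1 tz S).
Qed.

(** The puncture is the centre [top] of the last cell. The map needed for inertness comes from
    [squeeze_map], with the inclusion of the sphere in its vector space measuring distances. *)
Lemma handle_loop : Loop R (p + q) (q :: p :: ms) X.
Proof.
have ms2' : all (leq 2) (q :: p :: ms) by rewrite /= q2 p2.
have [rho [W [D [[cr oW Wn rW] [oD Db Da rD rb]]]]] :=
  @squeeze_map R q N2 a2 b2 f2 g2 f2' g2' t2 (@sphere_hausdorff R q) N1 p.+1 (\val : N1 -> _) a1 b1
    (@initial_continuous _ _ _) val_inj ab1.
have cl : closed [set b1].
  by apply: compact_closed; [exact: sphere_hausdorff|exact: compact_set1].
exists z; apply: (@hp_loop_rec R X z (~` [set top]) (q :: p :: ms) (p + q)).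
- by move=> /=; exact: z1.
- move=> n c cz c0; apply: (handle_inert hN cN hb hX cr oW Wn rW oD Db Da rD rb (nesym ab2) cl z2 z1) => //.
- by move=> n a Ha; apply: handle_Sprop => //; apply: cont_pcont; exact: cnt_id.
- by move=> n a Ha; apply: (top_cell t1 t2 hb hX u0 v0) => //; apply: cont_pcont; exact: cnt_id.
- exact: ms2'.
- lia.
Qed.
End SphereHandle.

Section Induction.
Variable R : realType.

Lemma sqnorm_const d (t : R) : sqnorm (const_mx t : 'rV[R]_d) = d%:R * t ^+ 2.
Proof.
by rewrite /sqnorm (eq_bigr (fun=> t ^+ 2)) ?sumr_const ?card_ord ?mulr_natl // => i _; rewrite mxE.
Qed.

Lemma const_neq0 d (t : R) : (0 < d)%N -> t != 0 -> (const_mx t : 'rV[R]_d) <> 0.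
Proof. by case: d => // d _ t0 /rowP /(_ ord0); rewrite !mxE; apply/eqP. Qed.

Lemma small_const d (s : R) : (0 < d)%N -> 0 < s -> exists2 t : R, t != 0 & d%:R * t ^+ 2 = s.
Proof.
move=> d0 s0; have dp : 0 < d%:R :> R by rewrite ltr0n.
exists (Num.sqrt (s / d%:R)); first by rewrite sqrtr_eq0 -ltNge divr_gt0.
by rewrite sqr_sqrtr ?divr_ge0 ?ltW // mulrC divfK // gt_eqF.
Qed.

Lemma homeo_refl (X : topologicalType) : homeomorphic X X.
Proof. by exists id, id; split=> //; exact: cnt_id. Qed.

Lemma homeo_trans (X Y Z : topologicalType) : homeomorphic X Y -> homeomorphic Y Z -> homeomorphic X Z.
Proof.
move=> [f [g [cf cg fK gK]]] [h [k [ch ck hK kK]]]; exists (h \o f), (g \o k); split.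
- exact: (cnt_comp cf ch).
- exact: (cnt_comp ck cg).
- by move=> x; rewrite /= hK fK.
- by move=> x; rewrite /= gK kK.
Qed.

(** A single product is a handle with nothing outside: the collar is then the chart about the
    puncture itself, which is contractible, so the list of cells starts empty. *)
Lemma base_step (p q : nat) (X : topologicalType) : (2 <= p)%N -> (2 <= q)%N ->
  homeomorphic X (sphere R p * sphere R q)%type -> Good R (p + q) [:: q; p] X /\ Loop R (p + q) [:: q; p] X.
Proof.
move=> p2 q2 [phi [psi [cphi cpsi phiK psiK]]].
have pt d : sphere R d.
  have h : sqnorm (cns 1 0 : 'rV[R]_d.+1) = 1 by rewrite sq_cns sqnorm0 expr1n addr0.
  exact: (SigSub (mem_set h)).
have [b1 [f1 [g1 [f1' [g1' t1]]]]] := sphere_charts (pt p).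
have [b2 [f2 [g2 [f2' [g2' t2]]]]] := sphere_charts (pt q).
have mX : mfd R (p + q) X.
  split; first by apply: (hausdorff_inj cphi); [exact: can_inj phiK|exact: N_hausdorff].
  move=> x; have [_ /(_ (phi x))[e [e' [v [ch ev]]]]] := @N_mfd R p q.
  exists (psi \o e), (e' \o phi), v; split; first exact: chart_homeo.
  by rewrite /= ev phiK.
have hb : handle (pt p, pt q) psi phi.
  split=> //; [exact: cont_pcont|exact: cont_pcont|move=> S oS _].
  have -> : psi @` S = phi @^-1` S.
    by apply/seteqP; split=> [_ [v Sv <-]|x Sx] /=; [rewrite psiK|exists (phi x)].
  by apply: open_comp => // x _; exact: cphi.
have u0 : (const_mx 1 : 'rV[R]_p) <> 0 by apply: const_neq0; rewrite ?oner_neq0 //; lia.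
have v0 : (const_mx 1 : 'rV[R]_q) <> 0 by apply: const_neq0; rewrite ?oner_neq0 //; lia.
have cc := chart_homeo (hchartP t1 t2) cphi cpsi phiK psiK.
have CE : collar psi (hchart g1 g2) setT = range (psi \o hchart g1 g2).
  apply/seteqP; split=> [x xc|_ [w _ <-] [y yr /(can_inj psiK) yw]].
    apply: contrapT => nx; apply: xc; exists (phi x); last exact: phiK.
    by move=> [w _ wx]; apply: nx; exists w => //=; rewrite wx phiK.
  by apply: yr; rewrite yw; exists w.
have S0 : Sprop R [::] (collar psi (hchart g1 g2) setT) (hpt g1 g2 psi (const_mx 1) (const_mx 1)).
  move=> Z x0 g pg n a _; rewrite /ssum big_nil CE; apply: acyc_hr0.
  have [ch hK ph _] := cc.
  by apply: (@chart_star R X Z x0 g _ _ _ ch ph hK _ setT) => //; rewrite -CE.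
have ms2 : all (leq 2) [::] by [].
split; first exact: (handle_good t1 t2 hb mX p2 q2 u0 v0 ms2 S0).
exact: (handle_loop t1 t2 hb mX p2 q2 u0 v0 ms2 S0).
Qed.

(** By [collar_outer], the collar in the gluing chart [f] is [Y] minus a ball, where the invariant
    for [Y] applies; [collar_compare] passes to the collar in the product chart, which the handle
    lemmas require. *)
Lemma csum_step (p q : nat) ms (Y X : topologicalType) : (2 <= p)%N -> (2 <= q)%N ->
  Good R (p + q) ms Y -> is_csum R (p + q) Y (sphere R p * sphere R q)%type X ->
  Good R (p + q) (q :: p :: ms) X /\ Loop R (p + q) (q :: p :: ms) X.
Proof.
move=> p2 q2 [mY ms2 SY] [e [f [oe opf [phi [psi [cphi cpsi phiK psiK]]]]]].
have [e' ce] := chart_of oe; have [f' cf] := chart_of opf.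
have ei : injective e by case: oe.
have fi : injective f by case: opf.
have d0 : (0 < p + q)%N by lia.
have p0 : (0 < p)%N by lia.
have q0 : (0 < q)%N by lia.
(* A point of [X] is needed as default value of the maps to come; a vector of square norm 1 lies
   outside the removed open disc. *)
have [x0 _] : exists x : X, True.
  have [t _ t1] : exists2 t : R, t != 0 & (p + q)%:R * t ^+ 2 = 1 by exact: small_const.
  have h : disc_complement e (e (const_mx t)).
    by move=> [w /= w1 /ei wE]; move: w1; rewrite wE sqnorm_const t1 ltxx.
  exists (psi ((\pi_({eq_quot (@csum_rel R (p + q) Y _ e f)})
    (existT (csum_piece e f) true (SigSub (mem_set h))))%qT)) => //.
have [j1 [j2 gl]] := csum_glued ei fi cphi cpsi phiK psiK x0.
have hY : hausdorff_space Y by case: mY.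
have hN := @N_hausdorff R p q.
have [a' ha] := amap_handle ce cf hY gl (e 0).
have [b' hb] := amap_handle cf ce hN (glued_sym gl) (f 0).
have mX := mfd_glued ce cf mY (@N_mfd R p q) gl.
have hX : hausdorff_space X by case: mX.
set A := amap e e' f j1 j2 in ha; set B := amap f f' e j2 j1 in hb.
case En : (f 0) hb => [a1 a2] hb.
have [b1 [f1 [g1 [f1' [g1' t1]]]]] := sphere_charts a1.
have [b2 [f2 [g2 [f2' [g2' t2]]]]] := sphere_charts a2.
have cN := N_compact (a1, a2).
have cH := hchartP t1 t2; have H0 := hchart0 t1 t2.
have [r [r0 sub ac]] := collar_compare hb hN cN hX cf cH En H0.
(* The base point must have the product form [hpt] and also lie in the smaller collar taken with
   respect to [f]; small constant vectors achieve both. *)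
have [s /andP[s0 _] sP] := ball_shrink cH cf H0 En r0.
have [t tn tE] := small_const d0 s0.
pose u : 'rV[R]_p := const_mx t; pose v : 'rV[R]_q := const_mx t.
have u0 : u <> 0 by exact: const_neq0.
have v0 : v <> 0 by exact: const_neq0.
have uvE : row_mx u v = const_mx t by exact: row_mx_const.
have [x /= xr xE] : (f @` [set w | sqnorm w <= r]) (hchart g1 g2 (row_mx u v)).
  by apply: sP; exists (row_mx u v) => //=; rewrite uvE sqnorm_const tE.
have x0' : x <> 0.
  move=> xz; have : hchart g1 g2 (row_mx u v) = hchart g1 g2 0 by rewrite -xE xz En H0.
  move=> /(congr1 (hchart' g1' g2')); case: cH => _ K _ _; rewrite !K uvE.
  exact: const_neq0.
have ri : 0 < r^-1 by rewrite invr_gt0.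
pose z0 := e (sinv x).
have z0n : e 0 <> z0 by move=> /ei /esym; exact: sinv_neq0.
have zo : outer e 0 r^-1 z0.
  move=> [w /= wr /ei wE]; move: wr; rewrite subr0 wE sqnorm_sinv // ltNge.
  by rewrite lef_pV2 ?posrE ?sqnorm_pos // xr.
have zE : A z0 = hpt g1 g2 B u v.
  rewrite /hpt -xE /A /z0 (amap_bmap ce cf gl) ?sinvK //; exact: sinv_neq0.
have S1 : Sprop R ms (outer e 0 r^-1) z0 by apply/(Sprop_outer ce hY _ ri zo); exact: SY.
have S2 := Sprop_embed ha (outer_not ri) zo S1.
have S0 : Sprop R ms (collar B (hchart g1 g2) setT) (hpt g1 g2 B u v).
  move=> Z y0 g pg n a Ha; rewrite -zE in Ha *.
  have CO : A @` outer e 0 r^-1 = collar B f [set w | sqnorm w <= r] by exact: collar_outer.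
  have zc : [set A z0] `<=` collar B f [set w | sqnorm w <= r].
    by rewrite -CO => _ ->; exists z0.
  apply: (iffLR (hp_left n _ zc sub (ac Z y0 g pg))); rewrite -CO; apply: S2 => //.
  by apply: pcont_sub pg; rewrite CO.
split; first exact: (handle_good t1 t2 hb mX p2 q2 u0 v0 ms2 S0).
exact: (handle_loop t1 t2 hb mX p2 q2 u0 v0 ms2 S0).
Qed.

(** The hypothesis on [M] covers every space homeomorphic to it, as sums are only given up to
    homeomorphism. The cell list is determined up to permutation, each step adding its pair in
    front. *)
Lemma csum_chain (d : nat) (pqs : seq (nat * nat)) ms (M X : topologicalType) :
  (forall pq, pq \in pqs -> [/\ (2 <= pq.1)%N, (2 <= pq.2)%N & (pq.1 + pq.2)%N = d]) ->
  (forall Y, homeomorphic Y M -> Good R d ms Y /\ Loop R d ms Y) ->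
  is_csum_from R d M [seq ((sphere R pq.1 * sphere R pq.2)%type : topologicalType) | pq <- pqs] X ->
  exists ms', [/\ perm_eq ms' (ms ++ flatten [seq [:: pq.1; pq.2] | pq <- pqs]), Good R d ms' X & Loop R d ms' X].
Proof.
elim: pqs ms M => [|[p q] pqs IH] ms M Hd HM /=.
  by move=> /HM[G L]; exists ms; rewrite cats0.
move=> [Y sY XY]; have [p2 q2 pq] := Hd (p, q) (mem_head _ _); rewrite /= in p2 q2 pq.
have [||ms' [pm G L]] := IH (q :: p :: ms) Y _ _ XY.
- by move=> pq' h; apply: Hd; rewrite inE h orbT.
- move=> Z ZY; have [GM _] := HM M (homeo_refl M); rewrite -pq in GM sY *.
  apply: csum_step GM _ => //; have [e [f [oe opf h]]] := sY.
  by exists e, f; split=> //; exact: homeo_trans h.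
exists ms'; split=> //; apply: (perm_trans pm).
by apply/permP => P; rewrite /= !count_cat /=; lia.
Qed.
End Induction.

(** * Comparison with singular homology and with the loop space *)

Section Compare.
Variables (R : realType) (L : topologicalType) (n : nat).
Local Notation C := {freeg (Sx R L) / int}.

(** Extraction of the component of degree [m], by a decidable comparison of dimensions and a cast;
    it is inverse to [inC] on chains of that degree. *)
Definition exS m (s : Sx R L) : chain R L m :=
  if (projT1 s =P m) is ReflectT e then << (ecast k (singular_simplex R L k) e (projT2 s)) >> else 0.

Lemma exS_id m (s : singular_simplex R L m) : exS m (existT _ m s) = << s >>.
Proof. by rewrite /exS; case: eqP => //= e; rewrite eq_axiomK. Qed.

Definition exC m : C -> chain R L m := fglift (@exS m).
HB.instance Definition _ m := GRing.Additive.on (@exC m).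

Lemma inCK m (c : chain R L m) : exC m (inC c) = c.
Proof.
apply: (@fg_ext _ _ (@exC m \o @inC R L m) idfun) => s /=.
by rewrite /inC fgliftU /exC fgliftU exS_id.
Qed.

Lemma inC_supp m (c : chain R L m) : supp (sP m (setT : set L)) (inC c).
Proof. by apply: (@fglift_supp _ _ setT) => // s _; exact: suppU. Qed.

Lemma exCK m (c : C) : supp (sP m (setT : set L)) c -> inC (exC m c) = c.
Proof.
move=> cm; apply: (@fg_ext_supp _ _ _ (@inC R L m \o @exC m) idfun _ cm) => -[k s] [/= km _].
by move: s; rewrite km => s; rewrite /exC fgliftU exS_id /inC fgliftU.
Qed.

Lemma bd_inC m (c : chain R L m.+1) : bd (inC c) = inC (boundary c).
Proof.
apply: (@fg_ext _ _ (@bd R L \o @inC R L m.+1) (@inC R L m \o @boundary R L m)) => s /=.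
by rewrite /inC fgliftU bdU /boundary fgliftU.
Qed.

Lemma bd_inC0 (c : chain R L 0) : bd (inC c) = 0.
Proof.
by apply: (@fg_ext _ _ (@bd R L \o @inC R L 0) \0) => s /=; rewrite /inC fgliftU bdU0.
Qed.

Lemma supp_empty m (c : C) : supp (sP m (set0 : set L)) c -> c = 0.
Proof.
apply: (@supp_sub _ _ [set 0]); first by split=> // x y -> ->; rewrite subrr.
by move=> s sA; have [] := @hat_range R L s _ sA.2 0.
Qed.

Lemma cycle_bd m (c : chain R L m) : @is_cycle R L m c -> bd (inC c) = 0.
Proof.
by case: m c => [|m] c; [rewrite bd_inC0|move=> /eqP c0; rewrite bd_inC c0 raddf0].
Qed.

Definition piH (z : cycles R L n) : homology R L n := (\pi_(Quotient.quot (@is_boundary R L n)) z)%qT.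
Fact piH_additive : zmod_morphism piH.
Proof. by move=> x y; rewrite /piH Quotient.pi_add Quotient.pi_opp. Qed.
HB.instance Definition _ := GRing.isZmodMorphism.Build (cycles R L n) (homology R L n) piH piH_additive.

Lemma piH0 z : piH z = 0 <-> z \in @is_boundary R L n.
Proof.
rewrite -{2}[z]subr0 Quotient.idealrBE; split=> [h|/eqP h].
  by apply/eqP; rewrite -/(piH z) h -/(piH 0) raddf0.
by rewrite /piH h -/(piH 0) raddf0.
Qed.

Definition cyc_in (z : cycles R L n) : C := inC (\val z).
Fact cyc_in_additive : zmod_morphism cyc_in.
Proof. by move=> x y; rewrite /cyc_in !raddfB. Qed.
HB.instance Definition _ := GRing.isZmodMorphism.Build (cycles R L n) C cyc_in cyc_in_additive.

(** Two comparisons: the quotient map from cycles to homology, and the inclusion of cycles in the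
    chains of all degrees. Pairs with empty second member give absolute homology, since no simplex
    has empty range. *)
Lemma homology_rank r : has_rank (homology R L n) r <-> hr R n (setT : set L) set0 r.
Proof.
have s0 (H : zmodType) : subgroup [set 0 : H] by split=> // x y -> ->; rewrite subrr.
apply: (iff_trans (B := has_srank (setT : set (homology R L n)) [set 0] r)).
  split=> -[[v vf] nv]; (split; [exists v|]).
  - by split=> // c /= c0; exact: vf.
  - by move=> w [_ H]; apply: (nv w) => c c0; exact: H.
  - by case: vf => _ H c c0; exact: H.
  - by move=> w wf; apply: (nv w); split=> // c /= c0; exact: wf.
apply: iff_sym; apply: (iff_trans (B := has_srank (setT : set (cycles R L n)) [set z | z \in @is_boundary R L n] r)).
  apply: iff_sym; apply: (@srank_iso _ _ cyc_in).
  - exact: relB_subgroup.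
  - move=> z _; apply: relZ_cycle; first exact: inC_supp.
    exact: (cycle_bd (valP z)).
  - by split.
  - move=> z _; split.
      move=> /asboolP[w wz]; rewrite /= /cyc_in -wz -bd_inC; apply: relB_bd; exact: inC_supp.
    move=> [w [u [wT uO E]]]; apply/asboolP; exists (exC n.+1 w).
    have u0 := supp_empty uO.
    by rewrite -(inCK (boundary _)) -bd_inC exCK // -[\val z]inCK -[inC (\val z)]/(cyc_in z) E u0 addr0.
  - move=> c [cT cO].
    have c0 : bd c = 0.
      case: (n) cT cO => [|m] cT cO; first by rewrite (bd_sP0 cT).
      exact: (supp_empty (@supp_bdS R L m setT set0 c (conj cT cO))).
    have cc : @is_cycle R L n (exC n c).
      case: (n) cT => [|m] cT //=; apply/eqP.
      by rewrite -(inCK (boundary _)) -bd_inC exCK // c0 raddf0.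
    exists (Sub (exC n c) cc) => //.
    rewrite /= /cyc_in SubK exCK // subrr; exact: (@relB_subgroup R L n setT set0).1.
apply: (@srank_iso _ _ piH) => //.
- by move=> z _; rewrite /= -piH0.
- by move=> h _; exists (repr h) => //=; rewrite /piH reprK subrr.
Qed.
End Compare.

Section LoopCompare.
Variables (R : realType) (X : topologicalType) (x0 : X).
Local Notation E := (totalT R X X).
Local Notation I := (unit_interval R).
Let D := pE R x0 id [set x0].

Let toE (l : loop_space R x0) : E := (x0, (l : {path I from x0 to x0 in X}) : I -> X).

Let DP e : D e -> [/\ continuous (e.2 : I -> X), e.2 zero = x0 & e.2 one = x0].
Proof. by move=> [-> ? ? ?]. Qed.

Let fromE (e : E) : loop_space R x0 := match pselect (D e) with
  | left h => let: And3 c p0 p1 := DP h in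
     (mk_path c p0 p1 : {path I from x0 to x0 in X})
  | right _ => (cst x0 : {path I from x0 to x0 in X}) end.

Let fromEE e : D e -> ((fromE e : {path I from x0 to x0 in X}) : I -> X) = e.2.
Proof. by rewrite /fromE; case: pselect => // h _; case: (DP h). Qed.

Let toE_D l : D (toE l).
Proof. by split=> //=; [exact: cts_fun|rewrite path_zero|rewrite path_one]. Qed.

(** The loop space carries the topology induced from the compact-open one, so it corresponds to the
    fibre over [x0], where the end point is constant and continuity is part of the condition. *)
Lemma loop_rank n r : hr R n (setT : set (loop_space R x0)) set0 r <-> hp R x0 id n [set x0] set0 r.
Proof.
apply: (@hr_transport R (loop_space R x0) E setT D toE fromE) => //.
- move=> W k t ck _ _ _; apply: cnt_pair; first exact: cnt_cst.
  by apply: (cnt_comp ck); exact: initial_continuous.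
- move=> W k t ck _ kD _; apply: continuous_comp_initial.
  rewrite (_ : _ \o _ = fun w => (k w).2); first exact: cnt_snd.
  by apply: funext => w; exact: fromEE.
- by move=> l _; apply/path_eqP => s; rewrite fromEE //; exact: toE_D.
- by move=> e De; rewrite /toE fromEE //; have [/= e1 _ _ _] := De; rewrite -e1 -surjective_pairing.
- exact: pE_mono.
- by move=> l _; exact: toE_D.
- by move=> e [].
Qed.
End LoopCompare.

Section BaseChange.
Variables (R : realType) (X : topologicalType).
Local Notation I := (unit_interval R).

Let rev_plot (x y : X) : @plot2 R (totalT R X X) (totalT R X X) (pE R x id [set y])
  (fun e _ => (x, fun s => e.2 (clampI (1 - ivl s)))).
Proof.
move=> W k t ck _ kD _; apply: cnt_pair; first exact: cnt_cst.
have cc : continuous (fun ws : W * I => (k ws.1).2 (clampI (1 - ivl ws.2))).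
  apply: (path_eval (k := fun ws : W * I => k ws.1) (s := fun ws : W * I => 1 - ivl ws.2)).
  - exact: (cnt_comp (cnt_fst (@cnt_id _)) ck).
  - apply: cntB; first exact: cnt_cst.
    exact: (cnt_comp (cnt_snd (@cnt_id _)) (@ivl_continuous R)).
  - by move=> w; have [] := kD w.1.
exact: (continuous_curry_fun cc).
Qed.

Let revf (x : X) (e : totalT R X X) : totalT R X X := (x, fun s => e.2 (clampI (1 - ivl s))).

Let rev_in (x y : X) e : pE R x id [set y] e -> pE R y id [set x] (revf x e).
Proof.
move=> [ey ec e0 e1]; split=> //=.
- apply: (path_eval (k := fun=> e) (s := fun s => 1 - ivl s)) => //; first exact: cnt_cst.
  by apply: cntB; [exact: cnt_cst|exact: ivl_continuous].
- by rewrite ivl0 subr0 clampI1 e1 ey.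
- by rewrite ivl1 subrr clampI0.
Qed.

Let revK (x y : X) e : pE R x id [set y] e -> revf y (revf x e) = e.
Proof.
case: e => z p [/= -> pc p0 p1]; congr (_, _); apply: funext => s /=.
have E : ivl (clampI (1 - ivl s)) = 1 - ivl s.
  rewrite /ivl /= clamp_id //; have /andP[s0 s1] := ivl_itv s.
  by rewrite subr_ge0 s1 lerBlDr lerDl s0.
by rewrite E opprB addrC subrK clampI_val.
Qed.

(** Running paths backwards exchanges the starting point with the end point. *)
Lemma hp_reverse (x y : X) n r : hp R x id n [set y] set0 r <-> hp R y id n [set x] set0 r.
Proof.
apply: (@hr_transport R _ _ (pE R x id [set y]) (pE R y id [set x]) (revf x) (revf y)) => //.
- exact: revK.
- exact: revK.
- by move=> e /rev_in.
- by move=> e /rev_in.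
- exact: pE_mono.
- exact: pE_mono.
- by move=> e /rev_in.
- by move=> e /rev_in.
- by move=> e [].
- by move=> e [].
Qed.

Variables (d : nat) (ms : seq nat).
Hypotheses (d0 : (0 < d)%N) (G : Good R d ms X).

(** A puncture [w] away from both end points is chosen among three points of a chart; the complement
    of [w] is connected by the invariant, so the end point can be moved from [x] to [y]. *)
Lemma hp_base_change (s x y : X) n r : hp R s id n [set x] set0 r <-> hp R s id n [set y] set0 r.
Proof.
have [[hX /(_ s)[e [e' [v [[_ eK _ _] ev]]]]] ms2 S] := G; have [mX _ _] := G.
have [w [wx wy]] : exists w, w <> x /\ w <> y.
  pose c (i : nat) : 'rV[R]_d := const_mx i%:R.
  have ne i j : i != j -> e (c i) <> e (c j).
    move=> ij /(congr1 e'); rewrite !eK => /rowP /(_ (Ordinal d0)).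
    by rewrite !mxE => /eqP; rewrite eqr_nat (negPf ij).
  have n01 : e (c 0%N) <> e (c 1%N) by exact: ne.
  have n02 : e (c 0%N) <> e (c 2%N) by exact: ne.
  have n12 : e (c 1%N) <> e (c 2%N) by exact: ne.
  have [E0|/eqP N0] := eqVneq (e (c 0%N)) x.
    have [E1|/eqP N1] := eqVneq (e (c 1%N)) y.
      by exists (e (c 2%N)); rewrite -E0 -E1; split; exact: nesym.
    by exists (e (c 1%N)); split=> //; rewrite -E0; exact: nesym.
  have [E0|/eqP N0'] := eqVneq (e (c 0%N)) y; last by exists (e (c 0%N)).
  have [E1|/eqP N1] := eqVneq (e (c 1%N)) x.
    by exists (e (c 2%N)); rewrite -E0 -E1; split; exact: nesym.
  by exists (e (c 1%N)); split=> //; rewrite -E0; exact: nesym.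
have ms1 : all (leq 1) ms by apply: sub_all ms2 => i; exact: ltnW.
have Sx := S w x wx.
have rb : base_equiv R (~` [set w]) x y.
  by apply: (Sprop_move_base mX ms1 _ Sx); [exact: open_punct|exact: nesym|exact: nesym].
by have [h _] := rb X s id (cont_pcont (@cnt_id _)) n r.
Qed.

(** Loops at [x] are compared with paths from [x] to [z], reversed into paths from [z] to [x], and
    then with loops at [z]; only end points are ever moved. *)
Lemma Loop_base (x : X) : Loop R d ms X -> exists a : nat -> nat,
  [/\ forall n, hp R x id n [set x] set0 (a n), a 0%N = 1%N &
    forall n, (a n.+1 + shift_rank a d n.+3)%N = ssum a ms n.+2].
Proof.
move=> [z [a [h a0 ar]]]; exists a; split=> // n.
by apply/(hp_base_change x z)/hp_reverse/(hp_base_change z z).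
Qed.
End BaseChange.

(** * From the recursion to the power series *)

Section Series.
Variable A : comNzRingType.
Implicit Types P Q : fps A.

Lemma fps_coefD P Q n : fps_coef (P + Q) n = fps_coef P n + fps_coef Q n. Proof. by []. Qed.
Lemma fps_coefN P n : fps_coef (- P) n = - fps_coef P n. Proof. by []. Qed.
Lemma fps_coef_sum (I : Type) (r : seq I) (F : I -> fps A) n :
  fps_coef (\sum_(i <- r) F i) n = \sum_(i <- r) fps_coef (F i) n.
Proof. by apply: (big_morph (fun P => fps_coef P n)). Qed.

Lemma fps_coef_mulXn P m n :
  fps_coef (P * fpsX A ^+ m) n = if (m <= n)%N then fps_coef P (n - m) else 0.
Proof.
elim: m n => [|m IH] n; first by rewrite expr0 mulr1 subn0.
rewrite exprS mulrCA /=; case: n => [|n].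
  by rewrite big_ord1 /= mul0r.
rewrite (bigD1 (lift ord0 ord0)) //= mul1r [X in _ + X]big1 ?addr0; last first.
  by move=> i /negPf i1; rewrite (_ : (i == 1 :> nat) = false) ?mul0r // -i1.
rewrite ltnS subSS -IH /=.
have -> : (n.+1 - bump 0 0)%N = n by rewrite /bump /= subn1.
by [].
Qed.
End Series.

Lemma shift_rankSS a m n : shift_rank a m.+1 n.+1 = shift_rank a m n.
Proof. by rewrite /shift_rank ltnS subSS. Qed.

(** Coefficientwise. In degree 0 all exponents [p i - 1], [q i - 1] and [d - 2] are positive, so
    only [a 0] survives; in degree [n + 1] the shifts turn into those of the recursion at [n + 2]
    and [n + 3]. *)
Lemma series_rec (a : nat -> nat) (I : Type) (r : seq I) (p q : I -> nat) (d : nat) : (3 <= d)%N ->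
  (forall i, (2 <= p i)%N) -> (forall i, (2 <= q i)%N) -> a 0%N = 1%N ->
  (forall n, (a n.+1 + shift_rank a d n.+3)%N =
    (\sum_(i <- r) (shift_rank a (p i) n.+2 + shift_rank a (q i) n.+2))%N) ->
  Fps (fun n => (a n)%:Z) * (1 - \sum_(i <- r) (fpsX int ^+ (p i - 1) + fpsX int ^+ (q i - 1)) +
    fpsX int ^+ (d - 2)) = 1.
Proof.
move=> d3 p2 q2 a0 ar.
have cX m n : fps_coef (Fps (fun n => (a n)%:Z) * fpsX int ^+ m) n = (shift_rank a m n)%:Z.
  by rewrite fps_coef_mulXn /shift_rank; case: ifP.
apply: fpsP => n; rewrite mulrDr mulrBr mulr1 mulr_sumr !fps_coefD fps_coefN fps_coef_sum cX.
rewrite (eq_bigr (fun i => (shift_rank a (p i - 1) n + shift_rank a (q i - 1) n)%N%:Z)); last first.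
  by move=> i _; rewrite mulrDr fps_coefD !cX PoszD.
rewrite -(big_morph Posz PoszD (erefl 0%:Z)) /=.
case: n => [|n] /=.
  rewrite a0 big1 => [|i _]; first by rewrite /shift_rank leqn0; case: (d) d3 => [|[|[|d']]].
  have -> : shift_rank a (p i - 1) 0 = 0%N by rewrite /shift_rank ifF //; have := p2 i; lia.
  by rewrite /shift_rank ifF //; have := q2 i; lia.
have -> : shift_rank a (d - 2) n.+1 = shift_rank a d n.+3.
  by case: d d3 {ar} => [|[|d]] // _; rewrite !subSS subn0 !shift_rankSS.
have sE m : (2 <= m)%N -> shift_rank a (m - 1) n.+1 = shift_rank a m n.+2.
  by case: m => // m _; rewrite subSS subn0 shift_rankSS.
rewrite (eq_bigr (fun i => (shift_rank a (p i) n.+2 + shift_rank a (q i) n.+2)%N)); last first.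
  by move=> i _; rewrite !sE.
by rewrite -ar PoszD opprD addrA subrr sub0r addNr.
Qed.

Theorem proposition4p2 (R : realType) (k d : nat) (dd : 'I_k -> nat)
    (X : topologicalType) (x0 : X) :
  (0 < k)%N -> (4 <= d)%N ->
  (forall i, (2 <= dd i)%N) -> (forall i, (2 <= d - dd i)%N) ->
  is_iterated_csum R d
    (fun i => (sphere R (dd i) * sphere R (d - dd i))%type) X ->
  (forall n, finite_rank (homology R (loop_space R x0) n)) /\
  poincare_series (homology R (loop_space R x0)) =
    1 / (1 - \sum_(i < k) (fpsX int ^+ (dd i - 1) + fpsX int ^+ (d - dd i - 1))
         + fpsX int ^+ (d - 2)).
Proof.
move=> k0 d4 dd2 dd2' hX.
have [ms' [pm G L]] : exists ms', [/\ perm_eq ms' (flatten [seq [:: dd i; (d - dd i)%N] | i <- enum 'I_k]),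
    Good R d ms' X & Loop R d ms' X].
  move: hX; rewrite /is_iterated_csum; have : enum 'I_k != [::].
    by rewrite -size_eq0 size_enum_ord -lt0n.
  case: (enum 'I_k) => // i0 js _ /= hX.
  have [|||ms' [pm G L]] := @csum_chain R d [seq (dd i, (d - dd i)%N) | i <- js]
    [:: (d - dd i0)%N; dd i0] (sphere R (dd i0) * sphere R (d - dd i0))%type X.
  - by move=> _ /mapP[i _ ->] /=; split=> //; have := dd2' i; lia.
  - move=> Y hY; have := base_step (dd2 i0) (dd2' i0) hY.
    by have -> : (dd i0 + (d - dd i0))%N = d by have := dd2' i0; lia.
  - by rewrite -map_comp.
  exists ms'; split=> //; apply: (perm_trans pm); rewrite -map_comp.
  by apply/permP => P; rewrite /= !addnA [(P _ + P _)%N]addnC.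
have d0 : (0 < d)%N by lia.
have [a [h a0 ar]] := Loop_base d0 G x0 L.
have hr n : has_rank (homology R (loop_space R x0) n) (a n).
  by apply/homology_rank/loop_rank.
have rE n : rank (homology R (loop_space R x0) n) = a n.
  have : has_rank (homology R (loop_space R x0) n) (rank (homology R (loop_space R x0) n)).
    by apply: (@xgetPex _ 0%N [set r | has_rank (homology R (loop_space R x0) n) r]); exists (a n); exact: hr.
  by move=> /homology_rank h1; have /homology_rank h2 := hr n; exact: has_srank_uniq h1 h2.
split=> [n|]; first by exists (a n).
have -> : poincare_series (homology R (loop_space R x0)) = Fps (fun n => (a n)%:Z).
  by apply: fpsP => n; rewrite /= rE.
(* The inverse is recognised from the product being 1, which also shows that the denominator is
   invertible. *)
rewrite div1r; apply/esym/mulr1_eq; rewrite mulrC.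
apply: (@series_rec a _ _ dd (fun i => (d - dd i)%N) d) => //; first by lia.
move=> n; rewrite ar /ssum (perm_big _ pm) big_flatten big_map big_enum /=.
by apply: eq_bigr => i _; rewrite !big_cons big_nil addn0.
Qed.
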